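(* Let $(M,g)$ be a conformally Osserman Riemannian manifold of dimension $m\ge 3$. \begin{enumerate} \item Suppose that $\tilde J_{W_P}$ has only one eigenvalue at each point $P$ of $M$. Then $(M,g)$ is conformally flat. \item Let $m\ge 8$. Suppose that $\tilde J_{W_P}$ has two distinct eigenvalues of multiplicities $1$ and $m-2$ for each point $P\in M$. Then $m=2n$ is even and $(M,g)$ is locally conformally equivalent to either $(\mathbb{CP}^n,g_{FS})$ or $({}^*\mathbb{CP}^n,{}^*g_{FS})$; that is, every point of $M$ has an open neighborhood which, with the metric $g$, is conformally equivalent to an open subset of either $(\mathbb{CP}^n,g_{FS})$ or $({}^*\mathbb{CP}^n,{}^*g_{FS})$. \end{enumerate}
   Context: Let $(M,g)$ be a smooth Riemannian manifold of dimension $m\ge 3$ with Levi-Civita connection $\nabla$. The curvature operator is $R(x,y)=\nabla_x\nabla_y-\nabla_y\nabla_x-\nabla_{[x,y]}$ and $R(x,y,z,w)=g(R(x,y)z,w)$. Relative to a local orthonormal frame $\{e_i\}$, the Ricci tensor is $\rho_{ij}=\sum_k R_{ikkj}$, the scalar curvature is $\tau=\sum_i\rho_{ii}$, and the Ricci operator is $\rho(e_i)=\sum_j\rho_{ij}e_j$. Set $$R_0(x,y)z=g(y,z)x-g(x,z)y,\qquad L(x,y)z=g(\rho y,z)x-g(\rho x,z)y+g(y,z)\rho x-g(x,z)\rho y.$$ The Weyl conformal curvature operator $W$ is defined by $$R(x,y)=W(x,y)-\frac{1}{(m-1)(m-2)}\,\tau R_0(x,y)+\frac{1}{m-2}L(x,y),$$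 and $W_P$ denotes its value at $P$. $(M,g)$ is conformally flat if $W$ vanishes identically. The conformal Jacobi operator is the self-adjoint map $J_W(x)y=W(y,x)x$. $(M,g)$ is conformally Osserman if for each $P\in M$ the eigenvalues (with multiplicity) of $J_W(x)$ are constant for $x$ in the unit sphere $S_P(M,g)=\{x\in T_PM: g(x,x)=1\}$; the eigenvalues may vary from point to point. Since $J_W(x)x=0$, $J_W(x)$ preserves $x^\perp$, and the reduced conformal Jacobi operator is $\tilde J_W(x)=J_W(x)|_{x^\perp}$. For a conformally Osserman manifold, the eigenvalues and multiplicities of $\tilde J_{W_P}$ mean those of $\tilde J_W(x)$ for any (equivalently every) $x\in S_P(M,g)$. Two metrics $g_1,g_2$ on the same manifold are conformally equivalent if $g_1=\alpha g_2$ for a smooth positive function $\alpha$; two Riemannian manifolds are conformally equivalent if there is a diffeomorphism between them pulling one metric back to a metric conformally equivalent to the other. $(\mathbb{CP}^n,g_{FS})$ is complex projective space (real dimension $2n$) with the Fubini-Study metric, and $({}^*\mathbb{CP}^n,{}^*g_{FS})$ is its negative curvature dual, i.e. complex hyperbolic space. *)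

(* Defs.v *)
From HB Require Import structures.
From mathcomp Require Import all_boot all_order all_algebra.
From mathcomp Require Import all_classical all_reals all_analysis.
From mathcomp Require Import complex ring.

Set Implicit Arguments.
Unset Strict Implicit.
Unset Printing Implicit Defensive.

Import Order.TTheory GRing.Theory Num.Theory.
Import numFieldNormedType.Exports.

Local Open Scope classical_set_scope.
Local Open Scope ring_scope.

Section Smooth.
Context {R : realType} {m : nat}.

Definition basis_vec (i : 'I_m) : 'rV[R]_m := delta_mx 0 i.

Definition iter_partial {V : normedModType R} (s : seq 'I_m)
    (f : 'rV[R]_m -> V) : 'rV[R]_m -> V :=
  foldr (fun i h p => 'D_(basis_vec i) h p) f s.

(* Meant for open D: all iterated partial derivatives exist and are
   continuous on D. *)
Definition smooth_on {V : normedModType R} (D : set 'rV[R]_m)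
    (f : 'rV[R]_m -> V) : Prop :=
  forall (s : seq 'I_m) (p : 'rV[R]_m), D p ->
    {for p, continuous (iter_partial s f)} /\
    forall i, derivable (iter_partial s f) p (basis_vec i).

End Smooth.

(* A set covered by local parametrizations [par i], defined on [dom i] in R^m,
   together with the Gram matrices [met i] of a metric in these coordinates.
   The axioms are in [riemannian_manifold] below. *)
Record metric_atlas (R : realType) (m : nat) := MetricAtlas {
  mpoint : Type;
  chart : Type;
  dom : chart -> set 'rV[R]_m;
  par : chart -> 'rV[R]_m -> mpoint;
  met : chart -> 'rV[R]_m -> 'M[R]_m }.

Section Manifold.
Context {R : realType}.

Definition mopen {m} {M : metric_atlas R m} (U : set (mpoint M)) : Prop :=
  forall i : chart M, open (dom i `&` par i @^-1` U).

(* The expression of F in the coordinates i and j, and its domain. The value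
   of [coordmap] outside the domain is irrelevant. *)
Definition coordmap {m n} {M : metric_atlas R m} {N : metric_atlas R n}
    (F : mpoint M -> mpoint N) (i : chart M) (j : chart N) (p : 'rV[R]_m) :
    'rV[R]_n :=
  xget 0 [set q | dom j q /\ par j q = F (par i p)].

Definition coorddom {m n} {M : metric_atlas R m} {N : metric_atlas R n}
    (U : set (mpoint M)) (F : mpoint M -> mpoint N) (i : chart M) (j : chart N) :
    set 'rV[R]_m :=
  [set p | [/\ dom i p, U (par i p) &
            exists q, dom j q /\ par j q = F (par i p)]].

(* For U open; the openness of the coordinate domains is the continuity of
   F. *)
Definition smooth_map {m n} {M : metric_atlas R m} {N : metric_atlas R n}
    (U : set (mpoint M)) (F : mpoint M -> mpoint N) : Prop :=
  forall i j, open (coorddom U F i j) /\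
              smooth_on (coorddom U F i j) (coordmap F i j).

Definition smooth_function {m} {M : metric_atlas R m}
    (U : set (mpoint M)) (a : mpoint M -> R) : Prop :=
  forall i : chart M, smooth_on (dom i `&` par i @^-1` U) (a \o par i).

(* Gram matrix at p, in the coordinates i, of the pullback by F of the metric
   of N. Tangent vectors are row vectors v of components, and dF(v) is
   v *m 'J F. *)
Definition pullback_met {m n} {M : metric_atlas R m} {N : metric_atlas R n}
    (F : mpoint M -> mpoint N) (i : chart M) (j : chart N) (p : 'rV[R]_m) :
    'M[R]_m :=
  jacobian (coordmap F i j) p *m met j (coordmap F i j p) *m
    (jacobian (coordmap F i j) p)^T.

Definition inner {m} (G : 'M[R]_m) (v w : 'rV[R]_m) : R :=
  (v *m G *m w^T) 0 0.

(* Nonempty smooth Hausdorff second countable manifold with a smooth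
   Riemannian metric. *)
Record riemannian_manifold {m} (M : metric_atlas R m) : Prop := {
  rm_nonempty : exists P : mpoint M, True;
  rm_dom_open : forall i : chart M, open (dom i);
  rm_par_inj : forall (i : chart M) p q,
    dom i p -> dom i q -> par i p = par i q -> p = q;
  rm_cover : forall P : mpoint M, exists i p, dom i p /\ par i p = P;
  rm_transition : @smooth_map m m M M setT idfun;
  rm_hausdorff : forall P Q : mpoint M, P <> Q ->
    exists U V : set (mpoint M),
      [/\ mopen U, mopen V, U P, V Q & U `&` V = set0];
  rm_second_countable : exists B : nat -> set (mpoint M),
    (forall k, mopen (B k)) /\
    forall U P, mopen U -> U P -> exists k, B k P /\ B k `<=` U;
  rm_met_smooth : forall i : chart M, smooth_on (dom i) (met i);
  rm_met_sym : forall (i : chart M) p, dom i p -> (met i p)^T = met i p;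
  rm_met_pos : forall (i : chart M) p v,
    dom i p -> v != 0 -> 0 < inner (met i p) v v;
  rm_met_compat : forall (i j : chart M) p, coorddom setT idfun i j p ->
    met i p = pullback_met idfun i j p }.

(* (U, g_M) and (V, g_N) are conformally equivalent: there is a diffeomorphism
   F : U -> V with F^* g_N = a g_M for a smooth positive function a. *)
Definition conformally_equivalent_opens {m n}
    {M : metric_atlas R m} {N : metric_atlas R n}
    (U : set (mpoint M)) (V : set (mpoint N)) : Prop :=
  exists (F : mpoint M -> mpoint N) (G : mpoint N -> mpoint M) (a : mpoint M -> R),
    [/\ (forall P, U P -> V (F P) /\ G (F P) = P),
        (forall Q, V Q -> U (G Q) /\ F (G Q) = Q),
        smooth_map U F, smooth_map V G &
        [/\ smooth_function U a,
            (forall P, U P -> 0 < a P) &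
            forall i j p, coorddom U F i j p ->
              pullback_met F i j p = a (par i p) *: met i p]].

Definition locally_conformal_at {m n}
    (M : metric_atlas R m) (N : metric_atlas R n) (P : mpoint M) : Prop :=
  exists (U : set (mpoint M)) (V : set (mpoint N)),
    [/\ mopen U, U P, mopen V & conformally_equivalent_opens U V].

End Manifold.

(* Here g p is the Gram matrix at p of a metric on an open subset of R^m, and
   tangent vectors are row vectors of components. *)
Section Curvature.
Context {R : realType} {m : nat}.
Implicit Types (g : 'rV[R]_m -> 'M[R]_m) (p x y z w : 'rV[R]_m).
Implicit Types (X Y Z : 'rV[R]_m -> 'rV[R]_m).

Definition dmet g p (k i j : 'I_m) : R := 'D_(basis_vec k) (fun q => g q i j) p.

Definition christoffel g p (i j k : 'I_m) : R :=
  2^-1 * \sum_l invmx (g p) k l * (dmet g p i j l + dmet g p j i l - dmet g p l i j).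

(* The Levi-Civita covariant derivative of the vector field Y along X; see
   [christoffel_sym] and [christoffel_metric]. *)
Definition nabla g X Y p : 'rV[R]_m :=
  'D_(X p) Y p +
  \row_k \sum_i \sum_j X p 0 i * Y p 0 j * christoffel g p i j k.

Definition lie_bracket X Y p : 'rV[R]_m := 'D_(X p) Y p - 'D_(Y p) X p.

Definition curv_fields g X Y Z p : 'rV[R]_m :=
  nabla g X (nabla g Y Z) p - nabla g Y (nabla g X Z) p
  - nabla g (lie_bracket X Y) Z p.

(* R(x,y)z at p; by tensoriality any extension of x, y, z to vector fields may
   be used, here the one with constant components. *)
Definition curv g p x y z : 'rV[R]_m :=
  curv_fields g (fun=> x) (fun=> y) (fun=> z) p.

Definition curv4 g p x y z w : R := inner (g p) (curv g p x y z) w.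

(* Gram matrix of the form rho(x,y) = sum_k R(x, e_k, e_k, y), the sum over an
   orthonormal frame being written as a contraction with the inverse metric;
   see [contraction_orthonormal]. *)
Definition ricci g p : 'M[R]_m :=
  \matrix_(a, b) \sum_k \sum_l invmx (g p) k l *
    curv4 g p (basis_vec a) (basis_vec k) (basis_vec l) (basis_vec b).

(* The operator with g(rho x, y) = rho(x,y). *)
Definition ricci_op g p x : 'rV[R]_m := x *m ricci g p *m invmx (g p).

Definition scalar_curv g p : R :=
  \sum_i \sum_j invmx (g p) i j * ricci g p i j.

Definition curv_R0 g p x y z : 'rV[R]_m :=
  inner (g p) y z *: x - inner (g p) x z *: y.

Definition curv_L g p x y z : 'rV[R]_m :=
  inner (g p) (ricci_op g p y) z *: x - inner (g p) (ricci_op g p x) z *: y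
  + inner (g p) y z *: ricci_op g p x - inner (g p) x z *: ricci_op g p y.

Definition weyl g p x y z : 'rV[R]_m :=
  curv g p x y z
  + (scalar_curv g p / ((m%:R - 1) * (m%:R - 2))) *: curv_R0 g p x y z
  - (m%:R - 2)^-1 *: curv_L g p x y z.

(* Matrix of y |-> W(y,x)x acting on row vectors. *)
Definition conf_jacobi g p x : 'M[R]_m := lin1_mx (fun y => weyl g p y x x).

(* A matrix whose rows span the g-orthogonal complement of x. *)
Definition orth g p x : 'M[R]_m := kermx (g p *m x^T).

Definition reduced_conf_jacobi g p x : 'M[R]_(\rank (orth g p x)) :=
  restrictmx (orth g p x) (conf_jacobi g p x).

(* For self-adjoint operators the geometric and algebraic multiplicities
   agree; it is 0 when a is not an eigenvalue. *)
Definition multiplicity n (A : 'M[R]_n) (a : R) : nat := \rank (eigenspace A a).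

Definition unit_vec g p x : Prop := inner (g p) x x = 1.

Lemma christoffel_sym g p i j k :
  (forall l a b, dmet g p l a b = dmet g p l b a) ->
  christoffel g p i j k = christoffel g p j i k.
Proof.
move=> dsym; congr (_ * _); apply: eq_bigr => l _.
by rewrite [dmet g p i j l + _]addrC (dsym l i j).
Qed.

(* d_k g_ij = g(nabla_k e_i, e_j) + g(e_i, nabla_k e_j) *)
Lemma christoffel_metric g p k i j : g p \in unitmx -> (g p)^T = g p ->
  (forall l a b, dmet g p l a b = dmet g p l b a) ->
  dmet g p k i j =
  \sum_l christoffel g p k i l * g p l j + \sum_l christoffel g p k j l * g p l i.
Proof.
move=> gU gT dsym.
have gs a b : g p a b = g p b a by rewrite -[in LHS]gT mxE.
have lower a b c : \sum_l christoffel g p a b l * g p l c =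
    2^-1 * (dmet g p a b c + dmet g p b a c - dmet g p c a b).
  rewrite /christoffel.
  under eq_bigr => l _ do rewrite -mulrA mulr_suml.
  rewrite -mulr_sumr; congr (_ * _); rewrite exchange_big /=.
  pose v := \col_d (dmet g p a b d + dmet g p b a d - dmet g p d a b).
  transitivity ((g p *m invmx (g p) *m v) c 0); last first.
    by rewrite mulmxV // mul1mx mxE.
  rewrite -mulmxA mxE exchange_big /=; apply: eq_bigr => l _.
  rewrite !mxE mulr_sumr; apply: eq_bigr => d _; rewrite !mxE (gs c l).
  by rewrite mulrC mulrA.
rewrite !lower (dsym i k j) (dsym j k i) (dsym k j i) (dsym i j k) (dsym j i k).
by field.
Qed.

(* The rows of E form a g-orthonormal frame. *)
Lemma contraction_orthonormal (G E : 'M[R]_m) (B : 'I_m -> 'I_m -> R) :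
  E *m G *m E^T = 1%:M ->
  \sum_i \sum_j invmx G i j * B i j =
  \sum_k \sum_i \sum_j E k i * E k j * B i j.
Proof.
move=> H.
have EU : E \in unitmx by case/mulmx1_unit: (H); rewrite unitmx_mul => /andP[].
have ETU : E^T \in unitmx by rewrite unitmx_tr.
have iG : invmx G = E^T *m E.
  have H1 : (E^T *m E) *m G = 1%:M.
    by rewrite -mulmxA; apply: mulmx1C.
  have GU : G \in unitmx by case/mulmx1_unit: H1.
  by rewrite -[RHS](mulmxK GU) H1 mul1mx.
rewrite exchange_big /= [RHS]exchange_big /= exchange_big /=.
apply: eq_bigr => i _; rewrite exchange_big /=; apply: eq_bigr => j _.
by rewrite iG mxE mulr_suml; apply: eq_bigr => k _; rewrite mxE.
Qed.

End Curvature.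

Section Osserman.
Context {R : realType} {m : nat}.
Variable M : metric_atlas R m.

(* In the definitions below the points of M are the par i p, and the tangent
   space at such a point is R^m with the inner product met i p. *)

Definition conformally_flat : Prop :=
  forall (i : chart M) p, dom i p -> forall x y z, weyl (met i) p x y z = 0.

Definition conformally_osserman : Prop :=
  forall (i : chart M) p, dom i p ->
  forall x y, unit_vec (met i) p x -> unit_vec (met i) p y ->
  forall a, multiplicity (conf_jacobi (met i) p x) a =
            multiplicity (conf_jacobi (met i) p y) a.

Definition one_reduced_eigenvalue (i : chart M) p : Prop :=
  exists a : R, forall x, unit_vec (met i) p x ->
    forall b, eigenvalue (reduced_conf_jacobi (met i) p x) b = (b == a).

Definition two_reduced_eigenvalues (k l : nat) (i : chart M) p : Prop :=
  exists a b : R, a != b /\ forall x, unit_vec (met i) p x ->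
    [/\ forall c, eigenvalue (reduced_conf_jacobi (met i) p x) c =
                  ((c == a) || (c == b)),
        multiplicity (reduced_conf_jacobi (met i) p x) a = k &
        multiplicity (reduced_conf_jacobi (met i) p x) b = l].

End Osserman.

Section ComplexSpaceForms.
Context {R : realType}.
Variables (eps : R) (n : nat).
Implicit Types u v p : 'rV[R[i]]_n.+1.

Definition herm u v : R[i] :=
  u 0 0 * conjc (v 0 0) +
  (eps%:C)%C * \sum_(k < n) u 0 (lift ord0 k) * conjc (v 0 (lift ord0 k)).

Definition positive_vec v : Prop := 0 < complex.Re (herm v v).

Definition cline v : set 'rV[R[i]]_n.+1 := [set a *: v | a in [set: R[i]]].

Definition positive_line : Type :=
  {L : set 'rV[R[i]]_n.+1 | exists v, positive_vec v /\ L = cline v}.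

Lemma positive_e0 : positive_vec (delta_mx 0 0).
Proof.
have z (k : 'I_n) : (delta_mx 0 0 : 'rV[R[i]]_n.+1) 0 (lift ord0 k) = 0.
  by rewrite mxE eq_sym (negPf (neq_lift _ _)) andbF.
rewrite /positive_vec /herm big1 => [|k _]; last by rewrite z mul0r.
by rewrite mxE !eqxx mulr0 addr0 conjc1 mulr1 /= ltr01.
Qed.

(* The line through v, with a junk value when v is not positive. *)
Definition line_of v : positive_line :=
  match pselect (positive_vec v) with
  | left h => exist _ (cline v) (ex_intro _ v (conj h erefl))
  | right _ => exist _ (cline (delta_mx 0 0))
                 (ex_intro _ (delta_mx 0 0) (conj positive_e0 erefl))
  end.

(* The vector of C^(n+1) with i-th entry a, the other entries being the
   complex numbers with real parts the first half of x and imaginary parts the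
   second half. *)
Definition affine_vec (i : 'I_n.+1) (a : R[i]) (x : 'rV[R]_(n + n)) :
    'rV[R[i]]_n.+1 :=
  \row_k (if unlift i k is Some j
          then (x 0 (lshift n j) +i* x 0 (rshift n j))%C else a).

(* The metric induced on the space of lines by projecting u and v
   herm-orthogonally to p. *)
Definition line_metric p u v : R :=
  eps * complex.Re (herm u v * herm p p - herm u p * herm p v) /
  (complex.Re (herm p p)) ^+ 2.

(* Affine charts {z_i = 1}. *)
Definition complex_space_form : metric_atlas R (n + n) :=
  @MetricAtlas R (n + n) positive_line 'I_n.+1
    (fun i => [set x | positive_vec (affine_vec i 1 x)])
    (fun i x => line_of (affine_vec i 1 x))
    (fun i x => \matrix_(a, b) line_metric (affine_vec i 1 x)
       (affine_vec i 0 (basis_vec a)) (affine_vec i 0 (basis_vec b))).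

End ComplexSpaceForms.

(* For eps = 1 every nonzero vector is positive, and this is CP^n with the
   Fubini-Study metric. *)
Definition CPn (R : realType) (n : nat) : metric_atlas R (n + n) :=
  complex_space_form 1 n.

(* For eps = -1 the chart {z_0 = 1} is the unit ball of C^n with the Bergman
   metric, and it covers the space. *)
Definition CHn (R : realType) (n : nat) : metric_atlas R (n + n) :=
  complex_space_form (-1) n.

(* Main.v *)
Require Import Defs.
From HB Require Import structures.
From mathcomp Require Import all_boot all_order all_algebra.
From mathcomp Require Import all_classical all_reals all_analysis.
From mathcomp Require Import complex ring lra.

Set Implicit Arguments.
Unset Strict Implicit.
Unset Printing Implicit Defensive.

Import Order.TTheory GRing.Theory Num.Theory.
Import numFieldNormedType.Exports.

Local Open Scope classical_set_scope.
Local Open Scope ring_scope.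

(* For a metric g with only one eigenvalue of the reduced operator, J_W(x) is a
   multiple of the projection to the complement of x; as its trace is 0 it
   vanishes, and the Weyl tensor is determined by its Jacobi operators.

   With eigenvalues a, b of multiplicities 1 and m-2, polarization of the
   Jacobi operators gives W = mu R_0 + lam R_J for an almost complex structure J,
   which, like mu and lam, is a smooth explicit function of W. The conformal
   metric |lam| g has curvature sign(lam) R_J plus terms of the form
   P wedge g. The second Bianchi identity, evaluated on vectors d, e orthogonal
   to a, b, c, does not see the latter and, when m >= 8, forces J to be
   parallel; hence the curvature commutes with J, which determines P and makes
   the curvature that of a complex space form. The flat connection on
   C z + C^n built from this curvature (as for horizontal lifts to the sphere
   or the anti-de Sitter quadric) has a parallel frame by Picard iteration, and
   its first row z gives homogeneous coordinates of a local isometry to CP^n or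
   CH^n. *)

(** * Functions of class C^k *)

(** The eigenvalue hypotheses hold point by point and fix J only up to sign, so smoothness must come
    from closed formulas: traces of the square and the cube of one Jacobi operator give mu, and the
    sign of J is settled near p0 by a fixed vector v, through the square root of a function that is
    positive at p0. The conformal factor |lam| makes the coefficient of R_J the constant 1 or -1, so
    no derivative of lam enters the Bianchi identity. The remaining curvature, that is, the part mu
    R_0, the Ricci terms and the Hessian of the factor, is gathered in one smooth unknown P, which
    stays arbitrary until J is known to be parallel. The bound on m provides a unit vector
    orthogonal to three given complex lines. On the side of the model, the line C z is not flat by
    itself: its curvature is a multiple of the Kahler form, which is closed as J is parallel. A
    potential eta, from the Poincare lemma on a ball, turns the phase of z and cancels this
    curvature; the phase drops out of the metric on lines. *)

Section Ck.
Context {R : realType} {m : nat}.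
Implicit Types (f g : 'rV[R]_m -> R) (D : set 'rV[R]_m) (p v : 'rV[R]_m).

Definition pd (i : 'I_m) f p : R := 'D_(basis_vec i) f p.

Fixpoint Ck k D f : Prop :=
  (forall p, D p -> {for p, continuous f}) /\
  if k is k'.+1 then forall i, (forall p, D p -> derivable f p (basis_vec i)) /\
                               Ck k' D (pd i f)
  else True.

Definition sm D f := forall k, Ck k D f.

Lemma Ck_cont k D f p : Ck k D f -> D p -> {for p, continuous f}.
Proof. by case: k => [|k] [h _]; exact: h. Qed.

Lemma Ck_der k D f i p : Ck k.+1 D f -> D p -> derivable f p (basis_vec i).
Proof. by move=> [_ /(_ i)[h _]]; exact: h. Qed.

Lemma Ck_pd k D f i : Ck k.+1 D f -> Ck k D (pd i f).
Proof. by move=> [_ /(_ i)[]]. Qed.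

Lemma Ck_sub k D D' f : D' `<=` D -> Ck k D f -> Ck k D' f.
Proof.
move=> s; elim: k f => [|k IH] f [c h]; split=> //; try by move=> p /s /c.
by move=> i; have [h1 h2] := h i; split=> [p /s /h1 //|]; exact: IH.
Qed.

Lemma Ck_le k l D f : (l <= k)%N -> Ck k D f -> Ck l D f.
Proof.
elim: k l f => [|k IH] [|l] f //= lk [c h]; split=> // i.
by have [h1 h2] := h i; split=> //; exact: IH.
Qed.

Lemma near_of_open D p (P : 'rV[R]_m -> Prop) : open D -> D p ->
  (forall q, D q -> P q) -> \near p, P p.
Proof.
move=> oD Dp h; have : \near p, D p by apply: open_nbhs_nbhs.
by apply: filterS.
Qed.

Lemma continuous_eq_on {T : topologicalType} D p (f g : 'rV[R]_m -> T) :
  open D -> D p -> (forall q, D q -> f q = g q) ->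
  {for p, continuous f} -> {for p, continuous g}.
Proof.
move=> oD Dp fg cf; rewrite /prop_for /continuous_at -(fg p Dp).
apply: cvg_trans cf; apply: (@near_eq_cvg _ _ (nbhs p)).
apply: (@near_of_open D p (fun q => _ q = _ q) oD Dp) => q Dq.
by rewrite fg.
Qed.

(** Derivatives at a point of D only see a neighborhood, which lies in D as D is open. This is how
    formulas valid on D alone are substituted for derivatives. *)
Lemma Ck_ext k D f g : open D -> (forall p, D p -> f p = g p) ->
  Ck k D f -> Ck k D g.
Proof.
move=> oD; elim: k f g => [|k IH] f g fg [c h]; split=> //.
- by move=> p Dp; apply: (continuous_eq_on oD Dp fg); exact: c.
- by move=> p Dp; apply: (continuous_eq_on oD Dp fg); exact: c.
- move=> i; have [h1 h2] := h i; split.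
  + move=> p Dp; apply: (@near_eq_derivable _ _ _ f) => //; last exact: h1.
    exact: (near_of_open oD Dp).
  + apply: (IH _ _ _ h2) => p Dp; apply: near_eq_derive.
    exact: (near_of_open oD Dp).
Qed.

Lemma Ck_cst k D (c : R) : Ck k D (fun=> c).
Proof.
elim: k c => [|k IH] c; split=> //; try by move=> p _; exact: cst_continuous.
move=> i; split=> [p _|]; first exact: derivable_cst.
have -> : pd i (fun=> c) = fun=> 0 by apply/funext => p; exact: derive_cst.
exact: IH.
Qed.

Lemma pdD i f g p : derivable f p (basis_vec i) -> derivable g p (basis_vec i) ->
  pd i (fun q => f q + g q) p = pd i f p + pd i g p.
Proof. exact: deriveD. Qed.

Lemma pdN i f p : derivable f p (basis_vec i) ->
  pd i (fun q => - f q) p = - pd i f p.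
Proof. exact: deriveN. Qed.

Lemma pdM i f g p : derivable f p (basis_vec i) -> derivable g p (basis_vec i) ->
  pd i (fun q => f q * g q) p = f p * pd i g p + g p * pd i f p.
Proof. exact: deriveM. Qed.

Lemma Ck_add k D f g : open D -> Ck k D f -> Ck k D g ->
  Ck k D (fun p => f p + g p).
Proof.
move=> oD; elim: k f g => [|k IH] f g [cf hf] [cg hg]; split=> //.
- by move=> p Dp; apply: continuousD; [exact: cf|exact: cg].
- by move=> p Dp; apply: continuousD; [exact: cf|exact: cg].
- move=> i; have [f1 f2] := hf i; have [g1 g2] := hg i; split=> [p Dp|].
    by apply: derivableD; [exact: f1|exact: g1].
  apply: Ck_ext (IH _ _ f2 g2) => // p Dp.
  by rewrite pdD //; [exact: f1|exact: g1].
Qed.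

Lemma Ck_opp k D f : open D -> Ck k D f -> Ck k D (fun p => - f p).
Proof.
move=> oD; elim: k f => [|k IH] f [cf hf]; split=> //.
- by move=> p Dp; apply: continuousN; exact: cf.
- by move=> p Dp; apply: continuousN; exact: cf.
- move=> i; have [f1 f2] := hf i; split=> [p Dp|].
    by apply: derivableN; exact: f1.
  apply: Ck_ext (IH _ f2) => // p Dp.
  by rewrite pdN //; exact: f1.
Qed.

Lemma Ck_mul k D f g : open D -> Ck k D f -> Ck k D g ->
  Ck k D (fun p => f p * g p).
Proof.
move=> oD; elim: k f g => [|k IH] f g Hf Hg.
  move: Hf Hg => [cf _] [cg _]; split=> // p Dp.
  by apply: continuousM; [exact: cf|exact: cg].
split=> [p Dp|i].
  by apply: continuousM; [exact: (Ck_cont Hf)|exact: (Ck_cont Hg)].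
split=> [p Dp|].
  by apply: derivableM; [exact: (Ck_der Hf)|exact: (Ck_der Hg)].
have Hf' : Ck k D f by exact: (@Ck_le k.+1).
have Hg' : Ck k D g by exact: (@Ck_le k.+1).
have := Ck_add oD (IH _ _ Hf' (Ck_pd i Hg)) (IH _ _ Hg' (Ck_pd i Hf)).
apply: Ck_ext => // p Dp.
by rewrite pdM //; [exact: (Ck_der Hf)|exact: (Ck_der Hg)].
Qed.

Lemma Ck_sub2 k D f g : open D -> Ck k D f -> Ck k D g ->
  Ck k D (fun p => f p - g p).
Proof. by move=> oD hf hg; apply: Ck_add => //; exact: Ck_opp. Qed.

Lemma Ck_sum (I : Type) (r : seq I) (P : pred I) k D (F : I -> 'rV[R]_m -> R) :
  open D -> (forall i, P i -> Ck k D (F i)) ->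
  Ck k D (fun p => \sum_(i <- r | P i) F i p).
Proof.
move=> oD h; elim: r => [|a r IH].
  have -> : (fun p => \sum_(i <- [::] | P i) F i p) = fun=> 0.
    by apply/funext => p; rewrite big_nil.
  exact: Ck_cst.
have -> : (fun p => \sum_(i <- a :: r | P i) F i p) =
    fun p => if P a then F a p + \sum_(i <- r | P i) F i p
             else \sum_(i <- r | P i) F i p.
  by apply/funext => p; rewrite big_cons.
by case Pa: (P a) => //; apply: Ck_add => //; exact: h.
Qed.

Lemma Ck_prod (I : Type) (r : seq I) (P : pred I) k D (F : I -> 'rV[R]_m -> R) :
  open D -> (forall i, P i -> Ck k D (F i)) ->
  Ck k D (fun p => \prod_(i <- r | P i) F i p).
Proof.
move=> oD h; elim: r => [|a r IH].
  have -> : (fun p => \prod_(i <- [::] | P i) F i p) = fun=> 1.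
    by apply/funext => p; rewrite big_nil.
  exact: Ck_cst.
have -> : (fun p => \prod_(i <- a :: r | P i) F i p) =
    fun p => if P a then F a p * \prod_(i <- r | P i) F i p
             else \prod_(i <- r | P i) F i p.
  by apply/funext => p; rewrite big_cons.
by case Pa: (P a) => //; apply: Ck_mul => //; exact: h.
Qed.

Lemma pdV i f p : f p != 0 -> derivable f p (basis_vec i) ->
  pd i (fun q => (f q)^-1) p = - (f p) ^- 2 * pd i f p.
Proof. exact: deriveV. Qed.

Lemma Ck_inv k D f : open D -> (forall p, D p -> f p != 0) -> Ck k D f ->
  Ck k D (fun p => (f p)^-1).
Proof.
move=> oD fN0; elim: k => [|k IH] Hf.
  by split=> // p Dp; apply: continuousV; [exact: fN0|exact: (Ck_cont Hf)].
split=> [p Dp|i].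
  by apply: continuousV; [exact: fN0|exact: (Ck_cont Hf)].
split=> [p Dp|].
  by apply: derivableV; [exact: fN0|exact: (Ck_der Hf)].
have HV : Ck k D (fun p => (f p)^-1) by apply: IH; exact: (@Ck_le k.+1).
have := Ck_mul oD (Ck_opp oD (Ck_mul oD HV HV)) (Ck_pd i Hf).
apply: Ck_ext => // p Dp; rewrite pdV //; [|exact: fN0|exact: (Ck_der Hf)].
by rewrite -exprVn expr2.
Qed.

Lemma derivable_coord i p v : derivable (fun q : 'rV[R]_m => q 0 i) p v.
Proof.
have /derivable_mxP h : derivable (id : 'rV[R]_m -> 'rV[R]_m) p v.
  exact: derivable_id.
exact: h.
Qed.

Lemma derive_coord i p v : 'D_v (fun q : 'rV[R]_m => q 0 i) p = v 0 i.
Proof.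
have := derive_mx (@derivable_id _ _ p v); rewrite derive_id.
by move/matrixP/(_ 0 i); rewrite mxE.
Qed.

Lemma Ck_coord k D i : Ck k D (fun p => p 0 i).
Proof.
case: k => [|k]; split=> //; try by move=> p _; exact: coord_continuous.
move=> j; split=> [p _|]; first exact: derivable_coord.
have -> : pd j (fun p => p 0 i) = fun=> basis_vec j 0 i.
  by apply/funext => p; exact: derive_coord.
exact: Ck_cst.
Qed.

End Ck.

(** * Directional derivatives, mean value theorem and first-order Taylor estimate *)

Section Line.
Context {R : realType} {m : nat}.
Implicit Types (f g : 'rV[R]_m -> R) (D : set 'rV[R]_m) (p v : 'rV[R]_m).

(** Both sides have the same difference quotient; one-variable results thus apply to directional
    derivatives. *)
Lemma is_derive_line f p v (t d : R) :
  is_derive (t *: v + p) v f d <-> is_derive t 1 (fun s : R => f (s *: v + p)) d.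
Proof.
have E : (fun h : R => h^-1 *: ((f \o shift (t *: v + p)) (h *: v) - f (t *: v + p)))
   = (fun h : R => h^-1 *: (((fun s : R => f (s *: v + p)) \o shift t) (h *: 1)
        - f (t *: v + p))).
  apply/funext => h /=; congr (_ *: (f _ - _)).
  by rewrite [h *: 1]mulr1 scalerDl addrA.
split=> -[h1 h2]; split.
- by rewrite /derivable -E.
- by rewrite -h2 /derive -E.
- by rewrite /derivable E.
- by rewrite -h2 /derive E.
Qed.

Lemma is_derive_line0 f p v (d : R) :
  is_derive p v f d <-> is_derive (0 : R) 1 (fun s : R => f (s *: v + p)) d.
Proof. by rewrite -is_derive_line scale0r add0r. Qed.

Lemma mvt_line f p v :
  (forall t : R, 0 <= t <= 1 -> derivable f (t *: v + p) v) ->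
  exists2 c : R, 0 <= c <= 1 & f (v + p) - f p = 'D_v f (c *: v + p).
Proof.
move=> df; pose g (s : R) := f (s *: v + p).
have dg (t : R) : t \in `[0, 1]%R -> is_derive t 1 g ('D_v f (t *: v + p)).
  by rewrite in_itv => h; apply/is_derive_line/derivableP/df.
have d1 (t : R) : t \in `]0, 1[%R -> is_derive t 1 g ('D_v f (t *: v + p)).
  by move=> /subset_itv_oo_cc; exact: dg.
have cg : {within `[(0 : R), 1], continuous g}.
  by apply: derivable_within_continuous => t /dg[].
have [c cI] := MVT_segment ler01 d1 cg.
rewrite subr0 mulr1 /g scale1r scale0r add0r => E; exists c => //.
Qed.

Lemma is_derive_scale f p v (a d : R) :
  is_derive p v f d -> is_derive p (a *: v) f (a * d).
Proof.
move=> /is_derive_line0 h; apply/is_derive_line0.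
have -> : (fun s : R => f (s *: (a *: v) + p)) =
   (fun s : R => f (s *: v + p)) \o (fun s => s * a).
  by apply/funext => s /=; rewrite scalerA.
rewrite mulrC; apply: is_derive1_comp; first by rewrite mul0r.
have := is_deriveM (@is_derive_id _ _ (0 : R) 1) (@is_derive_cst _ _ _ a (0 : R) 1).
by move=> /is_derive_eq; apply; rewrite !scaler0 add0r [_ *: _]mulr1.
Qed.

Lemma norm_coord p i : `|p 0 i| <= `|p|.
Proof.
rewrite [leRHS]/Num.Def.normr/= mx_normrE.
exact: (le_bigmax _ (fun ij : 'I_1 * 'I_m => `|p ij.1 ij.2|) (0, i)).
Qed.

Lemma norm_row_le p (e : R) : 0 <= e -> (forall i, `|p 0 i| <= e) -> `|p| <= e.
Proof.
move=> e0 h; rewrite [leLHS]/Num.Def.normr/= mx_normrE.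
by apply/bigmax_leP; split=> // -[i j] _ /=; rewrite ord1.
Qed.

(** Vertices of the path from 0 to v that moves along one coordinate at a time, so that only partial
    derivatives enter the Taylor estimate. *)
Definition trunc (k : nat) v : 'rV[R]_m :=
  \row_i (if (i < k)%N then v 0 i else 0).

Lemma norm_trunc k v (t : R) (i : 'I_m) : 0 <= t <= 1 ->
  `|t *: (v 0 i *: basis_vec i) + trunc k v| <= `|v| *+ 2.
Proof.
move=> /andP[t0 t1]; rewrite mulr2n; apply: (le_trans (ler_normD _ _)).
apply: lerD; apply: norm_row_le => // j; rewrite /basis_vec !mxE.
  have [_|_] := eqVneq j i; last by rewrite andbF !mulr0 normr0.
  rewrite /= mulr1 normrM (ger0_norm t0); apply: le_trans (norm_coord v i).
  by rewrite ler_piMl.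
by case: ifP => _; rewrite ?normr0 // norm_coord.
Qed.

(** The increment telescopes along the path [trunc]. By the mean value theorem each step is a
    coordinate of v times a partial derivative at an intermediate point, which continuity compares
    with its value at p. *)
Lemma Ck_taylor1 f D p (e : R) : open D -> D p -> Ck 1 D f -> 0 < e ->
  \forall v \near (0 : 'rV[R]_m),
    `|f (v + p) - f p - \sum_i v 0 i * pd i f p| <= e * `|v|.
Proof.
move=> oD Dp Hf e0.
have c i : {for p, continuous (pd i f)} by exact: (Ck_cont (Ck_pd i Hf)).
(* The m errors must add up to at most e; the divisor m+1 also covers m = 0. *)
have : \forall q \near p, D q /\ forall i, `|pd i f q - pd i f p| <= e / m.+1%:R.
  near=> q; split; first by near: q; apply: open_nbhs_nbhs.
  near: q; apply: filter_forall => i.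
  have /cvgrPdist_le h := c i.
  have e1 : 0 < e / m.+1%:R by rewrite divr_gt0 ?ltr0n.
  by have := h _ e1; apply: filterS => q; rewrite distrC.
move=> /nbhs_ballP[r /= r0 hr].
(* Half the radius, because [norm_trunc] bounds the intermediate points only by twice the norm of
   v. *)
apply/nbhs_norm0P; exists (r / 2) => [|v /= vr2]; first by rewrite /= divr_gt0.
have vr : `|v| *+ 2 < r by move: vr2; rewrite ltr_pdivlMr // mulr_natr.
have ball_in (k : nat) (t : R) (i : 'I_m) : 0 <= t <= 1 ->
   ball p r (t *: (v 0 i *: basis_vec i) + (trunc k v + p)).
  move=> t01; rewrite -ball_normE /ball_ /= addrA opprD addrCA subrr addr0 normrN.
  exact: le_lt_trans (norm_trunc _ _ _ t01) vr.
have step (i : 'I_m) : exists2 d : R, `|d - pd i f p| <= e / m.+1%:R &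
   f (trunc i.+1 v + p) - f (trunc i v + p) = v 0 i * d.
  have der (t : R) : 0 <= t <= 1 ->
     is_derive (t *: (v 0 i *: basis_vec i) + (trunc i v + p)) (v 0 i *: basis_vec i)
       f (v 0 i * pd i f (t *: (v 0 i *: basis_vec i) + (trunc i v + p))).
    move=> t01; apply: is_derive_scale; apply: derivableP.
    apply: (Ck_der Hf); exact: (hr _ (ball_in _ _ _ t01)).1.
  have [t t01|t t01] := @mvt_line f (trunc i v + p) (v 0 i *: basis_vec i).
    by have [] := der t t01.
  have -> : trunc i.+1 v + p = v 0 i *: basis_vec i + (trunc i v + p).
    rewrite addrA; congr (_ + _); apply/rowP => j; rewrite /basis_vec !mxE /= ltnS leq_eqVlt.
    case: (eqVneq j i) => [->|ji]; first by rewrite ltnn eqxx mulr1 addr0.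
    have -> : (j == i :> nat) = false by apply/negbTE.
    by rewrite mulr0 add0r.
  move=> ->; rewrite (@derive_val _ _ _ _ _ _ _ (der t t01)).
  by eexists; last by []; exact: (hr _ (ball_in _ _ _ t01)).2.
pose d i := sval (cid2 (step i)).
have d1 i : `|d i - pd i f p| <= e / m.+1%:R.
  by rewrite /d; case: cid2.
have d2 (i : 'I_m) : f (trunc i.+1 v + p) - f (trunc i v + p) = v 0 i * d i.
  by rewrite /d; case: cid2.
have tel : f (v + p) - f p = \sum_i v 0 i * d i.
  under eq_bigr => i _ do rewrite -d2.
  rewrite -(big_mkord xpredT (fun k => f (trunc k.+1 v + p) - f (trunc k v + p))).
  rewrite telescope_sumr //; congr (f (_ + _) - f _).
    by apply/rowP => j; rewrite !mxE ltn_ord.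
  by rewrite [trunc 0 v](_ : _ = 0) ?add0r //; apply/rowP => j; rewrite !mxE.
rewrite tel -sumrB; apply: (le_trans (ler_norm_sum _ _ _)).
apply: (@le_trans _ _ (\sum_(i < m) `|v| * (e / m.+1%:R))).
  apply: ler_sum => i _; rewrite -mulrBr normrM.
  by apply: ler_pM => //; exact: norm_coord.
rewrite sumr_const card_ord -mulrnAr mulrC ler_wpM2r //.
by rewrite -mulr_natr mulrAC ler_pdivrMr ?ltr0n // ler_wpM2l ?ler_nat // ltW.
Unshelve. all: by end_near. Qed.
End Line.

(** * Differentials of C^1 functions and the chain rule *)

Section Diff.
Context {R : realType}.

Section Dot.
Context {m : nat}.
Variable c : 'I_m -> R.
Definition rowdot (v : 'rV[R]_m) : R := \sum_i v 0 i * c i.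
Lemma rowdot_linear : linear rowdot.
Proof.
move=> a u v; rewrite /rowdot scaler_sumr -big_split /=.
by apply: eq_bigr => i _; rewrite !mxE mulrDl -mulrA.
Qed.
HB.instance Definition _ := GRing.isLinear.Build R 'rV[R]_m R _ rowdot rowdot_linear.

Lemma rowdot_continuous : continuous rowdot.
Proof.
move=> v; have : Ck 0 setT rowdot.
  apply: Ck_sum => [|i _]; first exact: openT.
  by apply: Ck_mul; [exact: openT|exact: Ck_coord|exact: Ck_cst].
by move/Ck_cont; apply.
Qed.
End Dot.

Context {m : nat}.
Implicit Types (f g : 'rV[R]_m -> R) (D : set 'rV[R]_m) (p v : 'rV[R]_m).

(** The Taylor estimate is exactly the little-o expansion that characterizes the differential. *)
Lemma Ck1_diff f D p : open D -> D p -> Ck 1 D f ->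
  differentiable f p /\ 'd f p = rowdot (fun i => pd i f p) :> (_ -> _).
Proof.
move=> oD Dp Hf; set L := rowdot _.
have E : f \o shift p = cst (f p) + L +o_ (0 : 'rV[R]_m) id.
  apply/eqaddoP => e e0; have := Ck_taylor1 oD Dp Hf e0.
  by apply: filterS => v; rewrite /= opprD addrA.
have dE : 'd f p = L :> (_ -> _) by apply: diff_unique => //; exact: rowdot_continuous.
split=> //; apply/diff_locallyP; rewrite dE; split=> //; exact: rowdot_continuous.
Qed.

Lemma Ck1_is_derive f D p v : open D -> D p -> Ck 1 D f ->
  is_derive p v f (\sum_i v 0 i * pd i f p).
Proof.
move=> oD Dp Hf; have [df E] := Ck1_diff oD Dp Hf.
by split; [exact: diff_derivable|rewrite deriveE // E].
Qed.

Lemma is_derive_mx {n} (V : normedModType R) (h : V -> 'rV[R]_n) (p v : V) (w : 'rV[R]_n) :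
  (forall k, is_derive p v (fun q => h q 0 k) (w 0 k)) -> is_derive p v h w.
Proof.
move=> H; have dh : derivable h p v.
  by apply/derivable_mxP => i k; rewrite ord1; case: (H k).
split=> //; rewrite derive_mx //; apply/rowP => k; rewrite !mxE.
by case: (H k).
Qed.

Lemma derive_line0 (V W : normedModType R) (f : V -> W) (p v : V) :
  'D_v f p = 'D_1 (fun s : R => f (s *: v + p)) 0.
Proof.
rewrite /derive; set F := (X in lim (X @ _)); set G := (X in _ = lim (X @ _)).
suff -> : F = G by [].
by apply/funext => s; rewrite /F /G /= [s *: 1]mulr1 addr0 scale0r add0r.
Qed.

(** Here h is derivable only in the direction v. Restricted to the line through p it is a function
    of one variable, for which derivable and differentiable coincide, so the composition rule for
    differentials applies there. *)
Lemma is_derive_comp {n} (V : normedModType R) (h : V -> 'rV[R]_n) (f : 'rV[R]_n -> R) (p v : V) w :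
  is_derive p v h w -> differentiable f (h p) ->
  is_derive p v (f \o h) ('d f (h p) w).
Proof.
move=> [dh hE] df.
have Dh : differentiable (fun s : R => h (s *: v + p)) 0.
  exact: (iffLR (derivable1_diffP _ _) (iffLR (derivable1P _ _ _) dh)).
have h0 : h (0 *: v + p) = h p by rewrite scale0r add0r.
have df' : differentiable f ((fun s : R => h (s *: v + p)) 0) by rewrite h0.
have D2 := differentiable_comp Dh df'.
split.
  exact: (iffRL (derivable1P _ _ _) (iffRL (derivable1_diffP _ _) D2)).
rewrite derive_line0 -derive1E derive1E' //.
have -> := diff_comp Dh df'.
rewrite /= h0; congr ('d f (h p) _).
by rewrite -derive1E' // derive1E -hE [RHS]derive_line0.
Qed.
End Diff.

Section Chain.
Context {R : realType} {m n : nat}.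
Implicit Types (D : set 'rV[R]_m) (E : set 'rV[R]_n) (h : 'rV[R]_n -> 'rV[R]_m).

Lemma pd_comp f h D E i p : open D -> Ck 1 D f -> E p -> D (h p) ->
  (forall k, Ck 1 E (fun q => h q 0 k)) ->
  is_derive p (basis_vec i) (f \o h)
    (\sum_k pd k f (h p) * pd i (fun q => h q 0 k) p).
Proof.
move=> oD Hf Ep Dp Hh.
have dh : is_derive p (basis_vec i) h (\row_k pd i (fun q => h q 0 k) p).
  by apply: is_derive_mx => k; rewrite mxE; apply: derivableP; exact: (Ck_der (Hh k)).
have [df dE] := Ck1_diff oD Dp Hf.
have := is_derive_comp dh df; rewrite dE => H; apply: is_derive_eq H _.
by apply: eq_bigr => k _; rewrite mxE mulrC.
Qed.

Lemma continuous_mx {T : topologicalType} {a b} (h : T -> 'M[R]_(a, b)) p :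
  (forall i j, {for p, continuous (fun q => h q i j)}) -> {for p, continuous h}.
Proof.
move=> H; apply/cvgrPdist_le => e e0.
have : \forall q \near p, forall i j, `|h p i j - h q i j| <= e.
  apply: filter_forall => i; apply: filter_forall => j.
  by have /cvgrPdist_le := H i j; apply.
apply: filterS => q hq.
rewrite [leLHS]/Num.Def.normr/= mx_normrE.
by apply/bigmax_leP; split=> [|[i j] _ /=]; [exact: ltW|rewrite !mxE].
Qed.

Lemma Ck_comp k f h D E : open D -> open E -> (forall p, E p -> D (h p)) ->
  Ck k D f -> (forall j, Ck k E (fun q => h q 0 j)) -> Ck k E (f \o h).
Proof.
move=> oD oE hED; elim: k f => [|k IH] f Hf Hh.
  split=> // p Ep; apply: continuous_comp; last by apply: (Ck_cont Hf); exact: hED.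
  apply: continuous_mx => i j; rewrite ord1; exact: (Ck_cont (Hh j)).
have d i p (Ep : E p) := @pd_comp f h D E i p oD (@Ck_le _ _ k.+1 1 _ _ isT Hf) Ep
  (hED _ Ep) (fun j => @Ck_le _ _ k.+1 1 _ _ isT (Hh j)).
split=> [p Ep|i].
  apply: continuous_comp; last by apply: (Ck_cont Hf); exact: hED.
  apply: continuous_mx => i j; rewrite ord1; exact: (Ck_cont (Hh j)).
split=> [p Ep|]; first by case: (d i p Ep).
have : Ck k E (fun p => \sum_j (pd j f \o h) p * pd i (fun q => h q 0 j) p).
  apply: Ck_sum => // j _; apply: Ck_mul => //; last exact: (Ck_pd i (Hh j)).
  apply: IH; first exact: (Ck_pd j Hf).
  by move=> l; exact: (@Ck_le _ _ k.+1).
by apply: Ck_ext => // p Ep; case: (d i p Ep).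
Qed.
End Chain.

(** * Symmetry of second derivatives *)

Section Schwarz.
Context {R : realType} {m : nat}.
Implicit Types (f : 'rV[R]_m -> R) (D : set 'rV[R]_m) (p v : 'rV[R]_m).

Lemma norm_basis_vec_le (i : 'I_m) : `|basis_vec i : 'rV[R]_m| <= 1.
Proof.
apply: norm_row_le => // j; rewrite /basis_vec mxE /=.
by case: (_ == _); rewrite ?normr1 ?normr0.
Qed.

Lemma mvt_basis f p i (h : R) :
  (forall t : R, 0 <= t <= 1 -> derivable f (t *: (h *: basis_vec i) + p) (basis_vec i)) ->
  exists2 c : R, 0 <= c <= 1 &
    f (h *: basis_vec i + p) - f p = h * pd i f (c *: (h *: basis_vec i) + p).
Proof.
move=> df; have d (t : R) (t01 : 0 <= t <= 1) := is_derive_scale h (derivableP (df t t01)).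
have [t t01|c c01 ->] := @mvt_line _ _ f p (h *: basis_vec i); first by case: (d t t01).
by exists c => //; case: (d c c01).
Qed.

(** The mean value theorem is used twice: in direction i for the increment of f along direction j,
    then in direction j for the partial derivative of index i. *)
Lemma second_difference f p i j (h r : R) : 0 <= h -> h *+ 2 < r ->
  Ck 2 (ball p r) f ->
  exists2 q, `|q - p| <= h *+ 2 &
    f (h *: basis_vec i + (h *: basis_vec j + p)) - f (h *: basis_vec j + p) -
    (f (h *: basis_vec i + p) - f p) = h * (h * pd j (pd i f) q).
Proof.
move=> h0 hr Hf.
have near_p (s t : R) : 0 <= s <= 1 -> 0 <= t <= 1 ->
    `|s *: (h *: basis_vec i) + (t *: (h *: basis_vec j))| <= h *+ 2.
  move=> /andP[s0 s1] /andP[t0 t1]; rewrite mulr2n; apply: (le_trans (ler_normD _ _)).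
  apply: lerD; rewrite !normrZ !ger0_norm // mulrCA ler_piMr // mulr_ile1 //;
    exact: norm_basis_vec_le.
have inb (s t : R) : 0 <= s <= 1 -> 0 <= t <= 1 ->
    ball p r (s *: (h *: basis_vec i) + (t *: (h *: basis_vec j) + p)).
  move=> s01 t01; rewrite -ball_normE /ball_ /= distrC addrA addrK.
  by apply: le_lt_trans hr; exact: near_p.
have i0 : 0 <= (0 : R) <= 1 by rewrite lexx ler01.
have i1 : 0 <= (1 : R) <= 1 by rewrite lexx ler01.
pose g q := f (h *: basis_vec j + q) - f q.
have Hj t : 0 <= t <= 1 -> ball p r (t *: (h *: basis_vec i) + (h *: basis_vec j + p)).
  by move=> t01; have := inb t 1 t01 i1; rewrite scale1r.
have Hi t : 0 <= t <= 1 -> ball p r (t *: (h *: basis_vec i) + p).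
  by move=> t01; have := inb t 0 t01 i0; rewrite scale0r add0r.
have dshift t : 0 <= t <= 1 ->
    is_derive (t *: (h *: basis_vec i) + p) (basis_vec i)
      (fun q => f (h *: basis_vec j + q)) (pd i f (t *: (h *: basis_vec i) + (h *: basis_vec j + p))).
  move=> t01; have /derivableP/is_derive_line0 H := Ck_der (i := i) Hf (Hj t t01).
  apply/is_derive_line0; move: H; congr (is_derive _ _ _ _).
  by apply/funext => s; congr f; rewrite [RHS]addrCA; congr (_ + _); rewrite [RHS]addrCA.
have dg t : 0 <= t <= 1 -> is_derive (t *: (h *: basis_vec i) + p) (basis_vec i) g
    (pd i f (t *: (h *: basis_vec i) + (h *: basis_vec j + p)) -
     pd i f (t *: (h *: basis_vec i) + p)).
  move=> t01; apply: is_deriveB; first exact: dshift.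
  by apply: derivableP; exact: (Ck_der Hf (Hi _ t01)).
have [t t01|c c01] := @mvt_basis g p i h; first by case: (dg t t01).
have -> : g (h *: basis_vec i + p) - g p =
  f (h *: basis_vec i + (h *: basis_vec j + p)) - f (h *: basis_vec j + p) -
    (f (h *: basis_vec i + p) - f p).
  by rewrite /g addrCA; ring.
move=> ->; rewrite /pd (@derive_val _ _ _ _ _ _ _ (dg c c01)).
have [t t01|d d01] := @mvt_basis (pd i f) (c *: (h *: basis_vec i) + p) j h.
  apply: (Ck_der (Ck_pd i Hf)); rewrite addrCA; exact: inb.
rewrite addrCA => ->; exists (c *: (h *: basis_vec i) + (d *: (h *: basis_vec j) + p)).
  by rewrite addrA addrK; exact: near_p.
by rewrite addrCA.
Qed.

(** The second difference is symmetric in i and j, so the two mixed derivatives take a common value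
    at suitable points near p. If they differed by e > 0 at p, continuity up to e/4 would give e <=
    e/2. *)
Lemma pd_comm f D p i j : open D -> D p -> Ck 2 D f ->
  pd i (pd j f) p = pd j (pd i f) p.
Proof.
have absurd (x : R) : 0 < x -> x <= x / 4 + x / 4 -> False by lra.
move=> oD Dp Hf; apply/eqP; rewrite -subr_eq0 -normr_le0 leNgt; apply/negP => e0.
set e := `| _ | in e0.
have e4 : 0 < e / 4 by rewrite divr_gt0.
have c a b : {for p, continuous (pd a (pd b f))}.
  exact: (Ck_cont (Ck_pd a (Ck_pd b Hf))).
have /cvgrPdist_le/(_ _ e4) h1 := c i j.
have /cvgrPdist_le/(_ _ e4) h2 := c j i.
have h3 : \forall q \near p, D q by apply: open_nbhs_nbhs.
have : \forall q \near p, D q /\ (`|pd i (pd j f) p - pd i (pd j f) q| <= e / 4 /\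
     `|pd j (pd i f) p - pd j (pd i f) q| <= e / 4).
  apply: filterI; first exact: h3.
  apply: filterI; first exact: h1.
  exact: h2.
move=> /nbhs_ballP[r /= r0 hr].
pose h := r / 4; have h0 : 0 < h by rewrite divr_gt0.
have h2r : h *+ 2 < r by rewrite /h; lra.
have Hr : Ck 2 (ball p r) f by apply: Ck_sub Hf => q /hr[].
have [q1 n1 E1] := second_difference i j (ltW h0) h2r Hr.
have [q2 n2 E2] := second_difference j i (ltW h0) h2r Hr.
have E : pd j (pd i f) q1 = pd i (pd j f) q2.
  apply: (mulfI (lt0r_neq0 h0)); apply: (mulfI (lt0r_neq0 h0)).
  apply: (etrans (esym E1)); apply: (etrans _ E2).
  have -> : f (h *: basis_vec i + (h *: basis_vec j + p)) =
    f (h *: basis_vec j + (h *: basis_vec i + p)) by rewrite addrCA.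
  set f1 := f (_ + _); set f2 := f (_ + _); set f3 := f (_ + _); set f4 := f p.
  by clearbody f1 f2 f3 f4; ring.
have b q : `|q - p| <= h *+ 2 -> ball p r q.
  by move=> hq; rewrite -ball_normE /ball_ /= distrC; exact: le_lt_trans h2r.
have [_ [_ k1]] := hr _ (b _ n1); have [_ [k2 _]] := hr _ (b _ n2).
have : e <= e / 4 + e / 4.
  rewrite E in k1; apply: le_trans (lerD k2 k1).
  have -> : e = `|(pd i (pd j f) p - pd i (pd j f) q2) -
     (pd j (pd i f) p - pd i (pd j f) q2)|.
    by rewrite /e opprB addrA subrK.
  exact: ler_normB.
exact: absurd e0.
Qed.
End Schwarz.

(** * Comparison of the classes C^k with [smooth_on] *)

Section SmoothOn.
Context {R : realType} {m : nat}.
Implicit Types (f : 'rV[R]_m -> R) (D : set 'rV[R]_m) (p v : 'rV[R]_m).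

Lemma iter_partial_rcons {V : normedModType R} s i (F : 'rV[R]_m -> V) :
  iter_partial (rcons s i) F = iter_partial s (fun p => 'D_(basis_vec i) F p).
Proof. by elim: s => //= j s ->. Qed.

Lemma smooth_onP D f : smooth_on D f <-> sm D f.
Proof.
split=> [H k|H s].
  elim: k f H => [|k IH] f H; split=> //.
  - by move=> p Dp; have [] := H [::] p Dp.
  - by move=> p Dp; have [] := H [::] p Dp.
  - move=> i; split=> [p Dp|]; first by have [_] := H [::] p Dp; apply.
    by apply: IH => s p Dp; have := H (rcons s i) p Dp; rewrite iter_partial_rcons.
have {H} : Ck (size s).+1 D f by [].
(* [iter_partial] applies the last index of the list first, hence the induction from the right. *)
elim/last_ind: s f => [|s i IH] f H p Dp.
  by split=> [|i]; [exact: (Ck_cont H)|exact: (Ck_der H)].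
rewrite iter_partial_rcons; apply: IH => //.
by move: H; rewrite size_rcons => /Ck_pd; exact.
Qed.

(** The disjunction lets a single induction on the list serve both directions of [smooth_on_mxP]. *)
Lemma iter_partial_mx {a b} D (F : 'rV[R]_m -> 'M[R]_(a, b)) : open D ->
  (smooth_on D F \/ forall i j, smooth_on D (fun p => F p i j)) ->
  forall s p i j, D p ->
    iter_partial s F p i j = iter_partial s (fun p => F p i j) p /\
    forall k, derivable (iter_partial s F) p (basis_vec k) /\
              derivable (iter_partial s (fun p => F p i j)) p (basis_vec k).
Proof.
move=> oD H; elim=> [|l s IH] p i j Dp.
  split=> // k; case: H => H.
    have [_ /(_ k) d] := H [::] p Dp; split=> //.
    by move/derivable_mxP : d => /(_ i j).
  split; last by have [_] := H i j [::] p Dp; apply.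
  by apply/derivable_mxP => i' j'; have [_] := H i' j' [::] p Dp; apply.
have E q i' j' : D q -> iter_partial (l :: s) F q i' j' =
    iter_partial (l :: s) (fun p => F p i' j') q.
  move=> Dq /=; rewrite derive_mx; last by have [_ /(_ l)[]] := IH q i' j' Dq.
  rewrite mxE; apply: near_eq_derive.
  by apply: (near_of_open oD Dq) => r Dr; have [] := IH r i' j' Dr.
split; first exact: E.
move=> k; case: H => H.
  have [_ /(_ k) d] := H (l :: s) p Dp; split=> //.
  move/derivable_mxP : d => /(_ i j); apply: near_eq_derivable.
  by apply: (near_of_open oD Dp) => r Dr; rewrite E.
split; last by have [_] := H i j (l :: s) p Dp; apply.
apply/derivable_mxP => i' j'; have [_ /(_ k)] := H i' j' (l :: s) p Dp.
apply: near_eq_derivable.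
by apply: (near_of_open oD Dp) => r Dr; rewrite E.
Qed.

Lemma smooth_on_mxP {a b} D (F : 'rV[R]_m -> 'M[R]_(a, b)) : open D ->
  smooth_on D F <-> forall i j, sm D (fun p => F p i j).
Proof.
move=> oD; split=> [H i j|H].
  apply/smooth_onP => s p Dp.
  have K := iter_partial_mx oD (or_introl H); split; last by move=> k; case: (K s p i j Dp) => _ /(_ k)[].
  apply: (@continuous_eq_on _ _ _ D p (fun q => iter_partial s F q i j)) => //.
    by move=> q Dq; case: (K s q i j Dq).
  have [c _] := H s p Dp.
  exact: (@continuous_comp _ _ _ (iter_partial s F) (fun M : 'M[R]_(a, b) => M i j) p c
    (@coord_continuous _ _ _ i j _)).
have H' i j : smooth_on D (fun p => F p i j) by apply/smooth_onP; exact: H.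
have K := iter_partial_mx oD (or_intror H') => s p Dp.
split=> [|k].
  apply: continuous_mx => i j.
  apply: (@continuous_eq_on _ _ _ D p (iter_partial s (fun q => F q i j))) => //.
    by move=> q Dq; case: (K s q i j Dq).
  by have [] := H' i j s p Dp.
apply/derivable_mxP => i j; have [_ /(_ k)] := H' i j s p Dp.
apply: near_eq_derivable.
by apply: (near_of_open oD Dp) => r Dr; case: (K s r i j Dr).
Qed.

Lemma Ck_sqrt k D f : open D -> (forall p, D p -> 0 < f p) -> Ck k D f ->
  Ck k D (fun p => Num.sqrt (f p)).
Proof.
move=> oD f0; elim: k => [|k IH] Hf.
  split=> // p Dp; apply: continuous_comp; first exact: (Ck_cont Hf).
  exact: sqrt_continuous.
have d i p : D p -> is_derive p (basis_vec i) (fun p => Num.sqrt (f p))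
    (2^-1 * (Num.sqrt (f p))^-1 * pd i f p).
  move=> Dp; apply/is_derive_line0.
  have /derivableP/is_derive_line0 df := Ck_der (i := i) Hf Dp.
  apply: is_derive1_comp df.
  rewrite scale0r add0r; have := @is_derive1_sqrt R (f p) (f0 _ Dp).
  by rewrite invfM.
split=> [p Dp|i].
  apply: continuous_comp; first exact: (Ck_cont Hf).
  exact: sqrt_continuous.
split=> [p Dp|]; first by case: (d i p Dp).
have Hs : Ck k D (fun p => Num.sqrt (f p)) by apply: IH; exact: (@Ck_le _ _ k.+1).
have : Ck k D (fun p => 2^-1 * (Num.sqrt (f p))^-1 * pd i f p).
  apply: Ck_mul => //; last exact: (Ck_pd i Hf).
  apply: Ck_mul => //; first exact: Ck_cst.
  by apply: Ck_inv => // p Dp; rewrite gt_eqF // sqrtr_gt0 f0.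
by apply: Ck_ext => // p Dp; case: (d i p Dp).
Qed.
End SmoothOn.

Lemma pdE {R : realType} {m : nat} i (f : 'rV[R]_m -> R) p :
  pd i f p = 'D_(basis_vec i) f p.
Proof. by []. Qed.

#[global] Opaque pd.

(** * Calculus of matrix-valued functions *)

Section MatrixCalculus.
Context {R : realType} {m : nat}.
Implicit Types (D : set 'rV[R]_m) (p v : 'rV[R]_m).

Definition mC {a b} k D (F : 'rV[R]_m -> 'M[R]_(a, b)) : Prop :=
  forall i j, Ck k D (fun p => F p i j).

Definition mpd {a b} (i : 'I_m) (F : 'rV[R]_m -> 'M[R]_(a, b)) p : 'M[R]_(a, b) :=
  \matrix_(c, d) pd i (fun q => F q c d) p.

Lemma pd_ext i D (f g : 'rV[R]_m -> R) p : open D -> D p ->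
  (forall q, D q -> f q = g q) -> pd i f p = pd i g p.
Proof.
Transparent pd.
by move=> oD Dp fg; apply: near_eq_derive; exact: (near_of_open oD Dp).
Opaque pd.
Qed.

Lemma pd_cst i (c : R) p : pd i (fun=> c) p = 0.
Proof.
Transparent pd. exact: derive_cst. Opaque pd.
Qed.

Lemma pd_coord i j p : pd i (fun q => q 0 j) p = (i == j)%:R.
Proof.
Transparent pd. rewrite /pd derive_coord /basis_vec mxE /= eq_sym. by []. Opaque pd.
Qed.

Lemma pd_sum (I : Type) (r : seq I) (P : pred I) k D (F : I -> 'rV[R]_m -> R) i p :
  open D -> D p -> (forall j, P j -> Ck k.+1 D (F j)) ->
  pd i (fun q => \sum_(j <- r | P j) F j q) p = \sum_(j <- r | P j) pd i (F j) p.
Proof.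
move=> oD Dp h; elim: r => [|a r IH].
  rewrite big_nil; transitivity (pd i (fun=> 0 : R) p); last exact: pd_cst.
  by congr (pd i _ p); apply/funext => q; rewrite big_nil.
rewrite big_cons.
have -> : (fun q => \sum_(j <- a :: r | P j) F j q) =
    fun q => if P a then F a q + \sum_(j <- r | P j) F j q
             else \sum_(j <- r | P j) F j q.
  by apply/funext => q; rewrite big_cons.
case Pa: (P a) => //; rewrite -IH pdD //; first exact: (Ck_der (h _ Pa)).
by apply: (Ck_der (k := k)) Dp; apply: Ck_sum.
Qed.

Section Rules.
Variables (D : set 'rV[R]_m) (oD : open D).

Lemma mC_le {a b} k l (F : 'rV[R]_m -> 'M[R]_(a, b)) : (l <= k)%N -> mC k D F -> mC l D F.
Proof. by move=> lk H i j; exact: Ck_le lk _. Qed.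

Lemma mC_mpd {a b} k (F : 'rV[R]_m -> 'M[R]_(a, b)) i : mC k.+1 D F -> mC k D (mpd i F).
Proof.
move=> H c d; apply: (Ck_ext oD _ (Ck_pd i (H c d))) => p Dp; by rewrite mxE.
Qed.

Lemma mC_ext {a b} k (F G : 'rV[R]_m -> 'M[R]_(a, b)) :
  (forall p, D p -> F p = G p) -> mC k D F -> mC k D G.
Proof. by move=> FG H i j; apply: (Ck_ext oD _ (H i j)) => p /FG ->. Qed.

Lemma mC_cst {a b} k (A : 'M[R]_(a, b)) : mC k D (fun=> A).
Proof. by move=> i j; exact: Ck_cst. Qed.

Lemma mC_add {a b} k (F G : 'rV[R]_m -> 'M[R]_(a, b)) :
  mC k D F -> mC k D G -> mC k D (fun p => F p + G p).
Proof.
move=> HF HG i j; apply: (Ck_ext oD _ (Ck_add oD (HF i j) (HG i j))) => p _.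
by rewrite mxE.
Qed.

Lemma mC_opp {a b} k (F : 'rV[R]_m -> 'M[R]_(a, b)) :
  mC k D F -> mC k D (fun p => - F p).
Proof.
by move=> HF i j; apply: (Ck_ext oD _ (Ck_opp oD (HF i j))) => p _; rewrite mxE.
Qed.

Lemma mC_sub {a b} k (F G : 'rV[R]_m -> 'M[R]_(a, b)) :
  mC k D F -> mC k D G -> mC k D (fun p => F p - G p).
Proof. by move=> HF HG; apply: mC_add => //; exact: mC_opp. Qed.

Lemma mC_scale {a b} k (f : 'rV[R]_m -> R) (G : 'rV[R]_m -> 'M[R]_(a, b)) :
  Ck k D f -> mC k D G -> mC k D (fun p => f p *: G p).
Proof.
move=> Hf HG i j; apply: (Ck_ext oD _ (Ck_mul oD Hf (HG i j))) => p _.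
by rewrite mxE.
Qed.

Lemma mC_mul {a b c} k (F : 'rV[R]_m -> 'M[R]_(a, b)) (G : 'rV[R]_m -> 'M[R]_(b, c)) :
  mC k D F -> mC k D G -> mC k D (fun p => F p *m G p).
Proof.
move=> HF HG i j.
have : Ck k D (fun p => \sum_l F p i l * G p l j).
  by apply: Ck_sum => // l _; apply: Ck_mul.
by apply: Ck_ext => // p _; rewrite mxE.
Qed.

Lemma mC_tr {a b} k (F : 'rV[R]_m -> 'M[R]_(a, b)) : mC k D F -> mC k D (fun p => (F p)^T).
Proof. by move=> HF i j; apply: (Ck_ext oD _ (HF j i)) => p _; rewrite mxE. Qed.

Lemma Ck_det {n} k (F : 'rV[R]_m -> 'M[R]_n) : mC k D F -> Ck k D (fun p => \det (F p)).
Proof.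
move=> HF; rewrite /determinant; apply: Ck_sum => // s _; apply: Ck_mul => //.
  exact: Ck_cst.
by apply: Ck_prod => // i _; exact: HF.
Qed.

(** Cramer's rule: the entries of the inverse are minors divided by the determinant. *)
Lemma mC_invmx {n} k (F : 'rV[R]_m -> 'M[R]_n) :
  (forall p, D p -> F p \in unitmx) -> mC k D F -> mC k D (fun p => invmx (F p)).
Proof.
move=> FU HF i j.
have : Ck k D (fun p => (\det (F p))^-1 * ((-1) ^+ (j + i) * \det (row' j (col' i (F p))))).
  apply: Ck_mul => //.
    by apply: Ck_inv => // [p Dp|]; [have := FU p Dp; rewrite unitmxE unitfE|exact: Ck_det].
  apply: Ck_mul => //; first exact: Ck_cst.
  apply: Ck_det => c d; apply: (Ck_ext oD _ (HF (lift j c) (lift i d))) => p _.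
  by rewrite !mxE.
by apply: Ck_ext => // p Dp; rewrite /invmx FU // !mxE.
Qed.

Lemma mpd_ext {a b} i (F G : 'rV[R]_m -> 'M[R]_(a, b)) p : D p ->
  (forall q, D q -> F q = G q) -> mpd i F p = mpd i G p.
Proof.
move=> Dp FG; apply/matrixP => c d; rewrite !mxE; apply: (pd_ext i oD Dp) => q Dq.
by rewrite FG.
Qed.

Lemma mpd_cst {a b} i (A : 'M[R]_(a, b)) p : mpd i (fun=> A) p = 0.
Proof. by apply/matrixP => c d; rewrite !mxE pd_cst. Qed.

Lemma mpd_add {a b} i (F G : 'rV[R]_m -> 'M[R]_(a, b)) p : D p ->
  mC 1 D F -> mC 1 D G -> mpd i (fun q => F q + G q) p = mpd i F p + mpd i G p.
Proof.
move=> Dp HF HG; apply/matrixP => c d; rewrite !mxE -pdD.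
- by congr (pd i _ p); apply/funext => q; rewrite mxE.
- exact: (Ck_der (HF c d)).
- exact: (Ck_der (HG c d)).
Qed.

Lemma mpd_opp {a b} i (F : 'rV[R]_m -> 'M[R]_(a, b)) p : D p ->
  mC 1 D F -> mpd i (fun q => - F q) p = - mpd i F p.
Proof.
move=> Dp HF; apply/matrixP => c d; rewrite !mxE -pdN.
- by congr (pd i _ p); apply/funext => q; rewrite mxE.
- exact: (Ck_der (HF c d)).
Qed.

Lemma mpd_sub {a b} i (F G : 'rV[R]_m -> 'M[R]_(a, b)) p : D p ->
  mC 1 D F -> mC 1 D G -> mpd i (fun q => F q - G q) p = mpd i F p - mpd i G p.
Proof.
move=> Dp HF HG; rewrite (mpd_add i Dp HF (mC_opp HG)).
by rewrite (mpd_opp i Dp HG).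
Qed.

Lemma mpd_scale {a b} i f (G : 'rV[R]_m -> 'M[R]_(a, b)) p : D p ->
  Ck 1 D f -> mC 1 D G ->
  mpd i (fun q => f q *: G q) p = pd i f p *: G p + f p *: mpd i G p.
Proof.
move=> Dp Hf HG; apply/matrixP => c d; rewrite !mxE.
transitivity (pd i (fun q => f q * G q c d) p).
  by congr (pd i _ p); apply/funext => q; rewrite mxE.
rewrite pdM; first by rewrite [RHS]addrC [X in _ = _ + X]mulrC.

- exact: (Ck_der Hf).
- exact: (Ck_der (HG c d)).
Qed.

Lemma mpd_tr {a b} i (F : 'rV[R]_m -> 'M[R]_(a, b)) p :
  mpd i (fun q => (F q)^T) p = (mpd i F p)^T.
Proof.
apply/matrixP => c d; rewrite !mxE; congr (pd i _ p); apply/funext => q.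
by rewrite mxE.
Qed.

Lemma mpd_mul {a b c} i (F : 'rV[R]_m -> 'M[R]_(a, b)) (G : 'rV[R]_m -> 'M[R]_(b, c)) p :
  D p -> mC 1 D F -> mC 1 D G ->
  mpd i (fun q => F q *m G q) p = mpd i F p *m G p + F p *m mpd i G p.
Proof.
move=> Dp HF HG; apply/matrixP => d e; rewrite !mxE.
transitivity (pd i (fun q => \sum_l F q d l * G q l e) p).
  by congr (pd i _ p); apply/funext => q; rewrite mxE.
rewrite (@pd_sum _ _ _ 0 D) // => [|l _]; last first.
  by apply: Ck_mul; [exact: oD|exact: HF|exact: HG].
rewrite -big_split /=; apply: eq_bigr => l _; rewrite !mxE pdM.
- by rewrite [RHS]addrC [X in _ = _ + X]mulrC.
- exact: (Ck_der (HF d l)).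
- exact: (Ck_der (HG l e)).
Qed.

Lemma mpd_comm {a b} i j (F : 'rV[R]_m -> 'M[R]_(a, b)) p : D p -> mC 2 D F ->
  mpd i (mpd j F) p = mpd j (mpd i F) p.
Proof.
move=> Dp HF; apply/matrixP => c d; rewrite [LHS]mxE [RHS]mxE.
have E l : (fun q => mpd l F q c d) = pd l (fun q => F q c d).
  by apply/funext => q; rewrite mxE.
by rewrite !E; exact: (pd_comm i j oD Dp (HF c d)).
Qed.

End Rules.
End MatrixCalculus.

(** * Integrals over the unit interval *)

Section Int01.
Context {R : realType}.
Implicit Types (f g : R -> R).
Local Notation mu := (@lebesgue_measure R).
Local Notation I01 := (`[(0 : R), 1]%classic).

Definition int01 f : R := \int[mu]_(t in I01) f t.

Definition cont01 f : Prop := forall t : R, 0 <= t <= 1 -> {for t, continuous f}.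

Lemma cont01_within f : cont01 f -> {within I01, continuous f}.
Proof.
move=> cf; apply: continuous_in_subspaceT => t; rewrite inE /= in_itv /= => t01.
exact: cf.
Qed.

Lemma cont01_integrable f : cont01 f -> mu.-integrable I01 (EFin \o f).
Proof.
move=> cf; apply: continuous_compact_integrable; last exact: cont01_within.
exact: segment_compact.
Qed.

Lemma int01D f g : cont01 f -> cont01 g -> int01 (fun t => f t + g t) = int01 f + int01 g.
Proof. by move=> cf cg; apply: RintegralD => //; exact: cont01_integrable. Qed.

Lemma int01B f g : cont01 f -> cont01 g -> int01 (fun t => f t - g t) = int01 f - int01 g.
Proof. by move=> cf cg; apply: RintegralB => //; exact: cont01_integrable. Qed.

Lemma int01Z f (r : R) : cont01 f -> int01 (fun t => r * f t) = r * int01 f.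
Proof. by move=> cf; apply: RintegralZl => //; exact: cont01_integrable. Qed.

Lemma eq_int01 f g : (forall t : R, 0 <= t <= 1 -> f t = g t) -> int01 f = int01 g.
Proof. by move=> fg; apply: eq_Rintegral => t; rewrite inE /= in_itv /=; exact: fg. Qed.

Lemma int01_cst (c : R) : int01 (fun=> c) = c.
Proof. rewrite /int01 Rintegral_cst //=.
by rewrite lebesgue_measure_itv /= lte_fin ltr01 -EFinB subr0 /= mulr1. Qed.

Lemma cont01_cst (c : R) : cont01 (fun=> c).
Proof. by move=> t _; exact: cst_continuous. Qed.

Lemma int01_le f (C : R) : cont01 f -> (forall t : R, 0 <= t <= 1 -> `|f t| <= C) -> `|int01 f| <= C.
Proof.
move=> cf fC; have cn : cont01 (fun t => `|f t|).
  by move=> t t01; apply: (continuous_comp (cf t t01)); exact: norm_continuous.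
apply: (@le_trans _ _ (int01 (fun t => `|f t|))).
  by apply: le_normr_Rintegral => //; exact: cont01_integrable.
rewrite -[leRHS]int01_cst; apply: le_Rintegral => //.
- exact: cont01_integrable.
- by apply: cont01_integrable; exact: cont01_cst.
Qed.

Lemma int01_FTC (G g : R -> R) : (forall t : R, 0 <= t <= 1 -> is_derive t 1 G (g t)) ->
  cont01 g -> int01 g = G 1 - G 0.
Proof.
move=> dG cg; have dG' (t : R) : 0 <= t <= 1 -> {for t, continuous G}.
  by move=> t01; apply/differentiable_continuous/derivable1_diffP; case: (dG t t01).
have := @continuous_FTC2 R g G 0 1 ltr01 (cont01_within cg).
rewrite /int01 /Rintegral => -> //.
- split=> [t||] //.
  + by rewrite in_itv /= => /andP[t0 t1]; case: (dG t _) => //; rewrite !ltW.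
  + by apply: cvg_at_right_filter; apply: dG'; rewrite lexx ler01.
  + by apply: cvg_at_left_filter; apply: dG'; rewrite lexx ler01.
- move=> t; rewrite in_itv /= => /andP[t0 t1]; rewrite derive1E.
  by case: (dG t _) => //; rewrite !ltW.
Qed.

(** Differentiation under the integral sign, with the constant C as integrable bound for the
    derivative. *)
Lemma int01_param (f df : R -> R -> R) (e C : R) : 0 < e ->
  (forall h : R, `|h| < e -> cont01 (f h)) ->
  (forall h t : R, `|h| < e -> 0 <= t <= 1 -> is_derive h 1 (f ^~ t) (df h t)) ->
  (forall h t : R, `|h| < e -> 0 <= t <= 1 -> `|df h t| <= C) ->
  is_derive (0 : R) 1 (fun h => int01 (f h)) (int01 (df 0)).
Proof.
move=> e0 cf dfh dfC.
have I (h : R) : h \in `](- e), e[ -> `|h| < e by rewrite in_itv /= ltr_norml.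
have I' (h : R) : `](- e), e[%classic h -> `|h| < e by rewrite /= in_itv /= ltr_norml.
have J (t : R) : I01 t -> 0 <= t <= 1 by rewrite /= in_itv.
have C0 : 0 <= C.
  by apply: le_trans (dfC 0 0 _ _); rewrite ?normr0 ?lexx ?ler01.
have z : `](- e), e[%classic 0 by rewrite /= in_itv /= oppr_lt0 e0.
have E (h t : R) : `|h| < e -> 0 <= t <= 1 -> partial1of2 f h t = df h t.
  by move=> he t01; rewrite partial1of2E; case: (dfh h t he t01).
have mI : measurable (I01 : set (g_sigma_algebraType R.-ocitv.-measurable)) by [].
have ci : mu.-integrable I01 (EFin \o (fun=> C)).
  by apply: cont01_integrable; exact: cont01_cst.
have h1 : forall x, `](- e), e[%classic x -> mu.-integrable I01 (EFin \o f x).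
  by move=> x /I' xe; apply: cont01_integrable; exact: cf.
have h2 : forall x y, `](- e), e[%classic x -> I01 y -> derivable (f ^~ y) x 1.
  by move=> x y /I' xe /J yJ; case: (dfh x y xe yJ).
have h3 : forall x y, `](- e), e[%classic x -> I01 y -> `|partial1of2 f x y| <= C.
  by move=> x y /I' xe /J yJ; rewrite E //; exact: dfC.
split; first exact: (derivable_under_integral mI z h1 h2 (fun=> C0) ci h3).
rewrite -derive1E (differentiation_under_integral mI z h1 h2 (fun=> C0) ci h3).
by apply: eq_int01 => t t01; rewrite E // normr0.
Qed.

End Int01.

(** * Integrals along the rays from the center of a ball *)

Section Segment.
Context {R : realType} {m : nat}.
Variables (p0 : 'rV[R]_m) (r : R).
Implicit Types (f g : 'rV[R]_m -> R) (p v x y : 'rV[R]_m).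
Local Notation B := (ball p0 r).

Definition seg x (t : R) : 'rV[R]_m := p0 + t *: (x - p0).

Lemma seg_ball (s : R) x (t : R) : 0 <= t <= 1 -> ball p0 s x -> ball p0 s (seg x t).
Proof.
move=> /andP[t0 t1]; rewrite -ball_normE /ball_ /= /seg opprD addNKr normrN => xs.
rewrite normrZ ger0_norm // distrC; apply: le_lt_trans xs.
by rewrite ler_piMl.
Qed.

Lemma seg1 x : seg x 1 = x. Proof. by rewrite /seg scale1r addrC subrK. Qed.
(** The integrals along rays of the Poincare homotopy. The weight is a parameter because
    differentiating in x brings out one more factor t, see [pd_Ik]. *)
Definition Ik (k : nat) f x : R := int01 (fun t => t ^+ k * f (seg x t)).

Lemma open_B : open (B : set 'rV[R]_m).
Proof. exact: ball_open. Qed.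

Lemma seg_derive x (t : R) : is_derive t 1 (seg x) (x - p0).
Proof.
rewrite /seg -[X in is_derive _ _ _ X]add0r.
apply: is_deriveD.
split; last first.
  rewrite deriveE; last by apply: differentiableZl.
  by rewrite diffZl // diff_val scale1r.
exact/derivable1_diffP/differentiableZl.
Qed.

Lemma seg_cont x (t : R) : {for t, continuous (seg x)}.
Proof.
by apply/differentiable_continuous/derivable1_diffP; case: (seg_derive x t).
Qed.

Lemma cont_Ik k f x : Ck 0 B f -> B x -> cont01 (fun t => t ^+ k * f (seg x t)).
Proof.
move=> Hf Bx t t01; apply: continuousM.
  exact: exprn_continuous.
apply: (@continuous_comp _ _ _ (seg x) f t (@seg_cont x t)).
by apply: (Ck_cont Hf); exact: seg_ball.
Qed.

Lemma Ik_bound k f x (C : R) : Ck 0 B f -> B x ->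
  (forall t : R, 0 <= t <= 1 -> `|f (seg x t)| <= C) -> `|Ik k f x| <= C.
Proof.
move=> Hf Bx fC; apply: int01_le; first exact: cont_Ik.
move=> t /[dup] t01 /andP[t0 t1]; rewrite normrM; apply: le_trans (fC t t01).
by rewrite ler_piMl // normrX exprn_ile1 // ger0_norm.
Qed.

Lemma bounded_subball f (s : R) : Ck 0 B f -> s < r ->
  exists C : R, forall x, `|x - p0| <= s -> `|f x| <= C.
Proof.
move=> Hf sr; have [s0|s0] := ltP s 0.
  by exists 0 => x xs; have := le_lt_trans xs s0; rewrite normr_lt0.
pose A : set 'rV[R]_m := [set x | `|x - p0| <= s].
have AB x : A x -> B x.
  by rewrite -ball_normE /ball_ /= distrC => xs; exact: le_lt_trans xs sr.
have cA : compact A.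
  apply: bounded_closed_compact.
    exists (`|p0| + s); split; first exact: num_real.
    move=> M pM x /= xs; apply: le_trans (ltW pM).
    by rewrite -[x](subrK p0) addrC; apply: (le_trans (ler_normD _ _)); rewrite lerD2l.
  have -> : A = (fun x => `|x - p0|) @^-1` [set y : R | y <= s] by [].
  apply: closed_comp; last exact: closed_le.
  move=> x _; apply: continuous_comp; last exact: norm_continuous.
  by apply: continuousB; [exact: cvg_id|exact: cst_continuous].
have [||c Ac h] := @EVT_max_rV R m (fun x => `|f x|) A _ cA.
- by exists p0; rewrite /A /= subrr normr0.
- apply: continuous_in_subspaceT => x; rewrite inE => /AB Bx.
  apply: (@continuous_comp _ _ _ f (fun y : R => `|y|) x (Ck_cont Hf Bx)).
  exact: norm_continuous.
by exists `|f c| => x xs; apply: h; rewrite inE.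
Qed.

Lemma bounded_subball_pd f (s : R) : Ck 1 B f -> s < r ->
  exists C : R, forall i x, `|x - p0| <= s -> `|pd i f x| <= C.
Proof.
move=> Hf sr.
have h i : exists C : R, forall x, `|x - p0| <= s -> `|pd i f x| <= C.
  by apply: bounded_subball => //; exact: (Ck_pd i Hf).
exists (\sum_i `|sval (cid (h i))|) => i x xs.
have := svalP (cid (h i)) x xs => /le_trans; apply.
apply: (le_trans (ler_norm _)).
by rewrite (bigD1 i) //= lerDl sumr_ge0.
Qed.

Lemma lipschitz_ball f (s C : R) x y : s <= r -> Ck 1 B f ->
  (forall i q, ball p0 s q -> `|pd i f q| <= C) ->
  ball p0 s x -> ball p0 s y -> `|f x - f y| <= m%:R * C * `|x - y|.
Proof.
move=> sr Hf hC Bx By.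
have inb (c : R) : 0 <= c <= 1 -> ball p0 s (c *: (x - y) + y).
  move=> /andP[c0 c1]; move: Bx By; rewrite -ball_normE /ball_ /= => Bx By.
  have -> : p0 - (c *: (x - y) + y) = c *: (p0 - x) + (1 - c) *: (p0 - y).
    apply/rowP => i; rewrite !mxE; ring.
  apply: (le_lt_trans (ler_normD _ _)); rewrite !normrZ.
  rewrite (ger0_norm c0) (ger0_norm (_ : 0 <= 1 - c)) ?subr_ge0 //.
  set a := `|p0 - x| in Bx *; set b := `|p0 - y| in By *.
  have [c_0|c_0] := eqVneq c 0; first by rewrite c_0 mul0r add0r subr0 mul1r.
  have : c * a < c * s by rewrite ltr_pM2l // lt_neqAle eq_sym c_0.
  have : (1 - c) * b <= (1 - c) * s by rewrite ler_wpM2l ?subr_ge0 // ltW.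
  move: (c * a) => ca; rewrite [(1 - c) * s]mulrBl mul1r; move: (c * s) ((1 - c) * b) => u v.
  lra.
have sB q : ball p0 s q -> B q by apply: le_ball.
have D q v : ball p0 s q -> is_derive q v f (\sum_i v 0 i * pd i f q).
  by move=> /sB Bq; apply: Ck1_is_derive Bq Hf; exact: open_B.
have [t t01|c c01] := @mvt_line _ _ f y (x - y); first by case: (D _ (x - y) (inb t t01)).
rewrite subrK => ->; have [_ ->] := D _ (x - y) (inb c c01).
apply: (le_trans (ler_norm_sum _ _ _)).
apply: (@le_trans _ _ (\sum_(i < m) C * `|x - y|)).
  apply: ler_sum => i _; rewrite normrM mulrC; apply: ler_pM => //.
    exact: (hC _ _ (inb c c01)).
  exact: norm_coord.
by rewrite sumr_const card_ord -mulrA mulr_natl.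
Qed.

Lemma mid_radius x : B x -> exists s : R, [/\ `|x - p0| < s, s < r & 0 < s].
Proof.
rewrite -ball_normE /ball_ /= distrC => h; exists ((`|x - p0| + r) / 2).
have := normr_ge0 (x - p0); move: (`|x - p0|) h => a h a0; split; lra.
Qed.

Lemma ball_norm_le (s : R) x : ball p0 s x -> `|x - p0| <= s.
Proof. by rewrite -ball_normE /ball_ /= distrC; exact: ltW. Qed.

(** A Lipschitz bound for f on a smaller ball is inherited by the integral. This costs one
    derivative, whence the shift of order in [Ik_Ck]; all applications are to smooth functions. *)
Lemma Ik_cont k f x : Ck 1 B f -> B x -> {for x, continuous (Ik k f)}.
Proof.
move=> Hf Bx; have [s [xs sr s0]] := mid_radius Bx.
have [C hC] := bounded_subball_pd Hf sr.
have hC' i q : ball p0 s q -> `|pd i f q| <= C by move/ball_norm_le; exact: hC.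
have H0 : Ck 0 B f by exact: (@Ck_le _ _ 1).
have sB q : ball p0 s q -> B q by apply: le_ball; exact: ltW.
have bx : ball p0 s x by rewrite -ball_normE /ball_ /= distrC.
have L y : ball p0 s y -> `|Ik k f x - Ik k f y| <= m%:R * `|C| * `|x - y|.
  move=> By; rewrite -int01B; [|exact: cont_Ik H0 _|by apply: cont_Ik H0 _; exact: sB].
  apply: int01_le.
    move=> t t01; apply: continuousB; first by apply: cont_Ik t01.
    by apply: cont_Ik t01 => //; exact: sB.
  move=> t /[dup] t01 /andP[t0 t1]; rewrite -mulrBr normrM.
  have tk : `|t ^+ k| <= 1 by rewrite normrX exprn_ile1 // ger0_norm.
  apply: (@le_trans _ _ `|f (seg x t) - f (seg y t)|).
    by rewrite ler_piMl.
  apply: (le_trans (lipschitz_ball (C := `|C|) (ltW sr) Hf _ _ _)).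
  - by move=> i q bq; apply: (le_trans (hC' i q bq)); exact: ler_norm.
  - exact: seg_ball.
  - exact: seg_ball.
  rewrite ler_wpM2l ?mulr_ge0 //.
  have -> : seg x t - seg y t = t *: (x - y) by apply/rowP => i; rewrite !mxE; ring.
  by rewrite normrZ ger0_norm // ler_piMl.
apply/(cvgrPdist_le (F := nbhs x)) => e e0.
have M0 : 0 < m%:R * `|C| + 1 by rewrite ltr_wpDl ?mulr_ge0.
have : \forall y \near x, ball p0 s y.
  by apply: open_nbhs_nbhs; split; [exact: ball_open|exact: bx].
move=> /nbhs_ballP[d /= d0 hd].
have dm : 0 < Num.min d (e / (m%:R * `|C| + 1)) by rewrite lt_min d0 divr_gt0.
have : \forall y \near x, ball x (Num.min d (e / (m%:R * `|C| + 1))) y.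
  exact: nbhsx_ballx.
apply: filterS => y; rewrite -ball_normE /ball_ /= lt_min => /andP[yd ye].
apply: (le_trans (L y _)); first by apply: hd; rewrite -ball_normE.
have : (m%:R * `|C| + 1) * `|x - y| <= e.
  by rewrite mulrC -ler_pdivlMr // ltW.
by apply: le_trans; rewrite ler_wpM2r // lerDl.
Qed.

Lemma Ik_derive k f x i : Ck 1 B f -> B x ->
  is_derive x (basis_vec i) (Ik k f) (Ik k.+1 (pd i f) x).
Proof.
move=> Hf Bx; have [s [xs sr s0]] := mid_radius Bx.
have [C hC] := bounded_subball_pd Hf sr.
have H0 : Ck 0 B f by exact: (@Ck_le _ _ 1).
have sB q : ball p0 s q -> B q by apply: le_ball; exact: ltW.
have inb (h : R) : `|h| < s - `|x - p0| -> ball p0 s (h *: basis_vec i + x).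
  move=> hs; rewrite -ball_normE /ball_ /= distrC -addrA.
  apply: (le_lt_trans (ler_normD _ _)); rewrite -ltrBrDr; apply: le_lt_trans hs.
  by rewrite normrZ ler_piMr // norm_basis_vec_le.
have segE (h t : R) : seg (h *: basis_vec i + x) t = h *: (t *: basis_vec i) + seg x t.
  apply/rowP => j; rewrite !mxE; ring.
pose df (h t : R) := t ^+ k * (t * pd i f (seg (h *: basis_vec i + x) t)).
apply/is_derive_line0.
have := @int01_param R (fun h t => t ^+ k * f (seg (h *: basis_vec i + x) t)) df
  (s - `|x - p0|) C.
rewrite subr_gt0 => /(_ xs) H.
have -> : Ik k.+1 (pd i f) x = int01 (df 0).
  by apply: eq_int01 => t _; rewrite /df scale0r add0r exprSr mulrA.
apply: H => [h hs|h t hs t01|h t hs /[dup] t01 /andP[t0 t1]].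
- by apply: cont_Ik => //; apply: sB; exact: inb.
- have Bh : B (seg (h *: basis_vec i + x) t) by apply: seg_ball => //; apply: sB; exact: inb.
  have d2 : is_derive h 1 (fun h0 : R => f (seg (h0 *: basis_vec i + x) t))
      (t * pd i f (seg (h *: basis_vec i + x) t)).
    have -> : (fun h0 : R => f (seg (h0 *: basis_vec i + x) t)) =
      fun h0 : R => f (h0 *: (t *: basis_vec i) + seg x t).
      by apply/funext => h0; rewrite segE.
    apply/is_derive_line; rewrite -segE; apply: is_derive_scale.
    by apply: derivableP; exact: (Ck_der Hf).
  exact: (@is_deriveZ _ _ _ _ (t ^+ k) h 1 _ d2).
- have bh : ball p0 s (seg (h *: basis_vec i + x) t) by apply: seg_ball => //; exact: inb.
  rewrite /df mulrA normrM; apply: le_trans (hC i _ (ball_norm_le bh)).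
  by rewrite ler_piMl // -exprSr normrX exprn_ile1 // ger0_norm.
Qed.

Lemma pd_Ik k f x i : Ck 1 B f -> B x -> pd i (Ik k f) x = Ik k.+1 (pd i f) x.
Proof. Transparent pd. by move=> Hf Bx; case: (Ik_derive k i Hf Bx). Opaque pd. Qed.

Lemma Ik_Ck n k f : Ck n.+1 B f -> Ck n B (Ik k f).
Proof.
elim: n k f => [|n IH] k f Hf; first by split=> // x Bx; exact: Ik_cont.
have H1 : Ck 1 B f by exact: (@Ck_le _ _ n.+2).
split=> [x Bx|i]; first exact: Ik_cont.
split=> [x Bx|]; first by case: (Ik_derive k i H1 Bx).
apply: (@Ck_ext _ _ n B (Ik k.+1 (pd i f))); first exact: open_B.
- by move=> x Bx; rewrite pd_Ik.
- by apply: IH; exact: (Ck_pd i Hf).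
Qed.

Lemma int01_sum n (F : 'I_n -> R -> R) : (forall i, cont01 (F i)) ->
  cont01 (fun t => \sum_i F i t) /\ int01 (fun t => \sum_i F i t) = \sum_i int01 (F i).
Proof.
elim: n F => [|n IH] F cF.
  have -> : (fun t => \sum_(i < 0) F i t) = fun=> 0 by apply/funext => t; rewrite big_ord0.
  by rewrite big_ord0 int01_cst; split=> //; exact: cont01_cst.
have -> : (fun t => \sum_(i < n.+1) F i t) =
    fun t => F ord0 t + \sum_(i < n) F (lift ord0 i) t.
  by apply/funext => t; rewrite big_ord_recl.
have [c E] := IH (fun i => F (lift ord0 i)) (fun i => cF (lift ord0 i)).
by split; [move=> t t01; apply: continuousD; [exact: cF|exact: c]|rewrite int01D // big_ord_recl E].
Qed.

(** The derivative of t^(k+1) f(p0 + t (x - p0)) is integrated over [0, 1]. *)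
Lemma Ik_FTC k f x : Ck 1 B f -> B x ->
  f x = k.+1%:R * Ik k f x + \sum_a (x - p0) 0 a * Ik k.+1 (pd a f) x.
Proof.
move=> Hf Bx; have H0 : Ck 0 B f by exact: (@Ck_le _ _ 1).
pose G (t : R) := t ^+ k.+1 * f (seg x t).
pose F a (t : R) := (x - p0) 0 a * (t ^+ k.+1 * pd a f (seg x t)).
pose g (t : R) := k.+1%:R * (t ^+ k * f (seg x t)) + \sum_a F a t.
have cF a : cont01 (F a).
  move=> t t01; apply: continuousM; first exact: cst_continuous.
  by apply: cont_Ik t01 => //; exact: (Ck_pd a Hf).
have [cS ES] := int01_sum cF.
have c0 : cont01 (fun t => k.+1%:R * (t ^+ k * f (seg x t))).
  move=> t t01; apply: continuousM; first exact: cst_continuous.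
  exact: cont_Ik t01.
have dG (t : R) : 0 <= t <= 1 -> is_derive t 1 G (g t).
  move=> t01; have Bt : B (seg x t) by exact: seg_ball.
  have [df dE] := Ck1_diff open_B Bt Hf.
  have d1 : is_derive t 1 (f \o seg x) (\sum_a (x - p0) 0 a * pd a f (seg x t)).
    by have := is_derive_comp (seg_derive x t) df; rewrite dE.
  have dX : is_derive t 1 (fun s : R => s ^+ k.+1) (k.+1%:R * t ^+ k).
    by split; [exact: exprn_derivable|rewrite exp_derive /= [_%:A]mulr1].
  have := is_deriveM dX d1; move=> /is_derive_eq; apply.
  rewrite /g addrC; congr (_ + _).
    by rewrite -[LHS]/(f (seg x t) * (k.+1%:R * t ^+ k)) mulrC mulrA.
  rewrite -[LHS]/(t ^+ k.+1 * _) mulr_sumr; apply: eq_bigr => a _.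
  by rewrite /F mulrCA.
have := int01_FTC dG _.
rewrite /G expr1n mul1r seg1 expr0n mul0r subr0 => <-; last first.
  by move=> t t01; apply: continuousD; [exact: c0|exact: cS].
rewrite /g int01D // int01Z; last exact: cont_Ik.
rewrite ES; congr (_ + _); apply: eq_bigr => a _; rewrite /F int01Z //.
by apply: cont_Ik => //; exact: (Ck_pd a Hf).
Qed.
End Segment.

(** * Sequences of functions converging at a geometric rate *)

Section Limits.
Context {R : realType}.

Lemma le_of_le_geometric (a b c : R) : (forall n, a <= b + c / 2 ^+ n) -> a <= b.
Proof.
move=> h; rewrite leNgt; apply/negP => ba.
have e0 : 0 < a - b by rewrite subr_gt0.
have [n hn] : exists n : nat, `|c| / (a - b) < n%:R.
  by exists (Num.bound (`|c| / (a - b))); apply: archi_boundP; rewrite divr_ge0 ?(ltW e0).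
have n2 : n%:R < 2 ^+ n :> R by rewrite -natrX ltr_nat ltn_expl.
have p2 : 0 < 2 ^+ n :> R by rewrite exprn_gt0.
have : `|c| / 2 ^+ n < a - b.
  rewrite ltr_pdivrMr // mulrC -ltr_pdivrMr //; exact: lt_trans n2.
have := h n; have : c / 2 ^+ n <= `|c| / 2 ^+ n by rewrite ler_pM2r ?invr_gt0 // ler_norm.
move: (c / _) (`|c| / _) => u v; lra.
Qed.

Lemma geometric_cauchy (u : nat -> R) (M : R) :
  (forall n, `|u n.+1 - u n| <= M / 2 ^+ n) ->
  exists l, forall n, `|u n - l| <= 2 * M / 2 ^+ n.
Proof.
(* [e n] is the sum of the majorants M / 2^k from k = n on, so the intervals of radius [e n] around
   [u n] are nested. *)
move=> h; pose e n : R := 2 * M / 2 ^+ n.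
have eS n : e n - e n.+1 = M / 2 ^+ n.
  by rewrite /e exprS; field; rewrite expf_neq0.
have M0 : 0 <= M by have := le_trans (normr_ge0 _) (h 0%N); rewrite expr0 divr1.
have e0 n : 0 <= e n by rewrite divr_ge0 ?mulr_ge0 // exprn_ge0.
have inc n k : u n - e n <= u (n + k)%N - e (n + k)%N.
  elim: k => [|k IH]; first by rewrite addn0.
  apply: le_trans IH _; rewrite addnS; have := h (n + k)%N; have := eS (n + k)%N.
  rewrite ler_norml => E /andP[]; move: E; move: (u _) (u _) (e _) (e _) (M / _) => a b c d f.
  lra.
have dec n k : u (n + k)%N + e (n + k)%N <= u n + e n.
  elim: k => [|k IH]; first by rewrite addn0.
  apply: le_trans IH; rewrite addnS; have := h (n + k)%N; have := eS (n + k)%N.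
  rewrite ler_norml => E /andP[]; move: E; move: (u _) (u _) (e _) (e _) (M / _) => a b c d f.
  lra.
have ab n k : u n - e n <= u k + e k.
  apply: le_trans (inc n k) _; apply: le_trans (dec k n); rewrite addnC.
  have := e0 (k + n)%N; move: (e _) (u _) => x y; lra.
pose S := [set u n - e n | n in [set: nat]].
have hs : has_sup S.
  split; first by exists (u 0%N - e 0%N); exists 0%N.
  by exists (u 0%N + e 0%N) => _ [n _ <-].
exists (sup S) => n.
have h1 : u n - e n <= sup S.
  by apply: sup_ubound; [case: hs|exists n].
have h2 : sup S <= u n + e n.
  by apply: ge_sup; [case: hs|move=> _ [k _ <-]].
rewrite -/(e n) ler_norml; move: h1 h2; move: (sup S) (u n) (e n) => x y z; lra.
Qed.

Context {m : nat}.
Implicit Types (f g : 'rV[R]_m -> R) (p v x y : 'rV[R]_m).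

Lemma uniform_cont (D : set 'rV[R]_m) (F : nat -> 'rV[R]_m -> R) f (c : R) p :
  open D -> D p -> (forall n q, D q -> `|F n q - f q| <= c / 2 ^+ n) ->
  (forall n, {for p, continuous (F n)}) -> {for p, continuous f}.
Proof.
move=> oD Dp hF cF; apply/(cvgrPdist_le (F := nbhs p)) => e e0.
have [n hn] : exists n : nat, c / 2 ^+ n <= e / 3.
  apply: contrapT => /forallNP h.
  have : e / 3 <= 0.
    by apply: (@le_of_le_geometric _ _ c) => n; rewrite add0r ltW // ltNge; apply/negP/h.
  by rewrite leNgt divr_gt0.
have e3 : 0 < e / 3 by rewrite divr_gt0.
have h1 : \forall q \near p, D q by apply: open_nbhs_nbhs.
have /(cvgrPdist_le (F := nbhs p))/(_ _ e3) h2 := cF n.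
have : \forall q \near p, D q /\ `|F n p - F n q| <= e / 3 by apply: filterI h1 h2.
apply: filterS => q [Dq hq].
have a := le_trans (hF n q Dq) hn; have b := le_trans (hF n p Dp) hn.
rewrite distrC in b.
have -> : f p - f q = (f p - F n p) + ((F n p - F n q) + (F n q - f q)).
  by move: (f p) (f q) (F n p) (F n q) => *; ring.
apply: (le_trans (ler_normD _ _)); apply: (le_trans (lerD b (ler_normD _ _))).
apply: (le_trans (lerD (lexx _) (lerD hq a))).
by move: (e) => e'; lra.
Qed.

(** The mean value theorem is applied to F n on the segment from p to p + h e_i, and then n tends to
    infinity with h fixed. The error of the difference quotient of f is thus bounded by the
    oscillation of g near p. *)
Lemma uniform_derive (D : set 'rV[R]_m) (F : nat -> 'rV[R]_m -> R) f g (c : R) p i :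
  open D -> D p -> (forall n q, D q -> `|F n q - f q| <= c / 2 ^+ n) ->
  (forall n q, D q -> derivable (F n) q (basis_vec i)) ->
  (forall n q, D q -> `|pd i (F n) q - g q| <= c / 2 ^+ n) ->
  {for p, continuous g} -> is_derive p (basis_vec i) f (g p).
Proof.
move=> oD Dp hF dF hG cg.
suff H : (fun h : R => h^-1 *: ((f \o shift p) (h *: basis_vec i) - f p)) @ 0^' --> g p.
  by split; [apply/cvg_ex; exists (g p)|exact: cvg_lim H].
apply/(cvgrPdist_le (F := 0^')) => e e0.
have h1 : \forall q \near p, D q by apply: open_nbhs_nbhs.
have /(cvgrPdist_le (F := nbhs p))/(_ _ e0) h2 := cg.
have : \forall q \near p, D q /\ `|g p - g q| <= e by apply: filterI h1 h2.
move=> /nbhs_ballP[r /= r0 hr].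
have : \forall h \near (0 : R)^', h != 0 /\ `|h| < r.
  have A1 : \forall h \near (0 : R)^', h != 0 by exact: nbhs_dnbhs_neq.
  have A2 : \forall h \near (0 : R)^', `|h| < r by exact: dnbhs0_lt.
  by apply: filterI A1 A2.
apply: filterS => h [hN0 hr'].
have inb (t : R) : 0 <= t <= 1 -> ball p r (t *: (h *: basis_vec i) + p).
  move=> /andP[t0 t1]; rewrite -ball_normE /ball_ /= distrC addrK !normrZ.
  apply: le_lt_trans hr'; rewrite (ger0_norm t0) mulrCA ler_piMr //.
  by rewrite mulr_ile1 // norm_basis_vec_le.
have key n : `|f (h *: basis_vec i + p) - f p - h * g p| <= `|h| * e + (`|h| + 2) * c / 2 ^+ n.
  have [t t01|t t01 E] := @mvt_basis _ _ (F n) p i h.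
    by apply: dF; exact: (hr _ (inb t t01)).1.
  set q := t *: _ + p in E.
  have [Dq gq] : D q /\ `|g p - g q| <= e by apply: hr; exact: inb.
  have Dh : D (h *: basis_vec i + p).
    by have := (hr _ (inb 1 _)).1; rewrite scale1r; apply; rewrite lexx ler01.
  have -> : f (h *: basis_vec i + p) - f p - h * g p =
    - (F n (h *: basis_vec i + p) - f (h *: basis_vec i + p)) + (F n p - f p)
    + h * ((pd i (F n) q - g q) - (g p - g q)).
    move: E; move: (f (_ + _)) (f p) (F n (_ + _)) (F n p) (pd i _ _) (g p) (g q) => x1 x2 x3 x4 x5 x6 x7 E.
    have -> : x3 = x4 + h * x5 by rewrite -E addrC subrK.
    ring.
  apply: (le_trans (ler_normD _ _)); rewrite normrM.
  apply: (@le_trans _ _ ((c / 2 ^+ n + c / 2 ^+ n) + `|h| * (c / 2 ^+ n + e))).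
    apply: lerD.
      apply: (le_trans (ler_normD _ _)); rewrite normrN.
      by apply: lerD; exact: hF.
    rewrite ler_wpM2l //; apply: (le_trans (ler_normB _ _)).
    by apply: lerD => //; exact: hG.
  by rewrite -mulrA; move: (`|h|) (c / _) => *; lra.
have := le_of_le_geometric key.
have hp : 0 < `|h| by rewrite normr_gt0.
move=> H; rewrite /= distrC -(ler_pM2l hp) -normrM mulrBr.
by rewrite -[h^-1 *: _]/(h^-1 * _) mulVKf.
Qed.
End Limits.

(** * The Poincare lemma *)

Section Homotopy.
Context {R : realType} {m : nat}.
Variables (p0 : 'rV[R]_m) (r : R).
Implicit Types (f g : 'rV[R]_m -> R) (p v x y : 'rV[R]_m).
Local Notation B := (ball p0 r).
Let oB : open (B : set 'rV[R]_m) := @open_B R m p0 r.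

(** The homotopy operator of the Poincare lemma: contraction with x - p0 integrated along rays, the
    weight being t^k for forms of degree k+1. *)
Definition rad (k : nat) (F : 'I_m -> 'rV[R]_m -> R) x : R :=
  \sum_a (x - p0) 0 a * Ik p0 k (F a) x.

Lemma Ck_shift_coord n a : Ck n B (fun x => (x - p0) 0 a).
Proof.
apply: (@Ck_ext _ _ n B (fun x => x 0 a - p0 0 a)) => //.
  by move=> x _; rewrite !mxE.
by apply: Ck_sub2 => //; [exact: Ck_coord|exact: Ck_cst].
Qed.

Lemma rad_Ck n k F : (forall a, Ck n.+1 B (F a)) -> Ck n B (rad k F).
Proof.
move=> HF; apply: Ck_sum => // a _; apply: Ck_mul => //; first exact: Ck_shift_coord.
exact: Ik_Ck.
Qed.

Lemma pd_shift_coord a j x : pd j (fun x => (x - p0) 0 a) x = (j == a)%:R.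
Proof.
have -> : (fun x => (x - p0) 0 a) = fun x => x 0 a - p0 0 a.
  by apply/funext => y; rewrite !mxE.
have d1 : derivable (fun x : 'rV[R]_m => x 0 a) x (basis_vec j) by exact: derivable_coord.
transitivity (pd j (fun x => x 0 a) x + pd j (fun=> - p0 0 a) x).
  exact: (pdD d1 (@derivable_cst _ _ _ (- p0 0 a : R) x (basis_vec j))).
by rewrite pd_coord pd_cst addr0.
Qed.

Lemma pd_rad k F j x : (forall a, Ck 1 B (F a)) -> B x ->
  pd j (rad k F) x = Ik p0 k (F j) x + \sum_a (x - p0) 0 a * Ik p0 k.+1 (pd j (F a)) x.
Proof.
move=> HF Bx.
have dI a : derivable (Ik p0 k (F a)) x (basis_vec j) by case: (Ik_derive k j (HF a) Bx).
have dX a : derivable (fun x => (x - p0) 0 a) x (basis_vec j).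
  by apply: (Ck_der (Ck_shift_coord 1 a) Bx).
have E a : is_derive x (basis_vec j) (fun x => (x - p0) 0 a * Ik p0 k (F a) x)
   ((x - p0) 0 a * Ik p0 k.+1 (pd j (F a)) x + Ik p0 k (F a) x * (j == a)%:R).
  split; first exact: derivableM.
  have := pdM (dX a) (dI a); rewrite (pd_Ik k j (HF a) Bx) pd_shift_coord => <-.
  by rewrite pdE.
have := is_derive_sum E; rewrite [X in is_derive _ _ X](_ : _ = rad k F); last first.
  by apply/funext => y; rewrite /rad fct_sumE.
move=> [_ H]; transitivity ('D_(basis_vec j) (rad k F) x).
  by rewrite pdE.
rewrite H big_split /= addrC; congr (_ + _).
rewrite (bigD1 j) //= eqxx mulr1 big1 ?addr0 // => a aj.
by rewrite eq_sym (negPf aj) mulr0.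
Qed.

Lemma Ik_sub k f g x : Ck 0 B f -> Ck 0 B g -> B x ->
  Ik p0 k (fun y => f y - g y) x = Ik p0 k f x - Ik p0 k g x.
Proof.
move=> Hf Hg Bx; rewrite -int01B; [|exact: cont_Ik Hf Bx|exact: cont_Ik Hg Bx].
by apply: eq_int01 => t _; rewrite mulrBr.
Qed.

Lemma Ik_eq k f g x : B x -> (forall y, B y -> f y = g y) -> Ik p0 k f x = Ik p0 k g x.
Proof.
by move=> Bx fg; apply: eq_int01 => t t01; rewrite fg //; exact: seg_ball.
Qed.

(** The formula dK + Kd = id on 1-forms. The curl term is kept because the forms integrated in the
    Picard iteration below may fail to be closed at each finite stage. *)
Lemma homotopy F j x : (forall a, Ck 2 B (F a)) -> B x ->
  pd j (rad 0 F) x =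
  F j x + \sum_a (x - p0) 0 a * Ik p0 1 (fun y => pd j (F a) y - pd a (F j) y) x.
Proof.
move=> HF Bx; have H1 a : Ck 1 B (F a) by exact: (@Ck_le _ _ 2).
rewrite pd_rad // [F j x](Ik_FTC 0 (H1 j) Bx) mul1r -addrA -big_split /=; congr (_ + _).
apply: eq_bigr => a _; rewrite Ik_sub //; try exact: (Ck_pd _ (H1 _)).
by rewrite -mulrDr [X in _ = _ * X]addrC subrK.
Qed.

(** The homotopy formula for closed 2-forms: contraction with x - p0, integrated with the weight t,
    is a primitive. *)
Lemma poincare (Om : 'I_m -> 'I_m -> 'rV[R]_m -> R) :
  (forall a b, sm B (Om a b)) ->
  (forall a b x, B x -> Om a b x = - Om b a x) ->
  (forall a b c x, B x -> pd a (Om b c) x + pd b (Om c a) x + pd c (Om a b) x = 0) ->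
  exists eta : 'I_m -> 'rV[R]_m -> R, (forall a, sm B (eta a)) /\
    forall c b x, B x -> pd c (eta b) x - pd b (eta c) x = Om c b x.
Proof.
move=> sO aO dO; exists (fun b => rad 1 (fun a => Om a b)); split.
  by move=> a k; apply: rad_Ck => b; exact: sO.
move=> c b x Bx.
have C1 a d : Ck 1 B (Om a d) by exact: sO.
have aI k a d : Ik p0 k (Om a d) x = - Ik p0 k (Om d a) x.
  transitivity (Ik p0 k (fun y => 0 - Om d a y) x).
    by apply: Ik_eq => // y By; rewrite aO // sub0r.
  rewrite Ik_sub //; [|exact: Ck_cst|exact: (sO _ _ 0%N)].
  rewrite [X in X - _](_ : _ = 0) ?sub0r // /Ik.
  by rewrite (@eq_int01 _ _ (fun=> 0)) ?int01_cst // => t _; rewrite mulr0.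
rewrite !pd_rad //; try by move=> a; exact: C1.
(* The coefficient k+1 = 2 of [Ik_FTC] matches the two terms that come from differentiating the
   factor x - p0. *)
rewrite [Om c b x](Ik_FTC 1 (C1 c b) Bx) (aI 1%N b c).
rewrite opprD addrACA opprK; congr (_ + _); first by rewrite mulr_natl mulr2n.
rewrite -sumrB; apply: eq_bigr => a _; rewrite -mulrBr; congr (_ * _).
rewrite -Ik_sub //; try exact: (Ck_pd _ (C1 _ _)).
apply: Ik_eq => // y By.
have h : pd b (Om a c) y = - pd b (Om c a) y.
  transitivity (pd b (fun z => - Om c a z) y).
    by apply: (pd_ext b oB By) => z Bz; exact: aO.
  by apply: pdN; exact: (Ck_der (C1 c a) By).
have h' : pd a (Om b c) y = - pd a (Om c b) y.
  transitivity (pd a (fun z => - Om c b z) y).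
    by apply: (pd_ext a oB By) => z Bz; exact: aO.
  by apply: pdN; exact: (Ck_der (C1 c b) By).
have := dO a b c y By; rewrite h h'; move: (pd a _ y) (pd b _ y) (pd c _ y) => u v w.
by move=> /eqP; rewrite addr_eq0 => /eqP E; rewrite opprK -[w]opprK -E; ring.
Qed.
End Homotopy.

(** * Uniqueness for linear differential inequalities *)

Section Uniqueness.
Context {R : realType} {m : nat}.
Variables (p0 : 'rV[R]_m) (r : R).
Local Notation B := (ball p0 r).

Lemma entry_bound {a b c} (X : 'M[R]_(a, b)) (Y : 'M[R]_(b, c)) (x y : R) :
  (forall i j, `|X i j| <= x) -> (forall i j, `|Y i j| <= y) ->
  forall i j, `|(X *m Y) i j| <= b%:R * (x * y).
Proof.
move=> hX hY i j; rewrite mxE; apply: (le_trans (ler_norm_sum _ _ _)).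
apply: (@le_trans _ _ (\sum_(k < b) x * y)).
  by apply: ler_sum => k _; rewrite normrM; apply: ler_pM.
by rewrite sumr_const card_ord mulr_natl.
Qed.

(** Any bound M for X on the closed ball improves to m C s M, by the mean value theorem on the
    segment from p0. As m C s < 1, iteration forces X to vanish. *)
Lemma linear_uniqueness {a b} (X : 'rV[R]_m -> 'M[R]_(a, b)) (C s : R) :
  0 <= C -> 0 <= s -> s < r -> m%:R * C * s < 1 -> mC 1 B X -> X p0 = 0 ->
  (forall x (M : R), B x -> (forall i j, `|X x i j| <= M) ->
     forall c i j, `|pd c (fun y => X y i j) x| <= C * M) ->
  forall x, `|x - p0| <= s -> X x = 0.
Proof.
move=> C0 s0 sr q1 HX X0 dX.
have HX0 : mC 0 B X by apply: mC_le HX.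
have [K hK] : exists K : R, forall i j x, `|x - p0| <= s -> `|X x i j| <= K.
  have h ij : exists K : R, forall x, `|x - p0| <= s -> `|X x ij.1 ij.2| <= K.
    by apply: (@bounded_subball _ _ p0 r (fun x => X x ij.1 ij.2)) => //; exact: HX0.
  exists (\sum_ij `|sval (cid (h ij))|) => i j x xs.
  have := svalP (cid (h (i, j))) x xs => /le_trans; apply.
  apply: (le_trans (ler_norm _)).
  by rewrite (bigD1 (i, j)) //= lerDl sumr_ge0.
have q0 : 0 <= m%:R * C * s by rewrite !mulr_ge0.
have step M : (forall i j x, `|x - p0| <= s -> `|X x i j| <= M) ->
   forall i j x, `|x - p0| <= s -> `|X x i j| <= m%:R * C * s * M.
  move=> hM i j x xs.
  have inb (t : R) : 0 <= t <= 1 -> `|(t *: (x - p0) + p0) - p0| <= s.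
    move=> /andP[t0 t1]; rewrite addrK normrZ ger0_norm //; apply: le_trans xs.
    by rewrite ler_piMl.
  have inB y : `|y - p0| <= s -> B y.
    by move=> h; rewrite -ball_normE /ball_ /= distrC; exact: le_lt_trans sr.
  have D y : B y -> is_derive y (x - p0) (fun y => X y i j)
      (\sum_c (x - p0) 0 c * pd c (fun y => X y i j) y).
    by move=> By; apply: Ck1_is_derive By (HX i j); exact: open_B.
  have [t t01|t t01] := @mvt_line _ _ (fun y => X y i j) p0 (x - p0).
    by case: (D _ (inB _ (inb t t01))).
  rewrite subrK X0 mxE subr0 => ->; have By := inB _ (inb t t01).
  have [_ ->] := D _ By.
  apply: (le_trans (ler_norm_sum _ _ _)).
  apply: (@le_trans _ _ (\sum_(c < m) s * (C * M))).
    apply: ler_sum => c _; rewrite normrM; apply: ler_pM => //.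
      exact: le_trans (norm_coord _ _) xs.
    by apply: dX => // i' j'; apply: hM; exact: inb.
  rewrite sumr_const card_ord le_eqVlt; apply/orP; left; apply/eqP.
  rewrite -(mulr_natl (s * (C * M)) m); ring.
have iter n : forall i j x, `|x - p0| <= s -> `|X x i j| <= (m%:R * C * s) ^+ n * K.
  elim: n => [|n IH]; first by rewrite expr0 mul1r.
  by rewrite exprS -mulrA; exact: step.
move=> x xs; apply/matrixP => i j; rewrite mxE; apply/eqP; rewrite -normr_le0.
set q := m%:R * C * s in q0 q1 iter.
have cv : (fun n => q ^+ n * K) @ \oo --> 0 * K.
  apply: cvgMl; apply: cvg_expr; by rewrite ger0_norm.
rewrite mul0r in cv.
rewrite -(cvg_lim _ cv) //; apply: limr_ge; first by apply/cvg_ex; exists 0.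
by apply: nearW => n; exact: iter.
Qed.
End Uniqueness.

(** * Flat linear systems *)

Section FlatSystem.
Context {R : realType} {m N : nat}.
Variables (p0 : 'rV[R]_m) (r : R) (r0 : 0 < r) (A : 'I_m -> 'rV[R]_m -> 'M[R]_N).
Local Notation B := (ball p0 r).
Let oB : open (B : set 'rV[R]_m) := @open_B R m p0 r.
Hypothesis sA : forall a k, mC k B (A a).
Hypothesis flat : forall a b x, B x ->
  mpd a (A b) x - mpd b (A a) x + A b x *m A a x - A a x *m A b x = 0.

(** Integration along rays from p0 replaces the overdetermined system, one equation for each
    direction, by a single integral equation. *)
Fixpoint picard n (x : 'rV[R]_m) : 'M[R]_N :=
  if n is n'.+1 then
    1%:M + \matrix_(i, j) rad p0 0 (fun a y => (A a y *m picard n' y) i j) x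
  else 1%:M.

Lemma picard_mC n k : mC k B (picard n).
Proof.
elim: n k => [|n IH] k; first exact: mC_cst.
apply: mC_add => //; first exact: mC_cst.
move=> i j; apply: (Ck_ext oB _ (rad_Ck (p0 := p0) 0 (n := k) (fun a => mC_mul oB (sA a k.+1) (IH k.+1) i j))).
by move=> x _; rewrite mxE.
Qed.

Definition defect n c x := mpd c (picard n) x - A c x *m picard n x.

Lemma defect_mC n c k : mC k B (defect n c).
Proof.
apply: mC_sub => //; first by apply: mC_mpd => //; exact: picard_mC.
by apply: mC_mul => //; exact: picard_mC.
Qed.

(* Flatness is used here: it makes the curl of [A a *m picard n] linear in the
   defect. *)
Lemma mpd_picard n c x i j : B x ->
  (mpd c (picard n.+1) x - A c x *m picard n x) i j =
  rad p0 1 (fun a y => (A a y *m defect n c y - A c y *m defect n a y) i j) x.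
Proof.
move=> Bx; pose F a y := (A a y *m picard n y) i j.
have sF a k : Ck k B (F a) by exact: (mC_mul oB (sA a k) (picard_mC n k) i j).
have -> : (mpd c (picard n.+1) x - A c x *m picard n x) i j =
    pd c (rad p0 0 F) x - F c x.
  rewrite mxE [in LHS]mxE [X in _ + X]mxE; congr (_ - _).
  transitivity (pd c (fun y => (1%:M : 'M[R]_N) i j + rad p0 0 F y) x).
    by congr (pd c _ x); apply/funext => y; rewrite mxE; congr (_ + _); rewrite mxE.
  have sr : Ck 1 B (rad p0 0 F) by apply: rad_Ck.
  have := pdD (@derivable_cst _ _ _ ((1%:M : 'M[R]_N) i j) x (basis_vec c)) (Ck_der sr Bx).
  by move=> E; apply: (etrans E); rewrite pd_cst add0r.
rewrite (homotopy c (fun a => sF a 2%N) Bx) addrC addKr; apply: eq_bigr => a _.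
congr (_ * _); apply: (Ik_eq 1 Bx) => y By.
have dF b d : pd b (F d) y = (mpd b (A d) y *m picard n y + A d y *m mpd b (picard n) y) i j.
  rewrite -(mpd_mul (D := B)) //; last 1 first.
  - exact: picard_mC.
  by rewrite mxE.
rewrite !dF.
have := flat c a By => /eqP; rewrite subr_eq0 => /eqP E1.
have E : mpd c (A a) y = mpd a (A c) y + (A c y *m A a y - A a y *m A c y).
  apply/eqP; rewrite -subr_eq0 opprD addrA.
  by rewrite -(flat c a By) opprB addrA.
rewrite E /defect !mulmxBr !mulmxDl !mulNmx -!mulmxA.
set X1 := A c y *m (A a y *m _); set X2 := A a y *m (A c y *m _).
set X3 := mpd a (A c) y *m _; set X4 := A a y *m mpd c _ _; set X5 := A c y *m mpd a _ _.
by clearbody X1 X2 X3 X4 X5; rewrite !mxE; ring.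
Qed.

Lemma rad_bound k (F : 'I_m -> 'rV[R]_m -> R) (s c : R) x : s < r ->
  (forall a, Ck 0 B (F a)) -> (forall a y, `|y - p0| <= s -> `|F a y| <= c) ->
  `|x - p0| <= s -> `|rad p0 k F x| <= m%:R * (s * c).
Proof.
move=> sr HF hF xs; apply: (le_trans (ler_norm_sum _ _ _)).
have Bx : B x by rewrite -ball_normE /ball_ /= distrC; exact: le_lt_trans sr.
apply: (@le_trans _ _ (\sum_(a < m) s * c)).
  apply: ler_sum => a _; rewrite normrM; apply: ler_pM => //.
    exact: le_trans (norm_coord _ _) xs.
  apply: (Ik_bound (r := r)) => // t /andP[t0 t1]; apply: hF.
  rewrite /seg addrC addKr normrZ ger0_norm //; apply: le_trans xs.
  by rewrite ler_piMl.
by rewrite sumr_const card_ord mulr_natl.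
Qed.

Section Bounds.
Variables (s C : R).
Hypotheses (s0 : 0 < s) (sr : s < r) (C0 : 0 <= C).
Hypothesis hC : forall a x i j, `|x - p0| <= s -> `|A a x i j| <= C.
Hypothesis q8 : m%:R * s * N%:R * C <= 8^-1.

(** The weight K is such that a bound M / 2^n for K times the increments also bounds the products of
    [A] with the increments. *)
Let K : R := N%:R * C + 1.
Let K1 : 1 <= K. Proof. by rewrite /K lerDr mulr_ge0. Qed.
Let K0 : 0 < K. Proof. exact: lt_le_trans K1. Qed.

Let M : R := K * (m%:R * (s * C)) + m%:R * (s * (N%:R * (C * C) + N%:R * (C * C))).

Let s0' : 0 <= s. Proof. exact: ltW. Qed.

Let M0 : 0 <= M.
Proof. by rewrite /M addr_ge0 // !mulr_ge0 ?addr_ge0 ?mulr_ge0 // ltW. Qed.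

(** Increments and derivative errors are estimated together. The defect of step n+1 is a derivative
    error minus [A] times an increment, hence at most 2 M / 2^n. Two products of it with [A],
    integrated along a ray, give the factor 4 m s N C, which has to be at most 1/2: this is the
    origin of the 1/8 in [q8]. *)
Lemma picard_bounds n x : `|x - p0| <= s ->
  (forall i j, K * `|(picard n.+1 x - picard n x) i j| <= M / 2 ^+ n) /\
  (forall c i j, `|(mpd c (picard n.+1) x - A c x *m picard n x) i j| <= M / 2 ^+ n).
Proof.
have inB y : `|y - p0| <= s -> B y.
  by move=> h; rewrite -ball_normE /ball_ /= distrC; exact: le_lt_trans sr.
have two_prod (X1 X2 Y1 Y2 : 'M[R]_N) (d : R) :
    (forall i j, `|X1 i j| <= C) -> (forall i j, `|X2 i j| <= C) ->
    (forall i j, `|Y1 i j| <= d) -> (forall i j, `|Y2 i j| <= d) ->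
    forall i j, `|(X1 *m Y1 - X2 *m Y2) i j| <= N%:R * (C * d) + N%:R * (C * d).
  move=> h1 h2 h3 h4 i j; rewrite mxE [X in _ + X]mxE.
  by apply: (le_trans (ler_normB _ _)); apply: lerD; apply: entry_bound.
elim: n x => [|n IH] x xs.
  rewrite expr0 divr1; split=> [i j|c i j].
    have -> : (picard 1 x - picard 0 x) i j = rad p0 0 (fun a y => A a y i j) x.
      rewrite /= addrC addKr mxE; apply: eq_bigr => a _.
      by congr (_ * _); apply: (Ik_eq 0 (inB _ xs)) => y _; rewrite mulmx1.
    apply: (@le_trans _ _ (K * (m%:R * (s * C)))).
      rewrite ler_pM2l //; apply: (@rad_bound _ _ s) => // [a|a y ys]; first exact: (sA a 0).
      exact: hC.
    by rewrite /M lerDl !mulr_ge0 ?addr_ge0 ?mulr_ge0.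
  rewrite mpd_picard; last exact: inB.
  apply: (@le_trans _ _ (m%:R * (s * (N%:R * (C * C) + N%:R * (C * C))))); last first.
    by rewrite /M lerDr !mulr_ge0 // ltW.
  apply: (@rad_bound _ _ s) => // [a|a y ys].
    by apply: (mC_sub oB _ _ i j); apply: mC_mul => //; exact: (defect_mC 0 _ 0).
  have dC b k l : `|defect 0 b y k l| <= C.
    by rewrite /defect /= mpd_cst mulmx1 sub0r mxE normrN; exact: hC.
  by apply: two_prod => // k l; exact: hC.
have h n' : 2 ^+ n' != 0 :> R by rewrite expf_neq0.
have p2 : 0 <= M / 2 ^+ n by rewrite divr_ge0 // exprn_ge0.
have dn y i j : `|y - p0| <= s -> `|(picard n.+1 y - picard n y) i j| <= M / 2 ^+ n / K.
  by move=> ys; rewrite ler_pdivlMr // mulrC; have [+ _] := IH y ys; apply.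
have E2 : M / 2 ^+ n.+1 = 2^-1 * (M / 2 ^+ n) by rewrite exprS; field.
have KC : N%:R * C / K <= 1 by rewrite ler_pdivrMr // mul1r /K lerDl.
split=> [i j|c i j].
  have -> : (picard n.+2 x - picard n.+1 x) i j =
     rad p0 0 (fun a y => (A a y *m (picard n.+1 y - picard n y)) i j) x.
    rewrite [picard n.+2 x]/= [picard n.+1 x in X in _ - X]/= opprD addrACA subrr add0r.
    rewrite !mxE -sumrB; apply: eq_bigr => a _; rewrite -mulrBr; congr (_ * _).
    rewrite -(Ik_sub (r := r)) ?inB //.
    - by apply: (Ik_eq 0 (inB _ xs)) => y _; rewrite mulmxBr [RHS]mxE [X in _ = _ + X]mxE.
    - by apply: (mC_mul oB (sA a 0) (picard_mC n.+1 0)).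
    - by apply: (mC_mul oB (sA a 0) (picard_mC n 0)).
    - exact: inB.
  apply: (@le_trans _ _ (K * (m%:R * (s * (N%:R * (C * (M / 2 ^+ n / K))))))).
    rewrite ler_pM2l //; apply: (@rad_bound _ _ s) => // [a|a y ys].
      by apply: (mC_mul oB (sA a 0) (mC_sub oB (picard_mC n.+1 0) (picard_mC n 0))).
    by apply: entry_bound => k l; [exact: hC|exact: dn].
  have -> : K * (m%:R * (s * (N%:R * (C * (M / 2 ^+ n / K))))) =
     (m%:R * s * N%:R * C) * (M / 2 ^+ n) by field; rewrite h gt_eqF.
  rewrite E2 ler_wpM2r //; apply: le_trans q8 _.
  by rewrite lef_pV2 ?posrE // ler_nat.
rewrite mpd_picard; last exact: inB.
apply: (@le_trans _ _ (m%:R * (s * (N%:R * (C * (2 * (M / 2 ^+ n))) + N%:R * (C * (2 * (M / 2 ^+ n))))))).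
  apply: (@rad_bound _ _ s) => // [a|a y ys].
    by apply: (mC_sub oB _ _ i j); apply: mC_mul => //; exact: (defect_mC n.+1 _ 0).
  have dC b k l : `|defect n.+1 b y k l| <= 2 * (M / 2 ^+ n).
    have -> : defect n.+1 b y = (mpd b (picard n.+1) y - A b y *m picard n y)
       - A b y *m (picard n.+1 y - picard n y).
      rewrite /defect mulmxBr opprB addrA; congr (_ - _).
      by rewrite subrK.
    rewrite mxE [X in _ + X]mxE; apply: (le_trans (ler_normB _ _)).
    rewrite mulr2n mulrDl mul1r; apply: lerD; first by have [_] := IH y ys; apply.
    apply: (@le_trans _ _ (N%:R * (C * (M / 2 ^+ n / K)))).
      by apply: entry_bound => k' l'; [exact: hC|exact: dn].
    have -> : N%:R * (C * (M / 2 ^+ n / K)) = (N%:R * C / K) * (M / 2 ^+ n).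
      by field; rewrite h gt_eqF.
    by rewrite ler_piMl.
  by apply: two_prod => // k l; exact: hC.
rewrite E2; have -> : m%:R * (s * (N%:R * (C * (2 * (M / 2 ^+ n))) + N%:R * (C * (2 * (M / 2 ^+ n))))) =
  (4 * (m%:R * s * N%:R * C)) * (M / 2 ^+ n) by ring.
rewrite ler_wpM2r //; move: q8; move: (_ * C) => q; lra.
Qed.

Lemma flat_system_aux : exists Phi : 'rV[R]_m -> 'M[R]_N,
  [/\ forall k, mC k (ball p0 s) Phi, Phi p0 = 1%:M &
      forall c x, ball p0 s x -> mpd c Phi x = A c x *m Phi x].
Proof.
have lims x i j : `|x - p0| <= s ->
    exists l, forall n, `|picard n x i j - l| <= 2 * M / 2 ^+ n.
  move=> xs; apply: geometric_cauchy => n.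
  have [+ _] := picard_bounds n xs; move=> /(_ i j); apply: le_trans.
  rewrite [X in _ <= _ * `|X|]mxE [X in _ <= _ * `|_ + X|]mxE.
  by rewrite ler_peMl.
pose Phi x : 'M[R]_N := \matrix_(i, j) xget 0 [set l | forall n, `|picard n x i j - l| <= 2 * M / 2 ^+ n].
have hPhi x i j n : `|x - p0| <= s -> `|picard n x i j - Phi x i j| <= 2 * M / 2 ^+ n.
  move=> xs; have [l hl] := lims x i j xs; rewrite mxE.
  case: xgetP => [y _ /= hy|hn]; first exact: hy.
  by have := hn l; rewrite /= => H; case: H.
have bs x : ball p0 s x -> `|x - p0| <= s by exact: ball_norm_le.
have oS : open (ball p0 s : set 'rV[R]_m) by exact: ball_open.
have sB : ball p0 s `<=` B by apply: le_ball; exact: ltW.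
have cPhi : mC 0 (ball p0 s) Phi.
  move=> i j; split=> // x Bx.
  apply: (uniform_cont oS Bx (F := fun n y => picard n y i j) (c := 2 * M)).
    by move=> n q Bq; apply: hPhi; exact: bs.
  by move=> n; apply: (Ck_cont (picard_mC n 0 i j)); exact: sB.
have cA k : forall a, mC k (ball p0 s) (A a).
  by move=> a i j; apply: (Ck_sub sB); exact: sA.
have c0 : 0 <= N%:R * (C * (2 * M)) by rewrite !mulr_ge0.
have dPhi c x i j : ball p0 s x ->
    is_derive x (basis_vec c) (fun y => Phi y i j) ((A c x *m Phi x) i j).
  move=> Bx; apply: (uniform_derive (D := ball p0 s) (F := fun n y => picard n.+1 y i j)
    (g := fun y => (A c y *m Phi y) i j) (c := 2 * M + M + N%:R * (C * (2 * M)))) => //.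
  - move=> n q Bq; apply: (le_trans (hPhi _ _ _ n.+1 (bs _ Bq))).
    apply: (@le_trans _ _ (2 * M / 2 ^+ n)).
      rewrite ler_wpM2l ?mulr_ge0 // lef_pV2 ?posrE ?exprn_gt0 //.
      by rewrite exprS ler_peMl ?exprn_ge0 // ler1n.
    rewrite ler_wpM2r ?invr_ge0 ?exprn_ge0 //.
    by move: M0 c0; move: (M) (N%:R * _) => u v; lra.
  - by move=> n q Bq; apply: (Ck_der (picard_mC n.+1 1 i j)); exact: sB.
  - move=> n q Bq; have qs := bs _ Bq.
    have -> : pd c (fun y => picard n.+1 y i j) q - (A c q *m Phi q) i j =
       (mpd c (picard n.+1) q - A c q *m picard n q) i j
       + (A c q *m (picard n q - Phi q)) i j.
      have e (X Y : 'M[R]_N) : (X - Y) i j = X i j - Y i j.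
        by rewrite mxE [Z in _ + Z]mxE.
      rewrite mulmxBr !e addrA subrK; congr (_ - _).
      by rewrite [RHS]mxE.
    apply: (le_trans (ler_normD _ _)).
    have [_ h1] := picard_bounds n qs.
    have h2 : `|(A c q *m (picard n q - Phi q)) i j| <= N%:R * (C * (2 * M / 2 ^+ n)).
      apply: entry_bound => k l; first exact: hC.
      by rewrite mxE [X in _ + X]mxE; exact: hPhi.
    apply: (le_trans (lerD (h1 c i j) h2)).
    have -> : N%:R * (C * (2 * M / 2 ^+ n)) = N%:R * (C * (2 * M)) / 2 ^+ n by ring.
    rewrite -mulrDl ler_wpM2r ?invr_ge0 ?exprn_ge0 //.
    by move: M0 c0; move: (M) (N%:R * _) => u v; lra.
  - by apply: (Ck_cont (mC_mul oS (cA 0%N c) cPhi i j)).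
have mP c x : ball p0 s x -> mpd c Phi x = A c x *m Phi x.
  move=> Bx; apply/matrixP => i j; rewrite [LHS]mxE pdE.
  by case: (dPhi c x i j Bx).
exists Phi; split=> //.
  (* Bootstrapping: the derivatives of Phi are [A c *m Phi], so Phi is of class C^(k+1) once it is
     of class C^k. *)
  elim=> // k IH i j; split=> [x Bx|c].
    exact: (Ck_cont (cPhi i j)).
  split=> [x Bx|]; first by case: (dPhi c x i j Bx).
  have := mC_mul oS (cA k c) IH i j; apply: Ck_ext => // x Bx.
  by rewrite -mP // mxE.
apply/matrixP => i j; apply/eqP; rewrite -subr_eq0 -normr_le0.
apply: (@le_of_le_geometric _ _ _ (2 * M)) => n; rewrite add0r distrC.
have pn : picard n p0 = 1%:M.
  case: n => // n; rewrite /= [X in _ + X](_ : _ = 0) ?addr0 //.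
  apply/matrixP => k l; rewrite !mxE /rad big1 // => a _.
  by rewrite subrr mxE mul0r.
by rewrite -{1}pn; apply: hPhi; rewrite subrr normr0.
Qed.
End Bounds.

Lemma flat_system : exists s : R, 0 < s <= r /\
  exists Phi : 'rV[R]_m -> 'M[R]_N,
  [/\ forall k, mC k (ball p0 s) Phi, Phi p0 = 1%:M &
      forall c x, ball p0 s x -> mpd c Phi x = A c x *m Phi x].
Proof.
have r2 : r / 2 < r by rewrite ltr_pdivrMr // ltr_pMr // ltr1n.
have [C hC] : exists C : R, forall a x i j, `|x - p0| <= r / 2 -> `|A a x i j| <= C.
  have h (aij : 'I_m * ('I_N * 'I_N)) : exists K : R, forall x, `|x - p0| <= r / 2 ->
      `|A aij.1 x aij.2.1 aij.2.2| <= K.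
    by apply: (@bounded_subball _ _ p0 r (fun x => A aij.1 x aij.2.1 aij.2.2)) => //; exact: (sA _ 0).
  exists (\sum_aij `|sval (cid (h aij))|) => a x i j xs.
  have := svalP (cid (h (a, (i, j)))) x xs => /le_trans; apply.
  apply: (le_trans (ler_norm _)).
  by rewrite (bigD1 (a, (i, j))) //= lerDl sumr_ge0.
(* With s <= 1/Q one has m s N |C| <= 1/8; the summand 1 keeps Q positive. *)
pose Q : R := 8 * (m%:R * N%:R * `|C| + 1).
have Q0 : 0 < Q by rewrite mulr_gt0 // ltr_wpDl ?mulr_ge0.
pose s := Num.min (r / 2) Q^-1.
have s0 : 0 < s by rewrite lt_min divr_gt0 // invr_gt0.
have sr2 : s <= r / 2 by rewrite ge_min lexx.
have sr : s < r by exact: le_lt_trans r2.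
exists s; split; first by rewrite s0 ltW.
apply: (@flat_system_aux s `|C|) => //.
  move=> a x i j xs; apply: le_trans (ler_norm C); apply: hC.
  exact: le_trans sr2.
have sQ : s <= Q^-1 by rewrite ge_min lexx orbT.
have : s * Q <= 1 by rewrite -ler_pdivlMr // div1r.
rewrite /Q; have := normr_ge0 C; have : (0 : R) <= m%:R * N%:R by rewrite mulr_ge0.
have -> : m%:R * s * N%:R * `|C| = s * (m%:R * N%:R * `|C|) by ring.
move: (m%:R * N%:R) (`|C|) => u v u0 v0; move: s0; move: (u * v) => w; nra.
Qed.
End FlatSystem.

(** * The inverse function theorem *)

Section InverseFunction.
Context {R : realType} {m : nat}.
Implicit Types (p q x y v : 'rV[R]_m) (D : set 'rV[R]_m).

Definition jac (phi : 'rV[R]_m -> 'rV[R]_m) p : 'M[R]_m :=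
  \matrix_(i, j) pd i (fun q => phi q 0 j) p.

Lemma norm_mulmx (v : 'rV[R]_m) (L : 'M[R]_m) : exists2 c : R, 0 < c &
  forall v : 'rV[R]_m, `|v *m L| <= c * `|v|.
Proof.
exists (1 + \sum_i \sum_j `|L i j|); first by rewrite ltr_pwDl // sumr_ge0 // => i _; rewrite sumr_ge0.
move=> w; apply: norm_row_le => [|j].
  by rewrite mulr_ge0 // addr_ge0 // sumr_ge0 // => i _; rewrite sumr_ge0.
rewrite mxE; apply: (le_trans (ler_norm_sum _ _ _)).
rewrite mulrDl mul1r; apply: (@le_trans _ _ ((\sum_i \sum_j `|L i j|) * `|w|)); last by rewrite lerDr.
rewrite mulr_suml; apply: ler_sum => i _; rewrite normrM mulrC; apply: ler_pM => //.
  by rewrite (bigD1 j) //= lerDl sumr_ge0.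
exact: norm_coord.
Qed.

Lemma mulmx_continuous (L : 'M[R]_m) : continuous (fun v : 'rV[R]_m => v *m L).
Proof.
move=> v; apply: continuous_mx => i j; rewrite ord1.
have : Ck 0 setT (fun w : 'rV[R]_m => (w *m L) 0 j).
  apply: (mC_mul openT (F := fun w : 'rV[R]_m => w) (G := fun=> L)).
    by move=> a b; rewrite ord1; exact: Ck_coord.
  exact: mC_cst.
by move/Ck_cont; apply.
Qed.

Section Local.
Variables (D : set 'rV[R]_m) (oD : open D) (phi : 'rV[R]_m -> 'rV[R]_m) (p0 : 'rV[R]_m).
Hypotheses (Dp0 : D p0) (sphi : forall k j, Ck k D (fun p => phi p 0 j)).
Hypothesis uJ : forall p, D p -> jac phi p \in unitmx.

Let L := invmx (jac phi p0).
Let g x := x - phi x *m L.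

(** The first derivatives of g(x) = x - phi(x) L vanish at p0, hence are small on a small ball. *)
Lemma contraction_radius : exists2 s : R, 0 < s & ball p0 s `<=` D /\
  forall x y, ball p0 s x -> ball p0 s y -> `|g x - g y| <= 2^-1 * `|x - y|.
Proof.
have sg k j : Ck k D (fun p => g p 0 j).
  apply: (mC_sub oD (F := fun p : 'rV[R]_m => p) (G := fun p => phi p *m L)).
    by move=> a b; rewrite ord1; exact: Ck_coord.
  apply: (mC_mul oD (F := phi) (G := fun=> L)); last exact: mC_cst.
  by move=> a b; rewrite ord1; exact: sphi.
have g0 i j : pd i (fun p => g p 0 j) p0 = 0.
  transitivity (mpd i g p0 0 j); first by rewrite mxE.
  have cphi : mC 1 D phi by move=> a b; rewrite ord1; exact: sphi.
  have cid : mC 1 D (fun p : 'rV[R]_m => p) by move=> a b; rewrite ord1; exact: Ck_coord.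
  have cL : mC 1 D (fun=> L) by exact: mC_cst.
  rewrite (mpd_sub oD i Dp0 cid (mC_mul oD cphi cL)) (mpd_mul oD i Dp0 cphi cL).
  rewrite mpd_cst mulmx0 addr0.
  have -> : mpd i phi p0 = basis_vec i *m jac phi p0.
    by rewrite /basis_vec -rowE; apply/rowP => k; rewrite !mxE.
  rewrite mulmxK ?uJ // mxE [X in _ + X]mxE [mpd _ _ _ _ _]mxE pd_coord /basis_vec mxE eqxx eq_sym.
  by rewrite subrr.
(* [lipschitz_ball] multiplies the bound on the partial derivatives by m, and m e <= 1/2. *)
pose e : R := (2 * m.+1%:R)^-1.
have e0 : 0 < e by rewrite invr_gt0 mulr_gt0.
have : \forall x \near p0, D x /\ forall i j, `|pd i (fun p => g p 0 j) x| <= e.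
  have h1 : \forall x \near p0, D x by apply: open_nbhs_nbhs.
  have h2 : \forall x \near p0, forall i j, `|pd i (fun p => g p 0 j) x| <= e.
    have h i j : \forall x \near p0, `|pd i (fun p => g p 0 j) x| <= e.
      have /(cvgrPdist_le (F := nbhs p0))/(_ _ e0) := Ck_cont (Ck_pd i (sg 1%N j)) Dp0.
      by apply: filterS => x; rewrite g0 sub0r normrN.
    have h' i : \forall x \near p0, forall j, `|pd i (fun p => g p 0 j) x| <= e.
      exact: (@filter_forall _ _ (fun j x => `|pd i (fun p => g p 0 j) x| <= e) (nbhs p0) _ (h i)).
    exact: (@filter_forall _ _ (fun i x => forall j, `|pd i (fun p => g p 0 j) x| <= e) (nbhs p0) _ h').
  by apply: filterI h1 h2.
move=> /nbhs_ballP[s /= s0 hs]; exists s => //; split=> [x /hs[]//|x y Bx By].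
apply: norm_row_le => [|j]; first by rewrite mulr_ge0.
rewrite mxE [X in _ + X]mxE.
have sD : ball p0 s `<=` D by move=> z /hs[].
apply: (le_trans (lipschitz_ball (r := s) (C := e) (lexx _) (Ck_sub sD (sg 1%N j)) _ Bx By)).
  by move=> i q /hs[_]; apply.
rewrite ler_wpM2r // /e invfM mulrCA ler_piMr ?invr_ge0 //.
by rewrite ler_pdivrMr // mul1r ler_nat.
Qed.

Theorem inverse_function : exists (U V : set 'rV[R]_m) (psi : 'rV[R]_m -> 'rV[R]_m),
  [/\ open U, U p0, U `<=` D, open V &
  [/\ forall p, U p -> V (phi p) /\ psi (phi p) = p,
      forall q, V q -> U (psi q) /\ phi (psi q) = q &
      forall k j, Ck k V (fun q => psi q 0 j)]].
Proof.
have [s s0 [sD hg]] := contraction_radius.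
have LU : L \in unitmx by rewrite unitmx_inv uJ.
pose tph x := phi x *m L.
(* [tph] is the identity minus the 1/2-contraction g. This gives injectivity and the Lipschitz bound
   for the inverse. *)
have expand x y : ball p0 s x -> ball p0 s y -> `|x - y| <= 2 * `|tph x - tph y|.
  move=> Bx By; have := hg x y Bx By.
  have -> : g x - g y = (x - y) - (tph x - tph y).
    by rewrite /g /tph; apply/rowP => i; rewrite !mxE; ring.
  have := lerB_dist (x - y) (tph x - tph y); move: (`|_ - (tph x - _)|) (`|x - y|) (`|tph x - _|).
  by move=> a b c; lra.
(* Solutions are the fixed points of x |-> g(x) + y. From p0 the iterates travel at most twice |y -
   tph p0|, which is less than s/2, so they and their limit stay in the ball. *)
have solve y : `|y - tph p0| < s / 4 -> exists2 x, ball p0 s x & tph x = y.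
  move=> hy; pose it := fix it n := if n is n'.+1 then g (it n') + y else p0.
  pose d := `|y - tph p0|.
  have d0 : 0 <= d by exact: normr_ge0.
  have itS n : it n.+1 = g (it n) + y by [].
  have H n : `|it n - p0| <= (2 - 2 / 2 ^+ n) * d /\ `|it n.+1 - it n| <= d / 2 ^+ n.
    elim: n => [|n [IH1 IH2]].
      rewrite expr0 !divr1 /= !subrr mul0r normr0; split=> //.
      rewrite (_ : g p0 + y - p0 = y - tph p0) //.
      by rewrite /g /tph addrAC [p0 - _]addrC addrK addrC.
    have p2 : 0 < 2 ^+ n :> R by rewrite exprn_gt0.
    have e2 : 2 ^+ n.+1 = 2 * 2 ^+ n :> R by rewrite exprS.
    have u0 : 0 < (2 ^+ n)^-1 :> R by rewrite invr_gt0.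
    have hv : (2 ^+ n.+1)^-1 = 2^-1 * (2 ^+ n)^-1 :> R by rewrite e2 invfM.
    have c1 : `|it n.+1 - p0| <= (2 - 2 / 2 ^+ n.+1) * d.
      rewrite -[it n.+1](subrK (it n)) -addrA.
      apply: (le_trans (ler_normD _ _)); apply: (le_trans (lerD IH2 IH1)).
      rewrite hv; move: u0; move: ((2 ^+ n)^-1) => u u0.
      by rewrite le_eqVlt; apply/orP; left; apply/eqP; field.
    split=> //.
    have lt2 (k : nat) : (2 - 2 / 2 ^+ k) * d < s.
      have : 0 < (2 ^+ k)^-1 :> R by rewrite invr_gt0 exprn_gt0.
      move: ((2 ^+ k)^-1) hy d0; rewrite -/d => u; move: (d) => e h1 h2 h3; nra.
    have inb k : `|it k - p0| <= (2 - 2 / 2 ^+ k) * d -> ball p0 s (it k).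
      by move=> h; rewrite -ball_normE /ball_ /= distrC; exact: le_lt_trans (lt2 k).
    rewrite !itS [g (it n) + y]/(it n.+1) opprD addrACA subrr addr0.
    apply: (le_trans (hg _ _ (inb _ c1) (inb _ IH1))).
    by rewrite hv mulrCA ler_wpM2l // invr_ge0.
  have lt2 (k : nat) : (2 - 2 / 2 ^+ k) * d < s / 2.
    have : 0 < (2 ^+ k)^-1 :> R by rewrite invr_gt0 exprn_gt0.
    move: ((2 ^+ k)^-1) hy d0; rewrite -/d => u; move: (d) => e h1 h2 h3; nra.
  have lim j : exists l, forall n, `|it n 0 j - l| <= 2 * d / 2 ^+ n.
    apply: geometric_cauchy => n; apply: le_trans (H n).2.
    by have := norm_coord (it n.+1 - it n) j; rewrite mxE [X in _ + X]mxE.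
  pose x : 'rV[R]_m := \row_j sval (cid (lim j)).
  have hx n : `|it n - x| <= 2 * d / 2 ^+ n.
    apply: norm_row_le => [|j]; first by rewrite divr_ge0 ?mulr_ge0 // exprn_ge0.
    by rewrite mxE [X in _ + X]mxE [X in _ - X]mxE; exact: (svalP (cid (lim j))).
  have bx : ball p0 s x.
    rewrite -ball_normE /ball_ /= distrC; apply: (@le_lt_trans _ _ (s / 2)); last first.
      by rewrite ltr_pdivrMr // ltr_pMr // ltr1n.
    apply: (@le_of_le_geometric _ _ _ (2 * d)) => n.
    rewrite -[x](subrK (it n)) -addrA addrC; apply: (le_trans (ler_normD _ _)).
    apply: lerD; first exact: le_trans (H n).1 (ltW (lt2 n)).
    by rewrite distrC.
  exists x => //.
  have : `|g x + y - x| <= 0.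
    apply: (@le_of_le_geometric _ _ _ (2 * d)) => n; rewrite add0r.
    have -> : g x + y - x = - (g (it n) - g x) + (it n.+1 - x).
      by rewrite itS; apply/rowP => j; rewrite !mxE; ring.
    apply: (le_trans (ler_normD _ _)); rewrite normrN.
    have bi : ball p0 s (it n).
      rewrite -ball_normE /ball_ /= distrC; apply: (le_lt_trans (H n).1).
      by apply: (lt_trans (lt2 n)); rewrite ltr_pdivrMr // ltr_pMr // ltr1n.
    apply: (le_trans (lerD (hg _ _ bi bx) (hx n.+1))).
    have := hx n; have -> : 2 * d / 2 ^+ n.+1 = 2^-1 * (2 * d / 2 ^+ n).
      by rewrite exprS; field; rewrite expf_neq0.
    by move: (`|it n - x|) (2 * d / _) => a b; lra.
  rewrite normr_le0 => /eqP E; apply/esym/eqP; rewrite -subr_eq0.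
  have -> : y - tph x = g x + y - x.
    by rewrite /g /tph [RHS]addrAC [x - _]addrC addrK addrC.
  by rewrite E.
pose V := [set q | ball (tph p0) (s / 4) (q *m L)].
pose U := [set x | ball p0 s x /\ V (phi x)].
have oV : open V.
  apply: (@open_comp _ _ (fun q : 'rV[R]_m => q *m L)); last exact: ball_open.
  by move=> q _; exact: mulmx_continuous.
have ob : open (ball p0 s : set 'rV[R]_m) by exact: ball_open.
have oU : open U.
  rewrite openE => x [Bx Vx]; rewrite /interior.
  have h1 : \forall y \near x, ball p0 s y by apply: open_nbhs_nbhs.
  have cphi : {for x, continuous phi}.
    apply: continuous_mx => i j; rewrite ord1; apply: (Ck_cont (sphi 0 j)); exact: sD.
  have h2 : \forall y \near x, V (phi y).
    by apply: cphi; apply: open_nbhs_nbhs.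
  by apply: filterI h1 h2.
have inj x y : ball p0 s x -> ball p0 s y -> phi x = phi y -> x = y.
  move=> Bx By E; have := expand x y Bx By; rewrite /tph E subrr normr0 mulr0 normr_le0.
  by rewrite subr_eq0 => /eqP.
pose psi q := xget 0 [set x | ball p0 s x /\ phi x = q].
have hpsi q : V q -> ball p0 s (psi q) /\ phi (psi q) = q.
  move=> Vq; have : `|q *m L - tph p0| < s / 4.
    by move: Vq; rewrite /V /= -ball_normE /ball_ /= distrC.
  move=> /solve[x Bx Ex].
  have Ex' : phi x = q by apply: (can_inj (mulmxK LU)).
  rewrite /psi; case: xgetP => [z _ hz|/(_ x) hn]; first exact: hz.
  by case: hn; split.
have [c c0 hc] := norm_mulmx 0 L.
have lip q q' : V q -> V q' -> `|psi q - psi q'| <= 2 * c * `|q - q'|.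
  move=> /hpsi[B1 E1] /hpsi[B2 E2]; apply: (le_trans (expand _ _ B1 B2)).
  by rewrite /tph E1 E2 -mulmxBl -mulrA ler_pM2l.
have cpsi q : V q -> {for q, continuous psi}.
  move=> Vq; apply/(cvgrPdist_le (F := nbhs q)) => e e0.
  have h1 : \forall q' \near q, V q' by apply: open_nbhs_nbhs.
  have ec : 0 < e / (2 * c) by rewrite divr_gt0 ?mulr_gt0.
  have h2 : \forall q' \near q, ball q (e / (2 * c)) q' by exact: nbhsx_ballx.
  have : \forall q' \near q, V q' /\ ball q (e / (2 * c)) q' by apply: filterI h1 h2.
  apply: filterS => q' [Vq']; rewrite -ball_normE /ball_ /= => h.
  apply: (le_trans (lip _ _ Vq Vq')); rewrite mulrC -ler_pdivlMr ?mulr_gt0 //.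
  exact: ltW.
(* The Taylor estimate for phi at psi(q) is multiplied by the inverse Jacobian; the Lipschitz bound
   for psi turns an error small relative to the increment of psi into one small relative to h. *)
have dpsi q i j : V q -> is_derive q (basis_vec i) (fun q => psi q 0 j)
    (invmx (jac phi (psi q)) i j).
  move=> Vq; have [Bq Eq] := hpsi q Vq; set p := psi q in Bq Eq *.
  have Dp := sD _ Bq; set J := jac phi p; have JU : J \in unitmx by exact: uJ.
  have [k k0 hk] := norm_mulmx 0 (invmx J).
  suff H : (fun h : R => h^-1 *: (((fun q => psi q 0 j) \o shift q) (h *: basis_vec i) - psi q 0 j))
       @ 0^' --> invmx J i j.
    by split; [apply/cvg_ex; exists (invmx J i j)|exact: cvg_lim H].
  apply/(cvgrPdist_le (F := 0^')) => e e0.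
  (* Absorbs the norm bound k of the inverse Jacobian and the Lipschitz constant 2c of psi. *)
  pose e1 := e / (k * (2 * c)).
  have e10 : 0 < e1 by rewrite divr_gt0 // !mulr_gt0.
  have : \forall v \near (0 : 'rV[R]_m), forall l,
      `|phi (v + p) 0 l - phi p 0 l - \sum_a v 0 a * pd a (fun x => phi x 0 l) p| <= e1 * `|v|.
    have hl l := Ck_taylor1 oD Dp (sphi 1 l) e10.
    exact: (@filter_forall _ _ (fun l v => `|phi (v + p) 0 l - phi p 0 l
      - \sum_a v 0 a * pd a (fun x => phi x 0 l) p| <= e1 * `|v|) (nbhs (0 : 'rV[R]_m)) _ hl).
  move=> /nbhs_norm0P[d /= d0 hd].
  have [r /= r0 hr] : exists2 r : R, 0 < r & ball q r `<=` V.
    by have /nbhs_ballP : nbhs q V by apply: open_nbhs_nbhs.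
  pose r1 := Num.min r (d / (2 * c)).
  have r10 : 0 < r1 by rewrite lt_min r0 divr_gt0 ?mulr_gt0.
  have : \forall h \near (0 : R)^', h != 0 /\ `|h| < r1.
    have A1 : \forall h \near (0 : R)^', h != 0 by exact: nbhs_dnbhs_neq.
    have A2 : \forall h \near (0 : R)^', `|h| < r1 by exact: dnbhs0_lt.
    by apply: filterI A1 A2.
  apply: filterS => h [hN0]; rewrite lt_min => /andP[hr' hd'].
  have hp : 0 < `|h| by rewrite normr_gt0.
  have nh : `|(h *: basis_vec i + q) - q| <= `|h|.
    by rewrite addrK normrZ ler_piMr // norm_basis_vec_le.
  have Vh : V (h *: basis_vec i + q).
    by apply: hr; rewrite -ball_normE /ball_ /= distrC; exact: le_lt_trans hr'.
  have [Bh Eh] := hpsi _ Vh; set ph := psi (h *: basis_vec i + q) in Bh Eh.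
  pose v := ph - p.
  have nv : `|v| <= 2 * c * `|h|.
    by apply: (le_trans (lip _ _ Vh Vq)); rewrite ler_pM2l ?mulr_gt0.
  have vd : `|v| < d.
    by apply: (le_lt_trans nv); rewrite mulrC -ltr_pdivlMr ?mulr_gt0.
  have T : `|h *: basis_vec i - v *m J| <= e1 * `|v|.
    apply: norm_row_le => [|l]; first by rewrite mulr_ge0 // ltW.
    have := hd v vd l; rewrite /v subrK Eh Eq.
    congr (`|_| <= _); rewrite !mxE addrK; congr (_ - _).
    by apply: eq_bigr => a _; rewrite !mxE.
  have T2 : `|h *: (basis_vec i *m invmx J) - v| <= k * (e1 * `|v|).
    rewrite -[v in X in `|_ - X|](mulmxK JU) scalemxAl -mulmxBl.
    by apply: (le_trans (hk _)); rewrite ler_pM2l.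
  rewrite /= -/ph -(ler_pM2l hp) -normrM mulrBr -[h^-1 *: _]/(h^-1 * _) mulVKf //.
  have T3 : `|h * invmx J i j - (ph 0 j - p 0 j)| <= k * (e1 * `|v|).
    have := norm_coord (h *: (basis_vec i *m invmx J) - v) j.
    have -> : (h *: (basis_vec i *m invmx J) - v) 0 j = h * invmx J i j - (ph 0 j - p 0 j).
      by rewrite /basis_vec -rowE /v !mxE.
    by move/le_trans; apply.
  apply: (le_trans T3).
  apply: (@le_trans _ _ (k * (e1 * (2 * c * `|h|)))).
    by rewrite ler_pM2l // ler_pM2l.
  rewrite /e1 le_eqVlt; apply/orP; left; apply/eqP; field.
  by rewrite !gt_eqF.
exists U, V, psi; split=> //.
- split=> //; first exact: ballxx.
  by rewrite /V /=; apply: ballxx; rewrite divr_gt0.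
- by move=> x [/sD].
split.
- move=> p [Bp Vp]; split=> //; have [B1 E1] := hpsi _ Vp.
  exact: inj.
- by move=> q Vq; have [B1 E1] := hpsi _ Vq; split=> //; split=> //; rewrite E1.
(* The Jacobian of psi is the inverse Jacobian of phi composed with psi, so each order of regularity
   yields the next. *)
elim=> [|k IH] j.
  split=> // q Vq.
  exact: (@continuous_comp _ _ _ psi (fun x : 'rV[R]_m => x 0 j) q (cpsi q Vq)
    (@coord_continuous _ _ _ 0 j _)).
split=> [q Vq|i].
  exact: (@continuous_comp _ _ _ psi (fun x : 'rV[R]_m => x 0 j) q (cpsi q Vq)
    (@coord_continuous _ _ _ 0 j _)).
split=> [q Vq|]; first by case: (dpsi q i j Vq).
have VD q : V q -> D (psi q) by move=> /hpsi[/sD].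
have cJ : mC k V (fun q => jac phi (psi q)).
  move=> a b.
  have : Ck k V ((fun p => pd a (fun x => phi x 0 b) p) \o psi).
    by apply: (Ck_comp oD oV VD _ IH); exact: (Ck_pd a (sphi k.+1 b)).
  by apply: Ck_ext => // q _; rewrite mxE.
have := mC_invmx oV (fun q Vq => uJ (VD q Vq)) cJ i j.
by apply: Ck_ext => // q Vq; rewrite pdE; case: (dpsi q i j Vq).
Qed.
End Local.
End InverseFunction.

(** * Algebraic curvature tensors *)

Section Inner.
Context {R : realType} {m : nat}.
Variable G : 'M[R]_m.
Hypotheses (Gs : G^T = G) (Gp : forall v : 'rV[R]_m, v != 0 -> 0 < inner G v v).
Implicit Types (x y z t u v w : 'rV[R]_m).
Local Notation "'g[' x , y ]" := (inner G x y).

Lemma innerC x y : g[x, y] = g[y, x].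
Proof.
rewrite /inner -[x *m G *m y^T]trmxK mxE trmx_mul trmxK trmx_mul Gs.
by rewrite mulmxA.
Qed.

Lemma innerDl x y z : g[x + y, z] = g[x, z] + g[y, z].
Proof. by rewrite /inner !mulmxDl mxE. Qed.
Lemma innerDr x y z : g[z, x + y] = g[z, x] + g[z, y].
Proof. by rewrite /inner linearD /= mulmxDr mxE. Qed.
Lemma innerZl a x y : g[a *: x, y] = a * g[x, y].
Proof. by rewrite /inner -!scalemxAl mxE. Qed.
Lemma innerZr a x y : g[x, a *: y] = a * g[x, y].
Proof. by rewrite /inner linearZ /= -scalemxAr mxE. Qed.
Lemma innerNl x y : g[- x, y] = - g[x, y].
Proof. by rewrite -scaleN1r innerZl mulN1r. Qed.
Lemma innerNr x y : g[x, - y] = - g[x, y].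
Proof. by rewrite -scaleN1r innerZr mulN1r. Qed.
Lemma innerBl x y z : g[x - y, z] = g[x, z] - g[y, z].
Proof. by rewrite innerDl innerNl. Qed.
Lemma inner0l x : g[0, x] = 0.
Proof. by rewrite /inner !mul0mx mxE. Qed.
Lemma inner0r x : g[x, 0] = 0.
Proof. by rewrite innerC inner0l. Qed.

Definition innerE := (innerDl, innerDr, innerZl, innerZr, innerNl, innerNr, inner0l, inner0r).

Lemma inner_eq0 x : (g[x, x] == 0) = (x == 0).
Proof.
have [->|xN0] := eqVneq x 0; first by rewrite inner0l eqxx.
by rewrite gt_eqF ?Gp.
Qed.

Lemma inner_inj x : (forall y, g[x, y] = 0) -> x = 0.
Proof. by move=> h; apply/eqP; rewrite -inner_eq0 h. Qed.

Lemma inner_eq x y : (forall z, g[x, z] = g[y, z]) -> x = y.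
Proof. by move=> h; apply/subr0_eq/inner_inj => z; rewrite innerBl h subrr. Qed.

Lemma inner_unit : G \in unitmx.
Proof.
rewrite -row_free_unit -kermx_eq0; apply/eqP/row_matrixP => i; rewrite row0.
apply: inner_inj => y; rewrite /inner.
have : row i (kermx G) *m G = 0 by rewrite -row_mul mulmx_ker row0.
by move=> ->; rewrite mul0mx mxE.
Qed.

Lemma inner_normalize x : x != 0 -> exists2 c : R, 0 < c & g[c *: x, c *: x] = 1.
Proof.
move=> xN0; have h := Gp xN0; exists (Num.sqrt g[x, x])^-1.
  by rewrite invr_gt0 sqrtr_gt0.
rewrite innerZl innerZr mulrA -invfM -expr2 sqr_sqrtr ?ltW //.
by rewrite mulVf // gt_eqF.
Qed.

(** Orthogonality to k vectors is a homogeneous system of k equations in m unknowns. *)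
Lemma exists_orth k (s : k.-tuple 'rV[R]_m) : (k < m)%N ->
  exists u, g[u, u] = 1 /\ forall j, g[u, tnth s j] = 0.
Proof.
move=> km; pose A : 'M[R]_(m, k) := \matrix_(i, j) (G *m (tnth s j)^T) i 0.
have : kermx A != 0.
  rewrite -mxrank_eq0 mxrank_ker -lt0n subn_gt0.
  by apply: leq_ltn_trans km; exact: rank_leq_col.
move=> /rowV0Pn[v /sub_kermxP vA vN0].
have [c _ cv] := inner_normalize vN0.
exists (c *: v); split=> // j.
have E : (v *m A) 0 j = 0 by rewrite vA mxE.
rewrite innerZl /inner -mulmxA mxE [X in _ * X](_ : _ = 0) ?mulr0 //.
rewrite -[RHS]E [RHS]mxE; apply: eq_bigr => i _.
by rewrite [in RHS]mxE.
Qed.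

Definition multilinear4 (F : 'rV[R]_m -> 'rV[R]_m -> 'rV[R]_m -> 'rV[R]_m -> R) :=
  [/\ forall a x x' y z t, F (a *: x + x') y z t = a * F x y z t + F x' y z t,
      forall a x y y' z t, F x (a *: y + y') z t = a * F x y z t + F x y' z t,
      forall a x y z z' t, F x y (a *: z + z') t = a * F x y z t + F x y z' t &
      forall a x y z t t', F x y z (a *: t + t') = a * F x y z t + F x y z t'].

Definition alg_curv F :=
  [/\ multilinear4 F, forall x y z t, F x y z t = - F y x z t,
      forall x y z t, F x y z t = - F x y t z &
      forall x y z t, F x y z t + F y z x t + F z x y t = 0].

Section AlgCurv.
Variables (F : 'rV[R]_m -> 'rV[R]_m -> 'rV[R]_m -> 'rV[R]_m -> R) (hF : alg_curv F).

Lemma alg_curvD1 x x' y z t : F (x + x') y z t = F x y z t + F x' y z t.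
Proof. by case: hF => -[h _ _ _] _ _ _; rewrite -[x in LHS]scale1r h mul1r. Qed.
Lemma alg_curvD2 x y y' z t : F x (y + y') z t = F x y z t + F x y' z t.
Proof. by case: hF => -[_ h _ _] _ _ _; rewrite -[y in LHS]scale1r h mul1r. Qed.
Lemma alg_curvD3 x y z z' t : F x y (z + z') t = F x y z t + F x y z' t.
Proof. by case: hF => -[_ _ h _] _ _ _; rewrite -[z in LHS]scale1r h mul1r. Qed.
Lemma alg_curvD4 x y z t t' : F x y z (t + t') = F x y z t + F x y z t'.
Proof. by case: hF => -[_ _ _ h] _ _ _; rewrite -[t in LHS]scale1r h mul1r. Qed.
Lemma alg_curv01 y z t : F 0 y z t = 0.
Proof. by apply: (addrI (F 0 y z t)); rewrite -alg_curvD1 !addr0. Qed.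
Lemma alg_curv02 y z t : F y 0 z t = 0.
Proof. by apply: (addrI (F y 0 z t)); rewrite -alg_curvD2 !addr0. Qed.
Lemma alg_curvZ2 a x y z t : F x (a *: y) z t = a * F x y z t.
Proof. by case: hF => -[_ h _ _] _ _ _; rewrite -[_ *: _]addr0 h alg_curv02 addr0. Qed.
Lemma alg_curvZ3 a x y z t : F x y (a *: z) t = a * F x y z t.
Proof.
case: (hF) => -[_ _ h _] _ _ _; rewrite -[_ *: _]addr0 h.
by rewrite [X in _ + X](_ : _ = 0) ?addr0 //; apply: (addrI (F x y 0 t)); rewrite -alg_curvD3 !addr0.
Qed.

(** The first Bianchi identities for the four cyclic shifts of x, y, z, t are combined. *)
Lemma pair_sym x y z t : F x y z t = F z t x y.
Proof.
have [_ s1 s2 b] := hF.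
have e1 := b x y z t; have e2 := b y z t x; have e3 := b z t x y; have e4 := b t x y z.
have r1 := s2 x y t z; have r2 := s2 y z t x; have r3 := s2 z t x y; have r4 := s2 t x y z.
have r5 := s1 x z t y; have r6 := s2 z x t y; have r7 := s1 y t x z; have r8 := s2 t y x z.
lra.
Qed.

(** Polarization in y makes the Jacobi operators vanish, polarization in x makes F skew in its two
    middle arguments, and then the first Bianchi identity reads 3 F = 0. *)
Lemma alg_curv_eq0 : (forall x y, F y x x y = 0) -> forall x y z t, F x y z t = 0.
Proof.
have [_ s1 s2 b] := hF => h.
have h1 x y z : F y x x z = 0.
  have := h x (y + z); rewrite alg_curvD1 !alg_curvD4 !h add0r addr0.
  rewrite [F z x x y]pair_sym s1 s2 opprK => /eqP; rewrite -mulr2n mulrn_eq0 /=.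
  by move/eqP.
have h2 x x' y z : F y x x' z = - F y x' x z.
  have := h1 (x + x') y z; rewrite alg_curvD2 !alg_curvD3 !h1 add0r addr0 => /eqP.
  by rewrite addr_eq0 => /eqP.
move=> x y z t; have := b x y z t.
have := s1 x y z t; have := h2 x z y t; have := s1 z x y t; have := h2 z y x t.
lra.
Qed.
End AlgCurv.
End Inner.

(** * Model tensors, and tensors whose Jacobi operators have rank one *)

Section Models.
Context {R : realType} {m : nat}.
Variable G : 'M[R]_m.
Hypotheses (Gs : G^T = G) (Gp : forall v : 'rV[R]_m, v != 0 -> 0 < inner G v v).
Implicit Types (x y z t u v w : 'rV[R]_m) (F : 'rV[R]_m -> 'rV[R]_m -> 'rV[R]_m -> 'rV[R]_m -> R).
Local Notation "'g[' x , y ]" := (inner G x y).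

Lemma alg_curv_comb (a b : R) F F' : alg_curv F -> alg_curv F' ->
  alg_curv (fun x y z t => a * F x y z t + b * F' x y z t).
Proof.
move=> [[h1 h2 h3 h4] h5 h6 h7] [[k1 k2 k3 k4] k5 k6 k7]; split; first split.
- by move=> *; rewrite h1 k1; ring.
- by move=> *; rewrite h2 k2; ring.
- by move=> *; rewrite h3 k3; ring.
- by move=> *; rewrite h4 k4; ring.
- by move=> x y z t; rewrite h5 k5; ring.
- by move=> x y z t; rewrite h6 k6; ring.
- move=> x y z t; have := h7 x y z t; have := k7 x y z t.
  move: (F _ _ _ _) (F y _ _ _) (F z _ _ _) (F' _ _ _ _) (F' y _ _ _) (F' z _ _ _).
  move=> f1 f2 f3 f4 f5 f6 e1 e2.
  have -> : f1 = - f2 - f3 by lra.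
  have -> : f4 = - f5 - f6 by lra.
  ring.
Qed.

Definition R0 x y z t : R := g[y, z] * g[x, t] - g[x, z] * g[y, t].

Lemma R0_alg_curv : alg_curv R0.
Proof.
rewrite /R0; split; first by split=> *; rewrite !innerE; ring.
- by move=> x y z t; ring.
- by move=> x y z t; ring.
- move=> x y z t; rewrite (innerC Gs z x) (innerC Gs y x) (innerC Gs z y); ring.
Qed.

Section RJ.
Variable J : 'M[R]_m.
Hypothesis Jskew : forall x y, g[x *m J, y] = - g[y *m J, x].

Definition RJ x y z t : R :=
  g[y *m J, z] * g[x *m J, t] - g[x *m J, z] * g[y *m J, t]
  - 2 * g[x *m J, y] * g[z *m J, t].

Lemma RJ_alg_curv : alg_curv RJ.
Proof.
rewrite /RJ; split; first by split=> *; rewrite ?mulmxDl -?scalemxAl !innerE; ring.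
- by move=> x y z t; rewrite (Jskew y x); ring.
- by move=> x y z t; rewrite (Jskew z t); ring.
- move=> x y z t.
  by rewrite (Jskew z x) (Jskew z y) (Jskew y x); ring.
Qed.

Lemma RJ_jacobi x y : RJ y x x y = 3 * g[y *m J, x] ^+ 2.
Proof.
rewrite /RJ (Jskew x y).
have -> : g[x *m J, x] = 0 by have := Jskew x x; lra.
ring.
Qed.
End RJ.

(** If a is nonzero, then t = 0 gives d = 0. At the four points 1, 2, 3, 4 either the first factor
    has three zeros or the linear factor e + f t has two. *)
Lemma quad_prod_eq0 (a b c d e f : R) :
  (forall t : R, (a + b * t + c * t ^+ 2) * (d + e * t + f * t ^+ 2) = 0) ->
  a = 0 \/ f = 0.
Proof.
move=> h; have [->|aN0] := eqVneq a 0; [by left|right].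
have d0 : d = 0.
  have := h 0; rewrite expr0n !mulr0 !addr0 => /eqP.
  by rewrite mulf_eq0 (negPf aN0) => /eqP.
have H (t : R) : t != 0 -> a + b * t + c * t ^+ 2 = 0 \/ e + f * t = 0.
  move=> tN0; have /eqP := h t; rewrite d0 add0r mulf_eq0 => /orP[/eqP|]; first by left.
  rewrite expr2 mulrA -mulrDl mulf_eq0 (negPf tN0) orbF => /eqP; by right.
have [n1 n2 n3 n4] : [/\ (1 : R) != 0, (2 : R) != 0, (3 : R) != 0 & (4 : R) != 0].
  by split; rewrite ?oner_neq0 ?pnatr_eq0.
have C : a = 0 \/ f = 0.
  case: (H 1 n1) (H 2 n2) (H 3 n3) (H 4 n4) => [h1|h1] [h2|h2] [h3|h3] [h4|h4];
    solve [left; lra | right; lra].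
by case: C => // a0; move: aN0; rewrite a0 eqxx.
Qed.

Definition bilin (f : 'rV[R]_m -> 'rV[R]_m -> R) : 'M[R]_m :=
  \matrix_(i, j) f (basis_vec i) (basis_vec j).

Lemma bilinE f x y :
  (forall a x x' y, f (a *: x + x') y = a * f x y + f x' y) ->
  (forall a x y y', f x (a *: y + y') = a * f x y + f x y') ->
  (x *m bilin f *m y^T) 0 0 = f x y.
Proof.
move=> f1 f2.
have f01 z : f 0 z = 0 by have := f1 1 0 0 z; rewrite scale1r addr0; lra.
have f02 z : f z 0 = 0 by have := f2 1 z 0 0; rewrite scale1r addr0; lra.
have E2 z : f z y = \sum_j y 0 j * f z (basis_vec j).
  rewrite {1}(row_sum_delta y); elim/big_rec2: _ => // j s v _ <-.
  by rewrite f2.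
have E1 z : f x z = \sum_i x 0 i * f (basis_vec i) z.
  rewrite {1}(row_sum_delta x); elim/big_rec2: _ => // j s v _ <-.
  by rewrite f1.
rewrite E1 mxE.
transitivity (\sum_j \sum_i x 0 i * f (basis_vec i) (basis_vec j) * y 0 j).
  by apply: eq_bigr => j _; rewrite !mxE mulr_suml; apply: eq_bigr => i _; rewrite mxE.
rewrite exchange_big /=; apply: eq_bigr => i _; rewrite E2 mulr_sumr.
by apply: eq_bigr => j _; rewrite mulrAC mulrA.
Qed.

Section Structure.
Variables (T : 'rV[R]_m -> 'rV[R]_m -> 'rV[R]_m -> 'rV[R]_m -> R) (hT : alg_curv T).
Variables (y0 u : 'rV[R]_m).
Hypotheses (y0N : y0 != 0) (uy0 : g[u, u] = g[y0, y0]).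
Hypothesis Tu : forall x, T x y0 y0 x = g[x, u] ^+ 2.
Hypothesis Tpsi : forall x, exists psi, g[psi, psi] = g[x, x] /\
  forall y z, T y x x z = g[y, psi] * g[z, psi].

(* As T x y y x = g(x, yJ)^2, the values of T determine the bilinear map
   (x, y) |-> g(x, yJ) up to sign; u is the value of J at y0, which fixes the
   sign. This explicit formula makes J depend smoothly on the point. *)
Definition jform y x : R :=
  ((T y x u y0 + T y u x y0) * g[u, u] - T y u u y0 * g[x, u]) / g[u, u] ^+ 2.

Definition jmx : 'M[R]_m := bilin jform *m invmx G.

Let uu : 0 < g[u, u]. Proof. by rewrite uy0 Gp. Qed.

Lemma jmxE y x : g[y *m jmx, x] = jform y x.
Proof.
have [[t1 t2 t3 t4] _ _ _] := hT.
rewrite /inner /jmx mulmxA (mulmxKV (inner_unit Gp)) bilinE // => [a x1 x2 z|a z x1 x2].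
  by rewrite /jform !t1; ring.
by rewrite /jform t2 t3 innerDl innerZl; ring.
Qed.

(** T y x x y0 and g(x, psi) g(x, u) are quadratic forms in x with equal squares. The sign relating
    them cannot vary with x, since a product of two quadratic forms vanishes identically only if one
    of them does; w is psi or its opposite accordingly. *)
Lemma root_exists y : exists w, [/\ forall x, T y x x y0 = g[x, w] * g[x, u],
  forall x, T x y y x = g[x, w] ^+ 2 & g[w, w] = g[y, y]].
Proof.
have [psi [npsi hpsi]] := Tpsi y.
have h1 x : T y x x y = g[x, psi] ^+ 2.
  by rewrite (pair_sym hT) hpsi expr2.
have sq x : (T y x x y0 - g[x, psi] * g[x, u]) * (T y x x y0 + g[x, psi] * g[x, u]) = 0.
  have [ps [_ hp]] := Tpsi x.
  have e1 : g[y, ps] ^+ 2 = g[x, psi] ^+ 2 by rewrite -(h1 x) hp expr2.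
  have e2 : g[y0, ps] ^+ 2 = g[x, u] ^+ 2 by rewrite -(Tu x) (pair_sym hT) hp expr2.
  rewrite hp -subr_sqr !exprMn e1 e2 subrr //.
pose q1 x := T y x x y0 - g[x, psi] * g[x, u].
pose q2 x := T y x x y0 + g[x, psi] * g[x, u].
have [c1|[x1 x1N]] : (forall x, q1 x = 0) \/ exists x, q1 x != 0.
  have [h|/existsNP[x hx]] := pselect (forall x, q1 x = 0); [by left|right].
  by exists x; apply/eqP.
  exists psi; split; last exact: npsi.
    by move=> x; apply/subr0_eq; exact: c1.
  by move=> x; rewrite (pair_sym hT) h1.
have [c2|[x2 x2N]] : (forall x, q2 x = 0) \/ exists x, q2 x != 0.
  have [h|/existsNP[x hx]] := pselect (forall x, q2 x = 0); [by left|right].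
  by exists x; apply/eqP.
  exists (- psi); split=> [x|x|]; last by rewrite innerNl innerNr opprK.
    rewrite innerNr mulNr; apply/eqP; rewrite -addr_eq0; apply/eqP; exact: c2.
  by rewrite innerNr sqrrN (pair_sym hT) h1.
pose P x z := T y x z y0 + T y z x y0.
pose S x z := g[x, psi] * g[z, u] + g[z, psi] * g[x, u].
(* On the line x1 + t x2 both forms are quadratic polynomials in t; [q1 x1] is the constant term of
   one and [q2 x2] the leading coefficient of the other. *)
have := @quad_prod_eq0 (q1 x1) (P x1 x2 - S x1 x2) (q1 x2) (q2 x1) (P x1 x2 + S x1 x2) (q2 x2).
case.
- move=> t; rewrite -[RHS](sq (x1 + t *: x2)).
  rewrite /q1 /q2 /P /S !(alg_curvD2 hT) !(alg_curvD3 hT) !(alg_curvZ2 hT) !(alg_curvZ3 hT) !innerE.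
  by ring.
- by move=> e; move: x1N; rewrite e eqxx.
- by move=> e; move: x2N; rewrite e eqxx.
Qed.

(** Polarizing the identity at x and u and solving for g(x, w) yields the formula [jform]. *)
Lemma jmx_root y w : (forall x, T y x x y0 = g[x, w] * g[x, u]) -> y *m jmx = w.
Proof.
move=> h; apply: (inner_eq Gp) => x; rewrite jmxE /jform.
have e : T y x u y0 + T y u x y0 = g[x, w] * g[u, u] + g[u, w] * g[x, u].
  have := h (x + u); rewrite (alg_curvD2 hT) !(alg_curvD3 hT) !h !innerE.
  move: (T y x u y0) (T y u x y0) => a b; rewrite !mulrDl !mulrDr; lra.
rewrite e h (innerC Gs w x); field; exact: lt0r_neq0.
Qed.

Lemma jmx_sq x y : T x y y x = g[x, y *m jmx] ^+ 2.
Proof. by have [w [h1 h2 _]] := root_exists y; rewrite (jmx_root h1) h2. Qed.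

Lemma jmx_isom x y : g[x *m jmx, y *m jmx] = g[x, y].
Proof.
have n z : g[z *m jmx, z *m jmx] = g[z, z].
  by have [w [h1 _ h2]] := root_exists z; rewrite (jmx_root h1) h2.
have := n (x + y); rewrite mulmxDl !innerE !n (innerC Gs y x) (innerC Gs (y *m _) (x *m _)).
lra.
Qed.

Lemma jmx_skew x y : g[x *m jmx, y] = - g[y *m jmx, x].
Proof.
have [_ s _ _] := hT.
have h z : g[z *m jmx, z] = 0.
  have : g[z, z *m jmx] ^+ 2 = 0 by rewrite -jmx_sq; have := s z z z z; lra.
  by move=> /eqP; rewrite sqrf_eq0 (innerC Gs) => /eqP.
by have := h (x + y); rewrite mulmxDl !innerE !h; lra.
Qed.

Lemma jmx_mul : jmx *m jmx = - 1%:M.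
Proof.
apply/row_matrixP => i; rewrite !rowE; apply: (inner_eq Gp) => z.
by rewrite mulmxA jmx_skew jmx_isom (innerC Gs z) mulmxN mulmx1 innerNl.
Qed.

(** By [alg_curv_eq0] it suffices to compare Jacobi operators: [jmx_sq] on one side, and 3 g(yJ,
    x)^2 by [RJ_jacobi] on the other. *)
Lemma jmx_tensor x y z t : T x y z t = 3^-1 * RJ jmx x y z t.
Proof.
have hRJ := RJ_alg_curv jmx_skew.
have hD := alg_curv_comb 1 (- 3^-1) hT hRJ.
have := @alg_curv_eq0 _ _ _ hD; move=> /(_ _ x y z t) H.
apply/eqP; rewrite -subr_eq0 -mulNr -[X in X + _]mul1r; apply/eqP; apply: H => x' y'.
rewrite (RJ_jacobi jmx_skew) jmx_sq (jmx_skew y' x') (innerC Gs y') sqrrN.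
by move: (_ ^+ 2) => s; lra.
Qed.
End Structure.
End Models.

(** * Linear algebra of an orthogonal complex structure *)

Section Hermitian.
Context {R : realType} {m : nat}.
Variable G : 'M[R]_m.
Hypotheses (Gs : G^T = G) (Gp : forall v : 'rV[R]_m, v != 0 -> 0 < inner G v v).
Implicit Types (x y z t u v w a b c d e : 'rV[R]_m).
Local Notation "'g[' x , y ]" := (inner G x y).
Variable J : 'M[R]_m.
Hypotheses (Jskew : forall x y, g[x *m J, y] = - g[y *m J, x]) (JJ : J *m J = - 1%:M).

Lemma mulJJ x : x *m J *m J = - x.
Proof. by rewrite -mulmxA JJ mulmxN mulmx1. Qed.

Lemma innerJr x y : g[x, y *m J] = - g[x *m J, y].
Proof. by rewrite (innerC Gs) Jskew. Qed.

Lemma innerJJ x y : g[x *m J, y *m J] = g[x, y].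
Proof. by rewrite innerJr mulJJ innerNl opprK. Qed.

Lemma innerJx x : g[x *m J, x] = 0.
Proof. by have := Jskew x x; lra. Qed.

Section ParallelTensor.
Hypothesis m8 : (8 <= m)%N.
(** T a b c stands for g((nabla_a J) b, c). It is skew in b and c as J is skew, and [TJ] expresses
    that nabla_a J anticommutes with J, as J^2 = -1. *)
Variable T : 'rV[R]_m -> 'rV[R]_m -> 'rV[R]_m -> R.
Hypotheses (T1 : forall k a a' b c, T (k *: a + a') b c = k * T a b c + T a' b c)
           (T2 : forall k a b b' c, T a (k *: b + b') c = k * T a b c + T a b' c)
           (Tskew : forall a b c, T a b c = - T a c b)
           (TJ : forall a b c, T a (b *m J) c = T a b (c *m J)).

(* One summand of the second Bianchi identity for the curvature tensor RJ of a
   complex structure with covariant derivative T, evaluated on d, e; all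
   contributions of wedge terms vanish there, as d and e are orthogonal to a,
   b, c. *)
Definition bianchi_term a b c d e : R :=
  T a c d * g[b *m J, e] + g[c *m J, d] * T a b e - T a b d * g[c *m J, e]
  - g[b *m J, d] * T a c e - 2 * T a b c * g[d *m J, e] - 2 * g[b *m J, c] * T a d e.

Hypothesis Tbianchi : forall a b c d e,
  g[d, a] = 0 -> g[d, b] = 0 -> g[d, c] = 0 -> g[e, a] = 0 -> g[e, b] = 0 -> g[e, c] = 0 ->
  bianchi_term a b c d e + bianchi_term b c a d e + bianchi_term c a b d e = 0.

Let T3 k a b c c' : T a b (k *: c + c') = k * T a b c + T a b c'.
Proof. by rewrite Tskew T2 (Tskew a c) (Tskew a c'); ring. Qed.
Let T1D a a' b c : T (a + a') b c = T a b c + T a' b c.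
Proof. by rewrite -[a]scale1r T1 scale1r mul1r. Qed.
Let T2D a b b' c : T a (b + b') c = T a b c + T a b' c.
Proof. by rewrite -[b]scale1r T2 scale1r mul1r. Qed.
Let T3D a b c c' : T a b (c + c') = T a b c + T a b c'.
Proof. by rewrite -[c]scale1r T3 scale1r mul1r. Qed.
Let T01 b c : T 0 b c = 0.
Proof. by apply: (addrI (T 0 b c)); rewrite -T1D !addr0. Qed.
Let T02 b c : T b 0 c = 0.
Proof. by apply: (addrI (T b 0 c)); rewrite -T2D !addr0. Qed.
Let T03 b c : T b c 0 = 0.
Proof. by rewrite Tskew T02 oppr0. Qed.
Let T1Z k a b c : T (k *: a) b c = k * T a b c.
Proof. by rewrite -[_ *: _]addr0 T1 T01 addr0. Qed.
Let T2Z k a b c : T a (k *: b) c = k * T a b c.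
Proof. by rewrite -[_ *: _]addr0 T2 T02 addr0. Qed.
Let T2N a b c : T a (- b) c = - T a b c.
Proof. by rewrite -scaleN1r T2Z mulN1r. Qed.
Let T3N a b c : T a b (- c) = - T a b c.
Proof. by rewrite Tskew T2N opprK -Tskew. Qed.
Let Tdiag a b : T a b b = 0.
Proof. by have := Tskew a b b; lra. Qed.
Let TJdiag a b : T a b (b *m J) = 0.
Proof. by have := TJ a b b; rewrite Tskew; lra. Qed.

(** The six vectors a, b, c, aJ, bJ, cJ are avoided; this is the use of m >= 8. *)
Let orth3 a b c : exists u, [/\ g[u, u] = 1, g[u, a] = 0 /\ g[u *m J, a] = 0,
  g[u, b] = 0 /\ g[u *m J, b] = 0 & g[u, c] = 0 /\ g[u *m J, c] = 0].
Proof.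
have m6 : (6 < m)%N by apply: leq_trans m8.
have [u [u1 hu]] := exists_orth Gp [tuple a; b; c; a *m J; b *m J; c *m J] m6.
have H0 : g[u, a] = 0 by exact: (hu (@Ordinal 6 0 isT)).
have H1 : g[u, b] = 0 by exact: (hu (@Ordinal 6 1 isT)).
have H2 : g[u, c] = 0 by exact: (hu (@Ordinal 6 2 isT)).
have H3 : g[u, a *m J] = 0 by exact: (hu (@Ordinal 6 3 isT)).
have H4 : g[u, b *m J] = 0 by exact: (hu (@Ordinal 6 4 isT)).
have H5 : g[u, c *m J] = 0 by exact: (hu (@Ordinal 6 5 isT)).
have Hr x : g[u, x *m J] = 0 -> g[u *m J, x] = 0.
  by move=> h; rewrite -[LHS]opprK -innerJr h oppr0.
by exists u; split=> //; split=> //; exact: Hr.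
Qed.

(** For a unit vector d off the three complex lines and e = dJ, only the terms -2 T a b c g(dJ, e)
    and their cyclic images survive. The result says that the fundamental 2-form of J is closed. *)
Let closed a b c : T a b c + T b c a + T c a b = 0.
Proof.
have [d [d1 [da dJa] [db dJb] [dc dJc]]] := orth3 a b c.
have := Tbianchi (a := a) (b := b) (c := c) (d := d) (e := d *m J) da db dc dJa dJb dJc.
have nz x : g[d *m J, x] = 0 -> g[x *m J, d] = 0 by move=> h; rewrite Jskew h oppr0.
rewrite /bianchi_term !innerJJ d1 !TJdiag (nz _ dJa) (nz _ dJb) (nz _ dJc).
rewrite !(innerC Gs _ d) da db dc.
lra.
Qed.

(** With a unit vector b orthogonal to the three lines and d = bJ, the Bianchi identity reduces to T
    c a e = T a c e; [closed] and the skewness of T then leave T e c a = 0. *)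
Let distinct_lines a c e : g[a, c] = 0 -> g[a *m J, c] = 0 -> g[a, e] = 0 ->
  g[a *m J, e] = 0 -> g[c, e] = 0 -> g[c *m J, e] = 0 -> T e c a = 0.
Proof.
move=> ac aJc ae aJe ce cJe.
have [b [b1 [ba bJa] [bc bJc] [be bJe]]] := orth3 a c e.
have nz x y : g[x *m J, y] = 0 -> g[y *m J, x] = 0 by move=> h; rewrite Jskew h oppr0.
have C x y : g[x, y] = 0 -> g[y, x] = 0 by rewrite (innerC Gs).
have := Tbianchi (a := a) (b := b) (c := c) (d := b *m J) (e := e) bJa (innerJx b) bJc
  (C _ _ ae) (C _ _ be) (C _ _ ce).
rewrite /bianchi_term !innerJJ b1 mulJJ !innerNl.
rewrite ?bJe ?aJe ?cJe ?aJc ?(nz _ _ aJc) ?bJc ?(nz _ _ bJa) ?bJa ?(nz _ _ bJc) ?be ?(C _ _ ba) ?(C _ _ bc).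
have := closed a c e; have := Tskew a e c; have := Tskew e a c.
have := closed c a e; have := Tskew c e a.
lra.
Qed.

(** T b c b has the same value, namely that at e, for b = a and for b = aJ, whereas [closed] and
    [TJ] show that passing from a to aJ changes its sign. *)
Let same_line_unit a c : g[a, a] = 1 -> g[a, c] = 0 -> g[a *m J, c] = 0 -> T a a c = 0.
Proof.
move=> a1 ac aJc.
have [e [e1 [ea eJa] [ec eJc] _]] := orth3 a c c.
have nz x y : g[x *m J, y] = 0 -> g[y *m J, x] = 0 by move=> h; rewrite Jskew h oppr0.
have C x y : g[x, y] = 0 -> g[y, x] = 0 by rewrite (innerC Gs).
(* [distinct_lines] is polarized: e + b and e - b span orthogonal complex lines as b and e are
   units. *)
have key b : g[b, b] = 1 -> g[e, b] = 0 -> g[e *m J, b] = 0 -> g[b, c] = 0 ->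
    g[b *m J, c] = 0 -> T e c e = T b c b.
  move=> b1 eb eJb bc bJc.
  have h1 : T (e + b) c (e - b) = 0.
    apply: distinct_lines; rewrite ?mulmxBl !innerE ?mulmxDl ?innerE;
      rewrite ?innerJJ ?innerJx ?e1 ?b1 ?(innerC Gs b e) ?eb ?ec ?bc ?eJb ?bJc ?eJc
        ?(nz _ _ eJb) ?(C _ _ ec) ?(C _ _ bc) ?(nz _ _ bJc) ?(nz _ _ eJc); ring.
  have h2 : T e c b = 0.
    by apply: distinct_lines => //; [exact: C|exact: nz|exact: C|exact: nz].
  have h3 : T b c e = 0 by apply: distinct_lines => //; [exact: C|exact: nz].
  move: h1; rewrite T1D !T3D !T3N h2 h3; lra.
have e_a := key a a1 ea eJa ac aJc.
have e_aJ : T e c e = T (a *m J) c (a *m J).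
  apply: key; rewrite ?innerJJ ?innerJr ?eJa ?oppr0 //.
  by rewrite mulJJ innerNl ac oppr0.
have k (d : 'rV[R]_m) : T a (a *m J) d = T (a *m J) a d.
  have := closed a (a *m J) d; rewrite TJdiag (Tskew (a *m J)); lra.
have h4 : T (a *m J) (a *m J) c = - T a a c.
  by rewrite (TJ (a *m J) a c) -k (TJ a a) mulJJ T3N.
move: e_a e_aJ h4; rewrite (Tskew a c a) (Tskew (a *m J) c (a *m J)); lra.
Qed.

(** The part of c' in the complex line of a' contributes nothing to T a' a' c' by [Tdiag] and
    [TJdiag], the rest nothing by [same_line_unit]. Hence T is totally skew, and [closed] becomes 3
    T = 0. *)
Lemma parallel_tensor a b c : T a b c = 0.
Proof.
have alt a' c' : T a' a' c' = 0.
  have [->|aN0] := eqVneq a' 0; first exact: T01.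
  have [k k0] := inner_normalize Gp aN0; have [e Ee] : exists e, e = k *: a' by exists (k *: a').
  rewrite -Ee => k1.
  pose d := c' - g[c', e] *: e - g[c', e *m J] *: (e *m J).
  have ed : g[e, d] = 0.
    by rewrite /d !innerE k1 (innerJr e e) innerJx (innerC Gs e c'); ring.
  have eJd : g[e *m J, d] = 0.
    by rewrite /d !innerE innerJx innerJJ k1 (innerC Gs (e *m J) c'); ring.
  have E : c' = d + (g[c', e] *: e + g[c', e *m J] *: (e *m J)).
    by rewrite /d -[c' - _ - _]addrA -opprD subrK.
  have : T e e c' = 0.
    by rewrite E T3D (same_line_unit k1 ed eJd) T3 Tdiag -[_ *: (e *m J)]addr0 T3 TJdiag T03; ring.
  rewrite Ee T1Z T2Z => /eqP; rewrite !mulf_eq0 (gt_eqF k0) /=; by move/eqP.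
have sw x y z : T x y z = - T y x z.
  have := alt (x + y) z; rewrite T1D !T2D !alt; lra.
have := closed a b c; rewrite (sw b c a) (Tskew c b a) (sw c a b) (Tskew a c b); lra.
Qed.
End ParallelTensor.

Section WedgeCommute.
Hypothesis m8 : (8 <= m)%N.
Variable P : 'M[R]_m.

Definition wedge x y z : 'rV[R]_m :=
  g[y *m P, z] *: x - g[x *m P, z] *: y + g[y, z] *: (x *m P) - g[x, z] *: (y *m P).

Hypothesis Pcomm : forall x y z, wedge x y (z *m J) = wedge x y z *m J.

(** Pairing with a unit vector y orthogonal to the complex lines of x and z expresses g(xP, zJ) by
    the values g(yP, y) and g(yP, yJ). For units in two orthogonal complex lines these values are
    opposite; comparing three such lines shows that they are zero. *)
Lemma wedge_commute_eq0 : P = 0.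
Proof.
have m4 : (4 < m)%N by apply: leq_trans m8.
have orth2 x z : exists u, [/\ g[u, u] = 1, g[u, x] = 0, g[u, x *m J] = 0, g[u, z] = 0 & g[u, z *m J] = 0].
  have [u [u1 hu]] := exists_orth Gp [tuple x; z; x *m J; z *m J] m4.
  have H0 : g[u, x] = 0 by exact: (hu (@Ordinal 4 0 isT)).
  have H1 : g[u, z] = 0 by exact: (hu (@Ordinal 4 1 isT)).
  have H2 : g[u, x *m J] = 0 by exact: (hu (@Ordinal 4 2 isT)).
  have H3 : g[u, z *m J] = 0 by exact: (hu (@Ordinal 4 3 isT)).
  by exists u.
have star x z y : g[y, y] = 1 -> g[y, x] = 0 -> g[y, x *m J] = 0 -> g[y, z] = 0 ->
    g[y, z *m J] = 0 ->
    g[x *m P, z *m J] = - g[x, z *m J] * g[y *m P, y] - g[x, z] * g[y *m P, y *m J].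
  move=> y1 yx yxJ yz yzJ.
  have : g[wedge x y (z *m J), y] = - g[wedge x y z, y *m J].
    by rewrite innerJr opprK Pcomm.
  rewrite /wedge !(innerBl, innerDl, innerZl) y1 yz yzJ (innerC Gs x y) yx.
  have -> : g[x, y *m J] = 0 by rewrite innerJr (innerC Gs) yxJ oppr0.
  have -> : g[y, y *m J] = 0 by rewrite innerJr innerJx oppr0.
  lra.
have pair x y : g[x, x] = 1 -> g[y, y] = 1 -> g[y, x] = 0 -> g[y, x *m J] = 0 ->
    g[x *m P, x] = - g[y *m P, y] /\ g[x *m P, x *m J] = - g[y *m P, y *m J].
  move=> x1 y1 yx yxJ; split.
    have := star x (- (x *m J)) y y1 yx yxJ.
    rewrite mulNmx mulJJ opprK !innerNr yxJ oppr0 x1 (innerJr x x) innerJx => /(_ erefl yx).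
    lra.
  have := star x x y y1 yx yxJ yx yxJ; rewrite (innerJr x x) innerJx x1; lra.
have zero y : g[y, y] = 1 -> g[y *m P, y] = 0 /\ g[y *m P, y *m J] = 0.
  move=> y1; have [v [v1 vy vyJ _ _]] := orth2 y y.
  have [w [w1 wy wyJ wv wvJ]] := orth2 y v.
  have [a1 a2] := pair y v y1 v1 vy vyJ.
  have [b1 b2] := pair y w y1 w1 wy wyJ.
  have [c1 c2] := pair v w v1 w1 wv wvJ.
  by move: a1 a2 b1 b2 c1 c2; split; lra.
apply/row_matrixP => i; rewrite row0 rowE; apply: (inner_inj Gp) => z.
have [y [y1 yx yxJ yz yzJ]] := orth2 (delta_mx 0 i) (- (z *m J)).
have := star _ _ _ y1 yx yxJ yz yzJ.
by rewrite mulNmx mulJJ opprK; have [-> ->] := zero y y1; rewrite !mulr0 subr0.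
Qed.
End WedgeCommute.

(** The square of det J is det(-1) = (-1)^m, and a square is not negative. *)
Lemma complex_even : ~~ odd m.
Proof.
have : \det J ^+ 2 = (-1) ^+ m by rewrite expr2 -det_mulmx JJ -scaleN1r detZ det1 mulr1.
case: (odd m) (signr_odd R m) => // <-; rewrite expr1 => h.
by have := sqr_ge0 (\det J); rewrite h oppr_ge0 ler10.
Qed.
End Hermitian.

(** * Unitary bases *)

Section UnitaryBasis.
Context {R : realType} {n : nat}.
Variable G : 'M[R]_(n + n).
Hypotheses (Gs : G^T = G) (Gp : forall v : 'rV[R]_(n + n), v != 0 -> 0 < inner G v v).
Variable J : 'M[R]_(n + n).
Hypotheses (Jskew : forall x y, inner G (x *m J) y = - inner G (y *m J) x)
           (JJ : J *m J = - 1%:M).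

Lemma mx_inner_skew : J *m G = - (J *m G)^T.
Proof.
apply/matrixP => i j; have := Jskew (delta_mx 0 i) (delta_mx 0 j).
rewrite /inner -!(mulmxA _ J G) !trmx_delta -!rowE -!colE !mxE; exact.
Qed.

(** The next row has to be orthogonal to the rows of E and of EJ, that is, to 2k vectors, and 2k <
    2n leaves a nonzero choice. *)
Lemma unitary_frame k : (k <= n)%N -> exists E : 'M[R]_(k, n + n),
  E *m G *m E^T = 1%:M /\ E *m J *m G *m E^T = 0.
Proof.
elim: k => [|k IH] kn.
  by exists 0; split; apply/matrixP => -[].
have [E [E1 E2]] := IH (ltnW kn).
pose A : 'M[R]_(n + n, k + k) := row_mx (G *m E^T) (G *m (E *m J)^T).
have : kermx A != 0.
  rewrite -mxrank_eq0 mxrank_ker -lt0n subn_gt0.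
  apply: leq_ltn_trans (rank_leq_col A) _.
  by rewrite -addSn leq_add // ltnW.
move=> /rowV0Pn[v /sub_kermxP vA vN0].
have [c c0 cv] := inner_normalize Gp vN0.
set u := c *: v in cv.
have uA : u *m A = 0 by rewrite /u -scalemxAl vA scaler0.
move: uA; rewrite /A mul_mx_row => /eqP; rewrite row_mx_eq0 => /andP[/eqP u1 /eqP u2].
have u3 : u *m J *m G *m E^T = 0.
  rewrite -(mulmxA u) mx_inner_skew trmx_mul Gs mulmxN mulNmx.
  by rewrite -!mulmxA -trmx_mul u2 oppr0.
have v1 : E *m G *m u^T = 0.
  have -> : E *m G *m u^T = (u *m (G *m E^T))^T by rewrite !trmx_mul trmxK Gs.
  by rewrite u1 trmx0.
have v2 : E *m J *m G *m u^T = 0.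
  have -> : E *m J *m G *m u^T = (u *m (G *m (E *m J)^T))^T.
    by rewrite !trmx_mul !trmxK Gs.
  by rewrite u2 trmx0.
have uu1 : u *m G *m u^T = 1%:M.
  by apply/matrixP => i j; rewrite !ord1 [LHS]cv mxE.
have uu2 : u *m J *m G *m u^T = 0.
  by apply/matrixP => i j; rewrite !ord1 [RHS]mxE; have := Jskew u u; rewrite /inner; lra.
have u1' : u *m G *m E^T = 0 by rewrite -mulmxA.
have H1 : col_mx u E *m G *m (col_mx u E)^T = 1%:M.
  rewrite mul_col_mx tr_col_mx mul_col_row E1 u1' v1 uu1.
  by rewrite -scalar_mx_block.
have H2 : col_mx u E *m J *m G *m (col_mx u E)^T = 0.
  by rewrite (mul_col_mx u) (mul_col_mx (u *m J)) tr_col_mx mul_col_row E2 u3 v2 uu2 block_mx0.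
by exists (col_mx u E).
Qed.

(** The basis is E followed by EJ, which agrees with the order of real and imaginary parts in
    [affine_vec]. *)
Lemma unitary_basis : exists U : 'M[R]_(n + n),
  U *m G *m U^T = 1%:M /\ U *m J = block_mx 0 1%:M (- 1%:M) 0 *m U.
Proof.
have [E [E1 E2]] := unitary_frame (leqnn n).
exists (col_mx E (E *m J)); split.
  rewrite mul_col_mx tr_col_mx mul_col_row E1 E2.
  have sk : forall (a b : nat) (X : 'M[R]_(a, n + n)) (Y : 'M[R]_(b, n + n)),
      X *m G *m (Y *m J)^T = - (X *m J *m G *m Y^T).
    move=> a b X Y; rewrite -(mulmxA X J) mx_inner_skew !trmx_mul Gs mulmxN mulNmx opprK.
    by rewrite !mulmxA.
  rewrite sk E2 oppr0 sk -(mulmxA E J J) JJ !mulmxN mulmx1 !mulNmx E1 opprK.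
  by rewrite -scalar_mx_block.
rewrite mul_col_mx -mulmxA JJ mulmxN mulmx1 mul_block_col !mul0mx mul1mx add0r addr0.
by rewrite mulNmx mul1mx.
Qed.
End UnitaryBasis.

(** * Curvature in coordinates *)

Section Entries.
Context {R : realType} {a b : nat}.
Implicit Types (X Y : 'M[R]_(a, b)).
Lemma addmxE X Y i j : (X + Y) i j = X i j + Y i j. Proof. by rewrite mxE. Qed.
Lemma oppmxE X i j : (- X) i j = - X i j. Proof. by rewrite mxE. Qed.
Lemma scalemxE k X i j : (k *: X) i j = k * X i j. Proof. by rewrite mxE. Qed.
Lemma zeromxE i j : (0 : 'M[R]_(a, b)) i j = 0. Proof. by rewrite mxE. Qed.
End Entries.

Ltac mx_ring := apply/matrixP => ? ?;
  rewrite ?(addmxE, oppmxE, scalemxE, zeromxE); ring.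

(* Cancellation patterns, stated for variables because the tactic would
   otherwise compare the atoms up to conversion. *)
Section Cancellation.
Context {R : realType} {n k : nat}.
Implicit Types A B C E : 'M[R]_(n, k).

Lemma cancel_skew A B C E : A - B + C - E = - (B - A + E - C).
Proof. mx_ring. Qed.

Lemma cancel_bianchi1 x1 x2 x3 x4 x5 x6 y1 y2 y3 y4 y5 y6 :
  x1 = y1 -> x2 = y2 -> x3 = y3 -> x4 = y4 -> x5 = y5 -> x6 = y6 ->
  (x1 - x2 + x3 - x4) + (y2 - x5 + y4 - x6) + (y5 - y1 + y6 - y3) = 0 :> 'M[R]_(n, k).
Proof. move=> -> -> -> -> -> ->; mx_ring. Qed.

Lemma cancel_metric (G X Y P Q : 'M[R]_n) :
  X *m G + P *m (Q *m G + G *m Q^T) + ((Q *m G + G *m Q^T) *m P^T + G *m X^T) =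
  Y *m G + Q *m (P *m G + G *m P^T) + ((P *m G + G *m P^T) *m Q^T + G *m Y^T) ->
  (X - Y + P *m Q - Q *m P) *m G + G *m (X - Y + P *m Q - Q *m P)^T = 0.
Proof.
have -> : (X - Y + P *m Q - Q *m P)^T = X^T - Y^T + Q^T *m P^T - P^T *m Q^T.
  by rewrite raddfB raddfD raddfB /= !trmx_mul.
move=> /eqP; rewrite -subr_eq0 => /eqP <-.
rewrite !(mulmxDr, mulmxDl, mulNmx, mulmxN, mulmxA); mx_ring.
Qed.

Lemma cancel_bianchi2 (A B C aB bA aC cA bC cB S1 S2 S3 T1 T2 T3 M1 M2 M3 R1 R2 R3 : 'M[R]_n) :
  M1 = S1 - S2 + (aC *m B + C *m aB) - (aB *m C + B *m aC) ->
  M2 = S3 - T1 + (bA *m C + A *m bC) - (bC *m A + C *m bA) ->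
  M3 = T2 - T3 + (cB *m A + B *m cA) - (cA *m B + A *m cB) ->
  R1 = bC - cB + C *m B - B *m C -> R2 = cA - aC + A *m C - C *m A ->
  R3 = aB - bA + B *m A - A *m B -> S1 = T1 -> S2 = T2 -> S3 = T3 ->
  (M1 + R1 *m A - A *m R1) + (M2 + R2 *m B - B *m R2) + (M3 + R3 *m C - C *m R3) = 0.
Proof.
move=> -> -> -> -> -> -> -> -> ->.
rewrite !(mulmxDl, mulmxDr, mulNmx, mulmxN, mulmxA); mx_ring.
Qed.

End Cancellation.

Section Metric.
Context {R : realType} {m : nat}.
Variables (D : set 'rV[R]_m) (oD : open D) (g : 'rV[R]_m -> 'M[R]_m).
Hypotheses (gC : forall k, mC k D g) (gS : forall p, D p -> (g p)^T = g p)
  (gP : forall p v, D p -> v != 0 -> 0 < inner (g p) v v).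
Implicit Types (p q x y z t v w : 'rV[R]_m) (a b c i j : 'I_m).

Lemma met_unit p : D p -> g p \in unitmx.
Proof. by move=> Dp; apply: inner_unit => v; exact: gP. Qed.

Lemma dmetE p k i j : dmet g p k i j = mpd k g p i j.
Proof. by rewrite mxE pdE. Qed.

Lemma dmet_sym p k i j : D p -> dmet g p k i j = dmet g p k j i.
Proof.
move=> Dp; rewrite !dmetE !mxE; apply: (pd_ext k oD Dp) => q Dq.
by rewrite -[in LHS]gS // mxE.
Qed.

(** Vectors are rows, so the covariant derivative in direction a of a field v is d_a v + v *m Gam
    a. *)
Definition Gam a p : 'M[R]_m := \matrix_(j, k) christoffel g p a j k.

Lemma Gam_C (k : nat) a : mC k D (Gam a).
Proof.
move=> i j.
have : Ck k D (fun p => 2^-1 * \sum_l invmx (g p) j l *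
    (mpd a g p i l + mpd i g p a l - mpd l g p a i)).
  apply: Ck_mul => //; first exact: Ck_cst.
  apply: Ck_sum => // l _; apply: Ck_mul => //.
    exact: (mC_invmx oD (fun p Dp => met_unit Dp) (gC k)).
  apply: Ck_sub2 => //; last exact: (mC_mpd oD l (gC k.+1)).
  by apply: Ck_add => //; exact: (mC_mpd oD _ (gC k.+1)).
apply: Ck_ext => // p Dp; rewrite [RHS]mxE /christoffel; congr (_ * _).
by apply: eq_bigr => l _; rewrite !dmetE.
Qed.

Lemma Gam_sym a b p : D p -> basis_vec a *m Gam b p = basis_vec b *m Gam a p.
Proof.
move=> Dp; rewrite /basis_vec -!rowE; apply/rowP => k; rewrite !mxE.
by apply: christoffel_sym => l c d; exact: dmet_sym.
Qed.

Lemma Gam_metric a p : D p -> mpd a g p = Gam a p *m g p + g p *m (Gam a p)^T.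
Proof.
move=> Dp; apply/matrixP => i j.
rewrite -dmetE (christoffel_metric _ _ _ (met_unit Dp) (gS Dp)); last first.
  by move=> l c d; exact: dmet_sym.
rewrite !mxE; congr (_ + _); apply: eq_bigr => l _; rewrite !mxE //.
by rewrite mulrC -[g p i l]/((g p) i l) -{1}(gS Dp) mxE.
Qed.

(** Curvature of the connection d + Gam. The products are in reverse order because matrices act on
    rows from the right. *)
Definition Rm a b p : 'M[R]_m :=
  mpd a (Gam b) p - mpd b (Gam a) p + Gam b p *m Gam a p - Gam a p *m Gam b p.

Lemma Rm_C (k : nat) a b : mC k D (Rm a b).
Proof.
exact: (mC_sub oD (mC_add oD (mC_sub oD (mC_mpd oD a (Gam_C k.+1 b))
  (mC_mpd oD b (Gam_C k.+1 a))) (mC_mul oD (Gam_C k b) (Gam_C k a)))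
  (mC_mul oD (Gam_C k a) (Gam_C k b))).
Qed.

Lemma Rm_skew a b p : Rm a b p = - Rm b a p.
Proof. exact: cancel_skew. Qed.

Definition GamV v p : 'M[R]_m := \sum_a v 0 a *: Gam a p.

Lemma GamV_C (k : nat) v : mC k D (GamV v).
Proof.
move=> i j; have : Ck k D (fun p => \sum_a v 0 a * Gam a p i j).
  by apply: Ck_sum => // a _; apply: Ck_mul => //; [exact: Ck_cst|exact: (Gam_C k a i j)].
move=> H; apply: (Ck_ext oD _ H) => p Dp.
by rewrite /GamV summxE; apply: eq_bigr => a _; rewrite scalemxE.
Qed.

Lemma nablaE X Y p : nabla g X Y p = 'D_(X p) Y p + Y p *m GamV (X p) p.
Proof.
rewrite /nabla; congr (_ + _); apply/rowP => k; rewrite !mxE exchange_big /=.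
apply: eq_bigr => j _; rewrite summxE mulr_sumr; apply: eq_bigr => i _.
rewrite scalemxE [Gam _ _ _ _]mxE; ring.
Qed.

Lemma mpd_GamV a v p : D p -> mpd a (GamV v) p = \sum_b v 0 b *: mpd a (Gam b) p.
Proof.
move=> Dp; apply/matrixP => i j; rewrite mxE summxE.
transitivity (pd a (fun q => \sum_b v 0 b * Gam b q i j) p).
  congr (pd a _ p); apply/funext => q; rewrite summxE.
  by apply: eq_bigr => b _; rewrite scalemxE.
rewrite (@pd_sum _ _ _ _ _ 0 D) // => [|b _]; last first.
  by apply: Ck_mul => //; [exact: Ck_cst|exact: (Gam_C 1 b i j)].
apply: eq_bigr => b _; rewrite pdM; [|exact: derivable_cst|].
  by rewrite pd_cst mulr0 addr0 scalemxE [mpd _ _ _ _ _]mxE.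
exact: (Ck_der (Gam_C 1 b i j)).
Qed.

Lemma derive_row (F : 'rV[R]_m -> 'rV[R]_m) v p : D p -> mC 1 D F ->
  'D_v F p = \sum_a v 0 a *: mpd a F p.
Proof.
move=> Dp HF.
have H : is_derive p v F (\row_k \sum_a v 0 a * pd a (fun q => F q 0 k) p).
  by apply: is_derive_mx => k; rewrite mxE; exact: Ck1_is_derive Dp (HF 0 k).
case: H => _ ->; apply/rowP => k; rewrite mxE summxE; apply: eq_bigr => a _.
by rewrite !mxE.
Qed.

Lemma nabla_cst x y z p : D p ->
  nabla g (fun=> x) (nabla g (fun=> y) (fun=> z)) p =
  z *m (\sum_a x 0 a *: mpd a (GamV y) p + GamV y p *m GamV x p).
Proof.
move=> Dp.
have -> : nabla g (fun=> y) (fun=> z) = fun q => z *m GamV y q.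
  by apply/funext => q; rewrite nablaE derive_cst add0r.
have cz : mC 1 D (fun=> z) by exact: mC_cst.
have cy : mC 1 D (GamV y) by exact: GamV_C.
rewrite nablaE (derive_row _ Dp (mC_mul oD cz cy)) mulmxDr mulmxA.
congr (_ + _); rewrite mulmx_sumr; apply: eq_bigr => a _.
by rewrite (mpd_mul oD a Dp cz cy) mpd_cst mul0mx add0r scalemxAr.
Qed.

Definition RV x y p : 'M[R]_m := \sum_a \sum_b (x 0 a * y 0 b) *: Rm a b p.

Lemma RV_expand x y p : D p -> RV x y p =
  (\sum_a x 0 a *: mpd a (GamV y) p + GamV y p *m GamV x p) -
  (\sum_a y 0 a *: mpd a (GamV x) p + GamV x p *m GamV y p).
Proof.
move=> Dp.
have E (u v : 'rV[R]_m) : \sum_a u 0 a *: mpd a (GamV v) p + GamV v p *m GamV u p =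
    \sum_a \sum_b (u 0 a * v 0 b) *: (mpd a (Gam b) p + Gam b p *m Gam a p).
  rewrite [GamV u p]/GamV mulmx_sumr -big_split /=; apply: eq_bigr => a _.
  rewrite mpd_GamV // -scalemxAr -scalerDr /GamV mulmx_suml -big_split scaler_sumr /=.
  by apply: eq_bigr => b _; rewrite -scalemxAl -scalerDr scalerA.
rewrite !E [X in _ - X]exchange_big /= -sumrB; apply: eq_bigr => a _.
rewrite -sumrB; apply: eq_bigr => b _; rewrite (mulrC (y 0 b)) -scalerBr; congr (_ *: _).
by rewrite /Rm opprD addrACA addrA.
Qed.

Lemma curvE x y z p : D p -> curv g p x y z = z *m RV x y p.
Proof.
move=> Dp; rewrite /curv /curv_fields !nabla_cst // RV_expand // mulmxBr.
rewrite [X in _ - X](_ : _ = 0) ?subr0 // nablaE derive_cst add0r.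
have -> : lie_bracket (fun=> x) (fun=> y) p = 0 :> 'rV[R]_m.
  by rewrite /lie_bracket !derive_cst subrr.
by rewrite /GamV big1 ?mulmx0 // => a _; rewrite mxE scale0r.
Qed.

Lemma RV_basis a b p : RV (basis_vec a) (basis_vec b) p = Rm a b p.
Proof.
rewrite /RV (bigD1 a) //= [X in _ + X]big1 ?addr0 => [|i ia]; last first.
  by rewrite big1 // => j _; rewrite /basis_vec mxE /= (negPf ia) mul0r scale0r.
rewrite (bigD1 b) //= [X in _ + X]big1 ?addr0 => [|j jb]; last first.
  by rewrite /basis_vec [X in _ * X]mxE /= (negPf jb) mulr0 scale0r.
by rewrite /basis_vec !mxE !eqxx mulr1 scale1r.
Qed.

Lemma RV_lin1 k x x' y p : RV (k *: x + x') y p = k *: RV x y p + RV x' y p.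
Proof.
rewrite /RV scaler_sumr -big_split; apply: eq_bigr => a _ /=.
rewrite scaler_sumr -big_split; apply: eq_bigr => b _ /=.
by rewrite !mxE mulrDl scalerDl scalerA mulrA.
Qed.

Lemma RV_skew x y p : RV x y p = - RV y x p.
Proof.
rewrite /RV exchange_big -sumrN; apply: eq_bigr => a _ /=.
rewrite -sumrN; apply: eq_bigr => b _; rewrite Rm_skew scalerN; congr (- (_ *: _)).
exact: mulrC.
Qed.

Lemma RV_lin2 k x y y' p : RV x (k *: y + y') p = k *: RV x y p + RV x y' p.
Proof. by rewrite RV_skew RV_lin1 opprD -scalerN -!(RV_skew x). Qed.

Lemma trilinear_ext (W : lmodType R) (F : 'rV[R]_m -> 'rV[R]_m -> 'rV[R]_m -> W) :
  (forall k x x' y z, F (k *: x + x') y z = k *: F x y z + F x' y z) ->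
  (forall k x y y' z, F x (k *: y + y') z = k *: F x y z + F x y' z) ->
  (forall k x y z z', F x y (k *: z + z') = k *: F x y z + F x y z') ->
  (forall a b c, F (basis_vec a) (basis_vec b) (basis_vec c) = 0) ->
  forall x y z, F x y z = 0.
Proof.
move=> F1 F2 F3 F0 x y z.
have Z1 y' z' : F 0 y' z' = 0.
  by apply: (addrI (F 0 y' z')); rewrite addr0 -[X in X + _]scale1r -F1 scaler0 addr0.
have Z2 y' z' : F y' 0 z' = 0.
  by apply: (addrI (F y' 0 z')); rewrite addr0 -[X in X + _]scale1r -F2 scaler0 addr0.
have Z3 y' z' : F y' z' 0 = 0.
  by apply: (addrI (F y' z' 0)); rewrite addr0 -[X in X + _]scale1r -F3 scaler0 addr0.
have bas (f : 'rV[R]_m -> W) : f 0 = 0 -> (forall k x x', f (k *: x + x') = k *: f x + f x') ->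
    (forall a, f (basis_vec a) = 0) -> forall x, f x = 0.
  move=> f0 fl fb v; rewrite (row_sum_delta v); elim/big_ind: _ => // [u w fu fw|i _].
    by rewrite -[u]scale1r fl fu fw scaler0 addr0.
  by rewrite -[_ *: _]addr0 fl fb f0 scaler0 addr0.
apply: (bas (fun x => F x y z)) => // a; apply: (bas (fun y => F _ y z)) => // b.
by apply: (bas (fun z => F _ _ z)) => // c.
Qed.

(** On coordinate fields all terms cancel in pairs by the symmetry [Gam_sym] and its derivative,
    that is, by the absence of torsion. *)
Lemma bianchi1 x y z p : D p -> z *m RV x y p + x *m RV y z p + y *m RV z x p = 0.
Proof.
move=> Dp; move: x y z; apply: (trilinear_ext (F := fun x y z =>
  z *m RV x y p + x *m RV y z p + y *m RV z x p)).
- move=> k x x' y z; rewrite RV_lin1 RV_lin2 !mulmxDr !mulmxDl -!scalemxAr -!scalemxAl.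
  rewrite !scalerDr; mx_ring.
- move=> k x y y' z; rewrite RV_lin1 RV_lin2 !mulmxDr !mulmxDl -!scalemxAr -!scalemxAl.
  rewrite !scalerDr; mx_ring.
- move=> k x y z z'; rewrite RV_lin1 RV_lin2 !mulmxDr !mulmxDl -!scalemxAr -!scalemxAl.
  rewrite !scalerDr; mx_ring.
move=> a b c; rewrite !RV_basis /Rm.
have dsym i j k : basis_vec i *m mpd k (Gam j) p = basis_vec j *m mpd k (Gam i) p.
  have ci l : mC 1 D (fun=> basis_vec l : 'rV[R]_m) by exact: mC_cst.
  have E l n : basis_vec l *m mpd k (Gam n) p = mpd k (fun q => basis_vec l *m Gam n q) p.
    by rewrite (mpd_mul oD k Dp (ci l) (Gam_C 1 n)) mpd_cst mul0mx add0r.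
  by rewrite !E; apply: (mpd_ext oD k Dp) => q Dq; exact: Gam_sym.
rewrite !(mulmxDr, mulmxN, mulmxA).
have gsym i j k : basis_vec i *m Gam j p *m Gam k p = basis_vec j *m Gam i p *m Gam k p.
  by rewrite Gam_sym.
by apply: cancel_bianchi1; [exact: dsym|exact: dsym|exact: gsym|exact: gsym|exact: dsym|exact: gsym].
Qed.

(** The second derivatives of g, computed from [Gam_metric], commute. *)
Lemma Rm_metric a b p : D p -> Rm a b p *m g p + g p *m (Rm a b p)^T = 0.
Proof.
move=> Dp.
have cg := gC 1; have cG i := Gam_C 1 i.
have cT i : mC 1 D (fun q => (Gam i q)^T) by exact: (mC_tr oD (cG i)).
have E i j : mpd i (mpd j g) p = mpd i (Gam j) p *m g p + Gam j p *m (Gam i p *m g p + g p *m (Gam i p)^T)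
   + ((Gam i p *m g p + g p *m (Gam i p)^T) *m (Gam j p)^T + g p *m (mpd i (Gam j) p)^T).
  rewrite -(Gam_metric i Dp) -mpd_tr.
  rewrite -(mpd_mul oD i Dp (cG j) cg) -(mpd_mul oD i Dp cg (cT j)).
  rewrite -(mpd_add i Dp (mC_mul oD (cG j) cg) (mC_mul oD cg (cT j))).
  by apply: (mpd_ext oD i Dp) => q; exact: Gam_metric.
exact: (cancel_metric (etrans (esym (E a b)) (etrans (mpd_comm oD a b Dp (gC 2)) (E b a)))).
Qed.

(* D_a X = mpd a X + X Gam_a - Gam_a X is the covariant derivative of a field
   of endomorphisms. *)
Lemma bianchi2 a b c p : D p ->
  (mpd a (Rm b c) p + Rm b c p *m Gam a p - Gam a p *m Rm b c p) +
  (mpd b (Rm c a) p + Rm c a p *m Gam b p - Gam b p *m Rm c a p) +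
  (mpd c (Rm a b) p + Rm a b p *m Gam c p - Gam c p *m Rm a b p) = 0.
Proof.
move=> Dp; have cG k i := Gam_C k i.
have E i j k : mpd i (Rm j k) p = mpd i (mpd j (Gam k)) p - mpd i (mpd k (Gam j)) p
   + (mpd i (Gam k) p *m Gam j p + Gam k p *m mpd i (Gam j) p)
   - (mpd i (Gam j) p *m Gam k p + Gam j p *m mpd i (Gam k) p).
  have c1 d e : mC 1 D (mpd d (Gam e)) by exact: (mC_mpd oD d (cG 2%N e)).
  have c2 d e : mC 1 D (fun q => Gam d q *m Gam e q) by exact: (mC_mul oD (cG 1%N d) (cG 1%N e)).
  have c3 := mC_sub oD (c1 j k) (c1 k j).
  rewrite /Rm (mpd_sub oD i Dp (mC_add oD c3 (c2 k j)) (c2 j k)).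
  rewrite (mpd_add i Dp c3 (c2 k j)) (mpd_sub oD i Dp (c1 j k) (c1 k j)).
  by rewrite (mpd_mul oD i Dp (cG 1%N k) (cG 1%N j)) (mpd_mul oD i Dp (cG 1%N j) (cG 1%N k)).
exact: (cancel_bianchi2 (E a b c) (E b c a) (E c a b) erefl erefl erefl
  (mpd_comm oD a b Dp (cG 2%N c)) (mpd_comm oD a c Dp (cG 2%N b))
  (mpd_comm oD b c Dp (cG 2%N a))).
Qed.
End Metric.

Lemma mul_lin1_mx {R : realType} {m n : nat} (f : 'rV[R]_m -> 'rV[R]_n) y :
  (forall k x x', f (k *: x + x') = k *: f x + f x') -> y *m lin1_mx f = f y.
Proof.
move=> fl.
have f0 : f 0 = 0.
  by apply: (addrI (f 0)); rewrite addr0 -[X in X + _]scale1r -fl scaler0 addr0.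
have fD x x' : f (x + x') = f x + f x' by rewrite -[x in LHS]scale1r fl scale1r.
rewrite mulmx_sum_row [in RHS](row_sum_delta y); elim/big_rec2: _ => [|i u v _ ->].
  by rewrite f0.
rewrite fl; congr (_ *: _ + _); apply/rowP => j; by rewrite !mxE.
Qed.

Lemma mxtrace_lin1_mx {R : realType} {m : nat} (f : 'rV[R]_m -> 'rV[R]_m) :
  \tr (lin1_mx f) = \sum_i f (basis_vec i) 0 i.
Proof. by apply: eq_bigr => i _; rewrite mxE. Qed.

Section WedgeForm.
Context {R : realType} {m : nat}.
Variable G : 'M[R]_m.
Hypotheses (Gs : G^T = G) (Gp : forall v : 'rV[R]_m, v != 0 -> 0 < inner G v v).
Variable P : 'M[R]_m.
Hypothesis Ps : forall x y, inner G (x *m P) y = inner G (y *m P) x.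

(** This is the Kulkarni-Nomizu product of the metric with the symmetric form of P. *)
Lemma wedge_alg_curv : alg_curv (fun x y z t => inner G (wedge G P x y z) t).
Proof.
rewrite /wedge; split; first by split=> *; rewrite ?mulmxDl -?scalemxAl !(innerE Gs); ring.
- by move=> x y z t; rewrite !(innerE Gs); ring.
- by move=> x y z t; rewrite !(innerE Gs); ring.
- move=> x y z t; rewrite !(innerE Gs) (innerC Gs y x) (innerC Gs z x) (innerC Gs z y).
  by rewrite (Ps y x) (Ps z x) (Ps z y); ring.
Qed.
End WedgeForm.

(** * The Weyl tensor *)

Section Weyl.
Context {R : realType} {m : nat}.
Variables (D : set 'rV[R]_m) (oD : open D) (g : 'rV[R]_m -> 'M[R]_m).
Hypotheses (gC : forall k, mC k D g) (gS : forall p, D p -> (g p)^T = g p)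
  (gP : forall p v, D p -> v != 0 -> 0 < inner (g p) v v).
Implicit Types (p q x y z t v w : 'rV[R]_m) (a b c i j : 'I_m).

Lemma RV_metric x y p : D p -> RV g x y p *m g p + g p *m (RV g x y p)^T = 0.
Proof.
move=> Dp; rewrite /RV mulmx_suml linear_sum mulmx_sumr -big_split big1 //= => a _.
rewrite mulmx_suml linear_sum mulmx_sumr -big_split big1 //= => b _.
by rewrite linearZ /= -scalemxAl -scalemxAr -scalerDr (Rm_metric oD gC gS gP) ?scaler0.
Qed.

Lemma curv4E x y z t p : D p -> curv4 g p x y z t = inner (g p) (z *m RV g x y p) t.
Proof. by move=> Dp; rewrite /curv4 (curvE oD gC gP). Qed.

Lemma curv4_alg_curv p : D p -> alg_curv (curv4 g p).
Proof.
move=> Dp; have Gs := gS Dp; split; first split.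
- by move=> *; rewrite !curv4E // RV_lin1 mulmxDr -scalemxAr !(innerE Gs).
- by move=> *; rewrite !curv4E // RV_lin2 mulmxDr -scalemxAr !(innerE Gs).
- by move=> *; rewrite !curv4E // mulmxDl -scalemxAl !(innerE Gs).
- by move=> *; rewrite !curv4E // !(innerE Gs).
- by move=> x y z t; rewrite !curv4E // RV_skew mulmxN innerNl.
- move=> x y z t; rewrite !curv4E //; apply/eqP; rewrite -addr_eq0; apply/eqP.
  transitivity ((z *m (RV g x y p *m g p + g p *m (RV g x y p)^T) *m t^T) 0 0).
    rewrite mulmxDr mulmxDl addmxE; congr (_ + _); first by rewrite /inner !mulmxA.
    by rewrite (innerC Gs) /inner trmx_mul !mulmxA.
  by rewrite RV_metric // mulmx0 mul0mx zeromxE.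
- move=> x y z t; rewrite !curv4E // -!innerDl (bianchi1 oD gC gS gP) //.
  exact: inner0l.
Qed.

(** The Schouten operator with the opposite sign. As R_0 is the wedge product with half the
    identity, it gathers the scalar and the Ricci term of the Weyl tensor in one wedge product, see
    [weylE]. *)
Definition schouten p : 'M[R]_m :=
  (scalar_curv g p / ((m%:R - 1) * (m%:R - 2)) / 2)%:M
  - (m%:R - 2)^-1 *: (ricci g p *m invmx (g p)).

Lemma mul_schouten v p : v *m schouten p =
  (scalar_curv g p / ((m%:R - 1) * (m%:R - 2)) / 2) *: v - (m%:R - 2)^-1 *: ricci_op g p v.
Proof. by rewrite mulmxBr mul_mx_scalar -scalemxAr mulmxA. Qed.

Lemma weylE x y z p : weyl g p x y z = curv g p x y z + wedge (g p) (schouten p) x y z.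
Proof.
rewrite /weyl -addrA; congr (_ + _).
rewrite /wedge !mul_schouten !innerBl !innerZl /curv_R0 /curv_L.
move: (scalar_curv g p / _) (m%:R - 2)^-1 => k c.
apply/rowP => i; rewrite ?(addmxE, oppmxE, scalemxE); by field.
Qed.

Lemma invmx_sym p : D p -> (invmx (g p))^T = invmx (g p).
Proof. by move=> Dp; rewrite trmx_inv gS. Qed.

Lemma ricci_sym p : D p -> (ricci g p)^T = ricci g p.
Proof.
move=> Dp; have hc := curv4_alg_curv Dp; have [_ s1 s2 _] := hc.
apply/matrixP => a b; rewrite !mxE exchange_big /=; apply: eq_bigr => k _.
apply: eq_bigr => l _; rewrite -[in LHS](invmx_sym Dp) mxE; congr (_ * _).
by rewrite (pair_sym hc) s1 s2 opprK.
Qed.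

Lemma inner_ricci_op p x y : D p ->
  inner (g p) (ricci_op g p x) y = (x *m ricci g p *m y^T) 0 0.
Proof. by move=> Dp; rewrite /inner /ricci_op mulmxKV // (met_unit gP). Qed.

Lemma schouten_self p x y : D p ->
  inner (g p) (x *m schouten p) y = inner (g p) (y *m schouten p) x.
Proof.
move=> Dp; rewrite !mul_schouten !innerBl !innerZl.
rewrite (innerC (gS Dp) y x) !(inner_ricci_op _ _ Dp); congr (_ - _ * _).
by rewrite -[in LHS](trmxK (x *m _ *m _)) mxE !trmx_mul trmxK ricci_sym // mulmxA.
Qed.

Lemma weyl4_alg_curv p : D p -> alg_curv (fun x y z t => inner (g p) (weyl g p x y z) t).
Proof.
move=> Dp; have h1 := curv4_alg_curv Dp.
have h2 := wedge_alg_curv (gS Dp) (fun x y => schouten_self x y Dp).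
have := alg_curv_comb 1 1 h1 h2; congr alg_curv.
apply/funext => x; apply/funext => y; apply/funext => z; apply/funext => t.
by rewrite !mul1r weylE innerDl.
Qed.

Lemma conf_jacobiE p x y : D p -> y *m conf_jacobi g p x = weyl g p y x x.
Proof.
move=> Dp; have [[h _ _ _] _ _ _] := weyl4_alg_curv Dp.
rewrite /conf_jacobi (mul_lin1_mx (f := fun y => weyl g p y x x)) // => k u v.
apply: (inner_eq (fun v => @gP p v Dp)) => t.
by rewrite [RHS]innerDl [X in _ = X + _]innerZl; exact: h.
Qed.

Lemma ricciE p x y : D p -> (x *m ricci g p *m y^T) 0 0 =
  \sum_k \sum_l invmx (g p) k l * curv4 g p x (basis_vec k) (basis_vec l) y.
Proof.
move=> Dp; have [[h1 _ _ h4] _ _ _] := curv4_alg_curv Dp.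
pose f x y := \sum_k \sum_l invmx (g p) k l * curv4 g p x (basis_vec k) (basis_vec l) y.
rewrite -/(f x y) -(bilinE (f := f)) //.
- move=> k u v w; rewrite /f mulr_sumr -big_split; apply: eq_bigr => i _ /=.
  rewrite mulr_sumr -big_split; apply: eq_bigr => j _ /=; by rewrite h1 mulrDr mulrCA.
- move=> k u v w; rewrite /f mulr_sumr -big_split; apply: eq_bigr => i _ /=.
  rewrite mulr_sumr -big_split; apply: eq_bigr => j _ /=; by rewrite h4 mulrDr mulrCA.
Qed.

Lemma trace_form p (f : 'rV[R]_m -> 'rV[R]_m) : D p ->
  \sum_i f (basis_vec i) 0 i =
  \sum_k \sum_l invmx (g p) k l * inner (g p) (f (basis_vec k)) (basis_vec l).
Proof.
move=> Dp; apply: eq_bigr => k _.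
transitivity ((f (basis_vec k) *m g p *m invmx (g p)) 0 k).
  by rewrite mulmxK // (met_unit gP).
rewrite mxE; apply: eq_bigr => l _; rewrite mulrC -[in LHS](invmx_sym Dp) mxE.
by congr (_ * _); rewrite /inner /basis_vec trmx_delta -colE [RHS]mxE.
Qed.

Lemma scalar_curvE p : D p -> scalar_curv g p = \tr (ricci g p *m invmx (g p)).
Proof.
move=> Dp; rewrite /scalar_curv; apply: eq_bigr => i _; rewrite mxE.
by apply: eq_bigr => j _; rewrite mulrC -[in LHS](invmx_sym Dp) [X in _ * X]mxE.
Qed.

(** The Weyl tensor is trace-free: the coefficients in [schouten] are those for which the trace of
    the wedge term cancels the Ricci form. *)
Lemma trace_conf_jacobi p x : (3 <= m)%N -> D p -> \tr (conf_jacobi g p x) = 0.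
Proof.
move=> m3 Dp; rewrite mxtrace_lin1_mx.
have [_ s1 s2 _] := curv4_alg_curv Dp.
have E1 : \sum_i curv g p (basis_vec i) x x 0 i = (x *m ricci g p *m x^T) 0 0.
  rewrite (trace_form (fun y => curv g p y x x) Dp) (ricciE _ _ Dp).
  apply: eq_bigr => k _; apply: eq_bigr => l _; congr (_ * _).
  rewrite -[LHS]/(curv4 g p (basis_vec k) x x (basis_vec l)) s1 s2 opprK //.
have E2 : \sum_i wedge (g p) (schouten p) (basis_vec i) x x 0 i =
   (m%:R - 2) * inner (g p) (x *m schouten p) x + inner (g p) x x * \tr (schouten p).
  have L (v w : 'rV[R]_m) (A : 'M[R]_m) :
      \sum_i (inner (g p) (basis_vec i *m A) v *: w) 0 i = inner (g p) (w *m A) v.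
    have N (u : 'rV[R]_m) : inner (g p) (u *m A) v = (u *m (A *m g p *m v^T)) 0 0.
      by rewrite /inner !mulmxA.
    rewrite N mxE; apply: eq_bigr => i _; rewrite scalemxE N mulrC; congr (_ * _).
    by rewrite -rowE mxE.
  have L1 i (A : 'M[R]_m) : (basis_vec i *m A) 0 i = A i i by rewrite -rowE mxE.
  have L0 (v w : 'rV[R]_m) : \sum_i (inner (g p) (basis_vec i) v *: w) 0 i = inner (g p) w v.
    rewrite -[w in RHS]mulmx1 -L; apply: eq_bigr => i _; by rewrite mulmx1.
  rewrite /wedge.
  under eq_bigr => i _ do rewrite 2!addmxE oppmxE addmxE oppmxE.
  rewrite !big_split /= !sumrN (L x x (schouten p)) (L0 x (x *m schouten p)).
  under eq_bigr => i _ do rewrite scalemxE -[basis_vec i]mulmx1 L1.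
  under [X in _ + X - _]eq_bigr => i _ do rewrite scalemxE L1.
  rewrite -!mulr_sumr -/(mxtrace 1%:M) mxtrace1 -/(mxtrace _); ring.
rewrite (eq_bigr (fun i => curv g p (basis_vec i) x x 0 i +
  wedge (g p) (schouten p) (basis_vec i) x x 0 i)) => [|i _]; last by rewrite weylE addmxE.
rewrite big_split /= E1 E2.
have m1 : (m%:R - 1 : R) != 0 by rewrite subr_eq0 (eqr_nat R m 1); case: m m3 => [|[|]].
have m2 : (m%:R - 2 : R) != 0 by rewrite subr_eq0 (eqr_nat R m 2); case: m m3 => [|[|[|]]].
rewrite mul_schouten innerBl !innerZl.
rewrite (inner_ricci_op _ _ Dp) /schouten raddfB /= mxtraceZ mxtrace_scalar.
rewrite -(scalar_curvE Dp) -mulr_natr.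
by field; rewrite m1 m2.
Qed.

Lemma Ck_inner k (F : 'rV[R]_m -> 'rV[R]_m) v :
  mC k D F -> Ck k D (fun p => inner (g p) (F p) v).
Proof.
move=> HF; have H := mC_mul oD (mC_mul oD HF (gC k)) (mC_cst D k v^T).
exact: (Ck_ext oD (fun p _ => erefl) (H 0 0)).
Qed.

Lemma curv_C k x y z : mC k D (fun p => curv g p x y z).
Proof.
have H : mC k D (fun p => z *m RV g x y p).
  apply: (mC_mul oD (mC_cst D k z)) => i j.
  have H : Ck k D (fun p => \sum_a \sum_b (x 0 a * y 0 b) * Rm g a b p i j).
    apply: Ck_sum => // a _; apply: Ck_sum => // b _.
    exact: (Ck_mul oD (Ck_cst k D _) (Rm_C oD gC gP k a b i j)).
  apply: (Ck_ext oD _ H) => p Dp; rewrite /RV summxE; apply: eq_bigr => a _.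
  by rewrite summxE; apply: eq_bigr => b _; rewrite scalemxE.
by apply: (mC_ext oD _ H) => p Dp; rewrite (curvE oD gC gP).
Qed.

Lemma invmet_C k : mC k D (fun p => invmx (g p)).
Proof. exact: (mC_invmx oD (fun p Dp => met_unit gP Dp) (gC k)). Qed.

Lemma schouten_C k : mC k D schouten.
Proof.
have cr : mC k D (ricci g).
  move=> a b.
  have H : Ck k D (fun p => \sum_i \sum_j invmx (g p) i j *
      curv4 g p (basis_vec a) (basis_vec i) (basis_vec j) (basis_vec b)).
    apply: Ck_sum => // i _; apply: Ck_sum => // j _.
    exact: (Ck_mul oD (invmet_C k i j) (Ck_inner _ (curv_C k _ _ _))).
  by apply: (Ck_ext oD _ H) => p Dp; rewrite mxE.
have cP := mC_mul oD cr (invmet_C k).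
have ct : Ck k D (scalar_curv g).
  have H : Ck k D (fun p => \sum_i (ricci g p *m invmx (g p)) i i).
    by apply: Ck_sum => // i _; exact: cP.
  by apply: (Ck_ext oD _ H) => p Dp; rewrite (scalar_curvE Dp).
apply: (mC_sub oD _ (mC_scale oD (Ck_cst k D _) cP)) => i j.
have H := Ck_mul oD (Ck_mul oD (Ck_mul oD ct (Ck_cst k D (((m%:R - 1) * (m%:R - 2))^-1)))
  (Ck_cst k D 2^-1)) (Ck_cst k D (i == j)%:R).
by apply: (Ck_ext oD _ H) => p Dp; rewrite mxE mulr_natr.
Qed.

Lemma weyl_C k x y z : mC k D (fun p => weyl g p x y z).
Proof.
have cc (v : 'rV[R]_m) : mC k D (fun=> v) by exact: mC_cst.
have cP (v : 'rV[R]_m) : mC k D (fun p => v *m schouten p) by exact: (mC_mul oD (cc v) (schouten_C k)).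
have H := mC_add oD (curv_C k x y z) (mC_sub oD (mC_add oD (mC_sub oD
  (mC_scale oD (Ck_inner z (cP y)) (cc x)) (mC_scale oD (Ck_inner z (cP x)) (cc y)))
  (mC_scale oD (Ck_inner z (cc y)) (cP x))) (mC_scale oD (Ck_inner z (cc x)) (cP y))).
by apply: (mC_ext oD _ H) => p Dp; rewrite weylE.
Qed.
End Weyl.

Lemma mC_id {R : realType} {m : nat} k : mC k setT (fun v : 'rV[R]_m => v).
Proof. by move=> i j; rewrite ord1; exact: (Ck_coord k setT j). Qed.

(** * Spectra of the Jacobi operators *)

Section SelfAdjoint.
Context {R : realType} {m : nat}.
Variable G : 'M[R]_m.
Hypotheses (Gs : G^T = G) (Gp : forall v : 'rV[R]_m, v != 0 -> 0 < inner G v v).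
Implicit Types (x y z u v w : 'rV[R]_m).
Local Notation "'g[' x , y ]" := (inner G x y).

Lemma quad_continuous (A : 'M[R]_m) : continuous (fun v : 'rV[R]_m => (v *m A *m v^T) 0 0).
Proof. by move=> v; apply: (Ck_cont (D := setT) (k := 0)) => //; exact: (mC_mul openT (mC_mul openT (mC_id 0) (mC_cst setT 0 A)) (mC_tr openT (mC_id 0)) 0 0). Qed.

Lemma quad_le0_eq0 (b c : R) : (forall t : R, 2 * t * b + t ^+ 2 * c <= 0) -> b = 0.
Proof.
move=> h; have [//|bN0] := eqVneq b 0; exfalso.
have c1 : 0 < `|c| + 1 by rewrite ltr_pwDr.
have cc : - `|c| <= c by rewrite lerNl -normrN ler_norm.
have := h (b / (`|c| + 1)); set d := `|c| + 1 in c1 *.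
have -> : 2 * (b / d) * b + (b / d) ^+ 2 * c = b ^+ 2 / d ^+ 2 * (2 * d + c).
  by field; rewrite gt_eqF.
rewrite leNgt => /negP; apply; apply: mulr_gt0.
  by apply: divr_gt0; rewrite exprn_even_gt0 //= gt_eqF.
rewrite /d; have := normr_ge0 c; lra.
Qed.

Section Rayleigh.
Variables (A : 'M[R]_m) (k : nat) (C : 'M[R]_(m, k)).
Hypotheses (As : forall x y, g[x *m A, y] = g[y *m A, x])
           (stab : forall x, x *m C = 0 -> x *m A *m C = 0).

(** The Rayleigh quotient is homogeneous of degree 0, so it may be maximized on the sup-norm unit
    sphere of the kernel of C, which is compact. A maximum is an eigenvector. *)
Lemma rayleigh_max : (exists v : 'rV[R]_m, v != 0 /\ v *m C = 0) ->
  exists c v, [/\ v != 0, v *m C = 0, v *m A = c *: v &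
    forall w, w *m C = 0 -> g[w *m A, w] <= c * g[w, w]].
Proof.
move=> [v0 [v0N v0C]].
pose K : set 'rV[R]_m := [set v | `|v| = 1] `&` [set v | v *m C = 0].
pose q (B : 'M[R]_m) v := (v *m B *m v^T) 0 0.
have KN v : K v -> v != 0.
  by move=> [/= v1 _]; apply: contra_eqN v1 => /eqP ->; rewrite normr0 eq_sym oner_neq0.
have scal (t : R) v (B : 'M[R]_m) : q B (t *: v) = t ^+ 2 * q B v.
  by rewrite /q linearZ /= -!scalemxAl -scalemxAr scalerA scalemxE.
have K0 (v : 'rV[R]_m) : v != 0 -> v *m C = 0 -> K (`|v|^-1 *: v).
  move=> vN vC; split=> /=; last by rewrite -scalemxAl vC scaler0.
  by rewrite normrZ normfV normr_id mulVf // normr_eq0.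
have cK : compact K.
  apply: bounded_closed_compact.
    by exists 1; split=> [|M M1 v [/= -> _]]; [exact: num_real|exact: ltW].
  apply: closedI.
    have -> : [set v : 'rV[R]_m | `|v| = 1] = (fun v : 'rV[R]_m => `|v|) @^-1` [set 1] by [].
    apply: (closed_comp (f := fun v : 'rV[R]_m => `|v|)); last exact: closed_eq.
    by move=> v _; exact: norm_continuous.
  have -> : [set v : 'rV[R]_m | v *m C = 0] = (fun v : 'rV[R]_m => \sum_j ((v *m C) 0 j) ^+ 2) @^-1` [set 0].
    apply/seteqP; split=> v /= h; first by rewrite h big1 // => j _; rewrite mxE expr0n.
    apply/rowP => j; rewrite [RHS]mxE; apply/eqP; rewrite -sqrf_eq0; apply/eqP.
    have := psumr_eq0P (fun j _ => sqr_ge0 ((v *m C) 0 j)) h; exact.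
  apply: (closed_comp (f := fun v : 'rV[R]_m => \sum_j ((v *m C) 0 j) ^+ 2)); last exact: closed_eq.
  move=> v _; apply: (Ck_cont (D := setT) (k := 0)) => //.
  apply: Ck_sum => [|j _]; first exact: openT.
  have H := mC_mul openT (mC_id 0) (mC_cst setT 0 C).
  exact: (Ck_mul openT (H 0 j) (H 0 j)).
have cf : {within K, continuous (fun v : 'rV[R]_m => q (A *m G) v / q G v)}.
  apply: continuous_in_subspaceT => v; rewrite inE => Kv.
  apply: (@continuousM _ _ (q (A *m G)) (fun v => (q G v)^-1)); first exact: quad_continuous.
  apply: (@continuousV _ _ (q G) v); last exact: quad_continuous.
  by rewrite gt_eqF // Gp // KN.
have [|v] := EVT_max_rV _ cK cf; first by exists (`|v0|^-1 *: v0); exact: K0.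
rewrite inE => Kv hmax; have vN := KN _ Kv; have vC := Kv.2.
pose c := q (A *m G) v / q G v; exists c, v.
have qG w : q G w = g[w, w] by [].
have qA w : q (A *m G) w = g[w *m A, w] by rewrite /q mulmxA.
have le w : w *m C = 0 -> g[w *m A, w] <= c * g[w, w].
  move=> wC; have [->|wN] := eqVneq w 0; first by rewrite mul0mx !inner0l mulr0.
  have := hmax (`|w|^-1 *: w); rewrite inE => /(_ (K0 _ wN wC)); rewrite -/c !scal.
  have nw : `|w|^-1 ^+ 2 != 0 by rewrite expf_neq0 // invr_eq0 normr_eq0.
  rewrite invfM mulrACA mulfV // mul1r qA qG ler_pdivrMr //; exact: Gp.
split=> //; apply/eqP; rewrite -subr_eq0; apply/eqP.
have eqv : g[v *m A, v] = c * g[v, v].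
  by rewrite /c qA qG divfK // gt_eqF // Gp.
pose u := v *m A - c *: v.
have uC : u *m C = 0 by rewrite mulmxBl stab // -scalemxAl vC scaler0 subrr.
rewrite -/u; apply/eqP; rewrite -(inner_eq0 Gp) //; apply/eqP.
have Eu : g[u, u] = g[v *m A, u] - c * g[v, u] by rewrite {1}/u !(innerE Gs); ring.
(* In the variation v + t u with u = vA - cv, the first-order term of the maximality condition is 2
   t g(u, u), which must vanish. *)
clearbody u; apply: (@quad_le0_eq0 g[u, u] (g[u *m A, u] - c * g[u, u])) => t.
have := le (v + t *: u); rewrite mulmxDl -scalemxAl vC uC scaler0 addr0 => /(_ erefl).
rewrite mulmxDl -scalemxAl !(innerE Gs) eqv (As u v) (innerC Gs u v).
have E2 : t * g[u, u] = t * g[v *m A, u] - t * (c * g[v, u]) by rewrite {1}Eu; ring.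
move: E2; lra.
Qed.
End Rayleigh.

(** Maximum and minimum of the Rayleigh quotient, the latter obtained from -A, are eigenvalues and
    hence both equal to a. So the quadratic form of A is a g on the kernel of C, and polarization
    concludes. *)
Lemma single_eigenvalue (A : 'M[R]_m) k (C : 'M[R]_(m, k)) (a : R) :
  (forall x y, g[x *m A, y] = g[y *m A, x]) ->
  (forall x, x *m C = 0 -> x *m A *m C = 0) ->
  (forall c v, v != 0 -> v *m C = 0 -> v *m A = c *: v -> c = a) ->
  forall v, v *m C = 0 -> v *m A = a *: v.
Proof.
move=> As stab ha v vC; have [->|vN] := eqVneq v 0; first by rewrite mul0mx scaler0.
have [c [u [uN uC uA le1]]] := rayleigh_max As stab (ex_intro _ v (conj vN vC)).
have Ec := ha _ _ uN uC uA; rewrite {}Ec {c u uN uC uA} in le1.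
have [|x xC|c [u [uN uC uA le2]]] := @rayleigh_max (- A) _ C _ _ (ex_intro _ v (conj vN vC)).
- by move=> x y; rewrite !mulmxN !innerNl As.
- by rewrite mulmxN mulNmx stab ?oppr0.
have Ec : - c = a by apply: (ha _ _ uN uC); rewrite scaleNr -uA mulmxN opprK.
have E w : w *m C = 0 -> g[w *m A, w] = a * g[w, w].
  move=> wC; apply/eqP; rewrite eq_le le1 //=.
  have := le2 w wC; rewrite mulmxN innerNl -Ec; lra.
apply/eqP; rewrite -subr_eq0; apply/eqP.
pose u' := v *m A - a *: v; rewrite -/u'.
have uC' : u' *m C = 0 by rewrite mulmxBl stab // -scalemxAl vC scaler0 subrr.
apply/eqP; rewrite -(inner_eq0 Gp); apply/eqP.
have Eu : g[u', u'] = g[v *m A, u'] - a * g[v, u'] by rewrite {1}/u' !(innerE Gs); ring.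
clearbody u'; have : (v + u') *m C = 0 by rewrite mulmxDl vC uC' addr0.
move/E; rewrite mulmxDl !(innerE Gs) (E _ vC) (E _ uC') (As u' v) (innerC Gs u' v).
move: Eu; lra.
Qed.
End SelfAdjoint.

Section Restriction.
Context {R : realType} {m : nat}.
Variables (V A : 'M[R]_m).
Hypothesis stab : stablemx V A.

Lemma mul_restrictmx : row_base V *m A = restrictmx V A *m row_base V.
Proof.
rewrite /conjmx mulmxKpV //.
by rewrite (eqmxMr _ (eq_row_base V)) eq_row_base.
Qed.

Lemma restrict_eigenvector (u : 'rV[R]_(\rank V)) c :
  u *m restrictmx V A = c *: u <-> u *m row_base V *m A = c *: (u *m row_base V).
Proof.
have -> : u *m row_base V *m A = u *m restrictmx V A *m row_base V.
  rewrite -(mulmxA u (row_base V) A) mul_restrictmx; exact: mulmxA.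
split=> [->|]; first by rewrite scalemxAl.
by rewrite scalemxAl => /(row_free_inj (row_base_free V)).
Qed.

Lemma row_base_coord (v : 'rV[R]_m) : (v <= V)%MS -> exists u, v = u *m row_base V.
Proof. by rewrite -(eq_row_base V) => /submxP. Qed.
End Restriction.

Section TwoEigenvalues.
Context {R : realType} {m : nat}.
Variable G : 'M[R]_m.
Hypotheses (Gs : G^T = G) (Gp : forall v : 'rV[R]_m, v != 0 -> 0 < inner G v v).
Variables (A : 'M[R]_m) (x : 'rV[R]_m).
Hypotheses (As : forall y z, inner G (y *m A) z = inner G (z *m A) y)
  (xA : x *m A = 0) (x1 : inner G x x = 1).
Local Notation "'g[' x , y ]" := (inner G x y).
Local Notation V := (kermx (G *m x^T)).

Lemma orth_sub y : (y <= V)%MS = (g[y, x] == 0).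
Proof.
rewrite sub_kermx mulmxA; apply/eqP/eqP => [h|h]; first by rewrite /inner h mxE.
by apply/matrixP => i j; rewrite !ord1 [RHS]mxE.
Qed.

Lemma orth_stable : stablemx V A.
Proof.
apply/row_subP => i; rewrite row_mul orth_sub As xA.
by rewrite inner0l.
Qed.

Lemma orth_rank : \rank V = m.-1.
Proof.
rewrite mxrank_ker -subn1; congr (_ - _)%N; apply/eqP; rewrite eqn_leq rank_leq_col lt0n mxrank_eq0.
apply: contraTneq isT => h; have := x1.
by rewrite /inner -mulmxA h mulmx0 mxE => /eqP; rewrite eq_sym oner_eq0.
Qed.

(** The eigenspaces have ranks 1 and m-2, which add up to the rank of the complement of x, so they
    span it; they are orthogonal because A is self-adjoint. *)
Lemma two_eigenvalues (a b : R) : a != b ->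
  multiplicity (restrictmx V A) a = 1%N -> multiplicity (restrictmx V A) b = (m - 2)%N ->
  (2 <= m)%N ->
  exists psi, [/\ g[psi, psi] = 1, g[psi, x] = 0 &
    forall y, y *m A = b *: (y - g[y, x] *: x) + ((a - b) * g[y, psi]) *: psi].
Proof.
move=> ab; rewrite /multiplicity; set C := restrictmx V A => ra rb m2.
have dir : (eigenspace C a :&: eigenspace C b)%MS = 0.
  apply/eqP/rowV0P => w; rewrite sub_capmx => /andP[/eigenspaceP wa /eigenspaceP wb].
  apply/eqP; have : (a - b) *: w = 0 by rewrite scalerBl -wa -wb subrr.
  by move/eqP; rewrite scaler_eq0 subr_eq0 (negPf ab).
have full : row_full (eigenspace C a + eigenspace C b)%MS.
  apply/eqP; have /mxdirect_addsP : (eigenspace C a :&: eigenspace C b)%MS = 0 by [].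
  move/mxdirectP => /= ->; rewrite ra rb [RHS]orth_rank.
  by case: m m2 => [|[|n]] // _; rewrite subn2.
have /rowV0Pn[phi phiE phiN] : eigenspace C a != 0 by rewrite -mxrank_eq0 ra.
have one : (eigenspace C a <= phi)%MS.
  have [_ <-] := mxrank_leqif_sup phiE.
  by rewrite ra rank_rV phiN.
pose B := row_base V; pose ps := phi *m B.
have psN : ps != 0.
  by apply: contra_neq phiN => h; apply: (row_free_inj (row_base_free V)); rewrite mul0mx -/B -h.
have psV : g[ps, x] = 0.
  by apply/eqP; rewrite -orth_sub -(eq_row_base V) submxMl.
have psA : ps *m A = a *: ps.
  by apply/(restrict_eigenvector orth_stable phi a); apply/eigenspaceP.
have [c c0 c1] := inner_normalize Gp psN.
pose psi := c *: ps; exists psi.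
have psiA : psi *m A = a *: psi by rewrite /psi -scalemxAl psA !scalerA mulrC.
have psiV : g[psi, x] = 0 by rewrite /psi innerZl psV mulr0.
split=> // y.
have dec z : g[z, x] = 0 -> exists s w, [/\ z = s *: psi + w, w *m A = b *: w & g[w, x] = 0].
  move=> /eqP; rewrite -orth_sub => /row_base_coord[u ->].
  have /sub_addsmxP[[u1 u2] /= ->] : (u <= eigenspace C a + eigenspace C b)%MS by exact: submx_full.
  have /sub_rVP[s hs] : (u1 *m eigenspace C a <= phi)%MS by rewrite (submx_trans _ one) // submxMl.
  exists (s / c), (u2 *m eigenspace C b *m B); split.
  - by rewrite mulmxDl hs -scalemxAl /psi scalerA divfK // gt_eqF.
  - by apply/(restrict_eigenvector orth_stable (u2 *m eigenspace C b) b); apply/eigenspaceP; rewrite submxMl.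
  - by apply/eqP; rewrite -orth_sub -(eq_row_base V) submxMl.
pose z := y - g[y, x] *: x.
have zx : g[z, x] = 0 by rewrite /z innerBl innerZl x1 mulr1 subrr.
have yA : y *m A = z *m A by rewrite mulmxBl -scalemxAl xA scaler0 subr0.
have yp : g[y, psi] = g[z, psi] by rewrite /z innerBl innerZl (innerC Gs x psi) psiV mulr0 subr0.
have [s [w [zE wA wx]]] := dec z zx.
have wp : g[w, psi] = 0.
  have : b * g[w, psi] = a * g[w, psi].
    by rewrite -innerZl -wA As psiA innerZl (innerC Gs).
  move=> /eqP; rewrite -subr_eq0 -mulrBl mulf_eq0 subr_eq0 eq_sym (negPf ab) /=.
  by move/eqP.
rewrite yA yp -/z zE mulmxDl -scalemxAl psiA wA innerDl innerZl wp c1.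
apply/rowP => j; rewrite ?(addmxE, scalemxE); ring.
Qed.
End TwoEigenvalues.

(** * The case of one eigenvalue *)

Section PartOne.
Context {R : realType} {m : nat}.
Variables (D : set 'rV[R]_m) (oD : open D) (g : 'rV[R]_m -> 'M[R]_m).
Hypotheses (gC : forall k, mC k D g) (gS : forall p, D p -> (g p)^T = g p)
  (gP : forall p v, D p -> v != 0 -> 0 < inner (g p) v v).
Implicit Types (p q x y z t v w : 'rV[R]_m) (a b c i j : 'I_m).

Lemma conf_jacobi_self p x y z : D p ->
  inner (g p) (y *m conf_jacobi g p x) z = inner (g p) (z *m conf_jacobi g p x) y.
Proof.
move=> Dp; rewrite !(conf_jacobiE oD gC gS gP) //.
have hw := weyl4_alg_curv oD gC gS gP Dp; have [_ s1 s2 _] := hw.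
rewrite -[LHS]/((fun x y z t => inner (g p) (weyl g p x y z) t) y x x z).
by rewrite (pair_sym hw) s1 s2 opprK.
Qed.

Lemma conf_jacobi_diag p x : D p -> x *m conf_jacobi g p x = 0.
Proof.
move=> Dp; rewrite (conf_jacobiE oD gC gS gP) //.
have [_ s1 _ _] := weyl4_alg_curv oD gC gS gP Dp.
apply: (inner_inj (fun v => @gP p v Dp)) => t; have := s1 x x x t; lra.
Qed.

Lemma one_eigenvalue_weyl p : (3 <= m)%N -> D p ->
  (exists a : R, forall x, unit_vec g p x ->
     forall b : R, eigenvalue (reduced_conf_jacobi g p x) b = (b == a)) ->
  forall x y z, weyl g p x y z = 0.
Proof.
move=> m3 Dp [a ha]; have Gs := gS Dp; have Gp v := @gP p v Dp.
have hw := weyl4_alg_curv oD gC gS gP Dp; have [[h1 h2 h3 _] _ _ _] := hw.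
have key u : inner (g p) u u = 1 -> forall y, y *m conf_jacobi g p u = 0.
  move=> u1; set N := conf_jacobi g p u.
  have Ns y z : inner (g p) (y *m N) z = inner (g p) (z *m N) y by exact: conf_jacobi_self.
  have uN : u *m N = 0 by exact: conf_jacobi_diag.
  have stab y : y *m (g p *m u^T) = 0 -> y *m N *m (g p *m u^T) = 0.
    move=> _; apply/matrixP => i j; rewrite !ord1 mulmxA -[LHS]/(inner (g p) (y *m N) u).
    by rewrite Ns uN inner0l mxE.
  have S := single_eigenvalue Gs Gp Ns stab (a := a).
  have {}S v : v *m (g p *m u^T) = 0 -> v *m N = a *: v.
    apply: S => c w wN wC wA; apply/eqP; rewrite -(ha u u1).
    have [w' ew] : exists w' : 'rV_(\rank (orth g p u)), w = w' *m row_base (orth g p u).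
      by apply: row_base_coord; rewrite sub_kermx wC.
    apply/eigenvalueP; exists w'.
      by apply/(restrict_eigenvector (orth_stable Ns uN)); rewrite -ew.
    by apply: contra_neq wN => h; rewrite ew h mul0mx.
  have E y : y *m N = a *: (y - inner (g p) y u *: u).
    rewrite -S; first by rewrite mulmxBl -scalemxAl uN scaler0 subr0.
    apply/matrixP => i j; rewrite !ord1 mulmxA -[LHS]/(inner (g p) (y - _) u).
    by rewrite innerBl innerZl u1 mulr1 subrr mxE.
  have NE : N = a *: (1%:M - (g p *m u^T) *m u).
    apply/row_matrixP => i; rewrite !rowE E -scalemxAr mulmxBr mulmx1; congr (_ *: (_ - _)).
    rewrite !mulmxA; apply/rowP => j; rewrite scalemxE [RHS]mxE big_ord1 //.
  have := trace_conf_jacobi oD gC gS gP u m3 Dp; rewrite -/N NE mxtraceZ raddfB /= mxtrace1.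
  rewrite mxtrace_mulC mulmxA (_ : \tr (u *m g p *m u^T) = 1); last first.
    by rewrite /mxtrace big_ord1 -u1.
  have m1 : (m%:R - 1 : R) != 0 by rewrite subr_eq0 (eqr_nat R m 1); case: m m3 => [|[|]].
  move=> /eqP; rewrite mulf_eq0 (negPf m1) orbF => /eqP a0 y.
  by rewrite a0 scale0r mulmx0.
have zero x y : inner (g p) (weyl g p y x x) y = 0.
  have [->|xN] := eqVneq x 0.
    have := h2 0 y 0 0 0 y; rewrite scaler0 addr0 mul0r add0r.
    by have := alg_curv02 hw y 0 y; cbv beta.
  have [c c0 c1] := inner_normalize Gp xN.
  have := key _ c1 y; rewrite (conf_jacobiE oD gC gS gP) // => h.
  have : inner (g p) (weyl g p y (c *: x) (c *: x)) y = 0 by rewrite h inner0l.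
  have E : inner (g p) (weyl g p y (c *: x) (c *: x)) y = c * (c * inner (g p) (weyl g p y x x) y).
    exact: (etrans (alg_curvZ2 hw c y x (c *: x) y) (congr1 ( *%R c) (alg_curvZ3 hw c y x x y))).
  move: E => -> /eqP; rewrite !mulf_eq0 (gt_eqF c0) /=; exact/eqP.
move=> x y z; apply: (inner_inj Gp) => t.
exact: (@alg_curv_eq0 _ _ _ hw (fun x y => zero x y) x y z t).
Qed.
End PartOne.

(** * Two eigenvalues: smooth normal form of the Weyl tensor *)

Section FieldArguments.
Context {R : realType} {m : nat}.
Variables (D : set 'rV[R]_m) (oD : open D).

(** The argument is expanded in the standard basis, so smoothness for constant arguments
    suffices. *)
Lemma Ck_linear_arg k (f : 'rV[R]_m -> 'rV[R]_m -> R) (u : 'rV[R]_m -> 'rV[R]_m) :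
  (forall p, D p -> forall c v w, f p (c *: v + w) = c * f p v + f p w) ->
  (forall v, Ck k D (fun p => f p v)) -> mC k D u -> Ck k D (fun p => f p (u p)).
Proof.
move=> fl fC uC.
have H : Ck k D (fun p => \sum_i u p 0 i * f p (basis_vec i)).
  by apply: Ck_sum => // i _; apply: Ck_mul => //; exact: uC.
apply: (Ck_ext oD _ H) => p Dp.
have f0 : f p 0 = 0.
  by apply: (addrI (f p 0)); rewrite addr0 -[X in X + _]mul1r -fl // scaler0 addr0.
rewrite [in RHS](row_sum_delta (u p)).
elim/big_rec2: _ => [|i w v _ ->]; first by rewrite f0.
by rewrite fl.
Qed.

Lemma open_gt0 (f : 'rV[R]_m -> R) : Ck 0 D f -> open [set p | D p /\ 0 < f p].
Proof.
move=> fC; rewrite openE => p [Dp fp]; rewrite /interior.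
have h1 : \forall q \near p, D q by exact: open_nbhs_nbhs.
have h2 : \forall q \near p, 0 < f q.
  have cf := Ck_cont fC Dp; apply: (cf [set y | 0 < y]).
  by apply: open_nbhs_nbhs; split; [exact: open_gt|].
by apply: filterS2 h1 h2 => q.
Qed.

End FieldArguments.

Section TraceAlgebra.
Context {R : realType} {m : nat}.
Variable G : 'M[R]_m.
Variables (x psi : 'rV[R]_m).
Hypotheses (Gs : G^T = G) (x1 : inner G x x = 1) (p1 : inner G psi psi = 1) (px : inner G psi x = 0).
(** Eigenvalue 0 on x, a on psi and b on the complement of both; products and traces are thus
    computed on eigenvalues. *)
Let E (a b : R) : 'M[R]_m := b *: (1%:M - (G *m x^T) *m x) + (a - b) *: ((G *m psi^T) *m psi).

Lemma rank_one_mul (u v w z : 'rV[R]_m) :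
  ((G *m u^T) *m v) *m ((G *m w^T) *m z) = inner G v w *: ((G *m u^T) *m z).
Proof.
rewrite -!mulmxA (mulmxA G (w^T)) (mulmxA v) (mulmxA v) (_ : v *m G *m w^T = (inner G v w)%:M).
  by rewrite mul_scalar_mx -!scalemxAr.
by apply/matrixP => i j; rewrite !ord1 [RHS]mxE eqxx mulr1n.
Qed.

Lemma spectral_mul a b c d : E a b *m E c d = E (a * c) (b * d).
Proof.
have h1 := rank_one_mul x x x x; have h2 := rank_one_mul x x psi psi.
have h3 := rank_one_mul psi psi x x; have h4 := rank_one_mul psi psi psi psi.
rewrite x1 scale1r in h1; rewrite (innerC Gs) px scale0r in h2.
rewrite px scale0r in h3; rewrite p1 scale1r in h4; rewrite /E.
move: (G *m x^T *m x) (G *m psi^T *m psi) h1 h2 h3 h4 => X P h1 h2 h3 h4.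
rewrite !(mulmxDl, mulmxDr, mulNmx, mulmxN) -!scalemxAl -!scalemxAr.
rewrite !(mulmxDl, mulmxDr, mulNmx, mulmxN) !mul1mx !mulmx1 h1 h2 h3 h4.
apply/matrixP => i j; rewrite ?(addmxE, oppmxE, scalemxE, zeromxE); ring.
Qed.

Lemma spectral_trace a b : \tr (E a b) = b * (m%:R - 1) + (a - b).
Proof.
have t (v : 'rV[R]_m) : \tr (G *m v^T *m v) = inner G v v.
  by rewrite mxtrace_mulC mulmxA /mxtrace big_ord1.
by rewrite /E mxtraceD !mxtraceZ raddfB /= mxtrace1 !t x1 p1 mulr1.
Qed.
End TraceAlgebra.

Section NormalForm.
Context {R : realType} {m : nat}.
Variables (D : set 'rV[R]_m) (oD : open D) (g : 'rV[R]_m -> 'M[R]_m).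
Hypotheses (gC : forall k, mC k D g) (gS : forall p, D p -> (g p)^T = g p)
  (gP : forall p v, D p -> v != 0 -> 0 < inner (g p) v v).
Implicit Types (p q x y z v w : 'rV[R]_m).
Hypothesis m8 : (8 <= m)%N.
Hypothesis two : forall p, D p -> exists a b : R, a != b /\ forall x, unit_vec g p x ->
    multiplicity (reduced_conf_jacobi g p x) a = 1%N /\
    multiplicity (reduced_conf_jacobi g p x) b = (m - 2)%N.

Let w4 p x y z (t : 'rV[R]_m) : R := inner (g p) (weyl g p x y z) t.
Let y0 : 'rV[R]_m := basis_vec (Ordinal (leq_trans (isT : (0 < 8)%N) m8)).
Let y0N : y0 != 0.
Proof.
apply/eqP => /matrixP/(_ 0 (Ordinal (leq_trans (isT : (0 < 8)%N) m8))).
by rewrite !mxE !eqxx => /eqP; rewrite oner_eq0.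
Qed.

Let jac0 p := conf_jacobi g p y0.
(* J_W(x) has trace 0 and eigenvalues mu and -(m-2)mu, of multiplicities m-2 and
   1, so that mu is a rational function of the traces of its powers. *)
Definition weyl_mu p : R :=
  - \tr (jac0 p *m jac0 p *m jac0 p) / (\tr (jac0 p *m jac0 p) * (m%:R - 3) * inner (g p) y0 y0).
(** The part mu R_0 is removed from W and the rest is divided by the difference -(m-1) mu of the
    eigenvalues, so that the Jacobi operator at a unit vector becomes the projection to the simple
    eigenvector. *)
Definition weyl_T p x y z (t : 'rV[R]_m) : R :=
  (- ((m%:R - 1) * weyl_mu p))^-1 * w4 p x y z t +
  (m%:R - 1)^-1 * R0 (g p) x y z t.

Let M1 : (m%:R - 1 : R) != 0.
Proof. by rewrite subr_eq0 (eqr_nat R m 1); case: m m8 => [|[|]]. Qed.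
Let M2 : (m%:R - 2 : R) != 0.
Proof. by rewrite subr_eq0 (eqr_nat R m 2); case: m m8 => [|[|[|]]]. Qed.
Let M3 : (m%:R - 3 : R) != 0.
Proof. by rewrite subr_eq0 (eqr_nat R m 3); case: m m8 => [|[|[|[|]]]]. Qed.

Lemma weyl_mu_eigen p : D p -> weyl_mu p != 0 /\
  (forall x, inner (g p) x x = 1 -> exists psi, [/\ inner (g p) psi psi = 1,
    inner (g p) psi x = 0 & forall y, y *m conf_jacobi g p x =
      weyl_mu p *: (y - inner (g p) y x *: x)
      + (- ((m%:R - 1) * weyl_mu p) * inner (g p) y psi) *: psi]).
Proof.
move=> Dp; have Gs := gS Dp; have Gp v := @gP p v Dp.
have hw := weyl4_alg_curv oD gC gS gP Dp.
have [a [b [ab hab]]] := two Dp.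
have H x : inner (g p) x x = 1 -> exists psi, [/\ inner (g p) psi psi = 1,
    inner (g p) psi x = 0 & forall y, y *m conf_jacobi g p x =
      b *: (y - inner (g p) y x *: x) + ((a - b) * inner (g p) y psi) *: psi].
  move=> x1; have [ha hb] := hab x x1.
  apply: (two_eigenvalues Gs Gp _ _ x1 ab ha hb) => //.
  - by move=> y z; exact: (conf_jacobi_self oD gC gS gP).
  - exact: (conf_jacobi_diag oD gC gS gP).
  - exact: leq_trans m8.
have mat x psi : (forall y, y *m conf_jacobi g p x =
      b *: (y - inner (g p) y x *: x) + ((a - b) * inner (g p) y psi) *: psi) ->
    conf_jacobi g p x = b *: (1%:M - (g p *m x^T) *m x) + (a - b) *: ((g p *m psi^T) *m psi).
  move=> h; apply/row_matrixP => i; rewrite !rowE h.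
  have r1 (u v : 'rV[R]_m) : delta_mx 0 i *m (g p *m u^T *m v) = inner (g p) (delta_mx 0 i) u *: v.
    rewrite !mulmxA; apply/rowP => j; by rewrite mxE big_ord1 scalemxE.
  rewrite mulmxDr -!scalemxAr mulmxBr mulmx1 !r1 scalerA //.
have [c c0 c1] := inner_normalize Gp y0N.
have [psi [s1 s2 s3]] := H _ c1.
have tr0 : b * (m%:R - 1) + (a - b) = 0.
  rewrite -(spectral_trace c1 s1) -(mat _ _ s3).
  by apply: (trace_conf_jacobi oD gC gS gP _ _ Dp); exact: leq_trans m8.
have aE : a = - (m%:R - 2) * b by lra.
have bN : b != 0.
  apply: contra_neq ab => b0; by rewrite aE b0 mulr0.
have jE : conf_jacobi g p (c *: y0) = c ^+ 2 *: jac0 p.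
  apply/row_matrixP => i; rewrite !rowE -scalemxAr !(conf_jacobiE oD gC gS gP) //.
  apply: (inner_eq Gp) => t; rewrite innerZl expr2 -mulrA.
  exact: (etrans (alg_curvZ2 hw c _ y0 (c *: y0) t) (congr1 ( *%R c) (alg_curvZ3 hw c _ y0 y0 t))).
(* At a unit vector the traces of the square and the cube are (m-1)(m-2) b^2 and -(m-1)(m-2)(m-3)
   b^3. The factor g(y0, y0) of [weyl_mu] corrects for the length of y0. *)
have muE : weyl_mu p = b.
  have jj : jac0 p = (c ^+ 2)^-1 *: conf_jacobi g p (c *: y0).
    by rewrite jE scalerA mulVf ?scale1r // expf_neq0 // gt_eqF.
  have cy : inner (g p) y0 y0 = (c ^+ 2)^-1.
    move: c1; rewrite innerZl innerZr => h; apply: (mulfI (x := c ^+ 2)); first by rewrite expf_neq0 // gt_eqF.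
    by rewrite mulfV ?expf_neq0 ?gt_eqF // -h; ring.
  rewrite /weyl_mu jj cy -!scalemxAl -!scalemxAr -!scalemxAl !scalerA !mxtraceZ.
  rewrite (mat _ _ s3) !(spectral_mul Gs c1 s1 s2) !(spectral_trace c1 s1) aE.
  have cN : c != 0 by rewrite gt_eqF.
  have e1 : (b * b * (m%:R - 1) + (- (m%:R - 2) * b * (- (m%:R - 2) * b) - b * b)) = b ^+ 2 * (m%:R - 1) * (m%:R - 2) by ring.
  rewrite e1; field; rewrite M1 M2 M3 bN cN //.
split; first by rewrite muE.
move=> x x1; have [ps [q1 q2 q3]] := H x x1; exists ps; split=> // y.
by rewrite q3 muE aE; congr (_ + (_ * _) *: _); ring.
Qed.

Lemma weyl_T_alg_curv p : D p -> alg_curv (weyl_T p).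
Proof.
by move=> Dp; apply: alg_curv_comb; [exact: (weyl4_alg_curv oD gC gS gP)|exact: (R0_alg_curv (gS Dp))].
Qed.

Lemma weyl_T_psi p x : D p -> exists psi, inner (g p) psi psi = inner (g p) x x /\
  forall y z, weyl_T p y x x z = inner (g p) y psi * inner (g p) z psi.
Proof.
move=> Dp; have Gs := gS Dp; have Gp v := @gP p v Dp; have hT := weyl_T_alg_curv Dp.
have [muN H] := weyl_mu_eigen Dp.
have U u : inner (g p) u u = 1 -> exists psi, inner (g p) psi psi = 1 /\
    forall y z, weyl_T p y u u z = inner (g p) y psi * inner (g p) z psi.
  move=> u1; have [psi [h1 h2 h3]] := H u u1; exists psi; split=> // y z.
  rewrite /weyl_T /w4 -(conf_jacobiE oD gC gS gP) // h3 /R0 !(innerE Gs) u1.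
  rewrite (innerC Gs psi z) (innerC Gs u z); move: (weyl_mu p) muN => mu muN.
  by field; rewrite M1 muN.
have [->|xN] := eqVneq x 0.
  exists 0; split=> // y z; rewrite (alg_curv02 hT) !(inner0r Gs) mul0r //.
have [c c0 c1] := inner_normalize Gp xN.
have cN : c != 0 by rewrite gt_eqF.
have [psi [h1 h2]] := U _ c1; exists (c^-1 *: psi); split.
  move: c1; rewrite !innerZl !(innerZr) h1 => h; apply: (mulfI cN); apply: (mulfI cN).
  by rewrite h; field.
move=> y z; rewrite !(innerZr); have := h2 y z; rewrite (alg_curvZ2 hT) (alg_curvZ3 hT) => h.
by apply: (mulfI cN); apply: (mulfI cN); rewrite h; field.
Qed.

Lemma weyl_mu_C k : Ck k D weyl_mu.
Proof.
have jC : mC k D jac0.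
  move=> i j; have H := weyl_C oD gC gS gP k (basis_vec i) y0 y0 0 j.
  by apply: (Ck_ext oD _ H) => p Dp; rewrite [RHS]mxE.
have trC (F : 'rV[R]_m -> 'M[R]_m) : mC k D F -> Ck k D (fun p => \tr (F p)).
  by move=> HF; apply: Ck_sum => // i _; exact: HF.
have y0C : Ck k D (fun p => inner (g p) y0 y0) by apply: (Ck_inner oD gC); exact: mC_cst.
have j2 := mC_mul oD jC jC.
have den : Ck k D (fun p => \tr (jac0 p *m jac0 p) * (m%:R - 3) * inner (g p) y0 y0).
  exact: (Ck_mul oD (Ck_mul oD (trC _ j2) (Ck_cst k D _)) y0C).
apply: (Ck_mul oD (Ck_opp oD (trC _ (mC_mul oD j2 jC)))); apply: (Ck_inv oD _ den) => p Dp.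
have [muN _] := weyl_mu_eigen Dp; apply: contra_neq muN => h.
by rewrite /weyl_mu h invr0 mulr0.
Qed.

Lemma weyl_T_C k x y z (t : 'rV[R]_m) : Ck k D (fun p => weyl_T p x y z t).
Proof.
have ic v w : Ck k D (fun p => inner (g p) v w) by apply: (Ck_inner oD gC); exact: mC_cst.
have muC : Ck k D (fun p => (- ((m%:R - 1) * weyl_mu p))^-1).
  apply: (Ck_inv oD _ (Ck_opp oD (Ck_mul oD (Ck_cst k D _) (weyl_mu_C k)))) => p Dp.
  by have [muN _] := weyl_mu_eigen Dp; rewrite oppr_eq0 mulf_neq0.
exact: (Ck_add oD (Ck_mul oD muC (Ck_inner oD gC t (weyl_C oD gC gS gP k x y z)))
  (Ck_mul oD (Ck_cst k D _) (Ck_sub2 oD (Ck_mul oD (ic y z) (ic x t)) (Ck_mul oD (ic x z) (ic y t))))).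
Qed.

Theorem weyl_normal_form p0 : D p0 -> exists (D' : set 'rV[R]_m) (lam mu : 'rV[R]_m -> R)
    (J : 'rV[R]_m -> 'M[R]_m) (s : R),
  [/\ open D', D' p0 & D' `<=` D] /\
  [/\ forall k, Ck k D' lam, forall k, Ck k D' mu, forall k, mC k D' J & s = 1 \/ s = -1] /\
  forall p, D' p -> [/\ 0 < s * lam p,
    forall x y, inner (g p) (x *m J p) y = - inner (g p) (y *m J p) x,
    J p *m J p = - 1%:M &
    forall x y z t, inner (g p) (weyl g p x y z) t =
      mu p * R0 (g p) x y z t + lam p * RJ (g p) (J p) x y z t].
Proof.
move=> Dp0.
(* At p0 this vector is, up to sign, the image of y0 under the complex structure to be found; kept
   constant, it selects the sign at nearby points. *)
have [v [v1 v2]] := weyl_T_psi y0 Dp0.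
pose f p := weyl_T p v y0 y0 v.
have fC k : Ck k D f by exact: weyl_T_C.
have f0 : 0 < f p0 by rewrite /f v2 -expr2 v1 exprn_even_gt0 //= gt_eqF // gP.
(* The normalizing factor of [weyl_T] times the 1/3 of [jmx_tensor]. *)
pose lam p := - (m%:R - 1) / 3 * weyl_mu p.
have lC k : Ck k D lam by exact: (Ck_mul oD (Ck_cst k D _) (weyl_mu_C k)).
have lN p : D p -> lam p != 0.
  by move=> Dp; have [muN _] := weyl_mu_eigen Dp; rewrite mulf_neq0 // mulf_neq0 ?oppr_eq0 ?invr_eq0 ?(eqr_nat R 3 0).
have [s [hs ls]] : exists s : R, (s = 1 \/ s = -1) /\ 0 < s * lam p0.
  case: (ltgtP (lam p0) 0) (lN _ Dp0) => // h _.
    by exists (-1); split; [right|rewrite mulN1r oppr_gt0].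
  by exists 1; split; [left|rewrite mul1r].
pose D1 := [set p | D p /\ 0 < f p].
have oD1 : open D1 by exact: (open_gt0 oD (fC 0)).
have sub1 : D1 `<=` D by move=> p [].
have slC k : Ck k D1 (fun p => s * lam p).
  exact: (Ck_mul oD1 (Ck_cst k D1 s) (Ck_sub sub1 (lC k))).
pose D2 := [set p | D1 p /\ 0 < s * lam p].
have oD2 : open D2 by exact: (open_gt0 oD1 (slC 0)).
have sub2 : D2 `<=` D by move=> p [/sub1].
(* This is the form g(., psi) g(v, psi), while f = g(v, psi)^2. Hence u is psi with the sign for
   which g(v, u) > 0, and depends smoothly on p although psi is only chosen pointwise. *)
pose ual p : 'rV[R]_m := \row_i weyl_T p (basis_vec i) y0 y0 v.
pose u p : 'rV[R]_m := (Num.sqrt (f p))^-1 *: (ual p *m invmx (g p)).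
have uE p x : D2 p -> inner (g p) x (u p) = weyl_T p x y0 y0 v / Num.sqrt (f p).
  move=> [[Dp _] _]; have hT := weyl_T_alg_curv Dp; have [[h1 _ _ _] _ _ _] := hT.
  rewrite (innerC (gS Dp)) innerZl mulrC; congr (_ * _).
  rewrite /inner mulmxKV ?(met_unit gP) //.
  rewrite [in RHS](row_sum_delta x) mxE.
  elim/big_rec2: _ => [|i a b _ ->]; first by rewrite (alg_curv01 hT).
  by rewrite h1 !mxE mulrC.
have uC k : mC k D2 u.
  have sC : Ck k D2 (fun p => (Num.sqrt (f p))^-1).
    apply: (Ck_inv oD2) => [p [[_ fp] _]|]; first by rewrite gt_eqF // sqrtr_gt0.
    by apply: (Ck_sqrt oD2 _ (Ck_sub sub2 (fC k))) => p [[_ fp] _].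
  have iC : mC k D2 (fun p => invmx (g p)).
    by move=> i j; exact: (Ck_sub sub2 (invmet_C oD gC gP k i j)).
  apply: (mC_scale oD2 sC); apply: (mC_mul oD2 _ iC) => i j.
  apply: (Ck_ext oD2 _ (Ck_sub sub2 (weyl_T_C k (basis_vec j) y0 y0 v))) => p _.
  by rewrite mxE.
have prop p : D2 p -> inner (g p) (u p) (u p) = inner (g p) y0 y0 /\
    forall x, weyl_T p x y0 y0 x = inner (g p) x (u p) ^+ 2.
  move=> D2p; have Dp := sub2 _ D2p; have [psi [q1 q2]] := weyl_T_psi y0 Dp.
  have fE : f p = inner (g p) v psi ^+ 2 by rewrite /f q2 -expr2.
  have fp : 0 < f p by case: D2p => -[].
  have sq : Num.sqrt (f p) ^+ 2 = f p by rewrite sqr_sqrtr // ltW.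
  have sN : Num.sqrt (f p) != 0 by rewrite gt_eqF // sqrtr_gt0.
  pose c := inner (g p) v psi / Num.sqrt (f p).
  have c2 : c ^+ 2 = 1 by rewrite /c expr_div_n sq -fE divff // gt_eqF.
  have up : u p = c *: psi.
    apply: (inner_eq (fun v => @gP p v Dp)) => z; rewrite (innerC (gS Dp)) uE // q2 innerZl.
    by rewrite (innerC (gS Dp) psi z) /c; field.
  split; first by rewrite up innerZl innerZr q1 mulrA -expr2 c2 mul1r.
  by move=> x; rewrite q2 up innerZr exprMn c2 mul1r expr2.
pose J p := jmx (g p) (weyl_T p) y0 (u p).
exists D2, lam, weyl_mu, J, s; split=> //; split.
  split=> // k; first exact: (Ck_sub sub2 (lC k)); first exact: (Ck_sub sub2 (weyl_mu_C k)).
  have iC : mC k D2 (fun p => invmx (g p)).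
    by move=> i j; exact: (Ck_sub sub2 (invmet_C oD gC gP k i j)).
  have ic x y : Ck k D2 (fun p => inner (g p) x y).
    by apply: (Ck_sub sub2); apply: (Ck_inner oD gC); exact: mC_cst.
  have gC2 k' : mC k' D2 g by move=> i j; exact: (Ck_sub sub2 (gC k' i j)).
  have iu x : Ck k D2 (fun p => inner (g p) x (u p)).
    apply: (Ck_linear_arg oD2 (f := fun p => inner (g p) x)) => // p D2p c v' w.
    by rewrite (innerDr) (innerZr).
  have uu : Ck k D2 (fun p => inner (g p) (u p) (u p)).
    have H := mC_mul oD2 (mC_mul oD2 (uC k) (gC2 k)) (mC_tr oD2 (uC k)).
    exact: (Ck_ext oD2 (fun p _ => erefl) (H 0 0)).
  have T2 x y z : Ck k D2 (fun p => weyl_T p x y z y0) by exact: (Ck_sub sub2 (weyl_T_C k x y z y0)).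
  have T3u x y : Ck k D2 (fun p => weyl_T p x y (u p) y0).
    apply: (Ck_linear_arg oD2 (f := fun p z => weyl_T p x y z y0)) => // p D2p c v' w.
    by have [[_ _ h _] _ _ _] := weyl_T_alg_curv (sub2 _ D2p); rewrite h.
  have T2u x z : Ck k D2 (fun p => weyl_T p x (u p) z y0).
    apply: (Ck_linear_arg oD2 (f := fun p y => weyl_T p x y z y0)) => // p D2p c v' w.
    by have [[_ h _ _] _ _ _] := weyl_T_alg_curv (sub2 _ D2p); rewrite h.
  have Tuu x : Ck k D2 (fun p => weyl_T p x (u p) (u p) y0).
    apply: (Ck_linear_arg oD2 (f := fun p y => weyl_T p x y (u p) y0)) => // p D2p c v' w.
    by have [[_ h _ _] _ _ _] := weyl_T_alg_curv (sub2 _ D2p); rewrite h.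
  apply: (mC_mul oD2 _ iC) => i j.
  have den : Ck k D2 (fun p => (inner (g p) (u p) (u p) ^+ 2)^-1).
    apply: (Ck_inv oD2 _ (Ck_mul oD2 uu uu)) => p D2p; have [-> _] := prop p D2p.
    by rewrite -expr2 expf_neq0 // gt_eqF // gP //; exact: sub2.
  have H := Ck_mul oD2 (Ck_sub2 oD2 (Ck_mul oD2 (Ck_add oD2 (T3u (basis_vec i) (basis_vec j))
     (T2u (basis_vec i) (basis_vec j))) uu) (Ck_mul oD2 (Tuu (basis_vec i)) (iu (basis_vec j)))) den.
  by apply: (Ck_ext oD2 _ H) => p _; rewrite mxE.
move=> p D2p; have Dp := sub2 _ D2p; have [uy Tu] := prop p D2p; have hT := weyl_T_alg_curv Dp.
have Gp v := @gP p v Dp; have Gs := gS Dp.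
have Tpsi x := weyl_T_psi x Dp.
split.
- by case: D2p.
- exact: (jmx_skew Gs Gp hT y0N uy Tu Tpsi).
- exact: (jmx_mul Gs Gp hT y0N uy Tu Tpsi).
move=> x y z t.
have := jmx_tensor Gs Gp hT y0N uy Tu Tpsi x y z t; rewrite -/(J p) /weyl_T /w4 /lam.
have [muN _] := weyl_mu_eigen Dp.
move: (weyl_mu p) (RJ _ _ _ _ _ _) (R0 _ _ _ _ _) (inner _ _ _) muN => mu rj r0 w muN h.
have : w = - ((m%:R - 1) * mu) * ((- ((m%:R - 1) * mu))^-1 * w + (m%:R - 1)^-1 * r0) + mu * r0.
  by field; rewrite M1 muN.
by rewrite h => ->; field.
Qed.
End NormalForm.

(** * Conformal change of the metric *)

Section Operators.
Context {R : realType} {m : nat}.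
Implicit Types (G P J : 'M[R]_m) (x y z : 'rV[R]_m).

Definition wmx G P x y : 'M[R]_m :=
  G *m (y *m P)^T *m x - G *m (x *m P)^T *m y + G *m y^T *m (x *m P) - G *m x^T *m (y *m P).

Definition rjm G J x y : 'M[R]_m :=
  G *m (y *m J)^T *m (x *m J) - G *m (x *m J)^T *m (y *m J) - (2 * inner G (x *m J) y) *: J.

Lemma mul_outer G x y z : z *m (G *m x^T *m y) = inner G z x *: y.
Proof. by rewrite !mulmxA; apply/rowP => j; rewrite mxE big_ord1 scalemxE. Qed.

Lemma mul_wmx G P x y z : G^T = G -> z *m wmx G P x y = wedge G P x y z.
Proof.
move=> Gs; rewrite /wmx /wedge !(mulmxDr, mulmxN) !mul_outer.
by rewrite !(innerC Gs z).
Qed.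

Lemma mul_rjm G J x y z : G^T = G -> z *m rjm G J x y =
  inner G (y *m J) z *: (x *m J) - inner G (x *m J) z *: (y *m J)
  - (2 * inner G (x *m J) y) *: (z *m J).
Proof.
move=> Gs; rewrite /rjm !(mulmxDr, mulmxN) !mul_outer -scalemxAr.
by rewrite !(innerC Gs z).
Qed.

Lemma bilinear_ext {n} (F : 'rV[R]_m -> 'rV[R]_m -> 'M[R]_(m, n)) :
  (forall k x x' y, F (k *: x + x') y = k *: F x y + F x' y) ->
  (forall k x y y', F x (k *: y + y') = k *: F x y + F x y') ->
  (forall a b, F (basis_vec a) (basis_vec b) = 0) -> forall x y, F x y = 0.
Proof.
move=> F1 F2 F0 x y; apply/row_matrixP => i; rewrite rowE row0.
apply: (trilinear_ext (F := fun x y z => z *m F x y)) => [k u v w z|k u v w z|k u v w z|a b c].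
- by rewrite F1 mulmxDr -scalemxAr.
- by rewrite F2 mulmxDr -scalemxAr.
- by rewrite mulmxDl -scalemxAl.
- by rewrite F0 mulmx0.
Qed.

End Operators.

Section ConformalCancellation.
Context {R : realType} {m : nat}.
Variables (G A B : 'M[R]_m).
Hypothesis Gs : G^T = G.
Implicit Types (z x e s ds : 'rV[R]_m).
Local Notation "'g[' x , y ]" := (inner G x y).

(* z |-> conf_S s e_a z is the change of the Christoffel matrix Gam a under a
   conformal change of the metric, s being half the gradient of the logarithm
   of the factor, and conf_dS is its derivative. *)
Definition conf_S s e z : 'rV[R]_m := g[s, e] *: z + g[z, s] *: e - g[z, e] *: s.
Definition conf_dS s ds e (C : 'M[R]_m) (k : R) z : 'rV[R]_m :=
  k *: z + (g[ds, z] + g[s *m C, z] + g[s, z *m C]) *: e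
  - (g[z *m C, e] + g[z, e *m C]) *: s - g[z, e] *: ds.
(** If s is the gradient of f and the conformal factor is exp(2f), this is the vector dual to Hess f
    - df tensor df + |df|^2 g / 2 evaluated at e, the tensor by which the Schouten tensor changes up
    to sign. *)
Definition conf_v s ds e (C : 'M[R]_m) : 'rV[R]_m :=
  ds + s *m C - g[s, e] *: s + (2^-1 * g[s, s]) *: e.

Lemma conf_cancel s dsa dsb ea eb k z : eb *m A = ea *m B ->
  conf_dS s dsa eb A k z - conf_dS s dsb ea B k z
  + (conf_S s ea (z *m B) + conf_S s eb z *m A + conf_S s ea (conf_S s eb z))
  - (conf_S s eb (z *m A) + conf_S s ea z *m B + conf_S s eb (conf_S s ea z)) =
  g[- conf_v s dsb eb B, z] *: ea - g[- conf_v s dsa ea A, z] *: eb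
  + g[eb, z] *: (- conf_v s dsa ea A) - g[ea, z] *: (- conf_v s dsb eb B).
Proof.
move=> h; rewrite /conf_S /conf_dS /conf_v !(mulmxDl, mulNmx) -!scalemxAl h !(innerE Gs).
rewrite (innerC Gs z s) (innerC Gs z ea) (innerC Gs z eb) (innerC Gs z (ea *m B)) (innerC Gs eb ea).
rewrite (innerC Gs (z *m A) s) (innerC Gs (z *m B) s) (innerC Gs ea s) (innerC Gs eb s).
move: (inner G) (z *m A) (z *m B) (ea *m B) (s *m A) (s *m B) => f zA zB eB sA sB.
apply/rowP => i; rewrite ?(addmxE, oppmxE, scalemxE); by field.
Qed.
End ConformalCancellation.

Lemma conf_sum {R : realType} {m : nat} (h x1 x2 x3 g1 g2 d : 'I_m -> R) (al a1 a2 g3 : R) :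
  al != 0 ->
  \sum_l al^-1 * h l * (a1 * g1 l + al * x1 l + (a2 * g2 l + al * x2 l) - (d l * g3 + al * x3 l)) =
  \sum_l h l * (x1 l + x2 l - x3 l)
  + al^-1 * (a1 * \sum_l h l * g1 l + a2 * \sum_l h l * g2 l - g3 * \sum_l h l * d l).
Proof.
move=> alN; rewrite !mulr_sumr -big_split /= -sumrB mulr_sumr -big_split; apply: eq_bigr => l _ /=.
by field.
Qed.

Section Conformal.
Context {R : realType} {m : nat}.
Variables (D : set 'rV[R]_m) (oD : open D) (g : 'rV[R]_m -> 'M[R]_m).
Hypotheses (gC : forall k, mC k D g) (gS : forall p, D p -> (g p)^T = g p)
  (gP : forall p v, D p -> v != 0 -> 0 < inner (g p) v v).
Implicit Types (p q x y z v w : 'rV[R]_m) (a b i j : 'I_m).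
Variable al : 'rV[R]_m -> R.
Hypotheses (alC : forall k, Ck k D al) (al0 : forall p, D p -> 0 < al p).
Let gt p : 'M[R]_m := al p *: g p.

Lemma conf_C k : mC k D gt. Proof. exact: (mC_scale oD (alC k) (gC k)). Qed.
Lemma conf_sym p : D p -> (gt p)^T = gt p.
Proof. by move=> Dp; rewrite /gt linearZ /= gS. Qed.
Lemma conf_inner p x y : inner (gt p) x y = al p * inner (g p) x y.
Proof. by rewrite /inner /gt -scalemxAr -scalemxAl scalemxE. Qed.
Lemma conf_pos p v : D p -> v != 0 -> 0 < inner (gt p) v v.
Proof. by move=> Dp vN; rewrite conf_inner mulr_gt0 ?al0 ?gP. Qed.

Let t p : 'rV[R]_m := \row_a (pd a al p / (2 * al p)).
Let s p : 'rV[R]_m := t p *m invmx (g p).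

Let tC k : mC k D t.
Proof.
move=> i a; have H : Ck k D (fun p => pd a al p * (2 * al p)^-1).
  apply: (Ck_mul oD (Ck_pd a (alC k.+1))); apply: (Ck_inv oD _ (Ck_mul oD (Ck_cst k D 2) (alC k))) => p Dp.
  by rewrite mulf_neq0 ?(eqr_nat R 2 0) // gt_eqF // al0.
by apply: (Ck_ext oD _ H) => p Dp; rewrite mxE.
Qed.

Let sC k : mC k D s. Proof. exact: (mC_mul oD (tC k) (invmet_C oD gC gP k)). Qed.

Let tE p : D p -> t p = s p *m g p.
Proof. by move=> Dp; rewrite /s mulmxKV // (met_unit gP). Qed.

Let ta p a : D p -> inner (g p) (s p) (basis_vec a) = t p 0 a.
Proof. by move=> Dp; rewrite /inner -tE // /basis_vec trmx_delta -colE mxE. Qed.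

Definition conf_Smx a p : 'M[R]_m :=
  (t p 0 a)%:M + (t p)^T *m basis_vec a - g p *m (basis_vec a)^T *m s p.

Lemma Gam_conf a p : D p -> Gam gt a p = Gam g a p + conf_Smx a p.
Proof.
move=> Dp; apply/matrixP => j k.
have al0p : al p != 0 by rewrite gt_eqF // al0.
have d i c e : dmet gt p i c e = pd i al p * g p c e + al p * dmet g p i c e.
  by rewrite !dmetE (mpd_scale i Dp (alC 1) (gC 1)) addmxE !scalemxE.
have iE : invmx (gt p) = (al p)^-1 *: invmx (g p).
  by rewrite invmxZ //; exact: (met_unit (g := gt) conf_pos Dp).
have sg c : \sum_l invmx (g p) k l * g p c l = (c == k)%:R.
  transitivity ((g p *m invmx (g p)) c k); last by rewrite mulmxV ?(met_unit gP) // mxE.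
  rewrite mxE; apply: eq_bigr => l _; rewrite mulrC -[in LHS](invmx_sym gS Dp) mxE //.
have sk : \sum_l invmx (g p) k l * pd l al p = 2 * al p * s p 0 k.
  rewrite /s mxE mulr_sumr; apply: eq_bigr => l _.
  rewrite [t p 0 l]mxE -[in LHS](invmx_sym gS Dp) [(_^T) _ _]mxE; by field.
rewrite addmxE [Gam gt a p j k]mxE [Gam g a p j k]mxE /christoffel iE.
under eq_bigr => l _ do rewrite scalemxE !d.
have -> : \sum_l (al p)^-1 * invmx (g p) k l *
    (pd a al p * g p j l + al p * dmet g p a j l + (pd j al p * g p a l + al p * dmet g p j a l)
     - (pd l al p * g p a j + al p * dmet g p l a j)) =
  \sum_l invmx (g p) k l * (dmet g p a j l + dmet g p j a l - dmet g p l a j)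
  + (al p)^-1 * (pd a al p * \sum_l invmx (g p) k l * g p j l
    + pd j al p * \sum_l invmx (g p) k l * g p a l - g p a j * \sum_l invmx (g p) k l * pd l al p).
  exact: conf_sum.
rewrite !sg sk mulrDr; congr (_ + _).
rewrite /conf_Smx !addmxE oppmxE [(_%:M) _ _]mxE [((t p)^T *m _) _ _]mxE big_ord1.
rewrite [((t p)^T) _ _]mxE [t p 0 j]mxE [t p 0 a]mxE [basis_vec a 0 k]mxE /=.
rewrite [(_ *m s p) j k]mxE big_ord1 /basis_vec trmx_delta -colE [col _ _ _ _]mxE.
have -> : g p j a = g p a j by rewrite -[in LHS](gS Dp) mxE.
rewrite mulr_natr -[in LHS](mulr_natr _ (j == k)) (eq_sym k a) -mulr_natr.
by field.
Qed.

Lemma mul_conf_Smx a p z : D p -> z *m conf_Smx a p = conf_S (g p) (s p) (basis_vec a) z.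
Proof.
move=> Dp; rewrite /conf_Smx /conf_S !(mulmxDr, mulmxN) mul_mx_scalar mul_outer ta //.
rewrite tE // trmx_mul gS // mul_outer //.
Qed.

Lemma conf_Smx_C k a : mC k D (conf_Smx a).
Proof.
apply: (mC_sub oD (mC_add oD _ (mC_mul oD (mC_tr oD (tC k)) (mC_cst D k _)))
  (mC_mul oD (mC_mul oD (gC k) (mC_cst D k _)) (sC k))) => i j.
by apply: (Ck_ext oD _ (Ck_mul oD (tC k 0 a) (Ck_cst k D (i == j)%:R))) => p Dp; rewrite [RHS]mxE mulr_natr.
Qed.

Lemma mul_mpd_conf_Smx a b p z : D p -> z *m mpd a (conf_Smx b) p =
  conf_dS (g p) (s p) (mpd a s p) (basis_vec b) (Gam g a p) (pd a (fun q => t q 0 b) p) z.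
Proof.
move=> Dp; have Gs := gS Dp.
have c0 : mC 1 D (fun p => (t p 0 b)%:M : 'M[R]_m).
  move=> i j; apply: (Ck_ext oD _ (Ck_mul oD (tC 1 0 b) (Ck_cst 1 D (i == j)%:R))) => q Dq.
  by rewrite [RHS]mxE mulr_natr.
have ce n : mC n D (fun=> basis_vec b : 'rV[R]_m) by exact: mC_cst.
have cet n : mC n D (fun=> (basis_vec b : 'rV[R]_m)^T) by exact: mC_cst.
have cT := mC_tr oD (tC 1); have cg := mC_mul oD (gC 1) (cet 1%N).
rewrite /conf_Smx (mpd_sub oD a Dp (mC_add oD c0 (mC_mul oD cT (ce 1%N))) (mC_mul oD cg (sC 1))).
rewrite (mpd_add a Dp c0 (mC_mul oD cT (ce 1%N))) (mpd_mul oD a Dp cT (ce 1%N)).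
rewrite (mpd_mul oD a Dp cg (sC 1)) (mpd_mul oD a Dp (gC 1) (cet 1%N)) !mpd_cst !mulmx0 !addr0.
rewrite mpd_tr.
have -> : mpd a (fun q => (t q 0 b)%:M : 'M[R]_m) p = (pd a (fun q => t q 0 b) p)%:M.
  apply/matrixP => i j; rewrite [LHS]mxE [RHS]mxE.
  transitivity (pd a (fun q => t q 0 b * (i == j)%:R) p).
    by congr (pd a _ p); apply/funext => q; rewrite [LHS]mxE mulr_natr.
  rewrite pdM; [|exact: (Ck_der (tC 1 0 b))|exact: derivable_cst].
  by rewrite pd_cst mulr0 add0r mulrC mulr_natr.
have -> : mpd a t p = mpd a s p *m g p + s p *m mpd a g p.
  by rewrite -(mpd_mul oD a Dp (sC 1) (gC 1)); apply: (mpd_ext oD a Dp) => q Dq; exact: tE.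
rewrite (Gam_metric oD gS gP a Dp) /conf_dS !(mulmxDr, mulmxN) mul_mx_scalar -!addrA; congr (_ + _).
move: (mpd a s p) (s p) (Gam g a p) (basis_vec b : 'rV[R]_m) => ds sp A e.
have E1 (X : 'rV[R]_m) : z *m (X^T *m e) = (X *m z^T) 0 0 *: e.
  have -> : X *m z^T = (z *m X^T)^T by rewrite trmx_mul trmxK.
  by rewrite mulmxA mxE; apply/rowP => l; rewrite mxE big_ord1 scalemxE.
have E2 : inner (A *m g p + g p *m A^T) z e = inner (g p) (z *m A) e + inner (g p) z (e *m A).
  by rewrite /inner mulmxDr mulmxDl addmxE trmx_mul !mulmxA.
rewrite E1 !mul_outer E2 !mulmxDl !addmxE.
have -> : (ds *m g p *m z^T) 0 0 = inner (g p) ds z by [].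
have -> : (sp *m (A *m g p) *m z^T) 0 0 = inner (g p) (sp *m A) z by rewrite /inner !mulmxA.
have -> : (sp *m (g p *m A^T) *m z^T) 0 0 = inner (g p) sp (z *m A) by rewrite /inner trmx_mul !mulmxA.
by rewrite opprD.
Qed.

Definition conf_V p : 'M[R]_m :=
  \matrix_(a, k) conf_v (g p) (s p) (mpd a s p) (basis_vec a) (Gam g a p) 0 k.

Lemma conf_V_C k : mC k D conf_V.
Proof.
move=> a j; have HG := Gam_C oD gC gP k a.
have is1 (v : 'rV[R]_m) : Ck k D (fun p => inner (g p) (s p) v) by apply: (Ck_inner oD gC); exact: sC.
have iss : Ck k D (fun p => inner (g p) (s p) (s p)).
  exact: (Ck_ext oD (fun p _ => erefl) (mC_mul oD (mC_mul oD (sC k) (gC k)) (mC_tr oD (sC k)) 0 0)).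
have H := mC_add oD (mC_sub oD (mC_add oD (mC_mpd oD a (sC k.+1)) (mC_mul oD (sC k) HG))
  (mC_scale oD (is1 (basis_vec a)) (sC k))) (mC_scale oD (Ck_mul oD (Ck_cst k D 2^-1) iss) (mC_cst D k (basis_vec a))).
by apply: (Ck_ext oD _ (H 0 j)) => p Dp; rewrite [RHS]mxE.
Qed.

(** What matters later is that the curvature changes by a wedge product with a smooth operator,
    which can be merged with the Ricci part. *)
Lemma Rm_conf a b p : D p -> Rm gt a b p = Rm g a b p + wmx (g p) (- conf_V p) (basis_vec a) (basis_vec b).
Proof.
move=> Dp; have Gs := gS Dp; apply/row_matrixP => i; rewrite !rowE [RHS]mulmxDr mul_wmx //.
move: (delta_mx 0 i : 'rV[R]_m) => z {i}.
have rV c : basis_vec c *m conf_V p = conf_v (g p) (s p) (mpd c s p) (basis_vec c) (Gam g c p).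
  by apply/rowP => j; rewrite /basis_vec -rowE !mxE.
have E c d : mpd c (Gam gt d) p = mpd c (Gam g d) p + mpd c (conf_Smx d) p.
  rewrite -(mpd_add c Dp (Gam_C oD gC gP 1 d) (conf_Smx_C 1 d)).
  by apply: (mpd_ext oD c Dp) => q Dq; exact: Gam_conf.
(* The 1-form t is closed, being half the differential of log al; this removes the multiples of the
   identity from the change of curvature. *)
have sy : pd a (fun q => t q 0 b) p = pd b (fun q => t q 0 a) p.
  have H c d : pd c (fun q => t q 0 d) p = pd c (pd d al) p / (2 * al p)
      - pd d al p * pd c al p / (2 * al p ^+ 2).
    transitivity (pd c (fun q => 2^-1 * (pd d al q * (al q)^-1)) p).
      by congr (pd c _ p); apply/funext => q; rewrite mxE invfM; ring.
    have alN : al p != 0 by rewrite gt_eqF // al0.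
    have d1 := Ck_der (k := 0) (i := c) (Ck_pd d (alC 2)) Dp.
    have d2 := Ck_der (i := c) (alC 1) Dp.
    have d3 : derivable (fun q => (al q)^-1) p (basis_vec c).
      exact: (Ck_der (k := 0) (Ck_inv oD (fun q Dq => lt0r_neq0 (al0 Dq)) (alC 1)) Dp).
    have d4 : derivable (fun q => pd d al q * (al q)^-1) p (basis_vec c).
      exact: (Ck_der (k := 0) (Ck_mul oD (Ck_pd d (alC 2)) (Ck_inv oD (fun q Dq => lt0r_neq0 (al0 Dq)) (alC 1))) Dp).
    rewrite (pdM (derivable_cst _ _ _) d4) pd_cst mulr0 addr0 (pdM d1 d3) (pdV alN d2).
    rewrite [X in X * _](_ : _ = 2^-1) //; move: alN; move: (al p) (pd d al p) (pd c al p) (pd c (pd d al) p) => u v w z0 uN.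
    by field.
  by rewrite (H a b) (H b a) (pd_comm a b oD Dp (alC 2)) (mulrC (pd a al p)).
have cc := conf_cancel (A := Gam g a p) (B := Gam g b p) Gs (s p) (mpd a s p) (mpd b s p)
  (pd a (fun q => t q 0 b) p) z (esym (Gam_sym oD gS a b Dp)).
have -> : wedge (g p) (- conf_V p) (basis_vec a) (basis_vec b) z = 
  conf_dS (g p) (s p) (mpd a s p) (basis_vec b) (Gam g a p) (pd a (fun q => t q 0 b) p) z
  - conf_dS (g p) (s p) (mpd b s p) (basis_vec a) (Gam g b p) (pd a (fun q => t q 0 b) p) z
  + (conf_S (g p) (s p) (basis_vec a) (z *m Gam g b p) + conf_S (g p) (s p) (basis_vec b) z *m Gam g a p
     + conf_S (g p) (s p) (basis_vec a) (conf_S (g p) (s p) (basis_vec b) z))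
  - (conf_S (g p) (s p) (basis_vec b) (z *m Gam g a p) + conf_S (g p) (s p) (basis_vec a) z *m Gam g b p
     + conf_S (g p) (s p) (basis_vec b) (conf_S (g p) (s p) (basis_vec a) z)).
  by rewrite cc /wedge !mulmxN !rV.
rewrite -!(mul_conf_Smx _ _ Dp) -(mul_mpd_conf_Smx a b z Dp) sy -(mul_mpd_conf_Smx b a z Dp) {cc sy}.
rewrite /Rm !E !(Gam_conf _ Dp).
move: (conf_Smx a p) (conf_Smx b p) (Gam g a p) (Gam g b p) (mpd _ _ _) (mpd _ _ _) (mpd _ _ _) (mpd _ _ _).
move=> Sa Sb A B X1 X2 X3 X4.
rewrite !(mulmxDr, mulmxDl, mulmxN, mulmxA); mx_ring.
Qed.
End Conformal.

(** * Parallelism of the complex structure *)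

Section CovariantCancellation.
Context {R : realType} {m : nat}.
Variables (G : 'M[R]_m) (s : R).
Hypothesis Gs : G^T = G.
Implicit Types (J Q T U A : 'M[R]_m) (x y z b c d e : 'rV[R]_m).
Local Notation "'g[' x , y ]" := (inner G x y).

Definition Fmx J Q x y : 'M[R]_m := s *: rjm G J x y + wmx G Q x y.

(* The covariant derivative of [Fmx] when that of J is T and that of Q is U. *)
Definition NRmx J T U b c : 'M[R]_m :=
  s *: (G *m (c *m T)^T *m (b *m J) + G *m (c *m J)^T *m (b *m T)
   - G *m (b *m T)^T *m (c *m J) - G *m (b *m J)^T *m (c *m T)
   - (2 * g[b *m T, c]) *: J - (2 * g[b *m J, c]) *: T) + wmx G U b c.

Lemma mul_Fmx J Q x y z : z *m Fmx J Q x y =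
  s *: (g[y *m J, z] *: (x *m J) - g[x *m J, z] *: (y *m J) - (2 * g[x *m J, y]) *: (z *m J))
  + wedge G Q x y z.
Proof. by rewrite /Fmx [LHS]mulmxDr -scalemxAr mul_rjm // mul_wmx. Qed.

Lemma mul_NRmx J T U b c z : z *m NRmx J T U b c =
  s *: (g[z, c *m T] *: (b *m J) + g[z, c *m J] *: (b *m T)
   - g[z, b *m T] *: (c *m J) - g[z, b *m J] *: (c *m T)
   - (2 * g[b *m T, c]) *: (z *m J) - (2 * g[b *m J, c]) *: (z *m T)) + wedge G U b c z.
Proof.
rewrite /NRmx [LHS]mulmxDr -scalemxAr mul_wmx //; congr (_ *: _ + _).
by rewrite !(mulmxDr, mulmxN) !mul_outer -!scalemxAr.
Qed.

Lemma mx_eq_mul (A B : 'M[R]_m) : (forall z : 'rV[R]_m, z *m A = z *m B) -> A = B.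
Proof. by move=> h; apply/row_matrixP => i; rewrite !rowE. Qed.

Lemma Fmx_skew J Q x y : (forall x y, g[x *m J, y] = - g[y *m J, x]) ->
  Fmx J Q x y = - Fmx J Q y x.
Proof.
move=> Jskew; apply: mx_eq_mul => z; rewrite mulmxN !mul_Fmx /wedge (Jskew y x).
apply/rowP => i; rewrite ?(addmxE, oppmxE, scalemxE); ring.
Qed.

Lemma NRmx_lin J k T T' U U' b c :
  NRmx J (k *: T + T') (k *: U + U') b c = k *: NRmx J T U b c + NRmx J T' U' b c.
Proof.
apply: mx_eq_mul => z; rewrite [RHS]mulmxDr -scalemxAr !mul_NRmx /wedge.
rewrite !(mulmxDr) -!scalemxAr !(innerE Gs).
apply/rowP => i; rewrite ?(addmxE, oppmxE, scalemxE); ring.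
Qed.

Lemma NRmx_lin1 J T U k b b' c :
  NRmx J T U (k *: b + b') c = k *: NRmx J T U b c + NRmx J T U b' c.
Proof.
apply: mx_eq_mul => z; rewrite [RHS]mulmxDr -scalemxAr !mul_NRmx /wedge.
rewrite !(mulmxDl) -!scalemxAl !(innerE Gs).
apply/rowP => i; rewrite ?(addmxE, oppmxE, scalemxE); ring.
Qed.

Lemma NRmx_lin2 J T U k b c c' :
  NRmx J T U b (k *: c + c') = k *: NRmx J T U b c + NRmx J T U b c'.
Proof.
apply: mx_eq_mul => z; rewrite [RHS]mulmxDr -scalemxAr !mul_NRmx /wedge.
rewrite !(mulmxDl) -!scalemxAl !(innerE Gs).
apply/rowP => i; rewrite ?(addmxE, oppmxE, scalemxE); ring.
Qed.

Lemma Fmx_lin1 J Q k x x' y : Fmx J Q (k *: x + x') y = k *: Fmx J Q x y + Fmx J Q x' y.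
Proof.
apply: mx_eq_mul => z; rewrite [RHS]mulmxDr -scalemxAr !mul_Fmx /wedge.
rewrite !(mulmxDl) -!scalemxAl !(innerE Gs).
apply/rowP => i; rewrite ?(addmxE, oppmxE, scalemxE); ring.
Qed.

(** The product rule for [Fmx]. Here bA and cA stand for the covariant derivatives of the constant
    fields b and c; what remains besides them is the tensorial part [NRmx]. *)
Lemma cov_cancel J Q T U b c bA cA :
  s *: ((G *m (c *m T + cA *m J)^T *m (b *m J) + G *m (c *m J)^T *m (b *m T + bA *m J))
      - (G *m (b *m T + bA *m J)^T *m (c *m J) + G *m (b *m J)^T *m (c *m T + cA *m J))
      - ((2 * (g[b *m T + bA *m J, c] + g[b *m J, cA])) *: J + (2 * g[b *m J, c]) *: T))
  + ((G *m (c *m U + cA *m Q)^T *m b + G *m (c *m Q)^T *m bA)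
     - (G *m (b *m U + bA *m Q)^T *m c + G *m (b *m Q)^T *m cA)
     + (G *m cA^T *m (b *m Q) + G *m c^T *m (b *m U + bA *m Q))
     - (G *m bA^T *m (c *m Q) + G *m b^T *m (c *m U + cA *m Q))) =
  NRmx J T U b c + Fmx J Q bA c + Fmx J Q b cA.
Proof.
apply: mx_eq_mul => z.
have m3 (X Y Z : 'M[R]_m) : z *m (X + Y + Z) = z *m X + z *m Y + z *m Z by rewrite !mulmxDr.
rewrite [RHS]m3 [in RHS]mul_NRmx ![in RHS]mul_Fmx /wedge.
rewrite [LHS]mulmxDr -scalemxAr !(mulmxDr, mulmxN) !mul_outer -!scalemxAr !(innerE Gs).
rewrite !(innerC Gs z).
apply/rowP => i; rewrite ?(addmxE, oppmxE, scalemxE); ring.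
Qed.

(** Every term of the wedge product contains one of the four vanishing inner products, so the
    unknown U drops out. *)
Lemma inner_NRmx J T U b c d e : g[d, b] = 0 -> g[d, c] = 0 -> g[e, b] = 0 -> g[e, c] = 0 ->
  g[d *m NRmx J T U b c, e] = s * (g[c *m T, d] * g[b *m J, e] + g[c *m J, d] * g[b *m T, e]
    - g[b *m T, d] * g[c *m J, e] - g[b *m J, d] * g[c *m T, e]
    - 2 * g[b *m T, c] * g[d *m J, e] - 2 * g[b *m J, c] * g[d *m T, e]).
Proof.
move=> db dc eb ec; rewrite mul_NRmx /wedge !(innerE Gs) (innerC Gs b e) (innerC Gs c e).
rewrite (innerC Gs c d) (innerC Gs b d) db dc eb ec !(innerC Gs d); ring.
Qed.
End CovariantCancellation.

Section Kahler.
Context {R : realType} {m : nat}.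
Variables (D : set 'rV[R]_m) (oD : open D) (g : 'rV[R]_m -> 'M[R]_m).
Hypotheses (gC : forall k, mC k D g) (gS : forall p, D p -> (g p)^T = g p)
  (gP : forall p v, D p -> v != 0 -> 0 < inner (g p) v v).
Implicit Types (p q x y z v w : 'rV[R]_m) (a b c i j : 'I_m).
Variables (J Q : 'rV[R]_m -> 'M[R]_m) (s : R).
Hypotheses (JC : forall k, mC k D J) (QC : forall k, mC k D Q)
  (Jskew : forall p, D p -> forall x y, inner (g p) (x *m J p) y = - inner (g p) (y *m J p) x)
  (JJ : forall p, D p -> J p *m J p = - 1%:M) (sN : s != 0) (m8 : (8 <= m)%N)
  (hR : forall p, D p -> forall a b,
     Rm g a b p = Fmx (g p) s (J p) (Q p) (basis_vec a) (basis_vec b)).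

Definition cov a (X : 'rV[R]_m -> 'M[R]_m) p : 'M[R]_m :=
  mpd a X p + X p *m Gam g a p - Gam g a p *m X p.
Definition covr a (u : 'rV[R]_m -> 'rV[R]_m) p : 'rV[R]_m := mpd a u p + u p *m Gam g a p.

Lemma cov_ext a (X Y : 'rV[R]_m -> 'M[R]_m) p : D p -> (forall q, D q -> X q = Y q) ->
  cov a X p = cov a Y p.
Proof. by move=> Dp XY; rewrite /cov (mpd_ext oD a Dp XY) (XY p Dp). Qed.

Lemma cov_outer a (u v : 'rV[R]_m -> 'rV[R]_m) p : D p -> mC 1 D u -> mC 1 D v ->
  cov a (fun q => g q *m (u q)^T *m v q) p =
  g p *m (covr a u p)^T *m v p + g p *m (u p)^T *m covr a v p.
Proof.
move=> Dp Hu Hv; have Hg := gC 1; have Hut := mC_tr oD Hu.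
rewrite /cov /covr (mpd_mul oD a Dp (mC_mul oD Hg Hut) Hv) (mpd_mul oD a Dp Hg Hut) mpd_tr.
rewrite (Gam_metric oD gS gP a Dp) linearD /= trmx_mul.
move: (g p) (u p) (v p) (Gam g a p) (mpd a u p) (mpd a v p) => G U V A dU dV.
rewrite !(mulmxDl, mulmxDr, mulmxA); mx_ring.
Qed.

Lemma cov_add a X Y p : D p -> mC 1 D X -> mC 1 D Y ->
  cov a (fun q => X q + Y q) p = cov a X p + cov a Y p.
Proof.
move=> Dp HX HY; rewrite /cov (mpd_add a Dp HX HY).
move: (mpd a X p) (mpd a Y p) (X p) (Y p) (Gam g a p) => dX dY x y A.
rewrite mulmxDl mulmxDr; mx_ring.
Qed.

Lemma cov_sub a X Y p : D p -> mC 1 D X -> mC 1 D Y ->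
  cov a (fun q => X q - Y q) p = cov a X p - cov a Y p.
Proof.
move=> Dp HX HY; rewrite /cov (mpd_sub oD a Dp HX HY).
move: (mpd a X p) (mpd a Y p) (X p) (Y p) (Gam g a p) => dX dY x y A.
rewrite mulmxBl mulmxBr; mx_ring.
Qed.

Lemma cov_scale a f X p : D p -> Ck 1 D f -> mC 1 D X ->
  cov a (fun q => f q *: X q) p = pd a f p *: X p + f p *: cov a X p.
Proof.
move=> Dp Hf HX; rewrite /cov (mpd_scale a Dp Hf HX).
move: (mpd a X p) (X p) (Gam g a p) => dX x A.
rewrite -scalemxAl -scalemxAr; mx_ring.
Qed.

Lemma covr_cst a v p : covr a (fun=> v) p = v *m Gam g a p.
Proof. by rewrite /covr mpd_cst add0r. Qed.

Lemma covr_mul a v X p : D p -> mC 1 D X ->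
  covr a (fun q => v *m X q) p = v *m cov a X p + v *m Gam g a p *m X p.
Proof.
move=> Dp HX; rewrite /covr (mpd_mul oD a Dp (mC_cst D 1 v) HX) mpd_cst mul0mx add0r /cov.
move: (mpd a X p) (X p) (Gam g a p) => dX x A.
rewrite !(mulmxDr, mulmxN, mulmxA); mx_ring.
Qed.

Lemma pd_inner a (u v : 'rV[R]_m -> 'rV[R]_m) p : D p -> mC 1 D u -> mC 1 D v ->
  pd a (fun q => inner (g q) (u q) (v q)) p = inner (g p) (covr a u p) (v p) + inner (g p) (u p) (covr a v p).
Proof.
move=> Dp Hu Hv; have Hvt := mC_tr oD Hv.
transitivity (mpd a (fun q => u q *m g q *m (v q)^T) p 0 0); first by rewrite mxE.
rewrite (mpd_mul oD a Dp (mC_mul oD Hu (gC 1)) Hvt) (mpd_mul oD a Dp Hu (gC 1)) mpd_tr.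
rewrite (Gam_metric oD gS gP a Dp) /inner /covr.
move: (g p) (u p) (v p) (Gam g a p) (mpd a u p) (mpd a v p) => G U V A dU dV.
have -> : (dV + V *m A)^T = dV^T + A^T *m V^T by rewrite linearD /= trmx_mul.
rewrite -addmxE; congr (fun_of_matrix _ 0 0).
rewrite !(mulmxDl, mulmxDr, mulmxA); mx_ring.
Qed.

Let T a p := cov a J p.
Let U a p := cov a Q p.

Lemma cov_Rm a b c p : D p -> cov a (Rm g b c) p =
  NRmx (g p) s (J p) (T a p) (U a p) (basis_vec b) (basis_vec c)
  + Fmx (g p) s (J p) (Q p) (basis_vec b *m Gam g a p) (basis_vec c)
  + Fmx (g p) s (J p) (Q p) (basis_vec b) (basis_vec c *m Gam g a p).
Proof.
move=> Dp; rewrite -(cov_cancel s (gS Dp)).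
have -> : cov a (Rm g b c) p = cov a (fun q => Fmx (g q) s (J q) (Q q) (basis_vec b) (basis_vec c)) p.
  by apply: cov_ext => // q Dq; exact: hR.
have cb d : mC 1 D (fun=> basis_vec d : 'rV[R]_m) by exact: mC_cst.
have cJ d : mC 1 D (fun q => basis_vec d *m J q) by exact: (mC_mul oD (cb d) (JC 1)).
have cQ d : mC 1 D (fun q => basis_vec d *m Q q) by exact: (mC_mul oD (cb d) (QC 1)).
have co (u v : 'rV[R]_m -> 'rV[R]_m) : mC 1 D u -> mC 1 D v -> mC 1 D (fun q => g q *m (u q)^T *m (v q : 'rV[R]_m)).
  by move=> hu hv; exact: (mC_mul oD (mC_mul oD (gC 1) (mC_tr oD hu)) hv).
have cf : Ck 1 D (fun q => 2 * inner (g q) (basis_vec b *m J q) (basis_vec c)).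
  by apply: (Ck_mul oD (Ck_cst 1 D 2)); exact: (Ck_inner oD gC).
have Ef : pd a (fun q => 2 * inner (g q) (basis_vec b *m J q) (basis_vec c)) p =
    2 * (inner (g p) (basis_vec b *m cov a J p + basis_vec b *m Gam g a p *m J p) (basis_vec c)
         + inner (g p) (basis_vec b *m J p) (basis_vec c *m Gam g a p)).
  rewrite pdM; [|exact: derivable_cst|exact: (Ck_der (Ck_inner oD gC _ (cJ b)))].
  rewrite pd_cst mulr0 addr0 (pd_inner a Dp (cJ b) (cb c)) (covr_mul a _ Dp (JC 1)) covr_cst //.
have h1 := co _ _ (cJ c) (cJ b); have h2 := co _ _ (cJ b) (cJ c).
have h3 := mC_scale oD cf (JC 1); have h4 := mC_sub oD (mC_sub oD h1 h2) h3.
have k1 := co _ _ (cQ c) (cb b); have k2 := co _ _ (cQ b) (cb c).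
have k3 := co _ _ (cb c) (cQ b); have k4 := co _ _ (cb b) (cQ c).
have k5 := mC_sub oD k1 k2; have k6 := mC_add oD k5 k3; have k7 := mC_sub oD k6 k4.
rewrite /Fmx /rjm /wmx.
rewrite (cov_add a Dp (mC_scale oD (Ck_cst 1 D s) h4) k7) (cov_scale a Dp (Ck_cst 1 D s) h4).
rewrite pd_cst scale0r add0r (cov_sub a Dp (mC_sub oD h1 h2) h3) (cov_sub a Dp h1 h2).
rewrite (cov_outer a Dp (cJ c) (cJ b)) (cov_outer a Dp (cJ b) (cJ c)) (cov_scale a Dp cf (JC 1)).
rewrite (cov_sub a Dp k6 k4) (cov_add a Dp k5 k3) (cov_sub a Dp k1 k2).
rewrite (cov_outer a Dp (cQ c) (cb b)) (cov_outer a Dp (cQ b) (cb c)).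
rewrite (cov_outer a Dp (cb c) (cQ b)) (cov_outer a Dp (cb b) (cQ c)).
rewrite !(covr_mul a _ Dp (JC 1)) !(covr_mul a _ Dp (QC 1)) !covr_cst.
by rewrite Ef.
Qed.

Let TV x p : 'M[R]_m := \sum_a x 0 a *: T a p.
Let UV x p : 'M[R]_m := \sum_a x 0 a *: U a p.

Let V_lin (F : 'I_m -> 'M[R]_m) k x x' :
  \sum_a (k *: x + x') 0 a *: F a = k *: (\sum_a x 0 a *: F a) + \sum_a x' 0 a *: F a.
Proof.
rewrite scaler_sumr -big_split; apply: eq_bigr => a _ /=.
by rewrite addmxE scalemxE scalerDl scalerA.
Qed.

Let V_basis (F : 'I_m -> 'M[R]_m) b : \sum_a (basis_vec b : 'rV[R]_m) 0 a *: F a = F b.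
Proof.
rewrite (bigD1 b) //= [X in _ + X]big1 ?addr0 => [|i ib].
  by rewrite /basis_vec mxE !eqxx scale1r.
by rewrite /basis_vec mxE /= (negPf ib) scale0r.
Qed.

(** In the second Bianchi identity for coordinate fields, the terms of [cov_Rm] that contain Gam
    cancel in pairs, by the symmetry of Gam and the skewness of [Fmx]; the tensorial rest extends by
    linearity. *)
Lemma bianchi_J x y z p : D p ->
  NRmx (g p) s (J p) (TV x p) (UV x p) y z + NRmx (g p) s (J p) (TV y p) (UV y p) z x
  + NRmx (g p) s (J p) (TV z p) (UV z p) x y = 0.
Proof.
move=> Dp; have Gs := gS Dp; move: x y z.
have VL k x x' y z : NRmx (g p) s (J p) (TV (k *: x + x') p) (UV (k *: x + x') p) y z =
    k *: NRmx (g p) s (J p) (TV x p) (UV x p) y z + NRmx (g p) s (J p) (TV x' p) (UV x' p) y z.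
  by rewrite /TV /UV !V_lin; exact: NRmx_lin.
have lin3 k (A A1 A2 B B1 B2 C C1 C2 : 'M[R]_m) : A = k *: A1 + A2 -> B = k *: B1 + B2 ->
    C = k *: C1 + C2 -> A + B + C = k *: (A1 + B1 + C1) + (A2 + B2 + C2).
  by move=> -> -> ->; mx_ring.
apply: (trilinear_ext (F := fun x y z =>
  NRmx (g p) s (J p) (TV x p) (UV x p) y z + NRmx (g p) s (J p) (TV y p) (UV y p) z x
  + NRmx (g p) s (J p) (TV z p) (UV z p) x y)).
- by move=> k x x' y z; apply: lin3; [exact: VL|exact: NRmx_lin2|exact: NRmx_lin1].
- by move=> k x y y' z; apply: lin3; [exact: NRmx_lin1|exact: VL|exact: NRmx_lin2].
- by move=> k x y z z'; apply: lin3; [exact: NRmx_lin2|exact: NRmx_lin1|exact: VL].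
move=> a b c; rewrite /TV /UV !V_basis.
have B : cov a (Rm g b c) p + cov b (Rm g c a) p + cov c (Rm g a b) p = 0.
  exact: (bianchi2 oD gC gP a b c Dp).
have sk := Fmx_skew s Gs (Q p) _ _ (Jskew Dp).
have e1 : Fmx (g p) s (J p) (Q p) (basis_vec b *m Gam g a p) (basis_vec c) =
    - Fmx (g p) s (J p) (Q p) (basis_vec c) (basis_vec a *m Gam g b p).
  by rewrite (Gam_sym oD gS b a Dp); exact: sk.
have e2 : Fmx (g p) s (J p) (Q p) (basis_vec b) (basis_vec c *m Gam g a p) =
    - Fmx (g p) s (J p) (Q p) (basis_vec a *m Gam g c p) (basis_vec b).
  by rewrite (Gam_sym oD gS c a Dp); exact: sk.
have e3 : Fmx (g p) s (J p) (Q p) (basis_vec c *m Gam g b p) (basis_vec a) =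
    - Fmx (g p) s (J p) (Q p) (basis_vec a) (basis_vec b *m Gam g c p).
  by rewrite (Gam_sym oD gS c b Dp); exact: sk.
have canc (N1 N2 N3 F1 F2 F3 F4 F5 F6 : 'M[R]_m) : F1 = - F4 -> F2 = - F5 -> F3 = - F6 ->
    (N1 + F1 + F2) + (N2 + F3 + F4) + (N3 + F5 + F6) = 0 -> N1 + N2 + N3 = 0.
  by move=> -> -> -> <-; mx_ring.
apply: (canc _ _ _ _ _ _ _ _ _ e1 e2 e3).
by rewrite -(cov_Rm a b c Dp) -(cov_Rm b c a Dp) -(cov_Rm c a b Dp).
Qed.

(** Differentiating J^2 = -1 and the skewness of J gives the algebraic hypotheses of
    [parallel_tensor]; [bianchi_J], paired with d and e and divided by s, gives its Bianchi
    hypothesis. *)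
Lemma parallel_J a p : D p -> cov a J p = 0.
Proof.
move=> Dp; have Gs := gS Dp; have Gp v := @gP p v Dp.
have anti b : T b p *m J p + J p *m T b p = 0.
  have H : mpd b (fun q => J q *m J q) p = 0.
    rewrite (mpd_ext oD b Dp (G := fun=> - 1%:M)) ?mpd_cst //.
  move: H; rewrite (mpd_mul oD b Dp (JC 1) (JC 1)) /T /cov => H; have hJ := JJ Dp.
  move: H hJ; move: (mpd b J p) (J p) (Gam g b p) => dJ j A H hJ.
  rewrite !(mulmxDl, mulmxDr, mulmxN, mulNmx) -(mulmxA j A j) -!(mulmxA A) !mulmxA.
  rewrite -(mulmxA A j j) hJ mulmxN mulmx1 mulNmx mul1mx -H; mx_ring.
have skew b x y : inner (g p) (x *m T b p) y = - inner (g p) (y *m T b p) x.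
  have cx (v : 'rV[R]_m) : mC 1 D (fun=> v) by exact: mC_cst.
  have cJ v : mC 1 D (fun q => v *m J q) by exact: (mC_mul oD (cx v) (JC 1)).
  have E v w := pd_inner b Dp (cJ v) (cx w).
  have H : pd b (fun q => inner (g q) (x *m J q) y) p = pd b (fun q => - inner (g q) (y *m J q) x) p.
    by apply: (pd_ext b oD Dp) => q Dq; exact: Jskew.
  move: H; rewrite pdN; last exact: (Ck_der (Ck_inner oD gC _ (cJ y))).
  rewrite !E !(covr_mul b _ Dp (JC 1)) !covr_cst -/(T b p) !(innerDl).
  rewrite (Jskew Dp (x *m Gam g b p)) (Jskew Dp (y *m Gam g b p)); lra.
have TVskew x y z : inner (g p) (y *m TV x p) z = - inner (g p) (z *m TV x p) y.
  rewrite /TV /inner !mulmx_sumr !mulmx_suml !summxE -sumrN; apply: eq_bigr => b _.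
  by have := skew b y z; rewrite /inner -!scalemxAr -!scalemxAl !scalemxE => ->; rewrite mulrN.
have TVJ x : TV x p *m J p + J p *m TV x p = 0.
  rewrite /TV mulmx_sumr mulmx_suml -big_split big1 //= => b _.
  by rewrite -scalemxAl -scalemxAr -scalerDr anti scaler0.
pose T3 x y z := inner (g p) (y *m TV x p) z.
have key : forall x y z, T3 x y z = 0.
  apply: (parallel_tensor Gs Gp (Jskew Dp) (JJ Dp) m8).
  - by move=> k x x' y z; rewrite /T3 /TV V_lin mulmxDr -scalemxAr innerDl innerZl.
  - by move=> k x x' y z; rewrite /T3 mulmxDl -scalemxAl innerDl innerZl.
  - by move=> x y z; exact: TVskew.
  - move=> x y z; rewrite /T3.
    have -> : y *m J p *m TV x p = - (y *m TV x p *m J p).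
      by apply/eqP; rewrite -addr_eq0 -!mulmxA -mulmxDr addrC TVJ mulmx0.
    by rewrite innerNl (Jskew Dp) opprK (innerC Gs).
  move=> x y z d e dx dy dz ex ey ez.
  have D3 (X Y Z : 'M[R]_m) : inner (g p) (d *m (X + Y + Z)) e =
      inner (g p) (d *m X) e + inner (g p) (d *m Y) e + inner (g p) (d *m Z) e.
    by rewrite !mulmxDr !innerDl.
  have := bianchi_J x y z Dp => /(congr1 (fun M => inner (g p) (d *m M) e)).
  rewrite mulmx0 inner0l D3.
  rewrite (inner_NRmx s Gs (J p) (TV x p) (UV x p) dy dz ey ez).
  rewrite (inner_NRmx s Gs (J p) (TV y p) (UV y p) dz dx ez ex).
  rewrite (inner_NRmx s Gs (J p) (TV z p) (UV z p) dx dy ex ey).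
  by rewrite -!mulrDr => /eqP; rewrite mulf_eq0 (negPf sN) /= => /eqP.
apply/row_matrixP => i; rewrite row0 rowE; apply: (inner_inj Gp) => z.
have := key (basis_vec a) (delta_mx 0 i) z; by rewrite /T3 /TV V_basis.
Qed.

(** The integrability condition of a parallel J: the two mixed second derivatives, computed from cov
    J = 0, agree. *)
Lemma Rm_commute a b p : D p -> Rm g a b p *m J p = J p *m Rm g a b p.
Proof.
move=> Dp; have dJ c q : D q -> mpd c J q = Gam g c q *m J q - J q *m Gam g c q.
  move=> Dq; have := parallel_J c Dq; rewrite /cov => /eqP; rewrite subr_eq0 => /eqP <-.
  by rewrite addrK.
have E c d : mpd c (mpd d J) p = mpd c (Gam g d) p *m J p + Gam g d p *m (Gam g c p *m J p - J p *m Gam g c p)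
   - ((Gam g c p *m J p - J p *m Gam g c p) *m Gam g d p + J p *m mpd c (Gam g d) p).
  have cG e := Gam_C oD gC gP 1 e.
  rewrite -(dJ c p Dp) -(mpd_mul oD c Dp (cG d) (JC 1)) -(mpd_mul oD c Dp (JC 1) (cG d)).
  rewrite -(mpd_sub oD c Dp (mC_mul oD (cG d) (JC 1)) (mC_mul oD (JC 1) (cG d))).
  by apply: (mpd_ext oD c Dp) => q Dq; exact: dJ.
have := etrans (esym (E a b)) (etrans (mpd_comm oD a b Dp (JC 2)) (E b a)).
rewrite /Rm; move: (mpd _ _ _) (mpd _ _ _) (Gam g a p) (Gam g b p) (J p) => X Y A B j.
move=> /eqP; rewrite -subr_eq0 => /eqP H; apply/eqP; rewrite -subr_eq0 -H; apply/eqP.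
rewrite !(mulmxDl, mulmxDr, mulmxN, mulNmx, mulmxA); mx_ring.
Qed.

(** R_0 + R_J commutes with J, and R_0 is the wedge product with half the identity. So the wedge
    product with Q - s/2 commutes with J as well, and [wedge_commute_eq0] applies. *)
Lemma Q_eq p : D p -> Q p = (s / 2)%:M.
Proof.
move=> Dp; have Gs := gS Dp; have Gp v := @gP p v Dp.
have com x y : Fmx (g p) s (J p) (Q p) x y *m J p - J p *m Fmx (g p) s (J p) (Q p) x y = 0.
  have sk := Fmx_skew s Gs (Q p) _ _ (Jskew Dp).
  pose H x y := Fmx (g p) s (J p) (Q p) x y *m J p - J p *m Fmx (g p) s (J p) (Q p) x y.
  have H1 k u u' v : H (k *: u + u') v = k *: H u v + H u' v.
    rewrite /H (Fmx_lin1 s Gs); move: (Fmx _ _ _ _ _ _) (Fmx _ _ _ _ _ _) => F1 F2.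
    rewrite mulmxDl mulmxDr -scalemxAl -scalemxAr; mx_ring.
  have Hs u v : H u v = - H v u.
    by rewrite /H (sk u v) mulNmx mulmxN opprB opprK addrC.
  apply: (bilinear_ext (F := H)) => // [k u v v'|a b].
    by rewrite Hs H1 (Hs u v) (Hs u v') scalerN opprD.
  by rewrite /H -(hR Dp) Rm_commute // subrr.
apply/eqP; rewrite -subr_eq0; apply/eqP.
apply: (wedge_commute_eq0 Gs Gp (Jskew Dp) (JJ Dp) m8) => x y z.
have /(congr1 (mulmx z)) := com x y.
rewrite mulmx0 mulmxBr !mulmxA !mul_Fmx // => /eqP; rewrite subr_eq0 => /eqP h.
have W u v w : wedge (g p) (Q p - (s / 2)%:M) u v w =
    wedge (g p) (Q p) u v w - s *: (inner (g p) v w *: u - inner (g p) u w *: v).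
  rewrite /wedge !mulmxBr !mul_mx_scalar !innerBl.
  have Z (c : R) (t t' : 'rV[R]_m) : inner (g p) (c *: t) t' = c * inner (g p) t t' by exact: innerZl.
  rewrite !Z; apply/rowP => i; rewrite ?(addmxE, oppmxE, scalemxE); by field.
rewrite !W; move: h; move: (wedge (g p) (Q p) x y z) (wedge (g p) (Q p) x y (z *m J p)) => w1 w2.
have jj v w : inner (g p) (v *m J p) (w *m J p) = inner (g p) v w by exact: (innerJJ Gs (Jskew Dp) (JJ Dp)).
have mj v : v *m J p *m J p = - v by exact: (mulJJ (JJ Dp)).
have jr v w : inner (g p) v (w *m J p) = - inner (g p) (v *m J p) w by exact: (innerJr Gs (Jskew Dp)).
rewrite !jj !jr !(mulmxDl, mulNmx) -!scalemxAl !(mulmxDl, mulNmx) -!scalemxAl !mj => h.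
move: h; move: (w1 *m J p) => w1' h.
move/eqP: h; rewrite -subr_eq0 => /eqP h; apply/eqP; rewrite -subr_eq0; apply/eqP.
rewrite -[RHS]oppr0 -[in RHS]h.
apply/rowP => i; rewrite ?(addmxE, oppmxE, scalemxE); ring.
Qed.
End Kahler.

(** * The flat frame *)

Section BlockCalculus.
Context {R : realType} {m : nat}.
Variables (D : set 'rV[R]_m) (oD : open D).

Lemma mC_block {a b c d} k (F1 : 'rV[R]_m -> 'M[R]_(a, b)) (F2 : 'rV[R]_m -> 'M[R]_(a, d))
    (F3 : 'rV[R]_m -> 'M[R]_(c, b)) (F4 : 'rV[R]_m -> 'M[R]_(c, d)) :
  mC k D F1 -> mC k D F2 -> mC k D F3 -> mC k D F4 ->
  mC k D (fun p => block_mx (F1 p) (F2 p) (F3 p) (F4 p)).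
Proof.
move=> H1 H2 H3 H4 i j; case: (split_ordP i) => i' ->; case: (split_ordP j) => j' ->.
- by apply: (Ck_ext oD _ (H1 i' j')) => p _; rewrite block_mxEul.
- by apply: (Ck_ext oD _ (H2 i' j')) => p _; rewrite block_mxEur.
- by apply: (Ck_ext oD _ (H3 i' j')) => p _; rewrite block_mxEdl.
- by apply: (Ck_ext oD _ (H4 i' j')) => p _; rewrite block_mxEdr.
Qed.

Lemma mpd_block {a b c d} i (F1 : 'rV[R]_m -> 'M[R]_(a, b)) (F2 : 'rV[R]_m -> 'M[R]_(a, d))
    (F3 : 'rV[R]_m -> 'M[R]_(c, b)) (F4 : 'rV[R]_m -> 'M[R]_(c, d)) p :
  mpd i (fun p => block_mx (F1 p) (F2 p) (F3 p) (F4 p)) p =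
  block_mx (mpd i F1 p) (mpd i F2 p) (mpd i F3 p) (mpd i F4 p).
Proof.
apply/matrixP => k l; rewrite [LHS]mxE; case: (split_ordP k) => k' ->; case: (split_ordP l) => l' ->.
- by rewrite block_mxEul mxE; congr (pd i _ p); apply/funext => q; rewrite block_mxEul.
- by rewrite block_mxEur mxE; congr (pd i _ p); apply/funext => q; rewrite block_mxEur.
- by rewrite block_mxEdl mxE; congr (pd i _ p); apply/funext => q; rewrite block_mxEdl.
- by rewrite block_mxEdr mxE; congr (pd i _ p); apply/funext => q; rewrite block_mxEdr.
Qed.

Lemma mC_col {a b c} k (F1 : 'rV[R]_m -> 'M[R]_(a, b)) (F2 : 'rV[R]_m -> 'M[R]_(c, b)) :
  mC k D F1 -> mC k D F2 -> mC k D (fun p => col_mx (F1 p) (F2 p)).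
Proof.
move=> H1 H2 i j; case: (split_ordP i) => i' ->.
- by apply: (Ck_ext oD _ (H1 i' j)) => p _; rewrite col_mxEu.
- by apply: (Ck_ext oD _ (H2 i' j)) => p _; rewrite col_mxEd.
Qed.

Lemma mpd_col {a b c} i (F1 : 'rV[R]_m -> 'M[R]_(a, b)) (F2 : 'rV[R]_m -> 'M[R]_(c, b)) p :
  mpd i (fun p => col_mx (F1 p) (F2 p)) p = col_mx (mpd i F1 p) (mpd i F2 p).
Proof.
apply/matrixP => k l; rewrite [LHS]mxE; case: (split_ordP k) => k' ->.
- by rewrite col_mxEu mxE; congr (pd i _ p); apply/funext => q; rewrite col_mxEu.
- by rewrite col_mxEd mxE; congr (pd i _ p); apply/funext => q; rewrite col_mxEd.
Qed.
End BlockCalculus.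

Section LinearSystemUniqueness.
Context {R : realType} {m N : nat}.
Variables (p0 : 'rV[R]_m) (r : R) (r0 : 0 < r).
Local Notation B := (ball p0 r).

(** The factor on the right serves for the hermitian form in [tractor_frame], whose defect X
    satisfies dX = A X + X A^T. *)
Lemma linear_system_uniqueness (A A' : 'I_m -> 'rV[R]_m -> 'M[R]_N) (X : 'rV[R]_m -> 'M[R]_N) :
  (forall c, mC 0 B (A c)) -> (forall c, mC 0 B (A' c)) -> mC 1 B X -> X p0 = 0 ->
  (forall c x, B x -> mpd c X x = A c x *m X x + X x *m A' c x) ->
  exists s, 0 < s <= r /\ forall x, ball p0 s x -> X x = 0.
Proof.
move=> AC A'C XC X0 dX.
have r2 : r / 2 < r by rewrite ltr_pdivrMr // ltr_pMr // ltr1n.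
have r20 : 0 < r / 2 by rewrite divr_gt0.
have bnd (F : 'I_m -> 'rV[R]_m -> 'M[R]_N) : (forall c, mC 0 B (F c)) ->
    exists K : R, 0 <= K /\ forall c x i j, `|x - p0| <= r / 2 -> `|F c x i j| <= K.
  move=> FC; have h (aij : 'I_m * ('I_N * 'I_N)) : exists K : R, forall x, `|x - p0| <= r / 2 ->
      `|F aij.1 x aij.2.1 aij.2.2| <= K.
    by apply: (@bounded_subball _ _ p0 r (fun x => F aij.1 x aij.2.1 aij.2.2)) => //; exact: FC.
  exists (\sum_aij `|sval (cid (h aij))|); split; first by apply: sumr_ge0.
  move=> a x i j xs; have := svalP (cid (h (a, (i, j)))) x xs => /le_trans; apply.
  apply: (le_trans (ler_norm _)).
  by rewrite (bigD1 (a, (i, j))) //= lerDl; apply: sumr_ge0.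
have [K [K0 hK]] := bnd A AC; have [K' [K'0 hK']] := bnd A' A'C.
pose C := N%:R * (K + K'); have C0 : 0 <= C by rewrite mulr_ge0 ?addr_ge0.
pose Z := m%:R * C + 1; have Z0 : 0 < Z by rewrite ltr_wpDl // mulr_ge0.
pose s := Num.min (r / 4) (2 * Z)^-1.
have s0 : 0 < s by rewrite lt_min divr_gt0 //= invr_gt0 mulr_gt0.
have sr : s < r / 2.
  by apply: (le_lt_trans (y := r / 4)); [rewrite ge_min lexx|move: r0; lra].
exists s; split; first by rewrite s0 /=; apply: ltW; exact: lt_trans sr r2.
move=> x hx.
apply: (@linear_uniqueness _ _ p0 (r / 2) _ _ X C s C0 (ltW s0) sr) => //.
- have : s <= (2 * Z)^-1 by rewrite ge_min lexx orbT.
  rewrite -div1r ler_pdivlMr ?mulr_gt0 // => h; rewrite -/C.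
  have : m%:R * C * s = Z * s - s by rewrite /Z; ring.
  move: s0; nra.
- move=> i j; apply: (Ck_sub _ (XC i j)) => y; rewrite -!ball_normE /= => h; exact: lt_trans h r2.
- move=> y M By hM c i j; have By' : B y.
    by move: By; rewrite -!ball_normE /= => h; exact: lt_trans h r2.
  have -> : pd c (fun y => X y i j) y = mpd c X y i j by rewrite mxE.
  rewrite (dX c y By') addmxE !mxE; apply: (le_trans (ler_normD _ _)).
  have yr : `|y - p0| <= r / 2.
    by move: By; rewrite -!ball_normE /= distrC => /ltW.
  have le1 (f g : 'I_N -> R) (k l : R) : 0 <= k -> (forall q, `|f q| <= k) -> (forall q, `|g q| <= l) ->
      `|\sum_q f q * g q| <= N%:R * (k * l).
    move=> k0 hf hg; apply: (le_trans (ler_norm_sum _ _ _)).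
    apply: (le_trans (y := \sum_(q < N) k * l)); last by rewrite sumr_const card_ord (mulr_natl (k * l) N).
    by apply: ler_sum => q _; rewrite normrM; apply: ler_pM.
  have h1 := le1 (fun q => A c y i q) (fun q => X y q j) K M K0 (fun q => hK c y i q yr) (fun q => hM q j).
  have h2 := le1 (fun q => A' c y q j) (fun q => X y i q) K' M K'0 (fun q => hK' c y q j yr) (fun q => hM i q).
  have e2 : \sum_j0 X y i j0 * A' c y j0 j = \sum_q A' c y q j * X y i q.
    by apply: eq_bigr => q _; rewrite mulrC.
  rewrite e2 /C; apply: (le_trans (lerD h1 h2)); rewrite le_eqVlt; apply/orP; left; apply/eqP; ring.
by move: hx; rewrite -ball_normE /= distrC => /ltW.
Qed.
End LinearSystemUniqueness.

Section TractorBlocks.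
Context {R : realType} {m d : nat}.
Variables (G J A B X Y dJa dJb : 'M[R]_m) (ua ub dua dub : 'M[R]_(d, m)) (jm : 'M[R]_d).
Variables (s ea eb dab dba w : R).
Hypotheses (f1 : dub = dua + ua *m B - ub *m A) (fa : jm *m ua = ua *m J) (fb : jm *m ub = ub *m J)
  (ga : J *m G *m ua^T = G *m ua^T *m jm) (gb : J *m G *m ub^T = G *m ub^T *m jm)
  (f4 : ub *m G *m ua^T - ua *m G *m ub^T = w *: jm) (fd : dab = dba + s * w)
  (fJa : dJa = A *m J - J *m A) (fJb : dJb = B *m J - J *m B)
  (fR : X - Y + B *m A - A *m B + (s * w) *: J + s *: (G *m ua^T *m ub - G *m ub^T *m ua) = 0).

(** This and the next three are the blocks of the flatness equation [tr_flat]. The upper left one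
    expresses that eta is a potential of the multiple [Om] of the Kahler form, the upper right one
    the vanishing of the torsion together with J being parallel, the lower left one is its adjoint,
    and the lower right one is the curvature formula. *)
Lemma tractor_ul : dab *: jm - dba *: jm + ((eb *: jm) *m (ea *: jm) + ub *m (- s *: (G *m ua^T)))
  - ((ea *: jm) *m (eb *: jm) + ua *m (- s *: (G *m ub^T))) = 0.
Proof.
rewrite fd scalerDl -(scalerA s w) -f4 -!scalemxAl -!scalemxAr !mulmxA; mx_ring.
Qed.

Lemma tractor_ur : dub - dua + ((eb *: jm) *m ua + ub *m (A + ea *: J))
  - ((ea *: jm) *m ub + ua *m (B + eb *: J)) = 0.
Proof.
rewrite f1 -!scalemxAl fa fb !mulmxDr -!scalemxAr; mx_ring.
Qed.

Lemma tractor_dl : - s *: ((A *m G + G *m A^T) *m ub^T + G *m dub^T)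
  - - s *: ((B *m G + G *m B^T) *m ua^T + G *m dua^T)
  + ((- s *: (G *m ub^T)) *m (ea *: jm) + (B + eb *: J) *m (- s *: (G *m ua^T)))
  - ((- s *: (G *m ua^T)) *m (eb *: jm) + (A + ea *: J) *m (- s *: (G *m ub^T))) = 0.
Proof.
have -> : dub^T = dua^T + B^T *m ua^T - A^T *m ub^T.
  by rewrite f1 raddfB raddfD /= !trmx_mul.
rewrite !(mulmxDl, mulmxDr, mulmxN, mulNmx) -!scalemxAl -!scalemxAr !mulmxA ga gb; mx_ring.
Qed.

Lemma tractor_dr : (X + (dab *: J + eb *: dJa)) - (Y + (dba *: J + ea *: dJb))
  + ((- s *: (G *m ub^T)) *m ua + (B + eb *: J) *m (A + ea *: J))
  - ((- s *: (G *m ua^T)) *m ub + (A + ea *: J) *m (B + eb *: J)) = 0.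
Proof.
rewrite fd fJa fJb -fR !(mulmxDl, mulmxDr, mulmxN, mulNmx) -!scalemxAl -!scalemxAr.
mx_ring.
Qed.
End TractorBlocks.

Section Tractor.
Context {R : realType} {m : nat}.
Variables (p0 : 'rV[R]_m) (r : R) (r0 : 0 < r) (g : 'rV[R]_m -> 'M[R]_m).
Local Notation D := (ball p0 r).
Let oD : open (D : set 'rV[R]_m) := @open_B R m p0 r.
Hypotheses (gC : forall k, mC k D g) (gS : forall p, D p -> (g p)^T = g p)
  (gP : forall p v, D p -> v != 0 -> 0 < inner (g p) v v).
Implicit Types (p q x y z v w : 'rV[R]_m) (a b c i j : 'I_m).
Variables (J : 'rV[R]_m -> 'M[R]_m) (s : R).
Hypotheses (JC : forall k, mC k D J)
  (Jskew : forall p, D p -> forall x y, inner (g p) (x *m J p) y = - inner (g p) (y *m J p) x)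
  (JJ : forall p, D p -> J p *m J p = - 1%:M)
  (par : forall a p, D p -> cov g a J p = 0)
  (hR : forall p, D p -> forall a b,
     Rm g a b p = Fmx (g p) s (J p) (s / 2)%:M (basis_vec a) (basis_vec b)).

Let Om c b p : R := 2 * s * inner (g p) (basis_vec c *m J p) (basis_vec b).

Let dJ c q : D q -> mpd c J q = Gam g c q *m J q - J q *m Gam g c q.
Proof.
by move=> Dq; have := par c Dq; rewrite /cov => /eqP; rewrite subr_eq0 => /eqP <-; rewrite addrK.
Qed.

(** [Om] is closed because J is parallel. Its potential is the phase term of the connection: without
    it, the line spanned by z and iz would contribute the curvature [Om]. *)
Lemma kahler_potential : exists eta : 'I_m -> 'rV[R]_m -> R, (forall a, sm D (eta a)) /\
  forall c b x, D x -> pd c (eta b) x - pd b (eta c) x = Om c b x.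
Proof.
have cb v : mC 1 D (fun=> v : 'rV[R]_m) by exact: mC_cst.
have cJ v k : mC k D (fun q => v *m J q) by exact: (mC_mul oD (mC_cst D k v) (JC k)).
apply: (@poincare _ _ p0 r) => //.
- by move=> a b k; apply: (Ck_mul oD (Ck_cst k D _)); exact: (Ck_inner oD gC).
- by move=> a b x Dx; rewrite /Om (Jskew Dx) mulrN.
move=> a b c p Dp.
have E i j l : pd i (Om j l) p = 2 * s * (inner (g p) (basis_vec j *m Gam g i p *m J p) (basis_vec l)
    + inner (g p) (basis_vec j *m J p) (basis_vec l *m Gam g i p)).
  rewrite /Om pdM; [|exact: derivable_cst|exact: (Ck_der (Ck_inner oD gC _ (cJ _ 1%N)) Dp)].
  rewrite pd_cst mulr0 addr0 (pd_inner oD gC gS gP i Dp (cJ _ 1%N) (cb _)).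
  by rewrite (covr_mul oD g i _ Dp (JC 1)) par // mulmx0 add0r covr_cst.
have canc (k x1 x2 x3 x4 x5 x6 : R) : x1 = - x4 -> x5 = - x2 -> x3 = - x6 ->
    k * (x1 + x2) + k * (x3 + x4) + k * (x5 + x6) = 0 by move=> -> -> ->; ring.
rewrite (E a b c) (E b c a) (E c a b); apply: canc.
- by rewrite (Jskew Dp) (Gam_sym oD gS b a Dp).
- by rewrite (Jskew Dp) (Gam_sym oD gS a c Dp).
- by rewrite (Jskew Dp) (Gam_sym oD gS c b Dp).
Qed.

(* The rows of a solution Phi of d_a Phi = tr_A a Phi are z, iz and the image of
   the coordinate frame under dz modulo iz, for a horizontal map z to the
   quadric herm(z, z) = 1 of C^(n+1); tr_J is the multiplication by i and tr_H
   the hermitian form in this frame. *)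
Definition tr_j : 'M[R]_(1 + 1) := block_mx 0 1%:M (- 1%:M) 0.
Definition tr_u x p : 'M[R]_(1 + 1, m) := col_mx x (x *m J p).
Definition tr_J p : 'M[R]_((1 + 1) + m) := block_mx tr_j 0 0 (J p).
Definition tr_H p : 'M[R]_((1 + 1) + m) := block_mx 1%:M 0 0 (s *: g p).

Lemma tr_jT : tr_j^T = - tr_j.
Proof. by rewrite /tr_j tr_block_mx opp_block_mx !trmx0 linearN /= !trmx1 opprK oppr0. Qed.

Lemma tr_ju x p : D p -> tr_j *m tr_u x p = tr_u x p *m J p.
Proof.
move=> Dp; rewrite /tr_j /tr_u mul_block_col mul_col_mx !mul0mx mul1mx mulNmx mul1mx.
by rewrite add0r addr0 -mulmxA JJ // mulmxN mulmx1.
Qed.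

Lemma JG_skew p : D p -> J p *m g p = - (g p *m (J p)^T).
Proof.
move=> Dp; have := gS Dp; have := Jskew Dp; move: (g p) (J p) => G K hK Gs.
rewrite -[in RHS]Gs -trmx_mul; apply/matrixP => i j; have := hK (delta_mx 0 i) (delta_mx 0 j).
rewrite /inner -!(mulmxA _ K G) !trmx_delta -!rowE -!colE !mxE; exact.
Qed.

Lemma tr_jG x p : D p -> J p *m g p *m (tr_u x p)^T = g p *m (tr_u x p)^T *m tr_j.
Proof.
move=> Dp; rewrite JG_skew // mulNmx -!mulmxA -trmx_mul -tr_ju // trmx_mul tr_jT.
by rewrite !mulmxN opprK.
Qed.

Section WithPotential.
Variable eta : 'I_m -> 'rV[R]_m -> R.
Hypotheses (etaC : forall a k, Ck k D (eta a))
  (deta : forall c b x, D x -> pd c (eta b) x - pd b (eta c) x = Om c b x).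

(** The row of z reads d_a z = eta_a iz + e_a. The lower rows are the Gauss formula of the quadric:
    the Christoffel part, the phase part, and a component along z and iz with coefficient -s. *)
Definition tr_A a p : 'M[R]_((1 + 1) + m) :=
  block_mx (eta a p *: tr_j) (tr_u (basis_vec a) p)
    (- s *: (g p *m (tr_u (basis_vec a) p)^T)) (Gam g a p + eta a p *: J p).

Lemma tr_u_C k x : mC k D (tr_u x).
Proof. exact: (mC_col oD (mC_cst D k x) (mC_mul oD (mC_cst D k x) (JC k))). Qed.

Let uT_C k x : mC k D (fun p => - s *: (g p *m (tr_u x p)^T)).
Proof. exact: (mC_scale oD (Ck_cst k D (- s)) (mC_mul oD (gC k) (mC_tr oD (tr_u_C k x)))). Qed.

Lemma tr_A_C a k : mC k D (tr_A a).
Proof.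
apply: (mC_block oD (mC_scale oD (etaC a k) (mC_cst D k tr_j)) (tr_u_C k (basis_vec a)) (uT_C k _)).
exact: (mC_add oD (Gam_C oD gC gP k a) (mC_scale oD (etaC a k) (JC k))).
Qed.

Lemma mpd_tr_u a x p : D p -> mpd a (tr_u x) p = tr_u (x *m Gam g a p) p - tr_u x p *m Gam g a p.
Proof.
move=> Dp; rewrite /tr_u mpd_col mpd_cst (mpd_mul oD a Dp (mC_cst D 1 x) (JC 1)) mpd_cst mul0mx add0r.
rewrite (dJ a Dp) mul_col_mx opp_col_mx add_col_mx subrr mulmxBr !mulmxA //.
Qed.

Lemma tr_flat a b p : D p ->
  mpd a (tr_A b) p - mpd b (tr_A a) p + tr_A b p *m tr_A a p - tr_A a p *m tr_A b p = 0.
Proof.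
move=> Dp; have Gs := gS Dp.
have E i j : mpd i (tr_A j) p = block_mx (pd i (eta j) p *: tr_j) (mpd i (tr_u (basis_vec j)) p)
    (- s *: ((Gam g i p *m g p + g p *m (Gam g i p)^T) *m (tr_u (basis_vec j) p)^T
        + g p *m (mpd i (tr_u (basis_vec j)) p)^T))
    (mpd i (Gam g j) p + (pd i (eta j) p *: J p + eta j p *: mpd i J p)).
  rewrite /tr_A mpd_block; congr block_mx.
  - by rewrite (mpd_scale i Dp (etaC j 1) (mC_cst D 1 tr_j)) mpd_cst scaler0 addr0.
  - have hu := mC_tr oD (tr_u_C 1 (basis_vec j)).
    rewrite (mpd_scale i Dp (Ck_cst 1 D (- s)) (mC_mul oD (gC 1) hu)) pd_cst scale0r add0r.
    by rewrite (mpd_mul oD i Dp (gC 1) hu) mpd_tr (Gam_metric oD gS gP i Dp).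
  - rewrite (mpd_add i Dp (Gam_C oD gC gP 1 j) (mC_scale oD (etaC j 1) (JC 1))).
    by rewrite (mpd_scale i Dp (etaC j 1) (JC 1)).
rewrite !E /tr_A !mulmx_block !opp_block_mx !add_block_mx.
pose w := 2 * inner (g p) (basis_vec a *m J p) (basis_vec b).
have fd : pd a (eta b) p = pd b (eta a) p + s * w.
  have h := deta a b Dp; have -> : s * w = Om a b p by rewrite /w /Om; ring.
  by rewrite -h addrC subrK.
have f1 : mpd a (tr_u (basis_vec b)) p = mpd b (tr_u (basis_vec a)) p
    + tr_u (basis_vec a) p *m Gam g b p - tr_u (basis_vec b) p *m Gam g a p.
  by rewrite !mpd_tr_u // (Gam_sym oD gS a b Dp) subrK.
have sc (x y : 'rV[R]_m) : x *m g p *m y^T = (inner (g p) x y)%:M.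
  by apply/matrixP => i j; rewrite !ord1 [RHS]mxE eqxx mulr1n.
have f4 : tr_u (basis_vec b) p *m g p *m (tr_u (basis_vec a) p)^T
    - tr_u (basis_vec a) p *m g p *m (tr_u (basis_vec b) p)^T = w *: tr_j.
  rewrite /tr_u /tr_j !tr_col_mx !mul_col_mx !mul_mx_row !sc.
  rewrite -![col_mx (row_mx _ _) (row_mx _ _)]/(block_mx _ _ _ _) opp_block_mx add_block_mx scale_block_mx.
  have sM (k : R) : (k%:M : 'M[R]_1) 0 0 = k by rewrite mxE eqxx mulr1n.
  have e1 := innerC Gs (basis_vec b) (basis_vec a).
  have e2 := innerC Gs (basis_vec b) (basis_vec a *m J p).
  have e3 := innerC Gs (basis_vec a) (basis_vec b *m J p).
  have e4 := Jskew Dp (basis_vec b) (basis_vec a).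
  have e5 := innerJJ Gs (Jskew Dp) (JJ Dp) (basis_vec b) (basis_vec a).
  have e6 := innerJJ Gs (Jskew Dp) (JJ Dp) (basis_vec a) (basis_vec b).
  rewrite e5 e6 e2 e3 e1 e4 /w.
  by congr block_mx; apply/matrixP => i j; rewrite !ord1 ?(addmxE, oppmxE, scalemxE, zeromxE) !sM; ring.
have fR : mpd a (Gam g b) p - mpd b (Gam g a) p + Gam g b p *m Gam g a p - Gam g a p *m Gam g b p
    + (s * w) *: J p + s *: (g p *m (tr_u (basis_vec a) p)^T *m tr_u (basis_vec b) p
       - g p *m (tr_u (basis_vec b) p)^T *m tr_u (basis_vec a) p) = 0.
  rewrite -[_ - _ + _ - _]/(Rm g a b p) hR // /w.
  have hX x y : g p *m (tr_u x p)^T *m tr_u y p =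
      g p *m x^T *m y + g p *m (x *m J p)^T *m (y *m J p).
    by rewrite /tr_u tr_col_mx mul_mx_row mul_row_col.
  rewrite !hX; apply: mx_eq_mul => z.
  have m3 (F K X1 X2 Y1 Y2 : 'M[R]_m) k : z *m (F + k *: K + s *: (X1 + X2 - (Y1 + Y2))) =
      z *m F + k *: (z *m K) + s *: (z *m X1 + z *m X2 - (z *m Y1 + z *m Y2)).
    by rewrite !(mulmxDr, mulmxN) -!scalemxAr !(mulmxDr, mulmxN).
  rewrite m3 !mul_outer mulmx0 mul_Fmx // /wedge !mul_mx_scalar.
  have Z (c : R) (t t' : 'rV[R]_m) : inner (g p) (c *: t) t' = c * inner (g p) t t' by exact: innerZl.
  rewrite !Z !(innerC Gs z).
  by apply/rowP => i; rewrite ?(addmxE, oppmxE, scalemxE, zeromxE); field.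
have fa := tr_ju (basis_vec a) Dp; have fb := tr_ju (basis_vec b) Dp.
have ga := tr_jG (basis_vec a) Dp; have gb := tr_jG (basis_vec b) Dp.
rewrite -[RHS]block_mx0; congr block_mx.
- exact: (tractor_ul _ _ f4 fd).
- exact: (tractor_ur _ _ f1 fa fb).
- exact: (tractor_dl _ _ _ f1 ga gb).
- exact: (tractor_dr _ _ fd (dJ a Dp) (dJ b Dp) fR).
Qed.

Lemma tr_J_par a p : D p -> mpd a tr_J p = tr_A a p *m tr_J p - tr_J p *m tr_A a p.
Proof.
move=> Dp; rewrite /tr_J mpd_block !mpd_cst (dJ a Dp) /tr_A !mulmx_block opp_block_mx add_block_mx.
rewrite !mulmx0 !mul0mx !addr0 !add0r -scalemxAl -scalemxAr subrr tr_ju // subrr.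
rewrite -scalemxAl -scalemxAr mulmxA tr_jG // subrr; congr block_mx.
rewrite mulmxDl mulmxDr -scalemxAl -scalemxAr; mx_ring.
Qed.

Lemma tr_H_par a p : D p -> mpd a tr_H p = tr_A a p *m tr_H p + tr_H p *m (tr_A a p)^T.
Proof.
move=> Dp; have Gs := gS Dp; rewrite /tr_H mpd_block !mpd_cst.
rewrite (mpd_scale a Dp (Ck_cst 1 D s) (gC 1)) pd_cst scale0r add0r (Gam_metric oD gS gP a Dp).
rewrite /tr_A tr_block_mx !mulmx_block add_block_mx !mulmx0 !mul0mx !addr0 !add0r !mulmx1 !mul1mx.
have -> : (eta a p *: tr_j)^T = - (eta a p *: tr_j) by rewrite linearZ /= tr_jT scalerN.
have -> : (- s *: (g p *m (tr_u (basis_vec a) p)^T))^T = - s *: (tr_u (basis_vec a) p *m g p).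
  by rewrite linearZ /= trmx_mul trmxK Gs.
have -> : (Gam g a p + eta a p *: J p)^T = (Gam g a p)^T + eta a p *: (J p)^T.
  by rewrite linearD linearZ.
rewrite subrr -!scalemxAr -!scalemxAl -scalerDl subrr scale0r -scalerDl addNr scale0r; congr block_mx.
have := JG_skew Dp; move: (J p) (g p) (Gam g a p) (eta a p) => K G A e h.
rewrite mulmxDl mulmxDr -scalemxAl -scalemxAr h; mx_ring.
Qed.
End WithPotential.

(** [tr_J] and [tr_H] are parallel, so the defects X1 and X2 solve homogeneous linear systems and
    vanish at p0, hence on a smaller ball. *)
Theorem tractor_frame : exists t (Phi : 'rV[R]_m -> 'M[R]_((1 + 1) + m))
    (eta : 'I_m -> 'rV[R]_m -> R),
  0 < t <= r /\ [/\ forall k, mC k (ball p0 t) Phi, Phi p0 = 1%:M,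
   forall c x, ball p0 t x -> mpd c Phi x = tr_A eta c x *m Phi x,
   forall x, ball p0 t x -> tr_J x *m Phi x = Phi x *m tr_J p0 &
   forall x, ball p0 t x -> Phi x *m tr_H p0 *m (Phi x)^T = tr_H x].
Proof.
have [eta [etaC deta]] := kahler_potential.
have AC a k := tr_A_C etaC a k.
have [t1 [/andP[t10 t1r] [Phi [PC P0 dP]]]] := flat_system r0 AC (tr_flat etaC deta).
have sub1 : ball p0 t1 `<=` D by exact: le_ball.
have o1 : open (ball p0 t1 : set 'rV[R]_m) by exact: open_B.
have JJC k : mC k (ball p0 t1) tr_J.
  move=> i j; apply: (Ck_sub sub1); exact: (mC_block oD (mC_cst D k tr_j) (mC_cst D k 0) (mC_cst D k 0) (JC k) i j).
have HHC k : mC k (ball p0 t1) tr_H.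
  move=> i j; apply: (Ck_sub sub1).
  exact: (mC_block oD (mC_cst D k 1%:M) (mC_cst D k 0) (mC_cst D k 0) (mC_scale oD (Ck_cst k D s) (gC k)) i j).
have AC1 a k : mC k (ball p0 t1) (tr_A eta a) by move=> i j; apply: (Ck_sub sub1); exact: AC.
have AT1 a k : mC k (ball p0 t1) (fun x => (tr_A eta a x)^T) by exact: (mC_tr o1 (AC1 a k)).
have z1 k : mC k (ball p0 t1) (fun=> 0 : 'M[R]_((1 + 1) + m)) by exact: mC_cst.
have PT k := mC_tr o1 (PC k).
have cst (M : 'M[R]_((1 + 1) + m)) k := mC_cst (ball p0 t1 : set 'rV[R]_m) k M.
pose X1 x := tr_J x *m Phi x - Phi x *m tr_J p0.
have X1C : mC 1 (ball p0 t1) X1.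
  exact: (mC_sub o1 (mC_mul o1 (JJC 1) (PC 1)) (mC_mul o1 (PC 1) (cst (tr_J p0) 1))).
have [||t2 [/andP[t20 t21] h2]] := linear_system_uniqueness t10 (fun c => AC1 c 0) (fun=> z1 0) X1C.
- by rewrite /X1 P0 mulmx1 mul1mx subrr.
- move=> c x Bx; have Dx := sub1 _ Bx.
  rewrite /X1 (mpd_sub o1 c Bx (mC_mul o1 (JJC 1) (PC 1)) (mC_mul o1 (PC 1) (cst (tr_J p0) 1))).
  rewrite (mpd_mul o1 c Bx (JJC 1) (PC 1)) (mpd_mul o1 c Bx (PC 1) (cst _ 1)) mpd_cst !mulmx0 !addr0.
  rewrite dP // (tr_J_par eta c Dx).
  move: (tr_J x) (tr_J p0) (tr_A eta c x) (Phi x) => K K0 A P.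
  rewrite !(mulmxDl, mulmxDr, mulNmx, mulmxN, mulmxA); mx_ring.
pose X2 x := Phi x *m tr_H p0 *m (Phi x)^T - tr_H x.
have PH k := mC_mul o1 (PC k) (cst (tr_H p0) k).
have X2C : mC 1 (ball p0 t1) X2.
  exact: (mC_sub o1 (mC_mul o1 (PH 1) (PT 1)) (HHC 1)).
have [||t3 [/andP[t30 t31] h3]] := linear_system_uniqueness t10 (fun c => AC1 c 0) (fun c => AT1 c 0) X2C.
- by rewrite /X2 P0 trmx1 mulmx1 mul1mx subrr.
- move=> c x Bx; have Dx := sub1 _ Bx.
  rewrite /X2 (mpd_sub o1 c Bx (mC_mul o1 (PH 1) (PT 1)) (HHC 1)).
  rewrite (mpd_mul o1 c Bx (PH 1) (PT 1)) (mpd_mul o1 c Bx (PC 1) (cst _ 1)) mpd_cst !mulmx0 !addr0.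
  rewrite mpd_tr dP // (tr_H_par eta c Dx) trmx_mul.
  move: (tr_H x) (tr_H p0) (tr_A eta c x) (Phi x) => K K0 A P.
  rewrite !(mulmxDl, mulmxDr, mulNmx, mulmxN, mulmxA); mx_ring.
have t23 : 0 < Num.min t2 t3 by rewrite lt_min t20.
have le2 : Num.min t2 t3 <= t2 by rewrite ge_min lexx.
have le3 : Num.min t2 t3 <= t3 by rewrite ge_min lexx orbT.
exists (Num.min t2 t3), Phi, eta; split; first by rewrite t23 (le_trans le2) // (le_trans t21).
split=> // [k i j|c x Bx|x Bx|x Bx].
- by apply: (Ck_sub _ (PC k i j)); apply: le_ball; exact: le_trans t21.
- by apply: dP; apply: le_ball Bx; exact: le_trans t21.
- by apply/eqP; rewrite -subr_eq0; apply/eqP; apply: (h2 x); exact: le_ball le2 _ Bx.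
- by apply/eqP; rewrite -subr_eq0; apply/eqP; apply: (h3 x); exact: le_ball le3 _ Bx.
Qed.
End Tractor.

(** * The locally conformal Kahler metric of constant holomorphic curvature *)

Section ConformalKahler.
Context {R : realType} {m : nat}.
Variables (D : set 'rV[R]_m) (oD : open D) (g : 'rV[R]_m -> 'M[R]_m).
Hypotheses (gC : forall k, mC k D g) (gS : forall p, D p -> (g p)^T = g p)
  (gP : forall p v, D p -> v != 0 -> 0 < inner (g p) v v).
Implicit Types (p q x y z v w : 'rV[R]_m).
Hypothesis m8 : (8 <= m)%N.
Hypothesis two : forall p, D p -> exists a b : R, a != b /\ forall x, unit_vec g p x ->
    multiplicity (reduced_conf_jacobi g p x) a = 1%N /\
    multiplicity (reduced_conf_jacobi g p x) b = (m - 2)%N.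

Theorem conformal_kahler p0 : D p0 -> exists (r s : R) (al : 'rV[R]_m -> R) (J : 'rV[R]_m -> 'M[R]_m),
  let G p := al p *: g p in
  [/\ 0 < r, ball p0 r `<=` D, s = 1 \/ s = -1, forall k, Ck k (ball p0 r) al &
      forall k, mC k (ball p0 r) J] /\
  [/\ forall p, ball p0 r p -> 0 < al p,
      forall p, ball p0 r p -> forall x y, inner (G p) (x *m J p) y = - inner (G p) (y *m J p) x,
      forall p, ball p0 r p -> J p *m J p = - 1%:M,
      forall a p, ball p0 r p -> cov G a J p = 0 &
      forall p, ball p0 r p -> forall a b,
        Rm G a b p = Fmx (G p) s (J p) (s / 2)%:M (basis_vec a) (basis_vec b)].
Proof.
move=> Dp0.
have [D1 [lam [mu [J [s [[oD1 D1p sub1] [[lC mC' JC hs] H]]]]]]] := weyl_normal_form oD gC gS gP m8 two Dp0.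
have [r r0 rD] : exists2 r : R, 0 < r & ball p0 r `<=` D1.
  by have /nbhs_ballP[r r0 h] := open_nbhs_nbhs (conj oD1 D1p); exists r.
pose B : set 'rV[R]_m := ball p0 r; have oB : open B by exact: open_B.
have subB : B `<=` D by move=> p /rD /sub1.
have gC1 k : mC k B g by move=> i j; exact: (Ck_sub subB (gC k i j)).
have gS1 p : B p -> (g p)^T = g p by move=> Bp; apply: gS; exact: subB.
have gP1 p v : B p -> v != 0 -> 0 < inner (g p) v v by move=> Bp; apply: gP; exact: subB.
have JC1 k : mC k B J by move=> i j; exact: (Ck_sub rD (JC k i j)).
(* This is |lam|. Since s^2 = 1, lam times the operator R_J of g is s times the operator R_J of al
   g. *)
pose al p := s * lam p.
have alC k : Ck k B al by exact: (Ck_mul oB (Ck_cst k B s) (Ck_sub rD (lC k))).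
have al0 p : B p -> 0 < al p by move=> /rD/H[].
have ss : s * s = 1 by case: hs => ->; rewrite ?mulrNN mulr1.
have sN : s != 0 by case: hs => ->; rewrite ?oppr_eq0 oner_eq0.
pose G p := al p *: g p.
have GC k : mC k B G := conf_C oB gC1 alC k.
have GS p : B p -> (G p)^T = G p := conf_sym gS1 al (p := p).
have GP p v : B p -> v != 0 -> 0 < inner (G p) v v := conf_pos gP1 al0 (p := p) (v := v).
have JJ p : B p -> J p *m J p = - 1%:M by move=> /rD/H[].
have Jskew p : B p -> forall x y, inner (g p) (x *m J p) y = - inner (g p) (y *m J p) x by move=> /rD/H[].
have JskewG p : B p -> forall x y, inner (G p) (x *m J p) y = - inner (G p) (y *m J p) x.
  by move=> Bp x y; rewrite !conf_inner Jskew // mulrN.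
pose V := conf_V g al.
have VC k : mC k B V := conf_V_C oB gC1 gP1 alC al0 k.
(* All parts of the curvature other than R_J: mu R_0 is the wedge with mu/2, the Weyl tensor differs
   from the curvature by [schouten], and the conformal change contributes -V. The factor 1/al passes
   from the wedge for g to that for G. *)
pose Q p := (al p)^-1 *: ((mu p / 2)%:M - schouten g p - V p).
have QC k : mC k B Q.
  have aV : Ck k B (fun p => (al p)^-1) := Ck_inv oB (fun p Bp => lt0r_neq0 (al0 p Bp)) (alC k).
  apply: (mC_scale oB aV (mC_sub oB (mC_sub oB _ (schouten_C oB gC1 gS1 gP1 k)) (VC k))) => i j.
  have hm := Ck_mul oB (Ck_mul oB (Ck_sub rD (mC' k)) (Ck_cst k B 2^-1)) (Ck_cst k B (i == j)%:R).
  by apply: (Ck_ext oB _ hm) => p Bp; rewrite [RHS]mxE mulr_natr.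
have hR p : B p -> forall a b, Rm G a b p = Fmx (G p) s (J p) (Q p) (basis_vec a) (basis_vec b).
  move=> Bp a b; have Gs := gS1 p Bp; have GGs := GS p Bp; have Gp v := @gP1 p v Bp.
  rewrite /G (Rm_conf oB gC1 gS1 gP1 alC al0 a b Bp) -/(G p).
  apply: mx_eq_mul => z; rewrite mul_Fmx //.
  have m2 (X Y : 'M[R]_m) : z *m (X + Y) = z *m X + z *m Y by exact: mulmxDr.
  rewrite m2 mul_wmx // -RV_basis -(curvE oB gC1 gP1) //.
  move: (basis_vec a : 'rV[R]_m) (basis_vec b : 'rV[R]_m) => x y.
  have hw : weyl g p x y z = mu p *: (inner (g p) y z *: x - inner (g p) x z *: y)
     + lam p *: (inner (g p) (y *m J p) z *: (x *m J p) - inner (g p) (x *m J p) z *: (y *m J p)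
        - (2 * inner (g p) (x *m J p) y) *: (z *m J p)).
    apply: (inner_eq Gp) => t; have [_ _ _ ->] := H p (rD p Bp); rewrite /R0 /RJ.
    by rewrite !(innerDl, innerNl, innerZl).
  have -> : curv g p x y z = weyl g p x y z - wedge (g p) (schouten g p) x y z by rewrite weylE addrK.
  have aN : al p != 0 by rewrite gt_eqF // al0.
  have lE : lam p = s * al p by rewrite /al mulrA ss mul1r.
  rewrite hw lE -/(V p) /Q; move: (schouten g p) (V p) (mu p) => S W u.
  have WG (M : 'M[R]_m) : wedge (G p) ((al p)^-1 *: M) x y z = wedge (g p) M x y z.
    rewrite /wedge !conf_inner -!scalemxAr !innerZl.
    apply/rowP => i; rewrite ?(addmxE, oppmxE, scalemxE); by field.
  rewrite WG !conf_inner; have Z (c : R) (t t' : 'rV[R]_m) : inner (g p) (c *: t) t' = c * inner (g p) t t' by exact: innerZl.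
  rewrite /wedge !mulmxN !mulmxBr !mul_mx_scalar !(innerBl, innerNl) !Z.
  by apply/rowP => i; rewrite ?(addmxE, oppmxE, scalemxE); field.
exists r, s, al, J; split; first by split.
have hQ p (Bp : B p) := Q_eq oB GC GS GP JC1 QC JskewG JJ sN m8 hR Bp.
split=> //.
- by move=> a p Bp; exact: (parallel_J oB GC GS GP JC1 QC JskewG JJ sN m8 hR).
- by move=> p Bp a b; rewrite -(hQ p Bp); exact: hR.
Qed.
End ConformalKahler.

(** * Complex coordinates *)

Section ComplexCoordinates.
Context {R : realType} {n : nat}.
Implicit Types (s : R) (u v z : 'rV[R]_((1 + 1) + (n + n))).

(* The real coordinates of a vector of C^(n+1) are ordered as Re z_0, Im z_0, the
   other real parts, the other imaginary parts. *)
Definition toC u : 'rV[R[i]]_n.+1 :=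
  \row_k (if unlift ord0 k is Some j
          then (u 0 (rshift (1 + 1) (lshift n j)) +i* u 0 (rshift (1 + 1) (rshift n j)))%C
          else (u 0 (lshift (n + n) (lshift 1 0)) +i* u 0 (lshift (n + n) (rshift 1 0)))%C).

Definition cx_J : 'M[R]_((1 + 1) + (n + n)) :=
  block_mx tr_j 0 0 (block_mx 0 1%:M (- 1%:M) 0).

Definition hre s u v : R :=
  u 0 (lshift (n + n) (lshift 1 0)) * v 0 (lshift (n + n) (lshift 1 0))
  + u 0 (lshift (n + n) (rshift 1 0)) * v 0 (lshift (n + n) (rshift 1 0))
  + s * \sum_k (u 0 (rshift (1 + 1) (lshift n k)) * v 0 (rshift (1 + 1) (lshift n k))
     + u 0 (rshift (1 + 1) (rshift n k)) * v 0 (rshift (1 + 1) (rshift n k))).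

Lemma mul_cx_J u : [/\ (u *m cx_J) 0 (lshift (n + n) (lshift 1 0)) = - u 0 (lshift (n + n) (rshift 1 0)),
   (u *m cx_J) 0 (lshift (n + n) (rshift 1 0)) = u 0 (lshift (n + n) (lshift 1 0)),
   forall k, (u *m cx_J) 0 (rshift (1 + 1) (lshift n k)) = - u 0 (rshift (1 + 1) (rshift n k)) &
   forall k, (u *m cx_J) 0 (rshift (1 + 1) (rshift n k)) = u 0 (rshift (1 + 1) (lshift n k))].
Proof.
rewrite -[u]hsubmxK -[lsubmx u]hsubmxK -[rsubmx u]hsubmxK.
move: (lsubmx (lsubmx u)) (rsubmx (lsubmx u)) (lsubmx (rsubmx u)) (rsubmx (rsubmx u)) => a b c d.
rewrite /cx_J /tr_j !mul_row_block !mulmx0 !mulmx1 !mulmxN !mulmx1 !addr0 !add0r.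
split=> [||k|k]; rewrite ?row_mxEl ?row_mxEr ?row_mxEl ?row_mxEr ?oppmxE //.
Qed.

(** The imaginary part of a hermitian form is, up to sign, its real part after multiplying one
    argument by i, which is [cx_J] in real coordinates. *)
Lemma herm_toC s u v : herm s (toC u) (toC v) = (hre s u v +i* (- hre s (u *m cx_J) v))%C.
Proof.
have [e1 e2 e3 e4] := mul_cx_J u.
rewrite /herm /hre e1 e2 !mxE unlift_none.
under eq_bigr => k _ do rewrite !mxE liftK.
under [X in (_ +i* - (_ + _ * X))%C]eq_bigr => k _ do rewrite e3 e4.
have S (f h f' h' : 'I_n -> R) : \sum_k ((f k +i* h k)%C * conjc (f' k +i* h' k)%C) =
    ((\sum_k (f k * f' k + h k * h' k)) +i* (- \sum_k (- h k * f' k + f k * h' k)))%C.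
  elim/big_rec3: _ => [|k x y z _ ->]; first by rewrite oppr0.
  by apply/eqP; rewrite eq_complex /=; apply/andP; split; apply/eqP; ring.
rewrite S; apply/eqP; rewrite eq_complex /=; apply/andP; split; apply/eqP; ring.
Qed.

Lemma hreE s u v : hre s u v = (u *m block_mx 1%:M 0 0 (s%:M : 'M[R]_(n + n)) *m v^T) 0 0.
Proof.
rewrite /hre -[u]hsubmxK -[v]hsubmxK -[lsubmx u]hsubmxK -[rsubmx u]hsubmxK.
rewrite -[lsubmx v]hsubmxK -[rsubmx v]hsubmxK.
move: (lsubmx (lsubmx u)) (rsubmx (lsubmx u)) (lsubmx (rsubmx u)) (rsubmx (rsubmx u)) => a b c d.
move: (lsubmx (lsubmx v)) (rsubmx (lsubmx v)) (lsubmx (rsubmx v)) (rsubmx (rsubmx v)) => a' b' c' d'.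
rewrite mul_row_block !mulmx0 mulmx1 addr0 add0r mul_mx_scalar !tr_row_mx mul_row_col.
rewrite mul_row_col -scalemxAl mul_row_col addmxE addmxE scalemxE addmxE.
rewrite !(row_mxEl, row_mxEr); congr (_ + _ + _ * _).
- by rewrite mxE big_ord1 mxE.
- by rewrite mxE big_ord1 mxE.
rewrite big_split /=; congr (_ + _); rewrite mxE; apply: eq_bigr => k _;
 by rewrite !(row_mxEl, row_mxEr) mxE.
Qed.
End ComplexCoordinates.

(** * Homogeneous coordinates of the local isometry *)

Section LocalModel.
Context {R : realType} {n : nat}.
Local Notation m := (n + n)%N.
Variables (D : set 'rV[R]_m) (oD : open D) (g : 'rV[R]_m -> 'M[R]_m).
Hypotheses (gC : forall k, mC k D g) (gS : forall p, D p -> (g p)^T = g p)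
  (gP : forall p v, D p -> v != 0 -> 0 < inner (g p) v v).
Hypothesis m8 : (8 <= m)%N.
Hypothesis two : forall p, D p -> exists a b : R, a != b /\ forall x, unit_vec g p x ->
    multiplicity (reduced_conf_jacobi g p x) a = 1%N /\
    multiplicity (reduced_conf_jacobi g p x) b = (m - 2)%N.

Theorem local_model p0 : D p0 -> exists (r s : R) (al : 'rV[R]_m -> R) (Z : 'rV[R]_m -> 'rV[R]_((1 + 1) + m)),
  [/\ 0 < r, ball p0 r `<=` D, s = 1 \/ s = -1, forall k, Ck k (ball p0 r) al &
      forall k, mC k (ball p0 r) Z] /\
  [/\ forall p, ball p0 r p -> 0 < al p,
      Z p0 = delta_mx 0 (lshift m (lshift 1 0)),
      forall p, ball p0 r p -> herm s (toC (Z p)) (toC (Z p)) = 1 &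
      forall p, ball p0 r p -> forall a b,
        line_metric s (toC (Z p)) (toC (mpd a Z p)) (toC (mpd b Z p)) = al p * g p a b].
Proof.
move=> Dp0.
have [r [s [al [J]]]] := conformal_kahler oD gC gS gP m8 two Dp0.
set G := fun p => al p *: g p.
move=> [[r0 rD hs alC JC] [al0 Jskew JJ par hR]].
pose B : set 'rV[R]_m := ball p0 r; have oB : open B by exact: open_B.
have gC1 k : mC k B g by move=> i j; exact: (Ck_sub rD (gC k i j)).
have gS1 p : B p -> (g p)^T = g p by move=> Bp; apply: gS; exact: rD.
have gP1 p v : B p -> v != 0 -> 0 < inner (g p) v v by move=> Bp; apply: gP; exact: rD.
have GC k : mC k B G := conf_C oB gC1 alC k.
have GS p : B p -> (G p)^T = G p := conf_sym gS1 al (p := p).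
have GP p v : B p -> v != 0 -> 0 < inner (G p) v v := conf_pos gP1 al0 (p := p) (v := v).
have ss : s * s = 1 by case: hs => ->; rewrite ?mulrNN mulr1.
have [t [Phi [eta [/andP[t0 tr] [PC P0 dP hJ hH]]]]] := tractor_frame r0 GC GS GP JC Jskew JJ par hR.
have Bp0 : B p0 by exact: ballxx.
have [U [UG UJ]] := unitary_basis (GS _ Bp0) (fun v => @GP p0 v Bp0) (Jskew _ Bp0) (JJ _ Bp0).
have UU : U \in unitmx by have /mulmx1_unit[] := UG; rewrite unitmx_mul => /andP[].
(* A unitary basis at p0 identifies the frame at p0, with its complex structure and hermitian form,
   with the standard C^(n+1). *)
pose M : 'M[R]_((1 + 1) + m) := block_mx 1%:M 0 0 (invmx U).
pose Psi p := Phi p *m M.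
pose H' : 'M[R]_((1 + 1) + m) := block_mx 1%:M 0 0 (s%:M).
have MJ : tr_J J p0 *m M = M *m cx_J.
  rewrite /tr_J /M /cx_J !mulmx_block !mulmx0 !mul0mx !mulmx1 !mul1mx !addr0 !add0r; congr block_mx.
  apply: (can_inj (mulKmx UU)); rewrite !mulmxA mulmxV // mul1mx UJ -mulmxA mulmxV // mulmx1 //.
have MH : M *m H' *m M^T = tr_H G s p0.
  rewrite /tr_H /M /H' tr_block_mx !mulmx_block !trmx0 !trmx1 !mulmx0 !mul0mx !mulmx1 !addr0 !add0r.
  rewrite mul0mx; congr block_mx; rewrite mul_mx_scalar -scalemxAl; congr (_ *: _).
  have UT : U^T \in unitmx by rewrite unitmx_tr.
  apply: (can_inj (mulKmx UU)); apply: (can_inj (mulmxK UT)).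
  by rewrite UG !mulmxA mulmxV // mul1mx -trmx_mul mulmxV // trmx1.
have sub1 : ball p0 t `<=` B by exact: le_ball.
have hPJ p : ball p0 t p -> tr_J J p *m Psi p = Psi p *m cx_J.
  by move=> Bp; rewrite /Psi mulmxA hJ // -!mulmxA MJ.
have hPH p : ball p0 t p -> Psi p *m H' *m (Psi p)^T = tr_H G s p.
  by move=> Bp; rewrite /Psi trmx_mul !mulmxA -(mulmxA _ M H') -(mulmxA _ (M *m H')) MH hH.
pose e0 : 'rV[R]_((1 + 1) + m) := row_mx (row_mx 1%:M 0) 0.
pose e1 : 'rV[R]_((1 + 1) + m) := row_mx (row_mx 0 1%:M) 0.
pose E (x : 'rV[R]_m) : 'rV[R]_((1 + 1) + m) := row_mx 0 x.
pose Z p := e0 *m Psi p.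
have ot : open (ball p0 t : set 'rV[R]_m) by exact: open_B.
have PsC k : mC k (ball p0 t) Psi by exact: (mC_mul ot (PC k) (mC_cst _ k M)).
have e0J p : e0 *m tr_J J p = e1.
  by rewrite /e0 /e1 /tr_J /tr_j !(mul_row_block, mulmx0, mul0mx, mul1mx, mulmx1, addr0, add0r).
have e1J p : e1 *m tr_J J p = - e0.
  rewrite /e0 /e1 /tr_J /tr_j !(mul_row_block, mulmx0, mul0mx, mul1mx, mulmx1, addr0, add0r).
  by rewrite !opp_row_mx !oppr0.
have EJ p x : E x *m tr_J J p = E (x *m J p).
  by rewrite /E /tr_J !(mul_row_block, mulmx0, mul0mx, mul1mx, mulmx1, addr0, add0r).
have hh p u v : ball p0 t p -> hre s (u *m Psi p) (v *m Psi p) = (u *m tr_H G s p *m v^T) 0 0.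
  by move=> Bp; rewrite hreE -/H' -hPH // trmx_mul !mulmxA.
have HZ p : e0 *m tr_H G s p = e0.
  by rewrite /e0 /tr_H !(mul_row_block, mulmx0, mul0mx, mul1mx, mulmx1, addr0, add0r).
have HZ1 p : e1 *m tr_H G s p = e1.
  by rewrite /e1 /tr_H !(mul_row_block, mulmx0, mul0mx, mul1mx, mulmx1, addr0, add0r).
have HE p x : E x *m tr_H G s p = E (s *: (x *m G p)).
  by rewrite /E /tr_H !(mul_row_block, mulmx0, mul0mx, mul1mx, mulmx1, addr0, add0r) scalemxAr.
have d00 : (e0 *m e0^T) 0 0 = 1.
  by rewrite /e0 !(tr_row_mx, mul_row_col, trmx0, trmx1, mulmx0, mul0mx, mulmx1, addr0, add0r) mxE.
have d11 : (e1 *m e1^T) 0 0 = 1.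
  by rewrite /e1 !(tr_row_mx, mul_row_col, trmx0, trmx1, mulmx0, mul0mx, mulmx1, addr0, add0r) mxE.
have d10 : (e1 *m e0^T) 0 0 = 0.
  by rewrite /e0 /e1 !(tr_row_mx, mul_row_col, trmx0, trmx1, mulmx0, mul0mx, mulmx1, addr0, add0r) mxE.
have d01 : (e0 *m e1^T) 0 0 = 0.
  by rewrite /e0 /e1 !(tr_row_mx, mul_row_col, trmx0, trmx1, mulmx0, mul0mx, mulmx1, addr0, add0r) mxE.
have dE0 x : (E x *m e0^T) 0 0 = 0.
  by rewrite /E /e0 !(tr_row_mx, mul_row_col, trmx0, trmx1, mulmx0, mul0mx, mulmx1, addr0, add0r) mxE.
have dE1 x : (E x *m e1^T) 0 0 = 0.
  by rewrite /E /e1 !(tr_row_mx, mul_row_col, trmx0, trmx1, mulmx0, mul0mx, mulmx1, addr0, add0r) mxE.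
have d0E x : (e0 *m (E x)^T) 0 0 = 0.
  by rewrite /E /e0 !(tr_row_mx, mul_row_col, trmx0, trmx1, mulmx0, mul0mx, mulmx1, addr0, add0r) mxE.
have d1E x : (e1 *m (E x)^T) 0 0 = 0.
  by rewrite /E /e1 !(tr_row_mx, mul_row_col, trmx0, trmx1, mulmx0, mul0mx, mulmx1, addr0, add0r) mxE.
have dEE x y : (E x *m (E y)^T) 0 0 = (x *m y^T) 0 0.
  by rewrite /E !(tr_row_mx, mul_row_col, trmx0, trmx1, mulmx0, mul0mx, mulmx1, addr0, add0r).
have dZ a p : ball p0 t p -> mpd a Z p = (eta a p *: e1 + E (basis_vec a)) *m Psi p.
  move=> Bp; rewrite /Z (mpd_mul ot a Bp (mC_cst _ 1 e0) (PsC 1)) mpd_cst mul0mx add0r.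
  rewrite /Psi (mpd_mul ot a Bp (PC 1) (mC_cst _ 1 M)) mpd_cst mulmx0 addr0 dP // !mulmxA.
  congr (_ *m _ *m _); rewrite /e0 /tr_A /e1 /E /tr_u /tr_j !((mul_row_block, mulmx0, mul0mx, mul1mx, mulmx1, addr0, add0r), mul_row_col).
  rewrite -scalemxAr !(mul_row_block, mulmx0, mul0mx, mul1mx, mulmx1, addr0, add0r).
  by rewrite [in RHS]scale_row_mx scaler0 add_row_mx addr0 add0r.
exists t, s, al, Z; split.
  split=> //; first by move=> p /sub1/rD.
    by move=> k; exact: (Ck_sub sub1 (alC k)).
  by move=> k; exact: (mC_mul ot (mC_cst _ k e0) (PsC k)).
split.
- by move=> p /sub1/al0.
- rewrite /Z /Psi P0 mul1mx /e0 /M !(mul_row_block, mulmx0, mul0mx, mul1mx, mulmx1, addr0, add0r).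
  apply/rowP => j; case: (split_ordP j) => j' ->; rewrite ?row_mxEl ?row_mxEr.
    by case: (split_ordP j') => k ->; rewrite ?row_mxEl ?row_mxEr !ord1 [RHS]mxE -val_eqE ?mxE //=.
  by rewrite [RHS]mxE mxE eq_rlshift.
- move=> p Bp; rewrite herm_toC /Z hh // HZ d00 -mulmxA -hPJ // mulmxA e0J hh // HZ1 d10 oppr0 //.
move=> p Bp a b; rewrite /line_metric !dZ // !herm_toC /Z.
set u := eta a p *: e1 + E (basis_vec a); set v := eta b p *: e1 + E (basis_vec b).
have cJ w : w *m Psi p *m cx_J = w *m tr_J J p *m Psi p by rewrite -mulmxA -hPJ // mulmxA.
have uH w : u *m tr_H G s p *m w^T = eta a p *: (e1 *m w^T) + E (s *: (basis_vec a *m G p)) *m w^T.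
  by rewrite /u !mulmxDl -!scalemxAl HZ1 HE.
have h1 : (u *m tr_H G s p *m v^T) 0 0 = eta a p * eta b p + s * G p a b.
  rewrite uH /v linearD linearZ /= !mulmxDr -!scalemxAr !addmxE !scalemxE !addmxE !scalemxE.
  rewrite d11 d1E dE1 dEE mulr1 !mulr0 add0r addr0; congr (_ + _).
  by rewrite -scalemxAl scalemxE /basis_vec trmx_delta -rowE -colE !mxE.
have h2 : (u *m tr_H G s p *m e0^T) 0 0 = 0.
  by rewrite uH addmxE scalemxE d10 dE0 mulr0 addr0.
have h3 : (u *m tr_J J p *m tr_H G s p *m e0^T) 0 0 = - eta a p.
  rewrite /u mulmxDl -scalemxAl e1J EJ !mulmxDl HE -!scalemxAl !mulNmx HZ addmxE scalemxE oppmxE d00 dE0.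
  by rewrite addr0 mulrN1.
have h4 : (e0 *m tr_H G s p *m v^T) 0 0 = 0.
  by rewrite HZ /v linearD linearZ /= mulmxDr -scalemxAr addmxE scalemxE d01 d0E mulr0 addr0.
have h5 : (e0 *m tr_J J p *m tr_H G s p *m v^T) 0 0 = eta b p.
  by rewrite e0J HZ1 /v linearD linearZ /= mulmxDr -scalemxAr addmxE scalemxE d11 d1E mulr1 addr0.
(* The product of eta_a and eta_b occurs in herm(u, v) and in herm(u, z) herm(z, v) and cancels:
   projecting off z removes the phase. What remains is s^2 G. *)
rewrite !cJ !hh // h1 h2 h3 h4 h5 HZ d00 e0J HZ1 d10 /G scalemxE /= oppr0.
rewrite expr1n divr1; move: ss; move: (g p a b) (al p) (eta a p) (eta b p) => x y z w ss.
transitivity ((s * s) * (y * x)); last by rewrite ss mul1r.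
ring.
Qed.
End LocalModel.

Section JacobianMatrix.
Context {R : realType} {m n : nat}.
Implicit Types (f : 'rV[R]_m -> 'rV[R]_n).

Definition jacm f p : 'M[R]_(m, n) := \matrix_(i, j) pd i (fun q => f q 0 j) p.

Lemma row_jacm f i p : row i (jacm f p) = mpd i f p.
Proof. by apply/rowP => j; rewrite !mxE. Qed.

Lemma jacobian_jacm (D : set 'rV[R]_m) f p : open D -> D p -> mC 1 D f -> jacobian f p = jacm f p.
Proof.
move=> oD Dp fC.
have df : differentiable f p.
  have -> : f = \sum_j (fun q => f q 0 j *: (delta_mx 0 j : 'rV[R]_n)).
    by apply/funext => q; rewrite fct_sumE [LHS](row_sum_delta (f q)).
  apply: differentiable_sum => j; apply: differentiableZl.
  by have [] := Ck1_diff oD Dp (fC 0 j).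
apply/row_matrixP => i; rewrite rowE -[delta_mx 0 i]/(basis_vec i) -deriveEjacobian //.
have H : is_derive p (basis_vec i) f (row i (jacm f p)).
  apply: is_derive_mx => k.
  have -> : row i (jacm f p) 0 k = \sum_l (basis_vec i : 'rV[R]_m) 0 l * pd l (fun q => f q 0 k) p.
    rewrite [LHS]mxE [LHS]mxE (bigD1 i) //= /basis_vec mxE !eqxx mul1r big1 ?addr0 // => l li.
    by rewrite mxE /= (negPf li) mul0r.
  exact: (Ck1_is_derive (basis_vec i) oD Dp (fC 0 k)).
by case: H.
Qed.
End JacobianMatrix.

Lemma jacm_comp {R : realType} {m n l : nat} (f : 'rV[R]_n -> 'rV[R]_l) (h : 'rV[R]_m -> 'rV[R]_n)
    (D : set 'rV[R]_n) (E : set 'rV[R]_m) p :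
  open D -> mC 1 D f -> E p -> D (h p) -> mC 1 E h ->
  jacm (fun q => f (h q)) p = jacm h p *m jacm f (h p).
Proof.
move=> oD fC Ep Dhp hC; apply/matrixP => i j; rewrite !mxE.
have [_ H] := @pd_comp R n m (fun q => f q 0 j) h D E i p oD (fC 0 j) Ep Dhp (fun k => hC 0 k).
rewrite pdE; apply: (etrans H); apply: eq_bigr => k _; rewrite !mxE mulrC //.
Qed.

(** * The metric on lines and inhomogeneous coordinates *)

Section ComplexForms.
Context {R : realType} {n : nat}.
Local Notation C := R[i].
Implicit Types (s : R) (u v w : 'rV[C]_n.+1) (z : 'rV[R]_((1 + 1) + (n + n))) (l j : 'I_n.+1).

Lemma herm_linl s (a : C) u u' v : herm s (a *: u + u') v = a * herm s u v + herm s u' v.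
Proof.
rewrite /herm !mxE.
under eq_bigr => k _ do rewrite !mxE mulrDl -mulrA.
rewrite big_split /= -mulr_sumr; ring.
Qed.

Lemma herm_conj s u v : herm s v u = conjc (herm s u v).
Proof.
rewrite /herm.
transitivity (conjc (u 0 0 * conjc (v 0 0)) + conjc (s%:C)%C *
    conjc (\sum_(k < n) u 0 (lift ord0 k) * conjc (v 0 (lift ord0 k)))); last by rewrite -rmorphM -rmorphD.
congr (_ + _ * _).
- by rewrite rmorphM /= conjcK mulrC.
- by apply/eqP; rewrite eq_complex /= oppr0 !eqxx.
rewrite rmorph_sum; apply: eq_bigr => k _.
by rewrite rmorphM /= conjcK mulrC.
Qed.

Lemma herm_linr s (a : C) u u' v : herm s v (a *: u + u') = conjc a * herm s v u + herm s v u'.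
Proof. by rewrite herm_conj herm_linl rmorphD rmorphM /= -!herm_conj. Qed.

Lemma herm_real s v : herm s v v = (complex.Re (herm s v v))%:C%C.
Proof.
have := herm_conj s v v; case: (herm s v v) => a b /= [] h.
by congr (_ +i* _)%C; lra.
Qed.

Lemma hermZl s (a : C) u v : herm s (a *: u) v = a * herm s u v.
Proof.
have := herm_linl s a u 0 v; have := herm_linl s 1 0 0 v.
rewrite scaler0 addr0 mul1r => /eqP; rewrite -subr_eq subrr => /eqP <-.
by rewrite !addr0.
Qed.

Lemma hermZr s (a : C) u v : herm s v (a *: u) = conjc a * herm s v u.
Proof. by rewrite herm_conj hermZl rmorphM /= -herm_conj. Qed.

Definition norm2 (c : C) : R := complex.Re c ^+ 2 + complex.Im c ^+ 2.

Lemma mul_conjc_norm (c : C) : c * conjc c = (norm2 c)%:C%C.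
Proof. by case: c => a b; apply/eqP; rewrite eq_complex /norm2 /=; apply/andP; split; apply/eqP; ring. Qed.

Lemma norm2_gt0 (c : C) : (0 < norm2 c) = (c != 0).
Proof.
case: c => a b; rewrite /norm2 eq_complex /= negb_and.
have [->|aN] := eqVneq a 0; last by rewrite ltr_pwDl ?sqr_ge0 // exprn_even_gt0.
by rewrite expr0n add0r /= exprn_even_gt0.
Qed.

(** Multiples of v are removed by the projection, and scaling by c multiplies numerator and
    denominator by |c|^4. So any homogeneous coordinates compute the metric of the space of
    lines. *)
Lemma line_metric_inv s (c al be : C) v wa wb : c != 0 -> positive_vec s v ->
  line_metric s (c *: v) (al *: v + c *: wa) (be *: v + c *: wb) = line_metric s v wa wb.
Proof.
move=> cN; rewrite /positive_vec => vp; rewrite /line_metric.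
rewrite !(herm_linl, herm_linr, hermZl, hermZr) (herm_real s v).
move: (complex.Re (herm s v v)) vp => h h0.
have c0 : 0 < norm2 c by rewrite norm2_gt0.
move: (herm s wa v) (herm s v wb) (herm s wa wb) => x y w.
rewrite [complex.Re (_ - _)](_ : _ = norm2 c ^+ 2 * complex.Re (w * h%:C%C - x * y)); last first.
  transitivity (complex.Re ((c * conjc c) ^+ 2 * (w * h%:C%C - x * y))); first by congr complex.Re; ring.
  by rewrite mul_conjc_norm -rmorphXn /=; case: (w * _ - _) => a b /=; ring.
have -> : complex.Re (c * (conjc c * h%:C%C)) = norm2 c * h.
  by rewrite mulrA mul_conjc_norm /=; ring.
rewrite /=; by field; rewrite !gt_eqF.
Qed.

Definition ofC v : 'rV[R]_((1 + 1) + (n + n)) :=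
  row_mx (row_mx (complex.Re (v 0 ord0))%:M (complex.Im (v 0 ord0))%:M)
   (row_mx (\row_k complex.Re (v 0 (lift ord0 k))) (\row_k complex.Im (v 0 (lift ord0 k)))).

Lemma ofCK v : toC (ofC v) = v.
Proof.
apply/rowP => l; rewrite mxE /ofC; case: unliftP => [k ->|->].
  rewrite !row_mxEr row_mxEl !mxE; by case: (v _ _).
rewrite !row_mxEl row_mxEr !mxE eqxx !mulr1n; by case: (v _ _).
Qed.

Section Fields.
Context {m : nat}.
Variables (D : set 'rV[R]_m) (oD : open D) (Z : 'rV[R]_m -> 'rV[R]_((1 + 1) + (n + n))).

Lemma toC_C k l : mC k D Z -> Ck k D (fun p => complex.Re (toC (Z p) 0 l)) /\
  Ck k D (fun p => complex.Im (toC (Z p) 0 l)).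
Proof.
move=> ZC; split; case: (unliftP ord0 l) => [k' ->|->].
- by apply: (Ck_ext oD _ (ZC 0 (rshift (1 + 1) (lshift n k')))) => p _; rewrite mxE liftK.
- by apply: (Ck_ext oD _ (ZC 0 (lshift (n + n) (lshift 1 0)))) => p _; rewrite mxE unlift_none.
- by apply: (Ck_ext oD _ (ZC 0 (rshift (1 + 1) (rshift n k')))) => p _; rewrite mxE liftK.
- by apply: (Ck_ext oD _ (ZC 0 (lshift (n + n) (rshift 1 0)))) => p _; rewrite mxE unlift_none.
Qed.

Lemma pd_toC a l p : toC (mpd a Z p) 0 l =
  (pd a (fun q => complex.Re (toC (Z q) 0 l)) p +i* pd a (fun q => complex.Im (toC (Z q) 0 l)) p)%C.
Proof.
rewrite mxE; case: (unliftP ord0 l) => [k' ->|->]; rewrite !mxE; congr (_ +i* _)%C;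
  congr (pd a _ p); apply/funext => q; by rewrite mxE ?liftK ?unlift_none.
Qed.

Lemma mC_ofC k (v : 'rV[R]_m -> 'rV[C]_n.+1) :
  (forall l, Ck k D (fun p => complex.Re (v p 0 l)) /\ Ck k D (fun p => complex.Im (v p 0 l))) ->
  mC k D (fun p => ofC (v p)).
Proof.
move=> H i j; rewrite ord1; case: (split_ordP j) => j' ->; case: (split_ordP j') => j'' ->.
- apply: (Ck_ext oD _ (H ord0).1) => p _.
  by rewrite /ofC row_mxEl row_mxEl mxE ord1 eqxx mulr1n.
- apply: (Ck_ext oD _ (H ord0).2) => p _.
  by rewrite /ofC row_mxEl row_mxEr mxE ord1 eqxx mulr1n.
- apply: (Ck_ext oD _ (H (lift ord0 j'')).1) => p _.
  by rewrite /ofC row_mxEr row_mxEl mxE.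
- apply: (Ck_ext oD _ (H (lift ord0 j'')).2) => p _.
  by rewrite /ofC row_mxEr row_mxEr mxE.
Qed.
End Fields.

(* Inhomogeneous coordinates in the chart {z_j = 1}. *)
Definition dehom j z : 'rV[R]_(n + n) :=
  row_mx (\row_k ((complex.Re (toC z 0 (lift j k)) * complex.Re (toC z 0 j)
       + complex.Im (toC z 0 (lift j k)) * complex.Im (toC z 0 j)) / norm2 (toC z 0 j)))
    (\row_k ((complex.Im (toC z 0 (lift j k)) * complex.Re (toC z 0 j)
       - complex.Re (toC z 0 (lift j k)) * complex.Im (toC z 0 j)) / norm2 (toC z 0 j))).

Lemma dehom_affine j z : toC z 0 j != 0 -> toC z = toC z 0 j *: affine_vec j 1 (dehom j z).
Proof.
rewrite -norm2_gt0 => h; apply/rowP => l; rewrite [RHS]mxE [affine_vec _ _ _ _ _]mxE.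
case: (unliftP j l) => [k ->|->]; last by rewrite mulr1.
rewrite /dehom row_mxEl row_mxEr [(\row_k _) 0 k]mxE [(\row_k _) 0 k]mxE.
move: h; move: (toC z 0 j) (toC z 0 (lift j k)) => [a b] [c d]; rewrite /norm2 /= => h.
by apply/eqP; rewrite eq_complex /=; apply/andP; split; apply/eqP; field; rewrite gt_eqF.
Qed.

Lemma affine_dehom j (q : 'rV[R]_(n + n)) (c : C) z : c != 0 -> toC z = c *: affine_vec j 1 q ->
  toC z 0 j = c /\ dehom j z = q.
Proof.
move=> cN E; have zj : toC z 0 j = c by rewrite E !mxE unlift_none mulr1.
split=> //; have zj0 : toC z 0 j != 0 by rewrite zj.
have := dehom_affine zj0; rewrite zj E => /(scalerI cN) H.
apply/rowP => k; case: (split_ordP k) => k' ->.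
  have := congr1 (fun v => complex.Re (v 0 (lift j k'))) H.
  by rewrite [affine_vec _ _ q _ _]mxE [affine_vec _ _ _ _ _]mxE liftK /= => ->.
have := congr1 (fun v => complex.Im (v 0 (lift j k'))) H.
by rewrite [affine_vec _ _ q _ _]mxE [affine_vec _ _ _ _ _]mxE liftK /= => ->.
Qed.

Lemma mC_dehom {m : nat} (D : set 'rV[R]_m) (Z : 'rV[R]_m -> 'rV[R]_((1 + 1) + (n + n))) j k : open D ->
  (forall p, D p -> toC (Z p) 0 j != 0) -> mC k D Z -> mC k D (fun p => dehom j (Z p)).
Proof.
move=> oD ZN ZC; have Cr l := (toC_C oD l ZC).1; have Ci l := (toC_C oD l ZC).2.
have Cn : Ck k D (fun p => (norm2 (toC (Z p) 0 j))^-1).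
  apply: (Ck_inv oD _ (Ck_add oD (Ck_mul oD (Cr j) (Cr j)) (Ck_mul oD (Ci j) (Ci j)))) => p Dp.
  by have := ZN p Dp; rewrite -norm2_gt0 => /lt0r_neq0.
move=> i l; rewrite ord1; case: (split_ordP l) => l' ->.
  have H := Ck_mul oD (Ck_add oD (Ck_mul oD (Cr (lift j l')) (Cr j)) (Ck_mul oD (Ci (lift j l')) (Ci j))) Cn.
  by apply: (Ck_ext oD _ H) => p _; rewrite /dehom row_mxEl [RHS]mxE.
have H := Ck_mul oD (Ck_sub2 oD (Ck_mul oD (Ci (lift j l')) (Cr j)) (Ck_mul oD (Cr (lift j l')) (Ci j))) Cn.
by apply: (Ck_ext oD _ H) => p _; rewrite /dehom row_mxEr [RHS]mxE.
Qed.

Lemma affine_lin (j : 'I_n.+1) (k : R) (x x' : 'rV[R]_(n + n)) :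
  affine_vec j 0 (k *: x + x') = k%:C%C *: affine_vec j 0 x + affine_vec j 0 x'.
Proof.
apply/rowP => l; rewrite !mxE; case: (unlift j l) => [k'|]; last by rewrite mulr0 addr0.
by rewrite !mxE; apply/eqP; rewrite eq_complex /=; apply/andP; split; apply/eqP; ring.
Qed.

Lemma line_metric_bilin s v j x y :
  (x *m \matrix_(a, b) line_metric s v (affine_vec j 0 (basis_vec a)) (affine_vec j 0 (basis_vec b)) *m y^T) 0 0
  = line_metric s v (affine_vec j 0 x) (affine_vec j 0 y).
Proof.
rewrite -[X in _ *m X *m _]/(bilin (fun x y => line_metric s v (affine_vec j 0 x) (affine_vec j 0 y))).
have RC (k : R) (a b c d h e f : C) : complex.Re ((k%:C%C * a + b) * h - (k%:C%C * c + d) * e) =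
    k * complex.Re (a * h - c * e) + complex.Re (b * h - d * e).
  by case: a b c d h e => [? ?] [? ?] [? ?] [? ?] [? ?] [? ?] /=; ring.
have RC' (k : R) (a b c d h e f : C) : complex.Re ((k%:C%C * a + b) * h - e * (k%:C%C * c + d)) =
    k * complex.Re (a * h - e * c) + complex.Re (b * h - e * d).
  by case: a b c d h e => [? ?] [? ?] [? ?] [? ?] [? ?] [? ?] /=; ring.
apply: bilinE => [k u u' w|k u w w']; rewrite affine_lin /line_metric.
  by rewrite !herm_linl RC //; ring.
rewrite !herm_linr; have -> : conjc (k%:C%C) = k%:C%C :> C by rewrite /= oppr0.
by rewrite RC' //; ring.
Qed.

(** Z is the scalar function z_j times the affine vector of its inhomogeneous coordinates. By the
    product rule [dE] its derivative has the form to which [line_metric_inv] applies. *)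
Lemma chart_pullback {m : nat} s (D : set 'rV[R]_m) (Z : 'rV[R]_m -> 'rV[R]_((1 + 1) + (n + n))) j p :
  open D -> D p -> (forall q, D q -> toC (Z q) 0 j != 0) -> mC 1 D Z -> positive_vec s (toC (Z p)) ->
  let k q := dehom j (Z q) in
  jacm k p *m (@met R (n + n) (complex_space_form s n) j (k p)) *m (jacm k p)^T =
  \matrix_(a, b) line_metric s (toC (Z p)) (toC (mpd a Z p)) (toC (mpd b Z p)).
Proof.
move=> oD Dp ZN ZC pos k.
have kC : mC 1 D k by exact: mC_dehom.
have c0 := ZN p Dp; set c := toC (Z p) 0 j in c0.
pose v := affine_vec j 1 (k p).
have ZE : toC (Z p) = c *: v by exact: dehom_affine.
have vpos : positive_vec s v.
  move: pos; rewrite /positive_vec ZE hermZl hermZr mulrA mul_conjc_norm (herm_real s v) /= mul0r subr0.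
  by rewrite pmulr_rgt0 // norm2_gt0.
have dE a : toC (mpd a Z p) = toC (mpd a Z p) 0 j *: v + c *: affine_vec j 0 (mpd a k p).
  apply/rowP => l; rewrite [RHS]mxE [X in _ = X + _]mxE [X in _ = _ + X]mxE.
  rewrite [v 0 l]mxE [affine_vec _ 0 _ 0 l]mxE; case: (unliftP j l) => [l' ->|->]; last first.
    by rewrite mulr1 mulr0 addr0.
  have [c1 c2] := toC_C oD j ZC.
  have k1 := kC 0 (lshift n l'); have k2 := kC 0 (rshift n l').
  have d1 := Ck_der (i := a) c1 Dp; have d2 := Ck_der (i := a) c2 Dp.
  have d3 := Ck_der (i := a) k1 Dp; have d4 := Ck_der (i := a) k2 Dp.
  have E q : D q -> toC (Z q) 0 (lift j l') = toC (Z q) 0 j * (k q 0 (lshift n l') +i* k q 0 (rshift n l'))%C.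
    by move=> Dq; rewrite [in LHS](dehom_affine (ZN q Dq)) [LHS]mxE [affine_vec _ _ _ _ _]mxE liftK.
  have R1 : pd a (fun q => complex.Re (toC (Z q) 0 (lift j l'))) p =
      pd a (fun q => complex.Re (toC (Z q) 0 j) * k q 0 (lshift n l') - complex.Im (toC (Z q) 0 j) * k q 0 (rshift n l')) p.
    by apply: (pd_ext a oD Dp) => q Dq; rewrite E //; case: (toC (Z q) 0 j).
  have R2 : pd a (fun q => complex.Im (toC (Z q) 0 (lift j l'))) p =
      pd a (fun q => complex.Re (toC (Z q) 0 j) * k q 0 (rshift n l') + complex.Im (toC (Z q) 0 j) * k q 0 (lshift n l')) p.
    by apply: (pd_ext a oD Dp) => q Dq; rewrite E //; case: (toC (Z q) 0 j).
  have M1 := Ck_mul oD c1 k1; have M2 := Ck_mul oD c2 k2; have M3 := Ck_mul oD c1 k2; have M4 := Ck_mul oD c2 k1.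
  rewrite !pd_toC R1 R2 (pdD (Ck_der M1 Dp) (Ck_der (Ck_opp oD M2) Dp)) (pdN (Ck_der M2 Dp)).
  rewrite (pdD (Ck_der M3 Dp) (Ck_der M4 Dp)).
  rewrite (pdM d1 d3) (pdM d2 d4) (pdM d1 d4) (pdM d2 d3) ![mpd a k p 0 _]mxE /c.
  move: (pd a (fun q => k q 0 (lshift n l')) p) (pd a (fun q => k q 0 (rshift n l')) p).
  move: (pd a (fun q => complex.Re (toC (Z q) 0 j)) p) (pd a (fun q => complex.Im (toC (Z q) 0 j)) p).
  move: (toC (Z p) 0 j) (k p 0 (lshift n l')) (k p 0 (rshift n l')) => [x y] t1 t2 t3 t4 t5 t6.
  by apply/eqP; rewrite eq_complex /=; apply/andP; split; apply/eqP; ring.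
apply/matrixP => a b; rewrite [RHS]mxE (dE a) (dE b) ZE line_metric_inv //.
rewrite -!row_jacm /v -line_metric_bilin.
rewrite -[complex_space_form _ _]/(complex_space_form s n) /=.
move: (\matrix_(_, _) _) (jacm k p) => G Jm.
rewrite tr_row -row_mul [LHS]mxE [RHS]mxE; apply: eq_bigr => l _.
by rewrite [in RHS]mxE [X in _ = _ * X]mxE.
Qed.
End ComplexForms.

(** * Charts of the complex space forms *)

Section Lines.
Context {R : realType} {n : nat}.
Variable s : R.
Local Notation N := (complex_space_form s n).
Implicit Types (v w : 'rV[R[i]]_n.+1) (c : R[i]) (z : 'rV[R]_((1 + 1) + (n + n))) (j : 'I_n.+1).

Lemma positive_vecZ c v : c != 0 -> positive_vec s v -> positive_vec s (c *: v).
Proof.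
move=> c0; rewrite /positive_vec hermZl hermZr mulrA mul_conjc_norm (herm_real s v) /= mul0r subr0.
by rewrite pmulr_rgt0 // norm2_gt0.
Qed.

Lemma positive_neq0 v : positive_vec s v -> v != 0.
Proof.
rewrite /positive_vec; apply: contraTneq => ->.
by rewrite -(scale0r (0 : 'rV[R[i]]_n.+1)) hermZl mul0r /= ltxx.
Qed.

Lemma line_of_val v : positive_vec s v -> sval (line_of s v) = cline v.
Proof. by rewrite /line_of; case: pselect. Qed.

Lemma positive_line_inj (L L' : positive_line s n) : sval L = sval L' -> L = L'.
Proof.
case: L L' => [L hL] [L' hL'] /= E; subst L'; congr (exist _ L _); exact: Prop_irrelevance.
Qed.

Lemma line_ofZ c v : c != 0 -> positive_vec s v -> line_of s (c *: v) = line_of s v.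
Proof.
move=> c0 vp; apply: positive_line_inj; rewrite !line_of_val //; last exact: positive_vecZ.
apply/seteqP; split=> [_ [a _ <-]|_ [a _ <-]]; first by exists (a * c) => //; rewrite scalerA.
by exists (a / c) => //; rewrite scalerA divfK.
Qed.

Lemma line_of_inj v w : positive_vec s v -> positive_vec s w -> line_of s v = line_of s w ->
  exists2 c, c != 0 & w = c *: v.
Proof.
move=> vp wp E; have : cline w w by exists 1 => //; rewrite scale1r.
rewrite -(line_of_val wp) -E (line_of_val vp) => -[c _ cw]; exists c => //.
by apply: contra_neq (positive_neq0 wp) => c0; rewrite -cw c0 scale0r.
Qed.

Lemma chart_in j z : positive_vec s (toC z) -> toC z 0 j != 0 ->
  @dom R (n + n) N j (dehom j z) /\ @par R (n + n) N j (dehom j z) = line_of s (toC z).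
Proof.
move=> zp zj; have E := dehom_affine zj.
have E' : affine_vec j 1 (dehom j z) = (toC z 0 j)^-1 *: toC z.
  by rewrite [in X in _ = _ *: X]E scalerA mulVf // scale1r.
split; rewrite /= E'; first by apply: positive_vecZ => //; rewrite invr_eq0.
by rewrite line_ofZ // invr_eq0.
Qed.

Lemma chart_out j z q : positive_vec s (toC z) -> @dom R (n + n) N j q ->
  @par R (n + n) N j q = line_of s (toC z) -> toC z 0 j != 0 /\ dehom j z = q.
Proof.
move=> zp dq pq; have [c c0 E] := line_of_inj dq zp pq.
by have [-> ->] := affine_dehom c0 E.
Qed.

(** Evaluates the choice that [coordmap] makes in a chart of the space form. *)
Lemma chart_coord j z : positive_vec s (toC z) -> toC z 0 j != 0 ->
  xget 0 [set q | @dom R (n + n) N j q /\ @par R (n + n) N j q = line_of s (toC z)] = dehom j z.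
Proof.
move=> zp zj; have [h1 h2] := chart_in zp zj.
have [|h3 h4] := @xgetPex _ 0 [set q | @dom R (n + n) N j q /\ @par R (n + n) N j q = line_of s (toC z)].
  by exists (dehom j z).
by have [_ ->] := chart_out zp h3 h4.
Qed.

Lemma affine_C k j : mC k setT (fun q : 'rV[R]_(n + n) => ofC (affine_vec j 1 q)).
Proof.
apply: (mC_ofC openT) => l; case: (unliftP j l) => [l' ->|->]; split.
- by apply: (Ck_ext openT _ (Ck_coord k setT (lshift n l'))) => q _; rewrite mxE liftK.
- by apply: (Ck_ext openT _ (Ck_coord k setT (rshift n l'))) => q _; rewrite mxE liftK.
- by apply: (Ck_ext openT _ (Ck_cst k setT 1)) => q _; rewrite mxE unlift_none.
- by apply: (Ck_ext openT _ (Ck_cst k setT 0)) => q _; rewrite mxE unlift_none.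
Qed.

Lemma chart_dom_open j : open (@dom R (n + n) N j).
Proof.
have H : Ck 0 setT (fun q : 'rV[R]_(n + n) => complex.Re (herm s (affine_vec j 1 q) (affine_vec j 1 q))).
  have HC := affine_C 0 j.
  have H := mC_mul openT (mC_mul openT HC (mC_cst setT 0 (block_mx 1%:M 0 0 (s%:M : 'M[R]_(n + n)))))
    (mC_tr openT HC) 0 0.
  by apply: (Ck_ext openT _ H) => q _; rewrite -hreE -[in RHS](ofCK (affine_vec j 1 q)) herm_toC.
have := open_gt0 openT H; congr open.
by apply/seteqP; split=> [q []|q h].
Qed.
End Lines.

Lemma open_preimage {R : realType} {m n : nat} (E : set 'rV[R]_m) (W : set 'rV[R]_n) (f : 'rV[R]_m -> 'rV[R]_n) :
  open E -> open W -> mC 0 E f -> open [set p | E p /\ W (f p)].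
Proof.
move=> oE oW fC; rewrite openE => p [Ep Wp]; rewrite /interior.
have h1 : \forall q \near p, E q by exact: open_nbhs_nbhs.
have h2 : \forall q \near p, W (f q).
  have cf : {for p, continuous f} by apply: continuous_mx => i j; exact: (Ck_cont (fC i j) Ep).
  by apply: (cf W); exact: open_nbhs_nbhs.
by apply: filterS2 h1 h2 => q.
Qed.

Lemma mC_comp {R : realType} {m n a b : nat} k (E : set 'rV[R]_m) (D : set 'rV[R]_n)
    (f : 'rV[R]_n -> 'M[R]_(a, b)) (h : 'rV[R]_m -> 'rV[R]_n) :
  open D -> open E -> (forall p, E p -> D (h p)) -> mC k D f -> mC k E h ->
  mC k E (fun p => f (h p)).
Proof.
move=> oD oE hD fC hC i j.
exact: (@Ck_comp R n m k (fun q => f q i j) h D E oD oE hD (fC i j) (fun l => hC 0 l)).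
Qed.

Lemma mC_sub_dom {R : realType} {m a b : nat} k (E D : set 'rV[R]_m) (f : 'rV[R]_m -> 'M[R]_(a, b)) :
  E `<=` D -> mC k D f -> mC k E f.
Proof. by move=> ED fC i j; exact: (Ck_sub ED (fC i j)). Qed.

(** * The conformal diffeomorphism between atlases *)

Section Assembly.
Context {R : realType} {n : nat}.
Local Notation m := (n + n)%N.
Variables (M : metric_atlas R m) (hM : riemannian_manifold M).
Variables (i0 : chart M) (p0 : 'rV[R]_m) (r s : R) (al : 'rV[R]_m -> R)
  (Z : 'rV[R]_m -> 'rV[R]_((1 + 1) + m)).
Local Notation B := (ball p0 r).
Local Notation g := (met i0).
Local Notation N := (complex_space_form s n).
Hypotheses (r0 : 0 < r) (BD : B `<=` dom i0) (alC : forall k, Ck k B al) (ZC : forall k, mC k B Z)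
  (al0 : forall p, B p -> 0 < al p) (Z0 : Z p0 = delta_mx 0 (lshift m (lshift 1 0)))
  (Z1 : forall p, B p -> herm s (toC (Z p)) (toC (Z p)) = 1)
  (Zg : forall p, B p -> forall a b,
     line_metric s (toC (Z p)) (toC (mpd a Z p)) (toC (mpd b Z p)) = al p * g p a b).

Let oB : open (B : set 'rV[R]_m) := @open_B R m p0 r.

Let Zpos p : B p -> positive_vec s (toC (Z p)).
Proof. by move=> Bp; rewrite /positive_vec Z1 //= ltr01. Qed.

(** The points mapped into the chart {z_j = 1}; the strict inequality makes openness an instance of
    [open_gt0]. *)
Let nz j := [set p | B p /\ 0 < norm2 (toC (Z p) 0 j)].

Let nz_open j : open (nz j).
Proof.
have [c1 c2] := toC_C oB j (ZC 0).
exact: (open_gt0 oB (Ck_add oB (Ck_mul oB c1 c1) (Ck_mul oB c2 c2))).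
Qed.

Let nzN j p : nz j p -> toC (Z p) 0 j != 0. Proof. by case=> _; rewrite norm2_gt0. Qed.
Let nzB j : nz j `<=` B. Proof. by move=> p []. Qed.

Let dehomZ_C j k : mC k (nz j) (fun p => dehom j (Z p)).
Proof. by apply: mC_dehom => //; [move=> p /nzN|apply: mC_sub_dom (ZC k)]. Qed.

Let pull j p : nz j p -> jacm (fun q => dehom j (Z q)) p *m @met R m N j (dehom j (Z p))
   *m (jacm (fun q => dehom j (Z q)) p)^T = al p *: g p.
Proof.
move=> jp; have Bp := nzB jp.
have H := @chart_pullback R n m s (nz j) Z j p (@nz_open j) jp (@nzN j) (mC_sub_dom (@nzB j) (ZC 1)) (Zpos Bp).
by rewrite H; apply/matrixP => a b; rewrite mxE Zg // scalemxE.
Qed.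

(** By [Z0] the point p0 is sent into the chart {z_0 = 1}. There the map has invertible Jacobian,
    since it pulls the metric back to the nondegenerate al g, so the inverse function theorem
    applies. *)
Lemma model_locally_conformal : @locally_conformal_at R m m M N (par i0 p0).
Proof.
have gpos p (v : 'rV[R]_m) : dom i0 p -> v != 0 -> 0 < inner (g p) v v by exact: (rm_met_pos hM).
have Bp0 : B p0 by exact: ballxx.
have p0nz : nz ord0 p0.
  split=> //; rewrite norm2_gt0 mxE unlift_none Z0 !mxE !eqxx eq_complex /= negb_and.
  by rewrite oner_neq0.
have ju p : nz ord0 p -> jac (fun q => dehom ord0 (Z q)) p \in unitmx.
  move=> jp; have Bp := nzB jp; have := pull jp; rewrite -[jacm _ _]/(jac (fun q => dehom ord0 (Z q)) p) => E.
  have : al p *: g p \in unitmx.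
    rewrite unitmxZ ?unitfE ?gt_eqF ?al0 //; apply: inner_unit => v; apply: gpos; exact: BD.
  by rewrite -E !unitmx_mul => /andP[/andP[]].
have [U0 [V0 [psi [oU0 U0p U0D oV0 [ph psK psC]]]]] :=
  @inverse_function R m (nz ord0) (@nz_open ord0) (fun q => dehom ord0 (Z q)) p0 p0nz
    (fun k j => dehomZ_C ord0 k 0 j) ju.
have psiC k : mC k V0 psi by move=> i j; rewrite ord1; exact: psC.
have U0B p : U0 p -> B p by move=> /U0D/nzB.
have U0d p : U0 p -> dom i0 p by move=> /U0B/BD.
pose c0 (Q : mpoint M) : 'rV[R]_m := xget 0 [set p | dom i0 p /\ par i0 p = Q].
pose d0 (L : mpoint N) : 'rV[R]_m := xget 0 [set q | @dom R m N ord0 q /\ @par R m N ord0 q = L].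
have c0E p : dom i0 p -> c0 (par i0 p) = p.
  move=> dp; have [|h1 h2] := @xgetPex _ 0 [set p' | dom i0 p' /\ par i0 p' = par i0 p]; first by exists p.
  exact: (rm_par_inj hM h1 dp h2).
pose F Q : mpoint N := line_of s (toC (Z (c0 Q))).
pose G (L : mpoint N) : mpoint M := par i0 (psi (d0 L)).
pose U : set (mpoint M) := [set Q | exists2 p, U0 p & par i0 p = Q].
pose V : set (mpoint N) := [set L | exists2 p, U0 p & line_of s (toC (Z p)) = L].
have d0E p : U0 p -> d0 (line_of s (toC (Z p))) = dehom ord0 (Z p).
  by move=> Up; apply: chart_coord; [apply: Zpos; exact: U0B|apply: nzN; exact: U0D].
have FE p : U0 p -> F (par i0 p) = line_of s (toC (Z p)).
  by move=> Up; rewrite /F c0E //; exact: U0d.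
have GE p : U0 p -> G (line_of s (toC (Z p))) = par i0 p.
  by move=> Up; rewrite /G d0E //; have [_ ->] := ph _ Up.
pose tau i := coordmap (M := M) (N := M) idfun i i0.
pose E i := coorddom (M := M) (N := M) setT idfun i i0.
pose sig i := coordmap (M := M) (N := M) idfun i0 i.
pose E' i := coorddom (M := M) (N := M) setT idfun i0 i.
have oE i : open (E i) by have [] := rm_transition hM i i0.
have oE' i : open (E' i) by have [] := rm_transition hM i0 i.
have tauC i k : mC k (E i) (tau i).
  by move=> a b; have [_ /(smooth_on_mxP _ (oE i))] := rm_transition hM i i0; exact.
have sigC i k : mC k (E' i) (sig i).
  by move=> a b; have [_ /(smooth_on_mxP _ (oE' i))] := rm_transition hM i0 i; exact.
have tauE i p : E i p -> dom i0 (tau i p) /\ par i0 (tau i p) = par i p.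
  by move=> [_ _ h]; exact: (@xgetPex _ 0 _ h).
pose S i := [set p | E i p /\ U0 (tau i p)].
(* U, V and the domains of F and G in all charts are rewritten as preimages of open sets under
   smooth coordinate maps; openness and smoothness then follow from the corresponding facts about
   composites. *)
have SE i : dom i `&` par i @^-1` U = S i.
  apply/seteqP; split=> [p [dp [q Uq pq]]|p [Ep Up]].
    have Ep : E i p by split=> //; exists q; split=> //; exact: U0d.
    split=> //; have [h1 h2] := tauE i p Ep.
    by rewrite (rm_par_inj hM h1 (U0d _ Uq)) // h2 pq.
  by split; [case: Ep|exists (tau i p) => //; case: (tauE i p Ep)].
have oS i : open (S i) by exact: (open_preimage (oE i) oU0 (tauC i 0%N)).
have SsubE i : S i `<=` E i by move=> p [].
have tauS i k : mC k (S i) (tau i) := mC_sub_dom (@SsubE i) (tauC i k).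
have SF i p : S i p -> F (par i p) = line_of s (toC (Z (tau i p))).
  by move=> [Ep Up]; have [_ <-] := tauE i p Ep; exact: FE.
pose aff j (q : 'rV[R]_m) : 'rV[R]_((1 + 1) + m) := ofC (affine_vec j 1 q).
have affp j q : @dom R m N j q -> positive_vec s (toC (aff j q)) by rewrite /aff ofCK.
have affE j q : @par R m N j q = line_of s (toC (aff j q)) by rewrite /aff ofCK.
(* The overlap of the charts j and 0 of N; [f j] below is the transition map. *)
pose A j := [set q | @dom R m N j q /\ 0 < norm2 (toC (aff j q) 0 ord0)].
have oA j : open (A j).
  have od := @chart_dom_open R n s j; have aC := mC_sub_dom (@subsetT _ (@dom R m N j)) (@affine_C R n 0 j).
  have [c1 c2] := toC_C od ord0 aC.
  exact: (open_gt0 od (Ck_add od (Ck_mul od c1 c1) (Ck_mul od c2 c2))).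
have AN j q : A j q -> toC (aff j q) 0 ord0 != 0 by case=> _; rewrite norm2_gt0.
pose f j q := dehom ord0 (aff j q).
have fC j k : mC k (A j) (f j).
  by apply: mC_dehom => //; [exact: AN|exact: mC_sub_dom (@subsetT _ _) (@affine_C R n k j)].
pose T j := [set q | A j q /\ V0 (f j q)].
have oT j : open (T j) by exact: (open_preimage (oA j) oV0 (fC j 0%N)).
have TsubA j : T j `<=` A j by move=> q [].
have TL j q : T j q -> U0 (psi (f j q)) /\ @par R m N j q = line_of s (toC (Z (psi (f j q)))).
  move=> [Aq Vq]; have [Up pf] := psK _ Vq; split=> //.
  have [_ <-] := chart_in (Zpos (U0B _ Up)) (nzN (U0D _ Up)).
  by rewrite pf affE; have [_ <-] := chart_in (affp j q Aq.1) (AN _ _ Aq).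
have TE j : @dom R m N j `&` @par R m N j @^-1` V = T j.
  apply/seteqP; split=> [q [dq [p Up pq]]|q Tq].
    have [h1 h2] := chart_in (Zpos (U0B _ Up)) (nzN (U0D _ Up)).
    have [h3 h4] := chart_out (affp j q dq) h1 (etrans h2 (etrans pq (affE j q))).
    split; first by split=> //; rewrite norm2_gt0.
    by rewrite /f h4; case: (ph _ Up).
  split; first by case: Tq => -[].
  by have [Up pq] := TL j q Tq; exists (psi (f j q)).
have TG j q : T j q -> G (@par R m N j q) = par i0 (psi (f j q)).
  by move=> Tq; have [Up ->] := TL j q Tq; exact: GE.
pose SF2 i j := [set p | S i p /\ nz j (tau i p)].
have oSF2 i j : open (SF2 i j) by exact: (open_preimage (oS i) (@nz_open j) (tauS i 0%N)).
have domF i j : coorddom (M := M) (N := N) U F i j = SF2 i j.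
  apply/seteqP; split=> [p [dp Up [q [dq pq]]]|p [Sp nzp]].
    have Sp : S i p by rewrite -SE.
    split=> //; have Bt : B (tau i p) by apply: U0B; case: Sp.
    split=> //; rewrite norm2_gt0; rewrite SF // in pq.
    by have [] := chart_out (Zpos Bt) dq pq.
  have := Sp; rewrite -SE => -[dp Up]; split=> //.
  exists (dehom j (Z (tau i p))); rewrite SF //.
  exact: (chart_in (Zpos (nzB nzp)) (nzN nzp)).
have mapF i j p : SF2 i j p -> coordmap (M := M) (N := N) F i j p = dehom j (Z (tau i p)).
  move=> [Sp nzp]; rewrite /coordmap SF //.
  exact: (chart_coord (Zpos (nzB nzp)) (nzN nzp)).
have SFsub i j : SF2 i j `<=` S i by move=> p [].
have FC i j k : mC k (SF2 i j) (fun p => dehom j (Z (tau i p))).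
  apply: (mC_comp (@nz_open j) (oSF2 i j) _ (dehomZ_C j k)); first by move=> p [].
  exact: mC_sub_dom (@SFsub i j) (tauS i k).
have mapFC i j k : mC k (SF2 i j) (coordmap (M := M) (N := N) F i j).
  by apply: (mC_ext (oSF2 i j) _ (FC i j k)) => p hp; rewrite mapF.
exists U, V; split.
- by move=> i; rewrite SE.
- by exists p0.
- by move=> j; rewrite TE.
exists F, G, (fun Q => al (c0 Q)); split.
- by move=> Q [p Up <-]; rewrite FE // GE //; split=> //; exists p.
- by move=> L [p Up <-]; rewrite GE // FE //; split=> //; exists p.
- move=> i j; rewrite domF; split=> //.
  by apply/(smooth_on_mxP _ (oSF2 i j)) => a b k; exact: mapFC.
- move=> j i.
  pose W := [set q | T j q /\ E' i (psi (f j q))].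
  have pfC k : mC k (T j) (fun q => psi (f j q)).
    apply: (mC_comp oV0 (oT j) _ (psiC k)); first by move=> q [].
    exact: mC_sub_dom (@TsubA j) (fC j k).
  have oW : open W by exact: (open_preimage (oT j) (oE' i) (pfC 0%N)).
  have domG : coorddom (M := N) (N := M) V G j i = W.
    apply/seteqP; split=> [q [dq Vq [p [dp pq]]]|q [Tq Eq]].
      have Tq : T j q by rewrite -TE.
      split=> //; split=> //; first by apply: U0d; case: (TL j q Tq).
      by exists p; split=> //=; rewrite pq TG.
    have := Tq; rewrite -TE => -[dq Vq]; split=> //.
    by case: Eq => _ _ [p [dp pq]]; exists p; split=> //; rewrite pq TG.
  have mapG q : W q -> coordmap (M := N) (N := M) G j i q = sig i (psi (f j q)).
    by move=> [Tq Eq]; rewrite /sig /coordmap TG.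
  have WT : W `<=` T j by move=> q [].
  rewrite domG; split=> //; apply/(smooth_on_mxP _ oW) => a b k.
  have H : mC k W (fun q => sig i (psi (f j q))).
    apply: (mC_comp (oE' i) oW _ (sigC i k)); first by move=> q [].
    exact: mC_sub_dom WT (pfC k).
  by apply: (Ck_ext oW _ (H a b)) => q Wq; rewrite mapG.
split.
- move=> i; rewrite SE; apply/smooth_onP => k.
  have H : Ck k (S i) (al \o tau i).
    apply: (@Ck_comp R m m k al (tau i) B (S i) oB (oS i) _ (alC k) (fun l => tauS i k 0 l)).
    by move=> p [_ /U0B].
  apply: (Ck_ext (oS i) _ H) => p [Ep Up] /=; congr al.
- by move=> Q [p Up <-]; rewrite c0E; [apply: al0; exact: U0B|exact: U0d].
(* Both sides are referred to the chart i0 through tau: the metric of M by its compatibility, the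
   pullback by the chain rule and [pull]. *)
move=> i j p; rewrite domF => hp; have [Sp nzp] := hp; have [Ep Up] := Sp.
have [t1 t2] := tauE i p Ep.
rewrite -t2 c0E // /pullback_met mapF // (rm_met_compat hM Ep) /pullback_met -/(tau i p).
rewrite (jacobian_jacm (oSF2 i j) hp (mapFC i j 1%N)) (jacobian_jacm (oE i) Ep (tauC i 1%N)).
have -> : jacm (coordmap (M := M) (N := N) F i j) p = jacm (fun q => dehom j (Z (tau i q))) p.
  apply/matrixP => a b; rewrite !mxE; apply: (pd_ext a (oSF2 i j) hp) => q hq.
  by rewrite mapF.
rewrite (jacm_comp (@nz_open j) (dehomZ_C j 1%N) Ep nzp (tauC i 1%N)) trmx_mul.
have := pull nzp; move: (jacm _ _) (jacm _ _) => Jt Jk P.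
rewrite !mulmxA -(mulmxA Jt Jk) -(mulmxA Jt (Jk *m _)) P -scalemxAr -scalemxAl //.
Qed.
End Assembly.

Theorem theorem1p3 (R : realType) (m : nat) (hm : (3 <= m)%N)
    (M : metric_atlas R m) (hM : riemannian_manifold M)
    (hO : conformally_osserman M) :
  ((forall (i : chart M) (p : 'rV[R]_m), dom i p ->
      one_reduced_eigenvalue i p) ->
    conformally_flat M) /\
  ((8 <= m)%N ->
   (forall (i : chart M) (p : 'rV[R]_m), dom i p ->
      two_reduced_eigenvalues 1 (m - 2) i p) ->
    exists n : nat, m = (2 * n)%N /\
      forall P : mpoint M,
        locally_conformal_at (CPn R n) P \/ locally_conformal_at (CHn R n) P).
Proof.
have od i : open (@dom R m M i) by exact: (rm_dom_open hM).
have gC (i : chart M) k : mC k (dom i) (met i).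
  by move=> a b; have /(smooth_on_mxP _ (od i)) := @rm_met_smooth _ _ _ hM i; exact.
have gS (i : chart M) p : dom i p -> (met i p)^T = met i p by exact: (rm_met_sym hM).
have gP (i : chart M) p (v : 'rV[R]_m) : dom i p -> v != 0 -> 0 < inner (met i p) v v.
  exact: (rm_met_pos hM).
split=> [h1 i p dp|m8 h2].
  exact: (one_eigenvalue_weyl (od i) (gC i) (gS i) (gP i) hm dp (h1 i p dp)).
have two (i : chart M) p : dom i p -> exists a b : R, a != b /\ forall x, unit_vec (met i) p x ->
    multiplicity (reduced_conf_jacobi (met i) p x) a = 1%N /\
    multiplicity (reduced_conf_jacobi (met i) p x) b = (m - 2)%N.
  by move=> dp; have [a [b [ab h]]] := h2 i p dp; exists a, b; split=> // x /h[].
(* The complex structure at any one point makes m even; the atlas is nonempty and covered by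
   charts. *)
have [n mE] : exists n, m = (n + n)%N.
  have [P _] := rm_nonempty hM; have [i [p [dp _]]] := rm_cover hM P.
  have [D1 [lam [mu [J [s [[_ D1p _] [_ H]]]]]]] :=
    weyl_normal_form (od i) (gC i) (gS i) (gP i) m8 (two i) dp.
  have [_ _ JJ _] := H p D1p; have := complex_even JJ.
  by move=> mo; exists m./2; rewrite addnn even_halfK.
exists n; split; first by rewrite mul2n -addnn.
subst m => P; have [i [p [dp <-]]] := rm_cover hM P.
have [r [s [al [Z [[r0 BD hs alC ZC] [al0 Z0 Z1 Zg]]]]]] :=
  local_model (od i) (gC i) (gS i) (gP i) m8 (two i) dp.
have L := model_locally_conformal hM r0 BD alC ZC al0 Z0 Z1 Zg.
by case: hs L => ->; [left|right].
Qed.
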